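(* Let $\mathbb{X}$ be a weighted projective line of weight type $(p_1,p_2,p_3)$ with all $p_i\ge2$ over a finite field $\mathbf{k}=\mathbb{F}_q$. Let $E,E'$ be extension bundles on $\mathbb{X}$, and let $S=S_{i,j}^{(n)}$ be an indecomposable torsion sheaf in an exceptional tube $\mathcal{T}_i$, $i\in\{1,2,3\}$. Assume $[E']+[S]=[E]$ in $K_0(\mathbb{X})$ and $\mathrm{Hom}(E,\mathrm{top}\,S)\neq0$. Put $N=\lfloor\frac12\langle E',E\rangle\rfloor-1$. Then $$F_{SE'}^{E}=\begin{cases}1,&\text{if }N=-1;\\ f_{N+1}-f_{N}+(-1)^{N},&\text{if }N\ge0,\end{cases}$$ where $f_m=f_m(q)$.
   Context: Weighted projective line of weight type $(p_1,p_2,p_3)$ over a field $\mathbf{k}$: $\mathbb{L}$ is the abelian group with generators $\vec{x}_1,\vec{x}_2,\vec{x}_3$ and relations $p_1\vec{x}_1=p_2\vec{x}_2=p_3\vec{x}_3=:\vec{c}$. Every $\vec{x}\in\mathbb{L}$ has a unique normal form $\vec{x}=\sum_i l_i\vec{x}_i+l\vec{c}$ with $0\le l_i<p_i$, $l\in\mathbb{Z}$; $\mathbb{L}_+$ is the set of those with $l\ge 0$, and $\vec{x}\le\vec{y}$ means $\vec{y}-\vec{x}\in\mathbb{L}_+$. Let $A=\mathbf{k}[X_1,X_2,X_3]/(X_3^{p_3}-X_2^{p_2}+X_1^{p_1})$ (the exceptional points being normalized to $\infty,0,1$), $\mathbb{L}$-graded by $\deg X_i=\vec{x}_i$. Then $\mathrm{coh}\,\mathbb{X}=\mathrm{mod}^{\mathbb{L}}(A)/\mathrm{mod}_0^{\mathbb{L}}(A)$,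 the quotient of finitely generated $\mathbb{L}$-graded $A$-modules by those of finite length; it is a hereditary abelian category. The structure sheaf $\mathcal{O}$ is the image of $A$, the line bundles are the grading shifts $\mathcal{O}(\vec{x})$, $\vec{x}\in\mathbb{L}$, and $L(\vec{x})$ denotes the shift of $L$ by $\vec{x}$. The dualizing element is $\vec{\omega}=\vec{c}-\vec{x}_1-\vec{x}_2-\vec{x}_3$; the Auslander–Reiten translation $\tau$ is the shift by $\vec{\omega}$. Extension bundle: for a line bundle $L$ and $\vec{x}\in\mathbb{L}$ with $0\le\vec{x}\le\sum_{i=1}^3(p_i-2)\vec{x}_i$, one has $\dim\mathrm{Ext}^1(L(\vec{x}),L(\vec{\omega}))=1$, and $E_L\langle\vec{x}\rangle$ denotes the middle term of the (unique up to isomorphism of the middle term) non-split exact sequence $0\to L(\vec{\omega})\to E_L\langle\vec{x}\rangle\to L(\vec{x})\to 0$. An extension bundle is an object isomorphic to some $E_L\langle\vec{x}\rangle$. Torsion sheaves are the finite length objects of $\mathrm{coh}\,\mathbb{X}$. For $i\in\{1,2,3\}$, the exceptional tube $\mathcal{T}_i$ is the category of torsion sheaves supported at the $i$-th exceptional point; it is equivalent to the category of nilpotent representations of the cyclic quiver with $p_i$ vertices. Its simple objects are $S_{i,j}$, $j\in\mathbb{Z}/p_i\mathbb{Z}$, numbered so that $\tau S_{i,j}=S_{i,j-1}$; $S_{i,j}^{(n)}$ is the unique indecomposable object of $\mathcal{T}_i$ with top $S_{i,j}$ and length $n\ge 1$. $[X]$ denotes the class of $X$ in the Grothendieck group $K_0(\mathbb{X})$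 of $\mathrm{coh}\,\mathbb{X}$, and $\langle X,Y\rangle=\dim_{\mathbf{k}}\mathrm{Hom}(X,Y)-\dim_{\mathbf{k}}\mathrm{Ext}^1(X,Y)$. Hall number: $F_{AB}^{M}=|\{X\subseteq M\mid X\cong B,\ M/X\cong A\}|$. Polynomials $f_n$: for $n\ge1$, $f_n(q)=\sum_{i=1}^n(-1)^{i-1}(2i-1)q^{n+1-i}+(-1)^n(n+1)$; $f_0(q)=1$; and $f_{-n}(q)=0$ for $n\ge 1$. *)

(* Defs.v *)
From HB Require Import structures.
From mathcomp Require Import all_boot all_order all_algebra.
From mathcomp Require Import generic_quotient ring_quotient.
From mathcomp Require Import boolp classical_sets.
From mathcomp Require Import mpoly.

Set Implicit Arguments.
Unset Strict Implicit.
Unset Printing Implicit Defensive.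

Import GRing.Theory.
Local Open Scope ring_scope.
Local Open Scope quotient_scope.
Local Open Scope classical_set_scope.

Inductive zspan (V : zmodType) (G : V -> Prop) : V -> Prop :=
| zspan0 : zspan G 0
| zspanD v g : zspan G v -> G g -> zspan G (v + g)
| zspanB v g : zspan G v -> G g -> zspan G (v - g).

Definition zgen (V : zmodType) (G : V -> Prop) : {pred V} :=
  [pred v | `[< zspan G v >]].

Lemma zgen_closed (V : zmodType) (G : V -> Prop) : zmod_closed (zgen G).
Proof.
split; first by apply/asboolP; exact: zspan0.
move=> u v /asboolP hu /asboolP hv; apply/asboolP.
elim: hv => [|w g _ IH Gg|w g _ IH Gg]; first by rewrite subr0.
  by rewrite opprD addrA; apply: zspanB.
by rewrite opprB addrCA addrC; apply: zspanD.
Qed.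

HB.instance Definition _ (V : zmodType) (G : V -> Prop) :=
  GRing.isZmodClosed.Build V (zgen G) (zgen_closed G).

(* The indices 1, 2, 3 of the weights are 0, 1, 2 : 'I_3. *)
Record weights := Weights {
  wt :> 'I_3 -> nat;
  wt_ge2 : forall i, (2 <= wt i)%N }.

Section GradingGroup.
Variable p : weights.

Definition Lrel (v : 'rV[int]_3) : Prop :=
  exists i j, v = delta_mx 0 i *+ p i - delta_mx 0 j *+ p j.

(* Z^3 modulo the p_i e_i - p_j e_j *)
Definition Lgrp := {ideal_quot (zgen Lrel)}.
HB.instance Definition _ := GRing.Zmodule.on Lgrp.

Definition xvec (i : 'I_3) : Lgrp := \pi_Lgrp (delta_mx 0 i).
Definition cvec : Lgrp := xvec 0 *+ p 0.
Definition omega : Lgrp := cvec - \sum_i xvec i.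

Lemma xvec_wt i : xvec i *+ p i = cvec.
Proof.
rewrite /cvec /xvec -!raddfMn /=; apply/eqP; rewrite -Quotient.idealrBE.
apply/asboolP; rewrite -[X in zspan _ X]add0r; apply: zspanD; first exact: zspan0.
by exists i, 0.
Qed.

Definition Lpos (x : Lgrp) : Prop :=
  exists (l : 'I_3 -> nat) (m : nat),
    (forall i, (l i < p i)%N) /\ x = \sum_i xvec i *+ l i + cvec *+ m.
Definition Lle (x y : Lgrp) : Prop := Lpos (y - x).

Definition ldeg (m : 'X_{1..3}) : Lgrp := \sum_i xvec i *+ m i.

Lemma ldegD m1 m2 : ldeg (m1 + m2)%MM = ldeg m1 + ldeg m2.
Proof.
by rewrite /ldeg -big_split; apply: eq_bigr => i _; rewrite /= mnmDE mulrnDr.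
Qed.

Lemma ldegU i : ldeg U_(i)%MM = xvec i.
Proof.
rewrite /ldeg (bigD1 i) //= mnm1E eqxx mulr1n big1 ?addr0 // => j ji.
by rewrite mnm1E eq_sym (negPf ji) mulr0n.
Qed.

Lemma ldegUn i n : ldeg (U_(i) *+ n)%MM = xvec i *+ n.
Proof.
elim: n => [|n IH]; last by rewrite mulmS ldegD IH ldegU mulrS.
by rewrite mulm0n mulr0n /ldeg big1 // => j _; rewrite mnm0E.
Qed.
End GradingGroup.

Section CoordinateAlgebra.
Variables (k : fieldType) (p : weights).
Local Notation P := {mpoly k[3]}.
Local Notation L := (Lgrp p).

Definition relA : P := 'X_(2%:R) ^+ p 2%:R - 'X_1 ^+ p 1 + 'X_0 ^+ p 0.

Definition idA : {pred P} := [pred f | `[< exists g, f = g * relA >]].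

Lemma idA_closed : idealr_closed idA.
Proof.
split=> [||a u v /asboolP[g ->] /asboolP[h ->]].
- by apply/asboolP; exists 0; rewrite mul0r.
- apply/asboolP => -[g] /(congr1 (meval (fun=> 0))).
  rewrite rmorph1 rmorphM /= /relA mevalD mevalB !rmorphXn /= !mevalXU.
  have h i : (0 : k) ^+ p i = 0 by rewrite expr0n; case: (p i) (wt_ge2 p i).
  by rewrite !h subr0 addr0 mulr0 => /eqP; rewrite oner_eq0.
- by apply/asboolP; exists (a * g + h); rewrite mulrDl mulrA.
Qed.
HB.instance Definition _ := isIdealr.Build P idA idA_closed.

Definition coordA := {ideal_quot idA}.
HB.instance Definition _ := GRing.ComNzRing.on coordA.

Definition piA (f : P) : coordA := \pi_coordA f.
Definition Xvar (i : 'I_3) : coordA := piA 'X_i.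
Definition scalA (c : k) : coordA := piA c%:MP.

Definition pcomp (x : L) (f : P) : P :=
  \sum_(m <- msupp f | ldeg p m == x) f@_m *: 'X_[m].

Lemma mcoeff_pcomp x f m :
  (pcomp x f)@_m = if ldeg p m == x then f@_m else 0.
Proof.
rewrite /pcomp raddf_sum /= big_mkcond /=.
have [mf|mf] := boolP (m \in msupp f).
  rewrite (bigD1_seq m) //= ?msupp_uniq // big1 ?addr0; last first.
    by move=> n nm; case: ifP => // _; rewrite mcoeffZ mcoeffX (negPf nm) mulr0.
  by case: ifP => // _; rewrite mcoeffZ mcoeffX eqxx mulr1.
rewrite big_seq big1 => [|n nf].
  by rewrite (memN_msupp_eq0 mf); case: ifP.
case: ifP => // _; rewrite mcoeffZ mcoeffX; case: eqP => [nm|]; last by rewrite mulr0.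
by rewrite nm (negPf mf) in nf.
Qed.

Lemma pcompD x f g : pcomp x (f + g) = pcomp x f + pcomp x g.
Proof.
by apply/mpolyP => m; rewrite mcoeffD !mcoeff_pcomp mcoeffD; case: ifP; rewrite ?addr0.
Qed.

Lemma pcompN x f : pcomp x (- f) = - pcomp x f.
Proof.
by apply/mpolyP => m; rewrite mcoeffN !mcoeff_pcomp mcoeffN; case: ifP; rewrite ?oppr0.
Qed.

Lemma pcomp_pcomp x y f : pcomp x (pcomp y f) = if x == y then pcomp y f else 0.
Proof.
apply/mpolyP => m; rewrite !mcoeff_pcomp; have [->|xy] := eqVneq x y.
  by rewrite mcoeff_pcomp; case: (ldeg p m == y).
by rewrite mcoeff0; case: eqP => [->|//]; rewrite (negPf xy).
Qed.

Lemma pcomp_sum f :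
  f = \sum_(x <- undup [seq ldeg p m | m <- msupp f]) pcomp x f.
Proof.
apply/mpolyP => m; rewrite raddf_sum /=.
under eq_bigr do rewrite mcoeff_pcomp.
have [mf|mf] := boolP (m \in msupp f).
  rewrite (bigD1_seq (ldeg p m)) ?undup_uniq ?mem_undup ?map_f //= eqxx.
  by rewrite big1 ?addr0 // => x xm; rewrite eq_sym (negPf xm).
by rewrite (memN_msupp_eq0 mf) big1 // => x _; case: ifP.
Qed.

Definition phomog (y : L) (f : P) : Prop :=
  forall m, m \in msupp f -> ldeg p m = y.

Lemma pcomp_X x m : pcomp x 'X_[m] = if ldeg p m == x then 'X_[m] else 0.
Proof.
apply/mpolyP => n; rewrite mcoeff_pcomp mcoeffX; case: (m =P n) => [->|mn] /=.
  by case: ifP; rewrite ?mcoeffX ?eqxx ?mcoeff0.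
by rewrite if_same; case: ifP; rewrite ?mcoeff0 // mcoeffX; case: (m =P n).
Qed.

Lemma pcomp_is_additive x : zmod_morphism (pcomp x).
Proof. by move=> f g; rewrite pcompD pcompN. Qed.
HB.instance Definition _ x := GRing.isZmodMorphism.Build P P (pcomp x) (pcomp_is_additive x).

Lemma pcompZ x c f : pcomp x (c *: f) = c *: pcomp x f.
Proof.
by apply/mpolyP => m; rewrite mcoeffZ !mcoeff_pcomp mcoeffZ; case: ifP; rewrite ?mulr0.
Qed.

Lemma pcompM y x g f : phomog y g -> pcomp (y + x) (g * f) = g * pcomp x f.
Proof.
move=> hg; rewrite [in LHS](mpolyE f) [in RHS](mpolyE f) mulr_sumr !raddf_sum /= mulr_sumr.
apply: eq_bigr => m _; rewrite pcompZ pcomp_X -scalerAr pcompZ.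
rewrite -[RHS]scalerAr; congr (_ *: _) => {f}.
rewrite [X in pcomp _ (X * _)](mpolyE g) mulr_suml raddf_sum /=.
rewrite [X in _ = X * _](mpolyE g) mulr_suml.
apply: eq_big_seq => n /hg gn; rewrite -scalerAl -mpolyXD pcompZ pcomp_X ldegD gn.
by rewrite (inj_eq (addrI _)) -scalerAl; case: ifP; rewrite ?mulr0 ?mpolyXD.
Qed.
End CoordinateAlgebra.

Section GradedAlgebra.
Variables (k : fieldType) (p : weights).
Local Notation P := {mpoly k[3]}.
Local Notation L := (Lgrp p).
Local Notation A := (coordA k p).

Lemma phomogE (y : L) (f : P) : pcomp y f = f -> phomog y f.
Proof.
move=> hf m; rewrite mcoeff_msupp -hf mcoeff_pcomp.
by case: (ldeg p m =P y) => // _; rewrite eqxx.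
Qed.

Lemma pcomp_homog (y : L) (f : P) : phomog y (pcomp y f).
Proof. by apply: phomogE; rewrite pcomp_pcomp eqxx. Qed.

Lemma relA_homog : phomog (cvec p) (relA k p).
Proof.
apply: phomogE; rewrite /relA pcompD raddfB /= !mpolyXn !pcomp_X !ldegUn.
by rewrite !xvec_wt eqxx.
Qed.

Lemma piAD (f g : P) : piA p (f + g) = piA p f + piA p g.
Proof. exact: raddfD. Qed.

Lemma piAB (f g : P) : piA p (f - g) = piA p f - piA p g.
Proof. exact: raddfB. Qed.

Lemma piAM (f g : P) : piA p (f * g) = piA p f * piA p g.
Proof. exact: rmorphM. Qed.

Lemma piA_sum (I : eqType) (s : seq I) (F : I -> P) :
  piA p (\sum_(i <- s) F i) = \sum_(i <- s) piA p (F i).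
Proof. exact: raddf_sum. Qed.

Lemma piA_repr (a : A) : piA p (repr a) = a.
Proof. exact: reprK. Qed.

Lemma piA_eq (f g : P) : piA p f = piA p g <-> exists h, f - g = h * relA k p.
Proof.
split=> [/eqP|].
  by rewrite -(Quotient.idealrBE (@idA k p)) => /asboolP.
by move=> h; apply/eqP; rewrite -(Quotient.idealrBE (@idA k p)); apply/asboolP.
Qed.

Definition Ahomog (y : L) (a : A) : Prop :=
  exists f : P, phomog y f /\ a = piA p f.

Definition Acomp (x : L) (a : A) : A := piA p (pcomp x (repr a)).

Lemma Acomp_piA (x : L) (f : P) : Acomp x (piA p f) = piA p (pcomp x f).
Proof.
have /piA_eq[h eh] := piA_repr (piA p f).
apply/piA_eq; exists (pcomp (- cvec p + x) h).
have ex : x = cvec p + (- cvec p + x) by rewrite addNKr.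
rewrite -raddfB /= eh mulrC {1}ex (pcompM _ _ relA_homog).
exact: mulrC.
Qed.

Lemma scalA_homog (c : k) : Ahomog 0 (scalA p c).
Proof.
exists c%:MP; split=> //; apply: phomogE.
rewrite -[c%:MP]mulr1 mul_mpolyC pcompZ -mpolyX0 pcomp_X /ldeg big1 ?eqxx //.
by move=> i _; rewrite mnm0E.
Qed.

Lemma scalAD (a b : k) : scalA p (a + b) = scalA p a + scalA p b.
Proof. by rewrite /scalA mpolyCD piAD. Qed.
Lemma scalAM (a b : k) : scalA p (a * b) = scalA p a * scalA p b.
Proof. by rewrite /scalA mpolyCM piAM. Qed.
Lemma scalA1 : scalA p 1 = 1 :> A.
Proof. by rewrite /scalA mpolyC1; exact: rmorph1. Qed.

(* A grading M = (+)_x M_x is given by its projections hc x : M -> M_x, so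
   that M_x is the set of the u such that hc x u = u. *)
Record grmod := GrMod {
  gcar :> lmodType A;
  hc : L -> gcar -> gcar;
  hcD : forall x u v, hc x (u + v) = hc x u + hc x v;
  hc_hc : forall x y u, hc x (hc y u) = if x == y then hc y u else 0;
  hc_sum : forall u, exists s : seq L, uniq s /\ u = \sum_(x <- s) hc x u;
  hcZ : forall y x a u, Ahomog y a -> hc (y + x) (a *: u) = a *: hc x u;
  gfg : exists s : seq gcar, forall u, exists c : 'I_(size s) -> A,
          u = \sum_i c i *: s`_i }.

Lemma A_hcD x (u v : A^o) : Acomp x (u + v) = Acomp x u + Acomp x v.
Proof.
rewrite -(piA_repr u) -(piA_repr v) -piAD !Acomp_piA.
by rewrite pcompD piAD.
Qed.

Lemma A_hc_hc x y (u : A^o) :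
  Acomp x (Acomp y u) = if x == y then Acomp y u else 0 :> A^o.
Proof.
rewrite -(piA_repr u) !Acomp_piA pcomp_pcomp; case: ifP => // _.
exact: raddf0.
Qed.

Lemma A_hc_sum (u : A^o) :
  exists s : seq L, uniq s /\ u = \sum_(x <- s) Acomp x u :> A^o.
Proof.
exists (undup [seq ldeg p m | m <- msupp (repr u)]); split; first exact: undup_uniq.
by rewrite -{1}(piA_repr u) {1}(pcomp_sum p (repr u)) piA_sum.
Qed.

Lemma A_hcZ y x (a : A) (u : A^o) :
  Ahomog y a -> Acomp (y + x) (a *: u) = a *: (Acomp x u : A^o) :> A^o.
Proof.
move=> [f [hf ->]]; rewrite -(piA_repr u).
by rewrite /GRing.scale /= -piAM !Acomp_piA pcompM // piAM.
Qed.

Lemma A_fg : exists s : seq A^o, forall u, exists c : 'I_(size s) -> A,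
  u = \sum_i c i *: s`_i.
Proof.
exists [:: 1] => u; exists (fun=> u); rewrite big_ord1 /=.
by rewrite /GRing.scale /= mulr1.
Qed.

Definition strA : grmod := GrMod A_hcD A_hc_hc A_hc_sum A_hcZ A_fg.

Section Shift.
Variables (M : grmod) (z : L).

Lemma shift_hc_hc x y (u : M) :
  hc (z + x) (hc (z + y) u) = if x == y then hc (z + y) u else 0.
Proof. by rewrite hc_hc (inj_eq (addrI _)). Qed.

Lemma shift_hc_sum (u : M) :
  exists s : seq L, uniq s /\ u = \sum_(x <- s) hc (z + x) u.
Proof.
have [s [us es]] := hc_sum u; exists [seq - z + x | x <- s]; split.
  by rewrite map_inj_uniq //; apply: addrI.
by rewrite {1}es big_map; apply: eq_bigr => x _; rewrite addrA addrN add0r.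
Qed.

Lemma shift_hcZ y x a (u : M) :
  Ahomog y a -> hc (z + (y + x)) (a *: u) = a *: hc (z + x) u.
Proof. by move=> ha; rewrite addrCA hcZ. Qed.

(* M(z)_x = M_(z + x) *)
Definition shift : grmod :=
  GrMod (fun x => hcD (z + x)) shift_hc_hc shift_hc_sum shift_hcZ (gfg M).
End Shift.
End GradedAlgebra.

Record lincat (k : fieldType) := LinCat {
  obj :> Type;
  Mor : obj -> obj -> lmodType k;
  idm : forall X, Mor X X;
  compm : forall X Y Z, Mor Y Z -> Mor X Y -> Mor X Z;
  compA : forall X Y Z W (h : Mor Z W) (g : Mor Y Z) (f : Mor X Y),
    compm h (compm g f) = compm (compm h g) f;
  comp1f : forall X Y (f : Mor X Y), compm (idm Y) f = f;
  compf1 : forall X Y (f : Mor X Y), compm f (idm X) = f;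
  comp_linr : forall X Y Z (g : Mor Y Z) a (f1 f2 : Mor X Y),
    compm g (a *: f1 + f2) = a *: compm g f1 + compm g f2;
  comp_linl : forall X Y Z (g1 g2 : Mor Y Z) a (f : Mor X Y),
    compm (a *: g1 + g2) f = a *: compm g1 f + compm g2 f }.

Section SerreQuotient.
Variables (k : fieldType) (p : weights).
Local Notation L := (Lgrp p).
Local Notation A := (coordA k p).
Local Notation grmod := (grmod k p).

Record is_gsub (M : grmod) (S : set M) : Prop := IsGsub {
  gsub0 : S 0;
  gsub_lin : forall (a : A) u v, S u -> S v -> S (a *: u + v);
  gsub_hc : forall x u, S u -> S (hc x u) }.

(* flen P R: the quotient R/P of graded submodules P <= R has finite length,
   i.e. there is a chain from P to R whose factors are simple or zero. *)
Inductive flen (M : grmod) (P : set M) : set M -> Prop :=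
| flen_refl : flen P P
| flen_step Q R : flen P Q -> is_gsub R -> Q `<=` R ->
    (forall X, is_gsub X -> Q `<=` X -> X `<=` R -> X = Q \/ X = R) ->
    flen P R.

Record is_grel (M N : grmod) (r : M -> N -> Prop) : Prop := IsGrel {
  grel0 : r 0 0;
  grel_lin : forall (a : A) m m' n n',
    r m n -> r m' n' -> r (a *: m + m') (a *: n + n');
  grel_hc : forall x m n, r m n -> r (hc x m) (hc x n) }.

Definition rdom (M N : grmod) (r : M -> N -> Prop) : set M :=
  [set m | exists n, r m n].

Definition rimg (M N : grmod) (r : M -> N -> Prop) (S : set M) : set N :=
  [set n | exists2 m, S m & r m n].

(* A representative of a morphism M -> N of the quotient category: a morphism
   M' -> N/N' of graded modules with M' <= M, N' <= N graded submodules such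
   that M/M' and N' have finite length.  It is given by its graph
   {(m, n) | m in M', n in f(m)}, so that M' = rdom and N' = {n | (0, n)}. *)
Record frac (M N : grmod) := Frac {
  fgr :> M -> N -> Prop;
  fgrP : is_grel fgr;
  fdom_cofin : flen (rdom fgr) setT;
  find_fin : flen [set 0] (fgr 0) }.

(* f : M' -> N/N' and g : M'' -> N/N'' are identified when they induce the same
   morphism D -> N/T, for some D <= M' n M'' and T >= N' + N'' *)
Definition feq (M N : grmod) (f g : frac M N) : Prop :=
  exists (D : set M) (T : set N),
    [/\ is_gsub D /\ is_gsub T, flen D setT /\ flen [set 0] T,
        D `<=` rdom f `&` rdom g,
        f 0 `|` g 0 `<=` T &
        forall m n n', D m -> f m n -> g m n' -> T (n - n')].

Lemma hc0 (M : grmod) x : hc x (0 : M) = 0.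
Proof. by apply: (@addrI _ (hc x (0 : M))); rewrite -hcD !addr0. Qed.

Lemma gsubZ (M : grmod) (S : set M) : is_gsub S -> forall (a : A) u, S u -> S (a *: u).
Proof. by move=> hS a u hu; rewrite -[_ *: _]addr0; apply: (gsub_lin hS) => //; exact: gsub0. Qed.
Lemma gsubD (M : grmod) (S : set M) : is_gsub S -> forall u v, S u -> S v -> S (u + v).
Proof. by move=> hS u v hu hv; rewrite -[u]scale1r; apply: (gsub_lin hS). Qed.
Lemma gsubB (M : grmod) (S : set M) : is_gsub S -> forall u v, S u -> S v -> S (u - v).
Proof. by move=> hS u v hu hv; rewrite addrC -scaleN1r; apply: (gsub_lin hS). Qed.

Lemma grelB (M N : grmod) (r : M -> N -> Prop) : is_grel r ->
  forall m m' n n', r m n -> r m' n' -> r (m - m') (n - n').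
Proof.
move=> hr m m' n n' h h'; rewrite addrC [n - _]addrC -!scaleN1r.
exact: grel_lin.
Qed.
Lemma grelD (M N : grmod) (r : M -> N -> Prop) : is_grel r ->
  forall m m' n n', r m n -> r m' n' -> r (m + m') (n + n').
Proof.
by move=> hr m m' n n' h h'; rewrite -[m]scale1r -[n]scale1r; exact: grel_lin.
Qed.

Lemma rimg_gsub (M N : grmod) (r : M -> N -> Prop) S :
  is_grel r -> is_gsub S -> is_gsub (rimg r S).
Proof.
move=> hr hS; split.
- by exists 0; [exact: gsub0 | exact: grel0].
- move=> a u v [m Sm rm] [m' Sm' rm']; exists (a *: m + m'); first exact: gsub_lin.
  exact: grel_lin.
- by move=> x u [m Sm rm]; exists (hc x m); [exact: gsub_hc | exact: grel_hc].
Qed.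

Lemma rinv_grel (M N : grmod) (r : M -> N -> Prop) :
  is_grel r -> is_grel (fun n m => r m n).
Proof.
move=> hr; split; first exact: grel0.
  by move=> a m m' n n'; exact: grel_lin.
by move=> x m n; exact: grel_hc.
Qed.

Lemma gsubT (M : grmod) : is_gsub [set: M].
Proof. by []. Qed.
Lemma gsub_set0 (M : grmod) : is_gsub [set (0 : M)].
Proof.
split=> //= [a u v -> ->|x u ->]; first by rewrite scaler0 addr0.
exact: hc0.
Qed.

Lemma rdomE (M N : grmod) (r : M -> N -> Prop) :
  rdom r = rimg (fun n m => r m n) setT.
Proof. by apply/seteqP; split=> m [n]; exists n. Qed.

Lemma rdom_gsub (M N : grmod) (r : M -> N -> Prop) : is_grel r -> is_gsub (rdom r).
Proof. by move=> hr; rewrite rdomE; apply: rimg_gsub => //; exact: rinv_grel. Qed.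

Lemma rind_gsub (M N : grmod) (r : M -> N -> Prop) : is_grel r -> is_gsub (r 0).
Proof.
move=> hr; have -> : r 0 = rimg r [set 0].
  by apply/seteqP; split=> [n rn|n [m -> //]]; exists 0.
by apply: rimg_gsub => //; exact: gsub_set0.
Qed.

Definition gsum (M : grmod) (S T : set M) : set M :=
  [set u | exists2 v, S v & T (u - v)].

Lemma gsum_gsub (M : grmod) (S T : set M) : is_gsub S -> is_gsub T -> is_gsub (gsum S T).
Proof.
move=> hS hT; split.
- by exists 0; rewrite ?subr0; exact: gsub0.
- move=> a u v [u' Su Tu] [v' Sv Tv]; exists (a *: u' + v'); first exact: gsub_lin.
  by rewrite opprD addrACA -scalerBr; exact: gsub_lin.
- move=> x u [u' Su Tu]; exists (hc x u'); first exact: gsub_hc.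
  have -> : hc x u - hc x u' = hc x (u - u').
    by apply: (@addIr _ (hc x u')); rewrite -hcD !subrK.
  exact: gsub_hc.
Qed.

Lemma flen_gsub (M : grmod) (P Q : set M) : is_gsub P -> flen P Q -> is_gsub Q.
Proof. by move=> hP; case. Qed.

Lemma flen_le (M : grmod) (P Q : set M) : flen P Q -> P `<=` Q.
Proof. by elim=> // ? ? _ h _ h' _; apply: subset_trans h'. Qed.

Lemma flen_trans (M : grmod) (P Q R : set M) : flen P Q -> flen Q R -> flen P R.
Proof.
by move=> hPQ; elim=> // Q' R' _ h hR hQR hX; apply: (flen_step h).
Qed.

Lemma flen_rimg (M N : grmod) (r : M -> N -> Prop) (P Q : set M) :
  is_grel r -> is_gsub P -> flen P Q -> flen (rimg r P) (rimg r Q).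
Proof.
move=> hr hP; elim=> [|Q' R hPQ IH hR hQR hX]; first exact: flen_refl.
have hQ' := flen_gsub hP hPQ.
apply: (flen_step IH); first exact: rimg_gsub.
  by move=> n [m Qm rm]; exists m => //; exact: hQR.
move=> X gX lo up.
pose Y := R `&` rimg (fun n m => r m n) X.
have gY : is_gsub Y.
  have gI : is_gsub (rimg (fun n m => r m n) X) by apply: rimg_gsub => //; exact: rinv_grel.
  split; first by split; exact: gsub0.
    by move=> a u v [? ?] [? ?]; split; exact: gsub_lin.
  by move=> x u [? ?]; split; exact: gsub_hc.
have QS : Q' `<=` gsum Q' Y.
  by move=> u Qu; exists u => //; rewrite subrr; exact: gsub0.
have SR : gsum Q' Y `<=` R.
  move=> u [v Qv [Ru _]]; rewrite -[u](subrK v); apply: gsubD => //; exact: hQR.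
have [e|e] := hX _ (gsum_gsub hQ' gY) QS SR; [left|right].
  apply/seteqP; split=> // n Xn; have [m Rm rm] := up _ Xn.
  exists m => //; rewrite -e; exists 0; first exact: gsub0.
  by rewrite subr0; split=> //; exists n.
apply/seteqP; split=> // n [m]; rewrite -e => -[v Qv [_ [n' Xn' rn']]] rm.
rewrite -[n](subrK n'); apply: gsubD => //; apply: lo.
exists v => //; rewrite -[v](subKr m); exact: grelB.
Qed.

Lemma flen_setI (M : grmod) (D E : set M) : is_gsub D -> is_gsub E ->
  flen D setT -> flen E setT -> flen (D `&` E) setT.
Proof.
move=> gD gE fD fE; pose r (m n : M) := m = n /\ E m.
have hr : is_grel r.
  split; first by split=> //; exact: gsub0.
    by move=> a m m' n n' [-> ?] [-> ?]; split=> //; exact: gsub_lin.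
  by move=> x m n [-> ?]; split=> //; exact: gsub_hc.
have := flen_rimg hr gD fD.
have -> : rimg r D = D `&` E.
  by apply/seteqP; split=> [m [n Dn [<- En]]|m [Dm Em]] //; exists m.
have -> : rimg r setT = E.
  by apply/seteqP; split=> [m [n Dn [<- En]]|m Em] //; exists m.
by move=> h; exact: flen_trans h fE.
Qed.

Lemma gsubI (M : grmod) (D E : set M) : is_gsub D -> is_gsub E -> is_gsub (D `&` E).
Proof.
move=> gD gE; split; first by split; exact: gsub0.
  by move=> a u v [? ?] [? ?]; split; exact: gsub_lin.
by move=> x u [? ?]; split; exact: gsub_hc.
Qed.

Lemma flen_gsum (M : grmod) (S T : set M) : is_gsub S -> is_gsub T ->
  flen [set 0] S -> flen [set 0] T -> flen [set 0] (gsum S T).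
Proof.
move=> gS gT fS fT; pose r (m n : M) := T (n - m).
have hr : is_grel r.
  split; first by rewrite /r subr0; exact: gsub0.
    move=> a m m' n n' ? ?; rewrite /r opprD addrACA -scalerBr; exact: gsub_lin.
  move=> x m n h; rewrite /r.
  have -> : hc x n - hc x m = hc x (n - m).
    by apply: (@addIr _ (hc x m)); rewrite -hcD !subrK.
  exact: gsub_hc.
have := flen_rimg hr (@gsub_set0 M) fS.
have -> : rimg r [set 0] = T.
  apply/seteqP; split=> [n [m -> ]|n Tn]; first by rewrite /r subr0.
  by exists 0 => //; rewrite /r subr0.
by move=> h; exact: flen_trans fT h.
Qed.

Section Frac.
Variables M N : grmod.
Implicit Types f g h : frac M N.

Lemma frac0_gsub f : is_gsub (f 0).
Proof. exact/rind_gsub/fgrP. Qed.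
Lemma fdom_gsub f : is_gsub (rdom f).
Proof. exact/rdom_gsub/fgrP. Qed.

Lemma frac_sub f m n n' : f m n -> f m n' -> f 0 (n - n').
Proof. by move=> fn fn'; rewrite -[0](subrr m); apply: (grelB (fgrP f)). Qed.

Lemma feq_sub f g : (forall m n, f m n -> g m n) -> feq f g.
Proof.
move=> fg; exists (rdom f), (g 0); split.
- by split; [exact: fdom_gsub | exact: frac0_gsub].
- by split; [exact: fdom_cofin | exact: find_fin].
- by move=> m [n fn]; split; exists n => //; exact: fg.
- by move=> n [/fg|].
- by move=> m n n' _ /fg gn gn'; exact: frac_sub gn gn'.
Qed.

Lemma feq_refl f : feq f f. Proof. exact: feq_sub. Qed.

Lemma feq_sym f g : feq f g -> feq g f.
Proof.
move=> [D [T [[gD gT] fl D1 T1 H]]]; exists D, T; split=> //.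
- by rewrite setIC.
- by rewrite setUC.
- move=> m n n' Dm gn fn'; rewrite -opprB -[- _]add0r.
  by apply: gsubB => //; [exact: gsub0 | exact: H fn' gn].
Qed.

Lemma feq_trans f g h : feq f g -> feq g h -> feq f h.
Proof.
move=> [D [T [[gD gT] [fD fT] D1 T1 H]]] [D' [T' [[gD' gT'] [fD' fT'] D1' T1' H']]].
exists (D `&` D'), (gsum T T'); split.
- by split; [exact: gsubI | exact: gsum_gsub].
- by split; [exact: flen_setI | exact: flen_gsum].
- by move=> m [/D1[? _] /D1'[_ ?]].
- move=> n [fn|hn].
    by exists n; [apply: T1; left | rewrite subrr; exact: gsub0].
  by exists 0; [exact: gsub0 | rewrite subr0; apply: T1'; right].
- move=> m n n' [Dm Dm'] fn hn'; have [_ [n2 gn2]] := D1 _ Dm.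
  exists (n - n2); first exact: H gn2.
  by rewrite opprB addrC addrA subrK; apply: H' hn'.
Qed.
End Frac.
End SerreQuotient.

Section QuotientCategory.
Variables (k : fieldType) (p : weights).
Local Notation A := (coordA k p).
Local Notation grmod := (grmod k p).

Section Operations.
Variables M N : grmod.
Implicit Types f g h : frac M N.

Definition rzero (m : M) (n : N) : Prop := n = 0.

Lemma rzero_grel : is_grel rzero.
Proof.
split=> // [a m m' n n' -> ->|x m n ->]; first by rewrite /rzero scaler0 addr0.
exact: hc0.
Qed.

Lemma rzero_dom : flen (rdom rzero) setT.
Proof.
have -> : rdom rzero = setT by apply/seteqP; split=> // m _; exists 0.
exact: flen_refl.
Qed.

Lemma rzero_ind : flen [set 0] (rzero 0).
Proof. exact: flen_refl. Qed.

Definition fzero : frac M N := Frac rzero_grel rzero_dom rzero_ind.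

Definition radd f g (m : M) (n : N) : Prop :=
  exists n1 n2, [/\ f m n1, g m n2 & n = n1 + n2].

Lemma radd_grel f g : is_grel (radd f g).
Proof.
split.
- by exists 0, 0; split; rewrite ?addr0 //; exact: (grel0 (fgrP _)).
- move=> a m m' n n' [n1 [n2 [? ? ->]]] [n1' [n2' [? ? ->]]].
  exists (a *: n1 + n1'), (a *: n2 + n2'); split; try exact: (grel_lin (fgrP _)).
  by rewrite scalerDr addrACA.
- move=> x m n [n1 [n2 [? ? ->]]]; exists (hc x n1), (hc x n2).
  by split; rewrite ?hcD //; exact: (grel_hc (fgrP _)).
Qed.

Lemma radd_dom f g : flen (rdom (radd f g)) setT.
Proof.
have -> : rdom (radd f g) = rdom f `&` rdom g.
  apply/seteqP; split=> [m [n [n1 [n2 [? ? _]]]]|m [[n1 ?] [n2 ?]]].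
    by split; [exists n1 | exists n2].
  by exists (n1 + n2), n1, n2.
by apply: flen_setI; [exact: fdom_gsub | exact: fdom_gsub | exact: fdom_cofin | exact: fdom_cofin].
Qed.

Lemma radd_ind f g : flen [set 0] (radd f g 0).
Proof.
have -> : radd f g 0 = gsum (f 0) (g 0).
  apply/seteqP; split=> [n [n1 [n2 [? ? ->]]]|n [n1 ? ?]].
    by exists n1 => //; rewrite addrC addKr.
  by exists n1, (n - n1); split=> //; rewrite addrC subrK.
by apply: flen_gsum; [exact: frac0_gsub | exact: frac0_gsub | exact: find_fin | exact: find_fin].
Qed.

Definition fadd f g : frac M N := Frac (radd_grel f g) (radd_dom f g) (radd_ind f g).

Definition rscale (c : k) f (m : M) (n : N) : Prop :=
  exists2 n', f m n' & n = scalA p c *: n'.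

Lemma rscale_grel c f : is_grel (rscale c f).
Proof.
split.
- by exists 0; rewrite ?scaler0 //; exact: (grel0 (fgrP _)).
- move=> a m m' n n' [n1 ? ->] [n2 ? ->]; exists (a *: n1 + n2).
    exact: (grel_lin (fgrP _)).
  by rewrite scalerDr !scalerA mulrC.
- move=> x m n [n1 ? ->]; exists (hc x n1); first exact: (grel_hc (fgrP _)).
  by rewrite -[in LHS](add0r x) hcZ //; exact: scalA_homog.
Qed.

Lemma rscale_dom c f : flen (rdom (rscale c f)) setT.
Proof.
have -> : rdom (rscale c f) = rdom f.
  apply/seteqP; split=> [m [n [n1 ? _]]|m [n ?]]; first by exists n1.
  by exists (scalA p c *: n), n.
exact: fdom_cofin.
Qed.

Lemma rscale_ind c f : flen [set 0] (rscale c f 0).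
Proof.
pose r (m n : N) := n = scalA p c *: m.
have hr : is_grel r.
  split; first by rewrite /r scaler0.
    by move=> a m m' n n' -> ->; rewrite /r scalerDr !scalerA mulrC.
  by move=> x m n ->; rewrite /r -[in LHS](add0r x) hcZ //; exact: scalA_homog.
have := flen_rimg hr (@gsub_set0 k p N) (find_fin f).
have -> : rimg r [set 0] = [set 0].
  apply/seteqP; split=> [n [m -> ->]|n ->]; first by rewrite scaler0.
  by exists 0 => //; rewrite /r scaler0.
by have -> : rimg r (f 0) = rscale c f 0 by [].
Qed.

Definition fscale c f : frac M N :=
  Frac (rscale_grel c f) (rscale_dom c f) (rscale_ind c f).

Lemma fadd_feq f f' g g' : feq f f' -> feq g g' -> feq (fadd f g) (fadd f' g').
Proof.
move=> [D [T [[gD gT] [fD fT] D1 T1 H]]] [D' [T' [[gD' gT'] [fD' fT'] D1' T1' H']]].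
exists (D `&` D'), (gsum T T'); split.
- by split; [exact: gsubI | exact: gsum_gsub].
- by split; [exact: flen_setI | exact: flen_gsum].
- move=> m [/D1[[n ?] [n' ?]] /D1'[[n2 ?] [n2' ?]]].
  by split; [exists (n + n2), n, n2 | exists (n' + n2'), n', n2'].
- move=> n [|] [n1 [n2 [h1 h2 ->]]]; exists n1; rewrite 1?addrC ?addKr.
  + by apply: T1; left.
  + by apply: T1'; left.
  + by apply: T1; right.
  + by apply: T1'; right.
- move=> m n n' [Dm Dm'] [n1 [n2 [h1 h2 ->]]] [n1' [n2' [h1' h2' ->]]].
  exists (n1 - n1'); first exact: H h1'.
  rewrite opprD addrACA [X in T' X]addrC addKr; exact: H' h2'.
Qed.

Lemma fscale_feq c f f' : feq f f' -> feq (fscale c f) (fscale c f').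
Proof.
move=> [D [T [[gD gT] [fD fT] D1 T1 H]]]; exists D, T; split=> //.
- move=> m /D1[[n ?] [n' ?]].
  by split; [exists (scalA p c *: n), n | exists (scalA p c *: n'), n'].
- move=> n [|] [n1 h1 ->]; apply: gsubZ => //; apply: T1; first by left.
  by right.
- move=> m n n' Dm [n1 h1 ->] [n1' h1' ->]; rewrite -scalerBr; apply: gsubZ => //.
  exact: H h1'.
Qed.

HB.instance Definition _ := gen_eqMixin (frac M N).
HB.instance Definition _ := gen_choiceMixin (frac M N).

Definition feqb (f g : frac M N) : bool := `[< feq f g >].
Lemma feqb_refl : reflexive feqb.
Proof. by move=> f; apply/asboolP; exact: feq_refl. Qed.
Lemma feqb_sym : ssrbool.symmetric feqb.
Proof. by move=> f g; apply/asboolP/asboolP; exact: feq_sym. Qed.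
Lemma feqb_trans : transitive feqb.
Proof. by move=> g f h /asboolP fg /asboolP gh; apply/asboolP; exact: feq_trans gh. Qed.
Canonical feq_equiv := EquivRel feqb feqb_refl feqb_sym feqb_trans.

Definition qhom := {eq_quot feq_equiv}.
HB.instance Definition _ := Choice.on qhom.

Definition qpi f : qhom := \pi_qhom f.
Definition qrepr (u : qhom) : frac M N := repr u.
Lemma qreprK u : qpi (qrepr u) = u. Proof. exact: reprK. Qed.
Lemma qpiP f g : qpi f = qpi g <-> feq f g.
Proof.
split=> [/eqmodP/asboolP //|h]; apply/eqmodP; exact/asboolP.
Qed.
Lemma qpi_sub f g : (forall m n, f m n -> g m n) -> qpi f = qpi g.
Proof. by move=> fg; exact/qpiP/feq_sub. Qed.

Definition qadd (u v : qhom) : qhom := qpi (fadd (qrepr u) (qrepr v)).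
Definition qscale (c : k) (u : qhom) : qhom := qpi (fscale c (qrepr u)).
Definition qopp (u : qhom) : qhom := qscale (-1) u.
Definition qzero : qhom := qpi fzero.

Lemma qaddE f g : qadd (qpi f) (qpi g) = qpi (fadd f g).
Proof. by apply/qpiP/fadd_feq; apply/qpiP; rewrite qreprK. Qed.
Lemma qscaleE c f : qscale c (qpi f) = qpi (fscale c f).
Proof. by apply/qpiP/fscale_feq; apply/qpiP; rewrite qreprK. Qed.

Lemma qaddC : commutative qadd.
Proof.
move=> u v; apply: qpi_sub => m n [n1 [n2 [? ? ->]]].
by exists n2, n1; split=> //; rewrite addrC.
Qed.
Lemma qaddA : associative qadd.
Proof.
move=> u v w; rewrite -(qreprK u) -(qreprK v) -(qreprK w) !qaddE.
apply: qpi_sub => m n [n1 [n2 [h1 [n3 [n4 [h3 h4 ->]]] ->]]].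
by exists (n1 + n3), n4; split; rewrite ?addrA //; exists n1, n3.
Qed.
Lemma qadd0 : left_id qzero qadd.
Proof.
move=> u; rewrite -(qreprK u) qaddE; apply: qpi_sub => m n [n1 [n2 [-> h ->]]].
by rewrite add0r.
Qed.
Lemma qaddN : left_inverse qzero qopp qadd.
Proof.
move=> u; rewrite -(qreprK u) /qopp qscaleE qaddE; set f := qrepr u.
apply/esym; apply/qpiP; exists (rdom f), (f 0); split.
- by split; [exact: fdom_gsub | exact: frac0_gsub].
- by split; [exact: fdom_cofin | exact: find_fin].
- move=> m [n fn]; split; first by exists 0.
  by exists (scalA p (-1) *: n + n), (scalA p (-1) *: n), n; split=> //; exists n.
- move=> n [->|]; first exact: (grel0 (fgrP _)).
  move=> [n1 [n2 [[n3 h3 ->] h2 ->]]]; exact: (gsub_lin (frac0_gsub f)).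
- move=> m n n' [n0 fn0] -> [n1 [n2 [[n3 h3 ->] h2 ->]]].
  have e : scalA p (-1) = - 1 :> A.
    apply/eqP; rewrite -subr_eq0 opprK -scalA1 -scalAD addNr.
    by rewrite /scalA /piA mpolyC0; apply/eqP; exact: raddf0.
  by rewrite e scaleN1r sub0r opprD opprK; exact: frac_sub h3 h2.
Qed.
HB.instance Definition _ := GRing.isZmodule.Build qhom qaddA qaddC qadd0 qaddN.

Lemma qscaleA a b (u : qhom) : qscale a (qscale b u) = qscale (a * b) u.
Proof.
rewrite -(qreprK u) !qscaleE; apply: qpi_sub => m n [n1 [n2 h ->] ->].
by exists n2 => //; rewrite scalerA scalAM.
Qed.
Lemma qscale1 : left_id 1 qscale.
Proof.
move=> u; rewrite -(qreprK u) qscaleE; apply: qpi_sub => m n [n1 h ->].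
by rewrite scalA1 scale1r.
Qed.
Lemma qscaleDr : right_distributive qscale +%R.
Proof.
move=> a u v; rewrite -(qreprK u) -(qreprK v) [X in qscale _ X]qaddE !qscaleE.
rewrite [RHS]qaddE; apply: qpi_sub => m n [n1 [n2 [n3 [h2 h3 ->]]] ->].
exists (scalA p a *: n2), (scalA p a *: n3); split; rewrite ?scalerDr //.
  by exists n2.
by exists n3.
Qed.
Lemma qscaleDl u : {morph qscale^~ u : a b / a + b}.
Proof.
move=> a b; rewrite -(qreprK u) !qscaleE [RHS]qaddE; apply: qpi_sub => m n [n1 h ->].
exists (scalA p a *: n1), (scalA p b *: n1); split; try by exists n1.
by rewrite scalAD scalerDl.
Qed.
HB.instance Definition _ :=
  GRing.Zmodule_isLmodule.Build k qhom qscaleA qscale1 qscaleDr qscaleDl.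

Lemma qlinE a f g : a *: qpi f + qpi g = qpi (fadd (fscale a f) g).
Proof. by rewrite [a *: _]qscaleE [LHS]qaddE. Qed.
End Operations.

Section Identity.
Variable M : grmod.
Definition rid (m n : M) : Prop := n = m.
Lemma rid_grel : is_grel rid.
Proof. by split=> // [a m m' n n' -> ->|x m n ->]. Qed.
Lemma rid_dom : flen (rdom rid) setT.
Proof.
have -> : rdom rid = setT by apply/seteqP; split=> // m _; exists m.
exact: flen_refl.
Qed.
Lemma rid_ind : flen [set 0] (rid 0).
Proof. exact: flen_refl. Qed.
Definition fid : frac M M := Frac rid_grel rid_dom rid_ind.
Definition qid : qhom M M := qpi fid.
End Identity.

Section Composition.
Variables M N Q : grmod.
Implicit Types (f : frac M N) (g : frac N Q).

Definition rcomp g f (m : M) (q : Q) : Prop := exists2 n, f m n & g n q.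

Lemma rcomp_grel g f : is_grel (rcomp g f).
Proof.
split; first by exists 0; exact: (grel0 (fgrP _)).
  move=> a m m' q q' [n ? ?] [n' ? ?]; exists (a *: n + n'); exact: (grel_lin (fgrP _)).
by move=> x m q [n ? ?]; exists (hc x n); exact: (grel_hc (fgrP _)).
Qed.

Lemma rcomp_dom g f : flen (rdom (rcomp g f)) setT.
Proof.
have hr := rinv_grel (fgrP f).
have := flen_rimg hr (fdom_gsub g) (fdom_cofin g); rewrite -rdomE => h.
have <- : rimg (fun n m => f m n) (rdom g) = rdom (rcomp g f).
  apply/seteqP; split=> [m [n [q ?] ?]|m [q [n ? ?]]]; first by exists q, n.
  by exists n => //; exists q.
exact: flen_trans h (fdom_cofin f).
Qed.

Lemma rimg_fin g (T : set N) : flen [set 0] T -> flen [set 0] (rimg g T).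
Proof.
move=> hT; have := flen_rimg (fgrP g) (@gsub_set0 k p N) hT.
have -> : rimg g [set 0] = g 0.
  by apply/seteqP; split=> [q [n -> //]|q ?]; exists 0.
by move=> h; exact: flen_trans (find_fin g) h.
Qed.

Lemma rcomp_ind g f : flen [set 0] (rcomp g f 0).
Proof.
have <- : rimg g (f 0) = rcomp g f 0 by [].
exact/rimg_fin/find_fin.
Qed.

Definition fcomp g f : frac M Q := Frac (rcomp_grel g f) (rcomp_dom g f) (rcomp_ind g f).

Lemma fcomp_feql g f f' : feq f f' -> feq (fcomp g f) (fcomp g f').
Proof.
move=> [D [T [[gD gT] [fD fT] D1 T1 H]]].
exists (D `&` (rdom (fcomp g f) `&` rdom (fcomp g f'))), (rimg g T); split.
- split; last exact: (rimg_gsub (fgrP g)).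
  by apply: gsubI => //; apply: gsubI; exact: fdom_gsub.
- split; last exact: rimg_fin.
  apply: flen_setI => //; first by apply: gsubI; exact: fdom_gsub.
  by apply: flen_setI; [exact: fdom_gsub|exact: fdom_gsub|exact: fdom_cofin|exact: fdom_cofin].
- by move=> m [].
- by move=> q [|] [n fn gq]; exists n => //; apply: T1; [left | right].
- move=> m q q' [Dm _] [n fn gn] [n' fn' gn']; exists (n - n'); first exact: H fn'.
  exact: (grelB (fgrP g)).
Qed.

Lemma fcomp_feqr g g' f : feq g g' -> feq (fcomp g f) (fcomp g' f).
Proof.
move=> [D [T [[gD gT] [fD fT] D1 T1 H]]].
have gr (h : frac N Q) : is_gsub (rimg h (f 0)).
  by apply: (rimg_gsub (fgrP h)); exact: frac0_gsub.
have gF (h : frac N Q) : flen [set 0] (rimg h (f 0)) by exact/rimg_fin/find_fin.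
exists (rimg (fun n m => f m n) D), (gsum T (gsum (rimg g (f 0)) (rimg g' (f 0)))); split.
- split; first exact: (rimg_gsub (rinv_grel (fgrP f))).
  by apply: gsum_gsub => //; exact: gsum_gsub.
- split.
    have h := flen_rimg (rinv_grel (fgrP f)) gD fD; rewrite -rdomE in h.
    exact: flen_trans h (fdom_cofin f).
  by apply: flen_gsum => //; [exact: gsum_gsub | exact: flen_gsum].
- by move=> m [n /D1[[q ?] [q' ?]] ?]; split; [exists q, n | exists q', n].
- move=> q [|] [n fn gq]; exists 0; rewrite ?subr0; try exact: gsub0.
    by exists q; [exists n | rewrite subrr; exact: gsub0].
  by exists 0; [exact: gsub0 | rewrite subr0; exists n].
- move=> m q q' [n0 Dn0 fn0] [n1 fn1 gq] [n2 fn2 gq'].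
  have [[q0 gq0] [q0' gq0']] := D1 _ Dn0.
  exists (q0 - q0'); first exact: H gq0'.
  exists (q - q0).
    by exists (n1 - n0); [exact: frac_sub fn1 fn0 | exact: (grelB (fgrP g))].
  exists (n0 - n2); first exact: frac_sub fn0 fn2.
  have -> : q - q' - (q0 - q0') - (q - q0) = q0' - q'.
    have tel (a b c : Q) : a - b + (b - c) = a - c by rewrite addrA subrK.
    by rewrite !opprB -addrA tel addrC tel.
  exact: (grelB (fgrP g')).
Qed.

Definition qcomp (v : qhom N Q) (u : qhom M N) : qhom M Q :=
  qpi (fcomp (qrepr v) (qrepr u)).

Lemma qcompE g f : qcomp (qpi g) (qpi f) = qpi (fcomp g f).
Proof.
apply/qpiP; apply: (@feq_trans _ _ _ _ _ (fcomp g (qrepr (qpi f)))).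
  by apply: fcomp_feqr; apply/qpiP; rewrite qreprK.
by apply: fcomp_feql; apply/qpiP; rewrite qreprK.
Qed.
End Composition.

Lemma qcompA M N Q S (w : qhom Q S) (v : qhom N Q) (u : qhom M N) :
  qcomp w (qcomp v u) = qcomp (qcomp w v) u.
Proof.
rewrite -(qreprK u) -(qreprK v) -(qreprK w) !qcompE; apply: qpi_sub.
by move=> m s [q [n ? ?] ?]; exists n => //; exists q.
Qed.
Lemma qcomp1f M N (u : qhom M N) : qcomp (qid N) u = u.
Proof. by rewrite -(qreprK u) qcompE; apply: qpi_sub => m n [n' ? ->]. Qed.
Lemma qcompf1 M N (u : qhom M N) : qcomp u (qid M) = u.
Proof. by rewrite -(qreprK u) qcompE; apply: qpi_sub => m n [n' -> ?]. Qed.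
Lemma qcomp_linr M N Q (v : qhom N Q) a (u1 u2 : qhom M N) :
  qcomp v (a *: u1 + u2) = a *: qcomp v u1 + qcomp v u2.
Proof.
rewrite -(qreprK v) -(qreprK u1) -(qreprK u2) qlinE !qcompE qlinE.
apply/esym; apply: qpi_sub => m q [q1 [q2 [[q3 [n1 ? ?] ->] [n2 ? ?] ->]]].
exists (scalA p a *: n1 + n2); last exact: (grel_lin (fgrP _)).
by exists (scalA p a *: n1), n2; split=> //; exists n1.
Qed.
Lemma qcomp_linl M N Q (v1 v2 : qhom N Q) a (u : qhom M N) :
  qcomp (a *: v1 + v2) u = a *: qcomp v1 u + qcomp v2 u.
Proof.
rewrite -(qreprK v1) -(qreprK v2) -(qreprK u) qlinE !qcompE qlinE.
apply: qpi_sub => m q [n ? [q1 [q2 [[q3 ? ->] ? ->]]]].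
exists (scalA p a *: q3), q2; split=> //; last by exists n.
by exists q3 => //; exists n.
Qed.

(* The objects of the quotient category are those of mod^L(A). *)
Definition cohX : lincat k :=
  @LinCat k grmod (fun M N => qhom M N) qid qcomp qcompA qcomp1f qcompf1
    qcomp_linr qcomp_linl.
End QuotientCategory.

Section AbelianNotions.
Variables (k : fieldType) (C : lincat k).
Implicit Types X Y Z W : C.
Local Notation "g \c f" := (compm g f) (at level 40, left associativity).

Definition zero_obj X : Prop := idm X = 0.

Definition mono X Y (f : Mor X Y) : Prop :=
  forall W (g h : Mor W X), f \c g = f \c h -> g = h.

Definition is_iso X Y (f : Mor X Y) : Prop :=
  exists g : Mor Y X, g \c f = idm X /\ f \c g = idm Y.

Definition isomorphic X Y : Prop := exists f : Mor X Y, is_iso f.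

Definition is_kernel X Y Z (f : Mor X Y) (g : Mor Y Z) : Prop :=
  g \c f = 0 /\
  forall W (h : Mor W Y), g \c h = 0 -> exists! u : Mor W X, f \c u = h.

Definition is_cokernel X Y Z (g : Mor Y Z) (f : Mor X Y) : Prop :=
  g \c f = 0 /\
  forall W (h : Mor Y W), h \c f = 0 -> exists! u : Mor Z W, u \c g = h.

Definition short_exact X Y Z (f : Mor X Y) (g : Mor Y Z) : Prop :=
  is_kernel f g /\ is_cokernel g f.

Definition split_epi Y Z (g : Mor Y Z) : Prop :=
  exists s : Mor Z Y, g \c s = idm Z.

Definition is_biproduct X Y Z : Prop :=
  exists (i1 : Mor Y X) (i2 : Mor Z X) (p1 : Mor X Y) (p2 : Mor X Z),
    [/\ p1 \c i1 = idm Y, p2 \c i2 = idm Z, p1 \c i2 = 0, p2 \c i1 = 0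
      & i1 \c p1 + i2 \c p2 = idm X].

Definition indecomposable X : Prop :=
  ~ zero_obj X /\
  forall Y Z, is_biproduct X Y Z -> zero_obj Y \/ zero_obj Z.

Definition simple_obj X : Prop :=
  ~ zero_obj X /\
  forall Y (f : Mor Y X), mono f -> zero_obj Y \/ is_iso f.

Inductive has_length : nat -> C -> Prop :=
| has_length0 X : zero_obj X -> has_length 0 X
| has_lengthS n X Y Z (f : Mor X Y) (g : Mor Y Z) :
    has_length n X -> simple_obj Z -> short_exact f g -> has_length n.+1 Y.

Definition maximal_sub X Y (f : Mor X Y) : Prop :=
  [/\ mono f, ~ is_iso f &
      forall Z (g : Mor Z Y), mono g -> (exists u : Mor X Z, g \c u = f) ->
        is_iso g \/ exists v : Mor Z X, f \c v = g].

(* f : X -> Y is the intersection of the maximal subobjects of Y *)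
Definition is_radical X Y (f : Mor X Y) : Prop :=
  mono f /\
  forall W (h : Mor W Y),
    (exists u, f \c u = h) <->
    (forall Z (g : Mor Z Y), maximal_sub g -> exists u, g \c u = h).

Definition is_top Y T : Prop :=
  exists X (f : Mor X Y) (g : Mor Y T), is_radical f /\ is_cokernel g f.

Record subobj Y := SubObj {
  sdom : C;
  smor : Mor sdom Y;
  smor_mono : mono smor }.

Definition same_sub Y (s t : subobj Y) : Prop :=
  exists u : Mor (sdom s) (sdom t), is_iso u /\ smor t \c u = smor s.

(* hall_number A B M h: there are exactly h subobjects X of M such that
   X ~ B and M/X ~ A *)
Definition hall_number A B M (h : nat) : Prop :=
  let P (s : subobj M) :=
    isomorphic (sdom s) B /\
    exists Q (g : Mor M Q), is_cokernel g (smor s) /\ isomorphic Q A in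
  exists s : 'I_h -> subobj M,
    [/\ forall i, P (s i),
        forall i j, same_sub (s i) (s j) -> i = j &
        forall t, P t -> exists i, same_sub t (s i)].

(* Elements of the free abelian group on the objects are viewed as functions
   C -> int; K0_rel is its subgroup generated by the [Y] - [X] - [Z], for all
   short exact sequences 0 -> X -> Y -> Z -> 0. *)
Definition cls X : C -> int := fun Y => if `[< Y = X >] then 1 else 0.

Inductive K0_rel : (C -> int) -> Prop :=
| K0_rel0 : K0_rel (fun=> 0)
| K0_relD X Y Z (f : Mor X Y) (g : Mor Y Z) u : short_exact f g -> K0_rel u ->
    K0_rel (fun W => u W + (cls Y W - cls X W - cls Z W))
| K0_relB X Y Z (f : Mor X Y) (g : Mor Y Z) u : short_exact f g -> K0_rel u ->
    K0_rel (fun W => u W - (cls Y W - cls X W - cls Z W)).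

Definition K0_eq (u v : C -> int) : Prop := K0_rel (fun W => u W - v W).

Definition is_basis (V : lmodType k) (d : nat) (b : 'I_d -> V) : Prop :=
  forall v, exists! a : {ffun 'I_d -> k}, v = \sum_i a i *: b i.

(* dimHom and dimExt1 take the default value 0 on infinite-dimensional spaces. *)
Definition dimHom X Y : nat :=
  xget 0%N [set d | exists b : 'I_d -> Mor X Y, is_basis b].

Record extension X Y := Extension {
  emid : C;
  einj : Mor Y emid;
  eproj : Mor emid X;
  eexact : short_exact einj eproj }.

(* the class of xi' is the push-out of the class of xi along f *)
Definition ext_push X Y Y' (f : Mor Y Y')
    (xi : extension X Y) (xi' : extension X Y') : Prop :=
  exists w : Mor (emid xi) (emid xi'),
    w \c einj xi = einj xi' \c f /\ eproj xi' \c w = eproj xi.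

Definition is_power Y d B (pr : 'I_d -> Mor B Y) : Prop :=
  forall W (h : 'I_d -> Mor W Y), exists! u : Mor W B, forall i, pr i \c u = h i.

(* In the k-space Ext^1(X, Y) of classes of extensions (with the Baer sum),
   [zeta] = \sum_i a_i [xi_i]: if eta in Ext^1(X, Y^d) has components the xi_i,
   the linear combination is the push-out of eta along
   \sum_i a_i pr_i : Y^d -> Y. *)
Definition ext_lincomb X Y d (a : {ffun 'I_d -> k})
    (xi : 'I_d -> extension X Y) (zeta : extension X Y) : Prop :=
  exists B (pr : 'I_d -> Mor B Y) (eta : extension X B),
    [/\ is_power pr, forall i, ext_push (pr i) eta (xi i)
      & ext_push (\sum_i a i *: pr i) eta zeta].

Definition is_ext_basis X Y d (xi : 'I_d -> extension X Y) : Prop :=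
  forall zeta, exists! a : {ffun 'I_d -> k}, ext_lincomb a xi zeta.

Definition dimExt1 X Y : nat :=
  xget 0%N [set d | exists xi : 'I_d -> extension X Y, is_ext_basis xi].

Definition euler X Y : int := (dimHom X Y)%:Z - (dimExt1 X Y)%:Z.
End AbelianNotions.

Section WeightedProjectiveLine.
Variables (k : fieldType) (p : weights).
Local Notation coh := (cohX k p).

Definition strO : coh := strA k p.

Definition twist (M : coh) (x : Lgrp p) : coh := shift M x.

Definition tau (M : coh) : coh := twist M (omega p).

Definition extension_bundle (E : coh) : Prop :=
  exists y x : Lgrp p,
    [/\ Lle 0 x, Lle x (\sum_i xvec p i *+ (p i - 2)) &
      let: Lb := twist strO y in
      exists (f : Mor (twist Lb (omega p)) E) (g : Mor E (twist Lb x)),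
        short_exact f g /\ ~ split_epi g].

(* The points of X are the homogeneous prime ideals of A that do not contain
   the irrelevant ideal (X_1, X_2, X_3). *)
Definition is_point (P : set (strA k p)) : Prop :=
  [/\ is_gsub P, ~ P (1 : coordA k p),
      forall x y (a b : coordA k p), Ahomog x a -> Ahomog y b ->
        P (a * b) -> P a \/ P b &
      exists i, ~ P (Xvar k p i)].

Definition exc_point (i : 'I_3) : set (strA k p) :=
  [set a | exists b : coordA k p, a = Xvar k p i * b].

(* the stalk M_P is nonzero *)
Definition in_support (M : coh) (P : set (strA k p)) : Prop :=
  exists u : gcar M, forall x (s : coordA k p),
    Ahomog x s -> ~ P s -> s *: u <> 0.

Definition supported_at (i : 'I_3) (M : coh) : Prop :=
  forall P, is_point P -> in_support M P -> P = exc_point i.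

Definition in_tube (i : 'I_3) (M : coh) : Prop :=
  (exists n, has_length n M) /\ supported_at i M.

Definition tube_simples (Sij : forall i : 'I_3, 'Z_(p i) -> coh) : Prop :=
  forall i,
    [/\ forall j, simple_obj (Sij i j) /\ in_tube i (Sij i j),
        forall j j', isomorphic (Sij i j) (Sij i j') -> j = j',
        forall M : coh, simple_obj M -> in_tube i M ->
          exists j, isomorphic M (Sij i j) &
        forall j, isomorphic (tau (Sij i j)) (Sij i (j - 1))].

(* M is S_{i,j}^{(n)} *)
Definition is_tube_indec (Sij : forall i : 'I_3, 'Z_(p i) -> coh)
    (i : 'I_3) (j : 'Z_(p i)) (n : nat) (M : coh) : Prop :=
  [/\ in_tube i M, indecomposable M, is_top M (Sij i j) & has_length n M].
End WeightedProjectiveLine.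

Definition fpol (m : int) : {poly int} :=
  match m with
  | Posz 0 => 1
  | Posz n => \sum_(1 <= i < n.+1)
                ((-1) ^+ (i - 1)%N * (2 * i - 1)%N%:Z) *: 'X^(n + 1 - i)
              + ((-1) ^+ n * (n + 1)%N%:Z)%:P
  | Negz _ => 0
  end.

(* Main.v *)
Require Import Defs.
From HB Require Import structures.
From mathcomp Require Import all_boot all_order all_algebra.
From mathcomp Require Import generic_quotient ring_quotient.
From mathcomp Require Import boolp classical_sets.
From mathcomp Require Import zify ring.
From mathcomp Require Import mpoly.
Import Defs.

Set Implicit Arguments.
Unset Strict Implicit.
Unset Printing Implicit Defensive.

Import Order.TTheory GRing.Theory Num.Theory.
Local Open Scope ring_scope.
Local Open Scope quotient_scope.
Local Open Scope classical_set_scope.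

(** Near the i-th exceptional point an extension bundle E is a lattice: with
    {i, j, l} = {1, 2, 3} there are 0 < s_t < p_t and degrees d1, d2 such that E
    is the set W of the f in V = O(d1) (+) O(d2) with X_i^(s_i) | w /\ f, where
    w = (X_l^(s_l), - X_j^(s_j)) and e /\ f = e_1 f_2 - e_2 f_1.  If S has length
    n and its top is the quotient of E attached to this presentation, the
    subobjects of E with quotient S are the U_e = {f in V | X_i^(s_i + n) | e /\ f}
    for the primitive homogeneous e congruent to w modulo X_i up to a scalar.

    Write s_i + n = p_i m + r with 0 < r < p_i.  Extracting the factors X_i^(p_i)
    one at a time turns the U_e into non-backtracking paths of length m in a
    (q + 1)-regular tree of direct sums of two line bundles.  The vertices are
    classified by a depth h >= 0 and the lines leaving a vertex fall into three
    types; U_e is an extension bundle if and only if its path ends, at depth 0,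
    along one of the q - 1 generic lines.  Counting these paths gives a linear
    recursion, solved by f_m - f_(m-1) + (-1)^(m-1).

    The Hilbert function, which depends only on the class in K_0, determines an
    extension bundle of the form U_e up to isomorphism, so that all those
    extension bundles are isomorphic to E'.  It also makes E' explicit; then
    Ext^1(E', E) = 0 and <E', E> is 2m or 2m + 1, that is N = m - 1. *)

(** K_0, Ext^1 and torsion sheaves enter through their definitions in the quotient category, so the
    argument needs a concrete hold on them. A graded quotient has finite length if and only if
    powers of X_1, X_2, X_3 kill its elements; morphisms and exactness thereby become statements
    about elements, and Ext^1 out of a line bundle vanishes once Cech cochains for two of the
    elements X_t^(p_t), all of degree c, are coboundaries. An extension bundle is the cokernel of a
    map O(a) -> O(b_1) (+) O(b_2) (+) O(b_3): this shows that its numerical data determine it, and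
    reduces Hom(E', E) and Ext^1(E', E) to line bundles. Over a finite field dimensions are
    logarithms of cardinalities, so additivity is a matter of counting. The coordinate modulo p_i of
    the degree of a generator names a simple sheaf of the tube. An extension bundle maps onto two of
    them, and passing from s_t to p_t - s_t at i and at one other index exchanges the presentations
    adapted to one and to the other. *)

(** * Linear identities in abelian groups by reflection *)

Inductive zexpr :=
  Zat of nat | Z0 | Zadd of zexpr & zexpr | Zopp of zexpr | Zmul of zexpr & int.

Fixpoint zden (V : zmodType) (env : seq V) (e : zexpr) : V :=
  match e with
  | Zat n => nth 0 env n
  | Z0 => 0
  | Zadd e1 e2 => zden env e1 + zden env e2
  | Zopp e1 => - zden env e1
  | Zmul e1 c => zden env e1 *~ c
  end.

Fixpoint zcoef (e : zexpr) (n : nat) : int :=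
  match e with
  | Zat m => if eqn m n then 1 else 0
  | Z0 => 0
  | Zadd e1 e2 => zcoef e1 n + zcoef e2 n
  | Zopp e1 => - zcoef e1 n
  | Zmul e1 c => zcoef e1 n * c
  end.

(** A conjunction over the atoms, so that unfolding it leaves one integer identity per atom for
    [ring]. *)
Fixpoint zsame (m : nat) (f g : nat -> int) : Prop :=
  if m is m'.+1 then f 0%N = g 0%N /\ zsame m' (fun n => f n.+1) (fun n => g n.+1) else True.

Lemma zden_lin (V : zmodType) (env : seq V) e :
  zden env e = \sum_(n < size env) nth 0 env n *~ zcoef e n.
Proof.
elim: e => [n||e1 IH1 e2 IH2|e1 IH1|e1 IH1 c] /=.
- have [h|h] := ltnP n (size env).
    rewrite (bigD1 (Ordinal h)) //= eqnE eqxx mulr1z big1 ?addr0 // => m mn.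
    rewrite ?eqnE; case: eqP => [e|]; last by rewrite mulr0z.
    by case/eqP: mn; apply: val_inj.
  rewrite nth_default // big1 // => m _; rewrite ?eqnE; case: eqP => [e|]; last by rewrite mulr0z.
  by move: h; rewrite e leqNgt ltn_ord.
- by rewrite big1 // => n _; rewrite mulr0z.
- by rewrite IH1 IH2 -big_split; apply: eq_bigr => n _ /=; rewrite mulrzDr.
- by rewrite IH1 -sumrN; apply: eq_bigr => n _ /=; rewrite mulrNz.
- by rewrite IH1 mulrz_suml; apply: eq_bigr => n _ /=; rewrite mulrzA.
Qed.

Lemma zden_eq (V : zmodType) (env : seq V) e1 e2 :
  zsame (size env) (zcoef e1) (zcoef e2) -> zden env e1 = zden env e2.
Proof.
rewrite !zden_lin; move: (zcoef e1) (zcoef e2).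
elim: env => [|v env IH] f g /=; first by rewrite !big_ord0.
by move=> [e0 /IH h]; rewrite !big_ord_recl /= e0; congr (_ + _).
Qed.

Ltac zfind a l :=
  lazymatch l with
  | a :: _ => constr:(0%N)
  | _ :: ?l' => let n := zfind a l' in constr:(n.+1)
  end.
Ltac zadd a l :=
  match l with
  | context [a :: _] => l
  | _ => constr:(a :: l)
  end.
Ltac zatoms l t :=
  lazymatch t with
  | (?a + ?b)%R => let l1 := zatoms l a in zatoms l1 b
  | (- ?a)%R => zatoms l a
  | (?a *~ _)%R => zatoms l a
  | (0)%R => l
  | ?a => zadd a l
  end.
Ltac zquote l t :=
  lazymatch t with
  | (?a + ?b)%R => let x := zquote l a in let y := zquote l b in constr:(Zadd x y)
  | (- ?a)%R => let x := zquote l a in constr:(Zopp x)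
  | (?a *~ ?c)%R => let x := zquote l a in constr:(Zmul x c)
  | (0)%R => constr:(Z0)
  | ?a => let n := zfind a l in constr:(Zat n)
  end.
Ltac abel_with tac :=
  lazymatch goal with
  | |- @eq ?T ?a ?b =>
    let l0 := zatoms (@nil T) a in
    let l := zatoms l0 b in
    let x := zquote l a in
    let y := zquote l b in
    refine (@zden_eq _ l x y _); cbn [zsame zcoef size eqn]; repeat split; tac
  end.
(* equalities between integral linear combinations in an abelian group *)
Ltac abel := abel_with ltac:(try ring).

(** * The grading group *)

Section GradingGroupTheory.
Variable p : weights.
Local Notation L := (Lgrp p).
Implicit Types (x y : L) (n : 'I_3 -> int).

Lemma wt_gt0 i : (0 < (p i)%:Z)%R.
Proof. by have := wt_ge2 p i; lia. Qed.

(** Each generator is a combination of the p_i e_i whose coefficients have sum 0, a property stable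
    under sums and differences. This is what makes the normal form unique. *)
Lemma zspan_LrelP (v : 'rV[int]_3) : zspan (@Lrel p) v ->
  exists n, (forall i, v 0 i = n i * p i) /\ \sum_i n i = 0.
Proof.
have H (g : 'rV[int]_3) : Lrel p g ->
    exists n, (forall i, g 0 i = n i * p i) /\ \sum_i n i = 0.
  move=> [i [j ->]]; exists (fun t => (t == i)%:R - (t == j)%:R); split.
    move=> t; rewrite mxE [X in _ + X]mxE !mulmxnE !mxE eqxx /= mulrBl; congr (_ - _).
      by case: (t =P i) => [->|_]; rewrite ?mul1r ?mul0r ?mul0rn // natz.
    by case: (t =P j) => [->|_]; rewrite ?mul1r ?mul0r ?mul0rn // natz.
  have S (u : 'I_3) : \sum_t (t == u)%:R = 1 :> int.
    by rewrite (bigD1 u) //= eqxx big1 ?addr0 // => t /negPf ->.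
  by rewrite sumrB !S subrr.
elim=> [|u g _ [n [hn sn]] /H[n' [hn' sn']]|u g _ [n [hn sn]] /H[n' [hn' sn']]].
- by exists (fun=> 0); split=> [i|]; rewrite ?mxE ?mul0r // big1.
- exists (fun i => n i + n' i); split=> [i|]; first by rewrite mxE hn hn' mulrDl.
  by rewrite big_split sn sn'.
- exists (fun i => n i - n' i); split=> [i|].
    by rewrite mxE hn mxE hn' mulrBl.
  by rewrite sumrB sn sn'.
Qed.

Definition xs n : L := \sum_i xvec p i *~ n i.

Lemma xsE (v : 'rV[int]_3) : \pi_L v = xs (fun i => v 0 i).
Proof.
rewrite {1}(row_sum_delta v) raddf_sum; apply: eq_bigr => i _.
by rewrite /xvec -raddfMz /= -scaler_int intz.
Qed.

Lemma ord3E (s : 'I_3 -> int) (t : 'I_3 -> int) : s =1 t -> xs s = xs t.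
Proof. by move=> e; apply: eq_bigr => i _; rewrite e. Qed.

Lemma xs_pi n : xs n = \pi_L (\row_i n i).
Proof. by rewrite xsE; apply: ord3E => i; rewrite mxE. Qed.

Lemma xs_surj x : exists n, x = xs n.
Proof. by exists (fun i => (repr x) 0 i); rewrite -xsE reprK. Qed.

Lemma xsD n1 n2 : xs n1 + xs n2 = xs (fun i => n1 i + n2 i).
Proof. by rewrite /xs -big_split; apply: eq_bigr => i _ /=; rewrite mulrzDr. Qed.

Lemma xsN n1 : - xs n1 = xs (fun i => - n1 i).
Proof. by rewrite /xs -sumrN; apply: eq_bigr => i _ /=; rewrite mulrNz. Qed.

Lemma xvecz_xs i m : xvec p i *~ m = xs (fun t => m *+ (t == i)).
Proof.
by rewrite /xs (bigD1 i) //= eqxx big1 ?addr0 // => t /negPf ->; rewrite mulr0n mulr0z.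
Qed.

Lemma cvec_xvec i : cvec p = xvec p i *~ p i.
Proof. by rewrite -pmulrn xvec_wt. Qed.

(** Any representative gives the normal form by Euclidean division: [lres x i] is l_i and [llev x]
    is l. Independence of the representative is contained in [lres_xs] and [llev_xs]. *)
Definition lrep x (i : 'I_3) : int := repr x 0 i.
Definition lres x i : int := (lrep x i %% p i)%Z.
Definition llev x : int := \sum_i (lrep x i %/ p i)%Z.

Lemma xs_eq n1 n2 : xs n1 = xs n2 ->
  exists n, (forall i, n1 i = n2 i + n i * p i) /\ \sum_i n i = 0.
Proof.
rewrite !xs_pi => /eqP; rewrite -Quotient.idealrBE => /asboolP/zspan_LrelP[n [hn sn]].
exists n; split=> // i; have := hn i; rewrite !mxE => /eqP; rewrite subr_eq => /eqP ->.
by rewrite addrC.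
Qed.

Lemma xs_modn n1 n : \sum_i n i = 0 -> xs (fun i => n1 i + n i * p i) = xs n1.
Proof.
move=> sn; rewrite -[RHS]addr0 -[X in _ = _ + X](_ : xs (fun i => n i * p i) = 0) ?xsD //.
rewrite /xs (eq_bigr (fun i => cvec p *~ n i)) => [|i _].
  by rewrite -mulrz_sumr sn mulr0z.
by rewrite (cvec_xvec i) -mulrzA mulrC.
Qed.

Lemma lres_xs n i : lres (xs n) i = (n i %% p i)%Z.
Proof.
rewrite /lres /lrep; have := reprK (xs n); rewrite xsE => /xs_eq[m [hm _]].
by rewrite hm addrC modzMDl.
Qed.

Lemma llev_xs n : llev (xs n) = \sum_i (n i %/ p i)%Z.
Proof.
rewrite /llev /lrep; have := reprK (xs n); rewrite xsE => /xs_eq[m [hm sm]].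
rewrite (eq_bigr (fun i => (n i %/ p i)%Z + m i)) ?big_split /= ?sm ?addr0 // => i _.
by rewrite hm addrC divzMDl ?gt_eqF ?wt_gt0 // addrC.
Qed.

Lemma lres_ge0 x i : 0 <= lres x i.
Proof. by rewrite modz_ge0 // gt_eqF ?wt_gt0. Qed.
Lemma lres_lt x i : lres x i < p i.
Proof. by rewrite ltz_pmod ?wt_gt0. Qed.

Lemma Lnorm x : x = xs (lres x) + cvec p *~ llev x.
Proof.
have [n ->] := xs_surj x.
rewrite (cvec_xvec 0) -mulrzA mulrC xvecz_xs xsD llev_xs.
pose m i := (n i %/ p i)%Z - (\sum_i (n i %/ p i)%Z) *+ (i == 0).
have sm : \sum_i m i = 0.
  rewrite /m sumrB [X in _ - X](bigD1 0) //= mulr1n [X in _ - (_ + X)]big1 ?addr0 ?subrr //.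
  by move=> t /negPf ->.
rewrite -(xs_modn (fun i => lres (xs n) i + (\sum_i (n i %/ p i)%Z) * (p 0) *+ (i == 0)) sm).
apply: ord3E => i; rewrite lres_xs /m mulrBl [LHS](divz_eq (n i) (p i)).
by case: eqP => [->|_]; rewrite ?mulr1n ?mulr0n; ring.
Qed.

Lemma lresD x n i : lres (x + xs n) i = ((lres x i + n i) %% p i)%Z.
Proof. by have [m ->] := xs_surj x; rewrite xsD !lres_xs modzDml. Qed.

Lemma llevD x n : llev (x + xs n) = llev x + \sum_i ((lres x i + n i) %/ p i)%Z.
Proof.
have [m ->] := xs_surj x; rewrite xsD !llev_xs -big_split; apply: eq_bigr => i _ /=.
rewrite lres_xs {1}(divz_eq (m i) (p i)) -addrA divzMDl ?gt_eqF ?wt_gt0 //.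
Qed.

Lemma lresDc x m i : lres (x + cvec p *~ m) i = lres x i.
Proof.
rewrite (cvec_xvec i) -mulrzA xvecz_xs lresD eqxx mulr1n mulrC addrC modzMDl.
by rewrite modz_small // lres_ge0 lres_lt.
Qed.

Lemma llevDc x m : llev (x + cvec p *~ m) = llev x + m.
Proof.
rewrite (cvec_xvec 0) -mulrzA xvecz_xs llevD; congr (_ + _).
rewrite (bigD1 0) //= big1 ?addr0 => [|t /negPf ->].
  by rewrite mulr1n mulrC addrC divzMDl ?gt_eqF ?wt_gt0 // divz_small ?addr0 // lres_ge0 lres_lt.
by rewrite mulr0n addr0 divz_small // lres_ge0 lres_lt.
Qed.

Lemma lresDx x i m t : lres (x + xvec p i *~ m) t =
  if t == i then ((lres x i + m) %% p i)%Z else lres x t.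
Proof.
rewrite xvecz_xs lresD; case: eqP => [->|_]; rewrite ?mulr1n ?mulr0n //.
by rewrite addr0 modz_small // lres_ge0 lres_lt.
Qed.

Lemma llevDx x i m : llev (x + xvec p i *~ m) = llev x + ((lres x i + m) %/ p i)%Z.
Proof.
rewrite xvecz_xs llevD; congr (_ + _).
rewrite (bigD1 i) //= big1 ?addr0 => [|t /negPf ->]; first by rewrite eqxx mulr1n.
by rewrite mulr0n addr0 divz_small // lres_ge0 lres_lt.
Qed.

Lemma llev0 : llev 0 = 0.
Proof.
have -> : 0 = xs (fun=> 0) by rewrite /xs big1 // => i _; rewrite mulr0z.
by rewrite llev_xs big1 // => i _; rewrite div0z.
Qed.
Lemma lres0 i : lres 0 i = 0.
Proof.
have -> : 0 = xs (fun=> 0) by rewrite /xs big1 // => t _; rewrite mulr0z.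
by rewrite lres_xs mod0z.
Qed.

Lemma ldeg_xs (m : 'X_{1..3}) : ldeg p m = xs (fun i => (m i)%:Z).
Proof. by apply: eq_bigr => i _; rewrite pmulrn. Qed.

Lemma Lpos_llev x : Lpos x -> 0 <= llev x.
Proof.
move=> [l [m [hl ->]]].
have -> : \sum_i xvec p i *+ l i = xs (fun i => (l i)%:Z).
  by apply: eq_bigr => i _; rewrite pmulrn.
rewrite pmulrn llevDc llev_xs addr_ge0 // sumr_ge0 // => i _.
by rewrite divz_ge0 ?wt_gt0.
Qed.

(** The level of the upper bound minus x is - [llev x] plus a sum of nonpositive quotients. It is
    nonnegative, and so is [llev x]; hence all these terms vanish. *)
Lemma Lle_box x : Lle 0 x -> Lle x (\sum_i xvec p i *+ (p i - 2)) ->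
  exists l : 'I_3 -> nat, (forall i, (l i + 2 <= p i)%N) /\ x = xs (fun i => (l i)%:Z).
Proof.
rewrite /Lle subr0 => /Lpos_llev h0 /Lpos_llev.
have -> : \sum_i xvec p i *+ (p i - 2) = xs (fun i => (p i)%:Z - 2).
  by apply: eq_bigr => i _; rewrite pmulrn; congr (_ *~ _); have := wt_ge2 p i; lia.
have -> : xs (fun i => (p i)%:Z - 2) - x =
    xs (fun i => (p i)%:Z - 2 - lres x i) + cvec p *~ (- llev x).
  by rewrite [in LHS](Lnorm x) (opprD (xs (lres x))) addrA xsN xsD mulrNz.
rewrite llevDc llev_xs => h.
have hf i : (((p i)%:Z - 2 - lres x i) %/ p i)%Z <= 0.
  rewrite -ltzD1 add0r ltz_divLR ?wt_gt0 // mul1r; have := lres_ge0 x i; lia.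
have [l0 e0] : llev x = 0 /\ \sum_i (- (((p i)%:Z - 2 - lres x i) %/ p i)%Z) = 0.
  have : 0 <= \sum_i (- (((p i)%:Z - 2 - lres x i) %/ p i)%Z).
    by apply: sumr_ge0 => i _; rewrite oppr_ge0.
  by move: h; rewrite sumrN; move: (\sum_i _) => s h1 h2; split; lia.
exists (fun i => `|lres x i|%N); split=> [i|].
  have /eqP := e0; rewrite psumr_eq0 => [|t _]; last by rewrite oppr_ge0.
  move=> /allP/(_ i); rewrite mem_index_enum oppr_eq0 => /(_ isT)/eqP hi.
  have := lres_ge0 x i; have : 0 <= (p i)%:Z - 2 - lres x i.
    by rewrite -(divz_ge0 _ (wt_gt0 i)) hi.
  lia.
rewrite {1}(Lnorm x) l0 mulr0z addr0; apply: ord3E => i.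
by have := lres_ge0 x i; lia.
Qed.
End GradingGroupTheory.

(** * The coordinate algebra *)

Section CoordinateAlgebraTheory.
Variables (k : fieldType) (p : weights).
Local Notation P := {mpoly k[3]}.
Local Notation L := (Lgrp p).
Local Notation A := (coordA k p).
Local Notation X := (Xvar k p).
Implicit Types (i j l : 'I_3) (a b : A) (w : L).

(** Reduction modulo X_i with values in the same polynomial ring, so that the algebra A/(X_i) is
    never formed. *)
Definition ksub i : P -> P := mmap (@mpolyC 3 k) (fun t => if t == i then 0 else 'X_t).

HB.instance Definition _ i := GRing.RMorphism.on (ksub i).

Lemma ksubX i t : ksub i 'X_t = if t == i then 0 else 'X_t.
Proof. by rewrite /ksub mmapX mmap1U. Qed.

Lemma ksubZ i c f : ksub i (c *: f) = c *: ksub i f.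
Proof. by rewrite -mul_mpolyC rmorphM /= /ksub mmapC mul_mpolyC. Qed.

Lemma ksub_dvd i f : exists g, f = 'X_i * g + ksub i f.
Proof.
elim/mpolyind: f => [|c m f _ _ [g IH]].
  by exists 0; rewrite mulr0 raddf0 addr0.
have [g' e] : exists g', 'X_[m] = 'X_i * g' + ksub i 'X_[m].
  rewrite /ksub mmapX; have [mi|mi] := eqVneq (m i) 0%N.
    exists 0; rewrite mulr0 add0r mpolyXE_id /mmap1; apply: eq_bigr => t _.
    by case: eqP => // ->; rewrite mi !expr0.
  exists 'X_[m - U_(i)]; rewrite -mpolyXD addmC submK; last first.
    by apply/mnm_lepP => t; rewrite mnm1E; case: eqP => // <-; rewrite lt0n.
  by rewrite /mmap1 (bigD1 i) //= eqxx expr0n (negPf mi) mul0r addr0.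
exists (c *: g' + g); rewrite raddfD /= ksubZ {1}e {1}IH scalerDr mulrDr.
by rewrite -scalerAr !addrA; congr (_ + _); rewrite addrAC.
Qed.

Lemma ksub_mulX i f : ksub i ('X_i * f) = 0.
Proof. by rewrite rmorphM /= ksubX eqxx mul0r. Qed.

(** The signs of the defining relation; with them the three indices become interchangeable. *)
Definition relc i : k := if i == 1 then -1 else 1.

Lemma relAE : relA k p = \sum_i relc i *: 'X_i ^+ p i.
Proof.
rewrite /relA !big_ord_recl big_ord0 addr0 /relc /=.
have -> : lift 0 (0 : 'I_2) = 1 :> 'I_3 by apply/val_inj.
have -> : lift 0 (lift 0 (0 : 'I_1)) = 2%:R :> 'I_3 by apply/val_inj.
by rewrite !scale1r scaleN1r addrC [X in _ + X]addrC.
Qed.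

Lemma relc_neq0 i : relc i != 0.
Proof. by rewrite /relc; case: ifP => _; rewrite ?oppr_eq0 oner_eq0. Qed.

Lemma sum3 (V : nmodType) (F : 'I_3 -> V) i j l : i != j -> i != l -> j != l ->
  \sum_t F t = F i + F j + F l.
Proof.
move=> ij il jl; rewrite (bigD1 i) //= (bigD1 j) /=; last by rewrite eq_sym.
rewrite (bigD1 l) /=; last by rewrite ![l == _]eq_sym il jl.
rewrite big1 ?addr0 ?addrA // => t /andP[/andP[ti tj] tl].
have : (4 <= #|'I_3|)%N.
  rewrite cardE; apply: (@uniq_leq_size _ [:: i; j; l; t]) => [|x _]; last by rewrite mem_enum.
  by rewrite /= !inE !negb_or ij il jl ![_ == t]eq_sym ti tj tl.
by rewrite card_ord.
Qed.

Lemma relA_eq i j l : i != j -> i != l -> j != l ->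
  relA k p = relc i *: 'X_i ^+ p i + relc j *: 'X_j ^+ p j + relc l *: 'X_l ^+ p l.
Proof. by move=> ij il jl; rewrite relAE (sum3 _ ij il jl). Qed.

Lemma other2 i : exists j l, [/\ i != j, i != l & j != l].
Proof.
by case: i => -[|[|[|//]]] h; [exists 1, 2%:R | exists 0, 2%:R | exists 0, 1].
Qed.
Lemma other1 i j : i != j -> exists l, i != l /\ j != l.
Proof.
by case: i j => -[|[|[|//]]] h [] [|[|[|//]]] h' // _;
  (try by exists 0); (try by exists 1); (try by exists 2%:R).
Qed.

Lemma Xmp_neq0 (t : 'I_3) : ('X_t : P) != 0.
Proof.
apply/eqP => /(congr1 (meval (fun=> 1))); rewrite mevalXU raddf0 => /eqP.
by rewrite oner_eq0.
Qed.

Lemma Xpow_neq0 (t : 'I_3) n : ('X_t ^+ n : P) != 0.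
Proof. by rewrite expf_neq0 // Xmp_neq0. Qed.

Lemma ksubXn i t n : ksub i ('X_t ^+ n) = if t == i then 0 ^+ n else 'X_t ^+ n.
Proof. by rewrite rmorphXn /= ksubX; case: ifP. Qed.

Lemma wtn0 i : (p i == 0)%N = false.
Proof. by case: (p i) (wt_ge2 p i). Qed.

Lemma ksub_relA i j l : i != j -> i != l -> j != l ->
  ksub i (relA k p) = relc j *: 'X_j ^+ p j + relc l *: 'X_l ^+ p l.
Proof.
move=> ij il jl; rewrite (relA_eq ij il jl) !raddfD /= !ksubZ !ksubXn eqxx.
by rewrite ![_ == i]eq_sym (negPf ij) (negPf il) expr0n wtn0 scaler0 add0r.
Qed.

Lemma ksub2_relA i j l : i != j -> i != l -> j != l ->
  ksub l (ksub i (relA k p)) = relc j *: 'X_j ^+ p j.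
Proof.
move=> ij il jl; rewrite (ksub_relA ij il jl) raddfD /= !ksubZ !ksubXn eqxx.
by rewrite (negPf jl) expr0n wtn0 scaler0 addr0.
Qed.

Lemma scale_neq0 (c : k) (f : P) : c != 0 -> f != 0 -> c *: f != 0.
Proof. by move=> c0 f0; rewrite scaler_eq0 negb_or c0. Qed.

Lemma ksub_relA_neq0 i : ksub i (relA k p) != 0.
Proof.
have [j [l [ij il jl]]] := other2 i; apply: contraNneq (scale_neq0 (relc_neq0 j) (Xpow_neq0 j (p j))).
by move=> e; rewrite -(ksub2_relA ij il jl) e raddf0.
Qed.

Lemma piA_surj a : exists f, a = piA p f.
Proof. by exists (repr a); rewrite piA_repr. Qed.

Lemma piA0 (f : P) : piA p f = 0 <-> exists h, f = h * relA k p.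
Proof.
have -> : (0 : A) = piA p 0 by rewrite /piA raddf0.
by rewrite piA_eq subr0.
Qed.

(** If X_t f is h times the relation, reduce modulo X_t: the relation stays nonzero in a domain, so
    X_t divides h and can be cancelled. *)
Lemma Xvar_reg t a : X t * a = 0 -> a = 0.
Proof.
have [f ->] := piA_surj a; rewrite -piAM => /piA0[h e]; apply/piA0.
have [g eg] := ksub_dvd t h.
have /eqP : ksub t h * ksub t (relA k p) = 0 by rewrite -rmorphM /= -e ksub_mulX.
rewrite mulf_eq0 (negPf (ksub_relA_neq0 t)) orbF => /eqP h0.
exists g; apply: (mulfI (Xmp_neq0 t)); rewrite e eg h0 addr0 mulrA //.
Qed.

Definition dvdX i n a := exists b, a = X i ^+ n * b.

(** X_i, X_l is a regular sequence. Modulo X_i and then X_l only a nonzero multiple of X_j^(p_j)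
    remains of the relation, which forces X_l to divide its cofactor. *)
Lemma dvdX_prime i l a : i != l -> dvdX i 1 (X l * a) -> dvdX i 1 a.
Proof.
move=> il [b]; have [f ->] := piA_surj a; have [g ->] := piA_surj b.
have [j [ij lj]] := other1 il; have jl : j != l by rewrite eq_sym.
rewrite expr1 -!piAM => /piA_eq[h e].
have e1 : 'X_l * ksub i f = ksub i h * ksub i (relA k p).
  by rewrite -rmorphM -e raddfB /= ksub_mulX subr0 rmorphM /= ksubX eq_sym (negPf il).
have /eqP : ksub l (ksub i h) * (relc j *: 'X_j ^+ p j) = 0.
  by rewrite -(ksub2_relA ij il jl) -rmorphM /= -e1 ksub_mulX.
rewrite mulf_eq0 (negPf (scale_neq0 (relc_neq0 j) (Xpow_neq0 j (p j)))) orbF => /eqP h0.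
have [h1] := ksub_dvd l (ksub i h); rewrite h0 addr0 => eh1.
have e2 : ksub i f = h1 * ksub i (relA k p).
  by apply: (mulfI (Xmp_neq0 l)); rewrite e1 eh1 mulrA.
have [f1 ef] := ksub_dvd i f; have [r er] := ksub_dvd i (relA k p).
exists (piA p (f1 - h1 * r)); rewrite expr1 -piAM; apply/piA_eq; exists h1.
rewrite {1}ef e2 {2}er; ring.
Qed.

Lemma dvdX1N i : ~ dvdX i 1 1.
Proof.
move=> [b]; have [g ->] := piA_surj b.
have -> : (1 : A) = piA p 1 by rewrite /piA rmorph1.
rewrite expr1 -piAM => /piA_eq[h] /(congr1 (meval (fun=> 0))).
rewrite raddfB /= !rmorphM /= rmorph1 mevalXU mul0r subr0 relAE raddf_sum /= big1.
  by rewrite mulr0 => /eqP; rewrite oner_eq0.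
by move=> t _; rewrite mevalZ rmorphXn /= mevalXU expr0n wtn0 mulr0.
Qed.

Lemma XrelA i j l : i != j -> i != l -> j != l ->
  scalA p (relc i) * X i ^+ p i + scalA p (relc j) * X j ^+ p j
    + scalA p (relc l) * X l ^+ p l = 0.
Proof.
move=> ij il jl; have -> : (0 : A) = piA p (relA k p) by apply/esym/piA0; exists 1; rewrite mul1r.
by rewrite (relA_eq ij il jl) !piAD -!mul_mpolyC !piAM /Xvar /piA !rmorphXn.
Qed.

Lemma Ahomog0 w : Ahomog w (0 : A).
Proof. by exists 0; split=> [m|]; rewrite ?msupp0 // /piA raddf0. Qed.

Lemma AhomogM w w' a b : Ahomog w a -> Ahomog w' b -> Ahomog (w + w') (a * b).
Proof.
move=> [f [hf ->]] [g [hg ->]]; exists (f * g); rewrite piAM; split=> // m.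
by move=> /msuppM_le/allpairsP[[m1 m2] /= [/hf <- /hg <- ->]]; rewrite ldegD.
Qed.

Lemma AhomogD w a b : Ahomog w a -> Ahomog w b -> Ahomog w (a + b).
Proof.
move=> [f [hf ->]] [g [hg ->]]; exists (f + g); rewrite piAD; split=> // m.
by move=> /msuppD_le; rewrite mem_cat => /orP[/hf|/hg].
Qed.

Lemma AhomogN w a : Ahomog w a -> Ahomog w (- a).
Proof.
move=> [f [hf ->]]; exists (- f); split; last by rewrite /piA raddfN.
by move=> m; rewrite (perm_mem (msuppN f)); exact: hf.
Qed.

Lemma Ahomog1 : Ahomog 0 (1 : A).
Proof. by rewrite -scalA1; exact: scalA_homog. Qed.

Lemma Ahomog_monX (m : 'X_{1..3}) : Ahomog (ldeg p m) (piA p 'X_[k, m]).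
Proof. by exists 'X_[m]; split=> // n; rewrite msuppX inE => /eqP ->. Qed.

Lemma AhomogX t n : Ahomog (xvec p t *~ n%:Z) (X t ^+ n).
Proof.
by rewrite -pmulrn -ldegUn /Xvar /piA -rmorphXn /= mpolyXn; exact: Ahomog_monX.
Qed.

Lemma piA_monX (m : 'X_{1..3}) : piA p 'X_[k, m] = \prod_t X t ^+ m t.
Proof.
rewrite mpolyXE_id /piA rmorph_prod /=; apply: eq_bigr => t _.
by rewrite /Xvar /piA rmorphXn.
Qed.

Lemma AhomogP w a : Ahomog w a <-> Acomp w a = a.
Proof.
split=> [[f [hf ->]]|<-]; last by exists (Defs.pcomp w (repr a)); split=> //; exact: pcomp_homog.
rewrite Acomp_piA; congr piA; apply/mpolyP => m; rewrite mcoeff_pcomp.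
case: eqP => // mw; apply/esym/memN_msupp_eq0; apply/negP => /hf; exact: mw.
Qed.

Lemma Ahomog_lincomb w a : Ahomog w a -> exists (s : seq (k * 'X_{1..3})),
  (forall u, u \in s -> ldeg p u.2 = w) /\ a = \sum_(u <- s) scalA p u.1 * \prod_t X t ^+ u.2 t.
Proof.
move=> [f [hf ->]]; exists [seq (f@_m, m) | m <- msupp f]; split.
  by move=> u /mapP[m /hf <- ->].
rewrite big_map {1}(mpolyE f) piA_sum; apply: eq_bigr => m _ /=.
by rewrite -mul_mpolyC piAM piA_monX.
Qed.

Lemma Ahomog_lev w a : Ahomog w a -> llev w < 0 -> a = 0.
Proof.
move=> /Ahomog_lincomb[s [hs ->]] w0; rewrite big_seq big1 // => u /hs e.
have : 0 <= llev w.
  by rewrite -e ldeg_xs llev_xs sumr_ge0 // => t _; rewrite divz_ge0 ?wt_gt0.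
by rewrite leNgt w0.
Qed.

Lemma dvdX_sum i n (I : eqType) (s : seq I) (F : I -> A) :
  (forall t, t \in s -> dvdX i n (F t)) -> dvdX i n (\sum_(t <- s) F t).
Proof.
elim: s => [|t s IH] h; first by exists 0; rewrite big_nil mulr0.
have [b eb] := h t (mem_head _ _); have [c ec] := IH (fun u us => h u (@mem_behead _ (t :: s) u us)).
by exists (b + c); rewrite big_cons eb ec mulrDr.
Qed.

Lemma dvdX_M i n a b : dvdX i n a -> dvdX i n (b * a).
Proof. by move=> [c ->]; exists (b * c); rewrite mulrCA. Qed.

(** The exponent of X_i in a monomial of degree w is congruent to [lres w i] modulo p_i, hence
    positive. *)
Lemma Ahomog_dvdX w a i : Ahomog w a -> 0 < lres w i -> dvdX i 1 a.
Proof.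
move=> /Ahomog_lincomb[s [hs ->]] w0; apply: dvdX_sum => u /hs e.
apply: dvdX_M; rewrite (bigD1 i) //=; exists (X i ^+ (u.2 i).-1 * \prod_(t | t != i) X t ^+ u.2 t).
rewrite mulrA -exprD add1n prednK //; move: w0; rewrite -e ldeg_xs lres_xs.
by case: (u.2 i) => //; rewrite mod0z.
Qed.

(** For residue 0 at i and nonnegative level, a monomial of degree w free of X_i: the multiple of c
    is carried by X_j alone. The absolute values only convert integers to exponents. *)
Definition Amono w (j l : 'I_3) : A := X j ^+ absz (lres w j + llev w * p j) * X l ^+ absz (lres w l).

(* modulo X_i the relation makes Y_l a scalar multiple of Y_j *)
Lemma Ahomog_mod w a i j l : i != j -> i != l -> j != l -> Ahomog w a -> lres w i = 0 ->
  0 <= llev w -> exists c, dvdX i 1 (a - scalA p c * Amono w j l).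
Proof.
move=> ij il jl /Ahomog_lincomb[s [hs ->]] wi w0.
elim: s hs => [|u s IH] hs.
  exists 0; exists 0; rewrite big_nil /scalA mpolyC0 /piA raddf0 mul0r subr0 mulr0 //.
have [c [b eb]] := IH (fun v vs => hs v (@mem_behead _ (u :: s) v vs)).
suff [d [b' eb']] : exists d, dvdX i 1 (\prod_t X t ^+ u.2 t - scalA p d * Amono w j l).
  exists (u.1 * d + c), (scalA p u.1 * b' + b); rewrite big_cons mulrDr -eb.
  by rewrite (mulrCA (X i ^+ 1)) -eb' scalAD scalAM; ring.
have e := hs u (mem_head _ _); rewrite ldeg_xs in e.
have eP : \prod_t X t ^+ u.2 t = X i ^+ u.2 i * (X j ^+ u.2 j * X l ^+ u.2 l).
  rewrite (bigD1 i) //= (bigD1 j) /=; last by rewrite eq_sym.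
  rewrite (bigD1 l) /=; last by rewrite ![l == _]eq_sym il jl.
  rewrite big1 ?mulr1 // => t /andP[/andP[ti tj] tl].
  have := sum3 (fun v => (v == t)%:R : int) ij il jl.
  rewrite (bigD1 t) //= eqxx big1 => [|v /negPf -> //].
  by rewrite ![_ == t]eq_sym (negPf ti) (negPf tj) (negPf tl).
have [ui|ui] := posnP (u.2 i); last first.
  exists 0; rewrite /scalA mpolyC0 /piA raddf0 mul0r subr0 eP mulrC; apply: dvdX_M.
  by exists (X i ^+ (u.2 i).-1); rewrite -exprD add1n prednK.
have rj : lres w j = ((u.2 j)%:Z %% p j)%Z by rewrite -e lres_xs.
have rl : lres w l = ((u.2 l)%:Z %% p l)%Z by rewrite -e lres_xs.
have ew : llev w = ((u.2 j)%:Z %/ p j)%Z + ((u.2 l)%:Z %/ p l)%Z.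
  by rewrite -e llev_xs (sum3 _ ij il jl) ui div0z add0r.
set m := (u.2 l %/ p l)%N; have elm : u.2 l = (m * p l + absz (lres w l))%N.
  by rewrite rl modz_nat /= -divn_eq.
have ejm : absz (lres w j + llev w * p j) = (u.2 j + m * p j)%N.
  rewrite rj ew mulrDl addrA [X in X + _](_ : _ = (u.2 j)%:Z); last first.
    by rewrite addrC -divz_eq.
  by rewrite divz_nat -PoszM -PoszD.
exists ((- relc j / relc l) ^+ m).
rewrite eP ui expr0 mul1r /Amono ejm elm !exprD mulrA mulrA -mulrBl mulrC; apply: dvdX_M.
rewrite [X in dvdX _ _ X](_ : _ = X j ^+ u.2 j * (X l ^+ (m * p l) -
   scalA p ((- relc j / relc l) ^+ m) * X j ^+ (m * p j))); last by ring.
apply: dvdX_M; rewrite ![(m * _)%N]mulnC !exprM.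
have -> : scalA p ((- relc j / relc l) ^+ m) = scalA p (- relc j / relc l) ^+ m.
  by elim: m {elm ejm} => [|n IHn]; rewrite ?expr0 ?scalA1 // !exprS scalAM IHn.
rewrite -exprMn subrXX mulrC; apply: dvdX_M.
exists (scalA p (- relc i / relc l) * X i ^+ (p i).-1).
rewrite mulrCA -exprD add1n prednK; last by have := wt_ge2 p i; lia.
have /(congr1 (fun z => scalA p (relc l)^-1 * z)) := XrelA ij il jl.
rewrite mulr0 !mulrDr !mulrA -!scalAM mulVf ?relc_neq0 // scalA1 mul1r => h.
apply/eqP; rewrite -subr_eq0 -{}h; apply/eqP.
have sN c' : scalA p (- c') = - scalA p c' :> A.
  by rewrite /scalA mpolyCN /piA raddfN.
rewrite ![_ / relc l]mulrC !mulrN !sN; ring.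
Qed.

Lemma Xpow_reg t n a : X t ^+ n * a = 0 -> a = 0.
Proof.
by elim: n => [|n IH]; rewrite ?expr0 ?mul1r // exprS -mulrA => /Xvar_reg/IH.
Qed.

Lemma Xpow_inj t n a b : X t ^+ n * a = X t ^+ n * b -> a = b.
Proof.
by move=> /eqP; rewrite -subr_eq0 -mulrBr => /eqP/Xpow_reg/eqP; rewrite subr_eq0 => /eqP.
Qed.

Lemma dvdX0 i n : dvdX i n 0. Proof. by exists 0; rewrite mulr0. Qed.

Lemma dvdXD i n a b : dvdX i n a -> dvdX i n b -> dvdX i n (a + b).
Proof. by move=> [c ->] [d ->]; exists (c + d); rewrite mulrDr. Qed.
Lemma dvdXN i n a : dvdX i n a -> dvdX i n (- a).
Proof. by move=> [c ->]; exists (- c); rewrite mulrN. Qed.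
Lemma dvdXB i n a b : dvdX i n a -> dvdX i n b -> dvdX i n (a - b).
Proof. by move=> ha /dvdXN; apply: dvdXD. Qed.
Lemma dvdX_Ml i n a b : dvdX i n a -> dvdX i n (a * b).
Proof. by rewrite mulrC; apply: dvdX_M. Qed.
Lemma dvdX_le i m n a : (m <= n)%N -> dvdX i n a -> dvdX i m a.
Proof. by move=> /subnKC <- [b ->]; exists (X i ^+ (n - m) * b); rewrite exprD mulrA. Qed.
Lemma dvdX_id i n : dvdX i n (X i ^+ n). Proof. by exists 1; rewrite mulr1. Qed.
Lemma dvdXE i m n a : dvdX i (m + n) (X i ^+ m * a) <-> dvdX i n a.
Proof.
split=> -[b]; last by move=> ->; exists b; rewrite exprD mulrA.
by rewrite exprD -mulrA => /Xpow_inj ->; exists b.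
Qed.

Lemma dvdX_cancelX i l m n a : i != l -> dvdX i n (X l ^+ m * a) -> dvdX i n a.
Proof.
move=> il; have one b : dvdX i n (X l * b) -> dvdX i n b.
  elim: n b => [|n IH] b; first by exists b; rewrite expr0 mul1r.
  move=> h; have [c e] := dvdX_prime il (dvdX_le (ltn0Sn n) h); rewrite expr1 in e.
  move: h; rewrite e mulrCA -add1n -{1}[X i]expr1 => /dvdXE/IH h.
  by rewrite -{1}[X i]expr1; apply/dvdXE.
by elim: m a => [|m IH] a; rewrite ?expr0 ?mul1r // exprS -mulrA => /one/IH.
Qed.

Lemma Acomp_sum (w : L) (I : Type) (s : seq I) (F : I -> A) :
  Acomp w (\sum_(u <- s) F u) = \sum_(u <- s) Acomp w (F u).
Proof.
elim: s => [|u s IH]; last by rewrite !big_cons A_hcD IH.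
by rewrite !big_nil; apply/AhomogP; exact: Ahomog0.
Qed.

Lemma AcompM y x a b : Ahomog y a -> Acomp (y + x) (a * b) = a * Acomp x b.
Proof. by move=> h; have := A_hcZ x b h. Qed.

Lemma Acomp_homog w a : Ahomog w (Acomp w a).
Proof. by apply/AhomogP; have := A_hc_hc w w a; rewrite eqxx. Qed.

Lemma Ahomog_comp_ext (Q : A -> Prop) : Q 0 -> (forall a b, Q a -> Q b -> Q (a + b)) ->
  forall a, (forall w, Q (Acomp w a)) -> Q a.
Proof.
move=> Q0 QD a h; have [s [_ ->]] := A_hc_sum a.
by elim: s => [|x s IH]; rewrite ?big_nil ?big_cons //; apply: QD.
Qed.

Lemma Ahomog_divX i n w b : Ahomog w (X i ^+ n * b) -> Ahomog (w - xvec p i *~ n%:Z) b.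
Proof.
move=> /AhomogP e; apply/AhomogP; apply: (@Xpow_inj i n).
by rewrite -(AcompM _ _ (AhomogX i n)) addrC subrK e.
Qed.

Lemma dvdX_homog i n w a : Ahomog w a -> dvdX i n a ->
  exists2 b, Ahomog (w - xvec p i *~ n%:Z) b & a = X i ^+ n * b.
Proof. by move=> ha [b e]; exists b => //; apply: Ahomog_divX; rewrite -e. Qed.

Lemma dvdX_comp i n a : dvdX i n a <-> forall w, dvdX i n (Acomp w a).
Proof.
split=> [[b ->] w|]; last first.
  by apply: Ahomog_comp_ext; [exact: dvdX0 | exact: dvdXD].
by exists (Acomp (w - xvec p i *~ n%:Z) b); rewrite -(AcompM _ _ (AhomogX i n)) addrC subrK.
Qed.

Lemma scalA_unit c : c != 0 -> scalA p c * scalA p c^-1 = 1 :> A.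
Proof. by move=> c0; rewrite -scalAM mulfV // scalA1. Qed.

Lemma scalA0 : scalA p 0 = 0 :> A.
Proof. by rewrite /scalA mpolyC0 /piA raddf0. Qed.

Lemma scalAN c : scalA p (- c) = - scalA p c :> A.
Proof. by rewrite /scalA mpolyCN /piA raddfN. Qed.

Lemma dvdX_scal i n c a : c != 0 -> dvdX i n (scalA p c * a) -> dvdX i n a.
Proof.
move=> c0 /(dvdX_M (scalA p c^-1)); rewrite mulrA [_ * scalA p c]mulrC scalA_unit //.
by rewrite mul1r.
Qed.

(** A homogeneous [iunit] becomes a unit in the graded local ring at the i-th exceptional point; it
    need not be invertible in A. *)
Definition iunit i a := ~ dvdX i 1 a.

Lemma iunit_mod w a i j l : i != j -> i != l -> j != l -> Ahomog w a -> iunit i a ->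
  [/\ lres w i = 0, 0 <= llev w &
      exists c, c != 0 /\ dvdX i 1 (a - scalA p c * Amono w j l)].
Proof.
move=> ij il jl ha ua.
have wi : lres w i = 0.
  apply/eqP; rewrite eq_le lres_ge0 andbT leNgt; apply/negP => h.
  exact: ua (Ahomog_dvdX ha h).
have w0 : 0 <= llev w.
  by rewrite leNgt; apply/negP => /(Ahomog_lev ha) e; apply: ua; rewrite e; exact: dvdX0.
split=> //; have [c hc] := Ahomog_mod ij il jl ha wi w0; exists c; split=> //.
apply/eqP => c0; apply: ua; move: hc; by rewrite c0 scalA0 mul0r subr0.
Qed.

Lemma Amono_homog w i j l : i != j -> i != l -> j != l -> lres w i = 0 -> 0 <= llev w ->
  Ahomog w (Amono w j l).
Proof.
move=> ij il jl w0 l0.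
have e : w = xvec p j *~ (absz (lres w j + llev w * p j))%:Z + xvec p l *~ (absz (lres w l))%:Z.
  have e1 : Posz (absz (lres w j + llev w * p j)) = lres w j + llev w * p j.
    by apply: gez0_abs; rewrite addr_ge0 ?lres_ge0 // mulr_ge0 // ltW ?wt_gt0.
  have e2 : Posz (absz (lres w l)) = lres w l by rewrite gez0_abs ?lres_ge0.
  rewrite e1 e2 {1}(Lnorm w) {1}/xs (sum3 _ ij il jl) w0 mulr0z add0r.
  by rewrite mulrzDr [llev w * _]mulrC mulrzA -cvec_xvec addrAC.
by rewrite [X in Ahomog X]e /Amono; apply: AhomogM; exact: AhomogX.
Qed.

Lemma Amono_iunit i j l w : i != j -> i != l -> iunit i (Amono w j l).
Proof.
move=> ij il h; apply: (@dvdX1N i).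
have h1 := dvdX_cancelX ij h; rewrite -[X l ^+ _]mulr1 in h1.
exact: dvdX_cancelX il h1.
Qed.

(** Modulo X_i both factors are nonzero multiples of monomials in X_j and X_l, and these two
    variables are regular modulo X_i: the ideal of X_i is prime for homogeneous elements. *)
Lemma iunitM i w w' a b : Ahomog w a -> Ahomog w' b ->
  iunit i a -> iunit i b -> iunit i (a * b).
Proof.
have [j [l [ij il jl]]] := other2 i; move=> ha hb ua ub.
have [_ _ [c [c0 hc]]] := iunit_mod ij il jl ha ua.
have [_ _ [d [d0 hd]]] := iunit_mod ij il jl hb ub.
move=> hab; have : dvdX i 1 (scalA p c * (scalA p d * (Amono w j l * Amono w' j l))).
  have -> : scalA p c * (scalA p d * (Amono w j l * Amono w' j l)) =
    a * b - b * (a - scalA p c * Amono w j l) -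
    scalA p c * Amono w j l * (b - scalA p d * Amono w' j l) by ring.
  by apply: dvdXB; [apply: dvdXB => // |]; apply: dvdX_M.
move=> /(dvdX_scal c0)/(dvdX_scal d0); rewrite /Amono -!mulrA.
move=> /(dvdX_cancelX ij)/(dvdX_cancelX il)/(dvdX_cancelX ij) h.
apply: (@dvdX1N i); rewrite -[X l ^+ _]mulr1 in h; exact: dvdX_cancelX il h.
Qed.

Lemma iunit_cancel i n w a b : Ahomog w a -> iunit i a -> dvdX i n (a * b) -> dvdX i n b.
Proof.
move=> ha ua h; apply/dvdX_comp => x.
have {}h : dvdX i n (a * Acomp x b) by rewrite -(AcompM _ _ ha); move: (w + x); apply/dvdX_comp.
have hb := Acomp_homog x b; move: (Acomp x b) hb h => {}b hb.
elim: n x b hb => [|n IH] x b hb; first by exists b; rewrite expr0 mul1r.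
move=> h; have [c hc e] : exists2 c, Ahomog (x - xvec p i *~ 1) c & b = X i ^+ 1 * c.
  apply: dvdX_homog => //; apply: contrapT => ub.
  exact: iunitM ha hb ua ub (dvdX_le (ltn0Sn n) h).
move: h; rewrite e mulrCA -add1n => /dvdXE/(IH _ _ hc) h; exact/dvdXE.
Qed.

(** Extracting X_i stops: a factor X_i^(p_i) lowers the level of the degree by one, and there is
    nothing nonzero in negative level. *)
Lemma homog_iunit_dec i w a : Ahomog w a -> a <> 0 ->
  exists n b, [/\ a = X i ^+ n * b, Ahomog (w - xvec p i *~ n%:Z) b & iunit i b].
Proof.
move=> ha a0.
have [m hm] : exists m : nat, llev w < m%:Z by exists (absz (llev w + 1)); lia.
elim: m w a ha a0 hm => [|m IH] w a ha a0 hm.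
  by case: a0; apply: Ahomog_lev ha hm.
suff H : forall r : nat, exists n b, [/\ a = X i ^+ n * b, Ahomog (w - xvec p i *~ n%:Z) b &
   iunit i b \/ n = r].
  have [n [b [e hb [ub|en]]]] := H (p i); first by exists n, b.
  have b0 : b <> 0 by move=> b0; apply: a0; rewrite e b0 mulr0.
  have := IH _ _ hb b0.
  rewrite en -mulrNz llevDx.
  have -> : ((lres w i + - (p i)%:Z) %/ p i)%Z = -1.
    rewrite (_ : lres w i + - (p i)%:Z = (-1) * (p i)%:Z + lres w i); last by ring.
    by rewrite divzMDl ?gt_eqF ?wt_gt0 // divz_small ?addr0 // lres_ge0 lres_lt.
  move=> /(_ ltac:(lia))[n' [b' [e' hb' ub']]].
  exists (n + n')%N, b'; rewrite e e' exprD mulrA en; split=> //.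
  by move: hb'; rewrite PoszD mulrzDr opprD addrA mulrNz.
elim=> [|r [n [b [e hb [ub|en]]]]].
- by exists 0%N, a; rewrite expr0 mul1r mulr0z subr0; split=> //; right.
- by exists n, b; split=> //; left.
- have [ub|/contrapT hd] := EM (iunit i b); first by exists n, b; split=> //; left.
  have [c hc ec] := dvdX_homog hb hd.
  exists n.+1, c; rewrite e ec mulrA -exprD addn1 en; split=> //; last by right.
  by move: hc; rewrite en -addrA -opprD -mulrzDr -PoszD addn1.
Qed.

Lemma homog_reg w a b : Ahomog w a -> a <> 0 -> a * b = 0 -> b = 0.
Proof.
move=> ha a0 e; apply: (Ahomog_comp_ext (Q := fun b => b = 0)) => // [u v -> ->|x]; first exact: addr0.
have {e} : a * Acomp x b = 0.
  by rewrite -(AcompM _ _ ha) e; apply/AhomogP; exact: Ahomog0.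
have hb := Acomp_homog x b; move: (Acomp x b) hb => {}b hb e.
apply: contrapT => b0; pose i : 'I_3 := 0.
have [n [a' [ea ha' ua]]] := homog_iunit_dec i ha a0.
have [m [b' [eb hb' ub]]] := homog_iunit_dec i hb b0.
have := iunitM ha' hb' ua ub; move: e; rewrite ea eb mulrACA -exprD => /Xpow_reg ->.
by apply; exact: dvdX0.
Qed.

(** With Y_t = X_t^(p_t), the bound 2N - 1 is that of binary forms: in a monomial Y_i^u Y_j^v with u
    + v at least 2N - 1, one of the exponents is at least N. The vanishing of Ext^1 between line
    bundles rests on this. *)
Lemma Ahomog_dec w a i j l (N : nat) : i != j -> i != l -> j != l -> Ahomog w a -> 2 * N%:Z - 1 <= llev w ->
  exists b d, [/\ Ahomog (w - cvec p *~ N%:Z) b, Ahomog (w - cvec p *~ N%:Z) d &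
    a = X i ^+ (p i * N) * b + X j ^+ (p j * N) * d].
Proof.
move=> ij il jl ha hw.
(* One factor X_i is split off at a time. Whenever the residue at i is 0 and the level nonnegative,
   the level is still at least N, so that the monomial representing the element modulo X_i contains
   X_j^(p_j N) and can be removed. *)
have key : forall (m : nat) w a, Ahomog w a ->
    (forall s : nat, (s < m)%N -> lres (w - xvec p i *~ s%:Z) i = 0 ->
      0 <= llev (w - xvec p i *~ s%:Z) -> N%:Z <= llev (w - xvec p i *~ s%:Z)) ->
    exists b d, [/\ Ahomog (w - xvec p i *~ m%:Z) b, Ahomog (w - cvec p *~ N%:Z) d &
      a = X i ^+ m * b + X j ^+ (p j * N) * d].
  elim=> [|m IH] {hw}w {ha}a ha hs.
    exists a, 0; rewrite mulr0z subr0 expr0 mul1r mulr0 addr0; split=> //; exact: Ahomog0.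
  have [a1 [d1 [ha1 hd1 ea]]] : exists a1 d1, [/\ Ahomog (w - xvec p i *~ 1) a1,
      Ahomog (w - cvec p *~ N%:Z) d1 & a = X i * a1 + X j ^+ (p j * N) * d1].
    have h0 : exists2 c, Ahomog w c & dvdX i 1 (a - c) /\ dvdX j (p j * N) c.
      have [ua|/contrapT da] := EM (iunit i a); last first.
        by exists 0; [exact: Ahomog0 | rewrite subr0; split=> //; exact: dvdX0].
      have [w0 l0 [c [c0 hc]]] := iunit_mod ij il jl ha ua.
      have := hs 0%N (ltn0Sn m); rewrite mulr0z subr0 => /(_ w0 l0) hN.
      exists (scalA p c * Amono w j l).
        rewrite -[w in Ahomog w _]add0r; apply: AhomogM; first exact: scalA_homog.
        exact: Amono_homog ij il jl w0 l0.
      split=> //; apply: dvdX_M; apply: dvdX_Ml; apply: dvdX_le (dvdX_id _ _).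
      rewrite -lez_nat gez0_abs ?PoszM; last first.
        by rewrite addr_ge0 ?lres_ge0 // mulr_ge0 // ltW ?wt_gt0.
      by rewrite -[X in X <= _]add0r lerD ?lres_ge0 // mulrC ler_pM2r ?wt_gt0.
    have [c hc [d1 d2]] := h0.
    have [b1 hb1 e1] := dvdX_homog (AhomogD ha (AhomogN hc)) d1.
    have [b2 hb2 e2] := dvdX_homog hc d2.
    exists b1, b2; split=> //; last by rewrite -[a](subrK c) e1 {1}e2 expr1.
    by move: hb2; rewrite PoszM mulrC mulrzA mulrzAC -cvec_xvec.
  have [|b [d [hb hd eb]]] := IH _ _ ha1.
    move=> s sm; have := hs s.+1; rewrite ltnS => /(_ sm).
    by rewrite -!addrA -!opprD -!mulrzDr -PoszD add1n.
  exists b, (X i * d + d1); split.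
  - by move: hb; rewrite -addrA -opprD -mulrzDr -PoszD add1n.
  - apply: AhomogD => //; have := AhomogM (AhomogX i 1) hd.
    by rewrite expr1; congr Ahomog; abel.
  - by rewrite ea eb exprS; ring.
have [|b [d [hb hd e]]] := key (p i * N)%N w a ha.
  move=> s sm hr _; rewrite -mulrNz llevDx.
  move: hr; rewrite -mulrNz lresDx eqxx => hr.
  have hq : - N%:Z < ((lres w i + - s%:Z) %/ p i)%Z.
    have := divz_eq (lres w i + - s%:Z) (p i); rewrite hr addr0 => eq.
    rewrite -(@ltr_pM2r _ (p i)%:Z) ?wt_gt0 // -eq; have := lres_ge0 w i; nia.
  by lia.
exists b, d; split=> //.
by move: hb; rewrite PoszM mulrC mulrzA mulrzAC -cvec_xvec.
Qed.

Lemma Ahomog00 a : Ahomog 0 a -> exists c, a = scalA p c.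
Proof.
move=> ha; pose i : 'I_3 := 0; have [j [l [ij il jl]]] := other2 i.
have [c hc] : exists c, dvdX i 1 (a - scalA p c * Amono 0 j l).
  by apply: Ahomog_mod => //; rewrite ?lres0 ?llev0.
exists c; move: hc; rewrite /Amono !lres0 llev0 mul0r addr0 !expr0 !mulr1 => hc.
have [b hb e] := dvdX_homog (AhomogD ha (AhomogN (scalA_homog p c))) hc.
apply/eqP; rewrite -subr_eq0 e (Ahomog_lev hb) ?mulr0 //.
rewrite -mulrNz llevDx llev0 lres0 !add0r.
by rewrite ltz_divLR ?wt_gt0 //; lia.
Qed.

(** Such an element and X_i have no common zero. Modulo X_i it is a scalar times X_t^r X_l^m;
    completing X_l^m to X_l^(p_l m) and using the relation turns it into a power of X_t. *)
Lemma iunit_ideal i w a n : Ahomog w a -> iunit i a ->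
  exists N, forall t, exists b d, X t ^+ N = a * b + X i ^+ n * d.
Proof.
move=> ha ua.
suff H t : exists N b d, X t ^+ N = a * b + X i ^+ n * d.
  have [[N0 h0] [[N1 h1] [N2 h2]]] := (H 0, (H 1, H 2%:R)).
  exists (N0 + N1 + N2)%N => t.
  have [b [d e]] : exists b d, X t ^+ N0 = a * b + X i ^+ n * d \/
      X t ^+ N1 = a * b + X i ^+ n * d \/ X t ^+ N2 = a * b + X i ^+ n * d.
    case: t => -[|[|[|//]]] ht.
    - have [b [d e]] := h0; exists b, d; left; rewrite -e; congr (X _ ^+ _); exact: val_inj.
    - have [b [d e]] := h1; exists b, d; right; left; rewrite -e; congr (X _ ^+ _); exact: val_inj.
    - have [b [d e]] := h2; exists b, d; right; right; rewrite -e; congr (X _ ^+ _); exact: val_inj.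
  case: e => [e|[e|e]].
  - by exists (X t ^+ (N1 + N2) * b), (X t ^+ (N1 + N2) * d); rewrite -addnA addnC exprD e; ring.
  - by exists (X t ^+ (N0 + N2) * b), (X t ^+ (N0 + N2) * d); rewrite addnAC exprD e; ring.
  - by exists (X t ^+ (N0 + N1) * b), (X t ^+ (N0 + N1) * d); rewrite exprD e; ring.
have [->|ti] := eqVneq t i; first by exists n, 0, 1; rewrite mulr0 mulr1 add0r.
have it : i != t by rewrite eq_sym.
have [l [il tl]] := other1 it.
have [_ _ [c [c0 [v hv]]]] := iunit_mod it il tl ha ua.
suff [N1 [b [d e]]] : exists N1 b d, X t ^+ N1 = a * b + X i * d.
  exists (N1 * n)%N; elim: n => [|n [b' [d' IH]]]; first by exists 0, 1; rewrite muln0 !expr0 mulr0 mulr1 add0r.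
  exists (b * (a * b' + X i ^+ n * d') + X i * d * b'), (d * d').
  rewrite mulnS exprD e IH exprS; ring.
set m := absz (lres w l); set r := absz (lres w t + llev w * p t).
have [z hz] : exists z, X l ^+ (p l * m) = scalA p ((- relc t / relc l) ^+ m) * X t ^+ (p t * m) + X i * z.
  have /(congr1 (fun z => scalA p (relc l)^-1 * z)) := XrelA it il tl.
  rewrite mulr0 !mulrDr !mulrA -!scalAM mulVf ?relc_neq0 // scalA1 mul1r => h.
  have {}h : X l ^+ p l = scalA p (- relc t / relc l) * X t ^+ p t + X i * (- scalA p ((relc l)^-1 * relc i) * X i ^+ (p i).-1).
    rewrite mulrCA -exprS prednK; last by have := wt_ge2 p i; lia.
    rewrite [_ / relc l]mulrC !mulrN scalAN; apply/eqP; rewrite -subr_eq0 -{}h; apply/eqP; ring.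
  elim: m => [|m [z IH]]; first by exists 0; rewrite !muln0 !expr0 scalA1 mul1r mulr0 addr0.
  rewrite !mulnS !exprD IH exprS scalAM h; set u := _ * X i ^+ _.
  by exists (scalA p (- relc t / relc l) * X t ^+ p t * z + u * (scalA p ((- relc t / relc l) ^+ m) * X t ^+ (p t * m) + X i * z)); ring.
set e := (- relc t / relc l) ^+ m; have e0 : e != 0.
  by rewrite expf_neq0 // mulf_neq0 ?invr_eq0 ?oppr_eq0 ?relc_neq0.
exists (r + p t * m)%N, (scalA p (c * e)^-1 * X l ^+ (p l * m - m)).
exists (- scalA p (c * e)^-1 * (X l ^+ (p l * m - m) * v + scalA p c * X t ^+ r * z)).
have hlm : X l ^+ (p l * m - m) * X l ^+ m = X l ^+ (p l * m).
  by rewrite -exprD subnK // leq_pmull //; have := wt_ge2 p l; lia.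
move: hv; rewrite expr1 /Amono -/m -/r => hv.
have ea : a = scalA p c * (X t ^+ r * X l ^+ m) + X i * v by rewrite -hv addrC subrK.
have ece : scalA p (c * e)^-1 * (scalA p c * scalA p e) = 1 :> A.
  by rewrite -!scalAM mulVf ?scalA1 // mulf_neq0.
rewrite exprD -[LHS]mul1r -ece {1}ea.
transitivity (scalA p (c * e)^-1 * (scalA p c * X t ^+ r * (X l ^+ (p l * m) - X i * z))).
  rewrite hz addrK -/e; move: (scalA p (c * e)^-1) (scalA p c) (scalA p e) => u1 u2 u3.
  by move: (X t ^+ r) (X t ^+ (p t * m)) => u4 u5; ring.
rewrite -hlm; move: (scalA p (c * e)^-1) (scalA p c) => u1 u2.
by move: (X t ^+ r) (X l ^+ m) (X l ^+ _) => u3 u4 u5; ring.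
Qed.
End CoordinateAlgebraTheory.

(** * Noetherianity *)

Section Noetherian.
Variable R : pzRingType.

Definition submod (V : lmodType R) (N : V -> Prop) :=
  N 0 /\ forall a u v, N u -> N v -> N (a *: u + v).

(** The span as the intersection of all submodules containing s: membership serves as an induction
    principle, without families of coefficients. *)
Definition mspan (V : lmodType R) (s : seq V) (u : V) :=
  forall N, submod N -> (forall v, v \in s -> N v) -> N u.

Definition fgsub (V : lmodType R) (N : V -> Prop) :=
  exists s : seq V, (forall v, v \in s -> N v) /\ forall u, N u -> mspan s u.

Lemma mspan_submod (V : lmodType R) (s : seq V) : submod (mspan s).
Proof.
split=> [N [N0 _] //|a u v hu hv N hN hs]; apply: hN.2; [exact: hu | exact: hv].
Qed.

Lemma mem_mspan (V : lmodType R) (s : seq V) v : v \in s -> mspan s v.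
Proof. by move=> vs N _; apply. Qed.

Lemma mspan_sub (V : lmodType R) (s t : seq V) u :
  (forall v, v \in s -> mspan t v) -> mspan s u -> mspan t u.
Proof. by move=> h; apply=> //; exact: mspan_submod. Qed.

Lemma submodB (V : lmodType R) (N : V -> Prop) u v : submod N -> N u -> N v -> N (u - v).
Proof. by move=> hN hu hv; rewrite addrC -scaleN1r; apply: hN.2. Qed.
Lemma submodD (V : lmodType R) (N : V -> Prop) u v : submod N -> N u -> N v -> N (u + v).
Proof. by move=> hN hu hv; rewrite -[u]scale1r; apply: hN.2. Qed.
Lemma submodZ (V : lmodType R) (N : V -> Prop) a u : submod N -> N u -> N (a *: u).
Proof. by move=> hN hu; rewrite -[_ *: _]addr0; apply: hN.2 => //; exact: hN.1. Qed.

Lemma submod_sum (V : lmodType R) (N : V -> Prop) (I : Type) (s : seq I) (Q : pred I) (F : I -> V) :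
  submod N -> (forall i, Q i -> N (F i)) -> N (\sum_(i <- s | Q i) F i).
Proof.
move=> hN h; elim: s => [|i s IH]; first by rewrite big_nil; exact: hN.1.
rewrite big_cons; case: ifP => // Qi; apply: submodD => //; exact: h.
Qed.

Lemma mspan_cons (V : lmodType R) (s : seq V) v u :
  mspan (v :: s) u -> exists a, mspan s (u - a *: v).
Proof.
have [s0 sl] := mspan_submod s.
move=> /(_ (fun u => exists a, mspan s (u - a *: v))); apply; first split.
  by exists 0; rewrite scale0r subr0.
  move=> a u1 u2 [b1 h1] [b2 h2]; exists (a * b1 + b2).
  rewrite scalerDl -scalerA opprD addrACA -scalerBr; exact: sl.
move=> w; rewrite inE => /orP[/eqP ->|ws]; first by exists 1; rewrite scale1r subrr.
by exists 0; rewrite scale0r subr0; exact: mem_mspan.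
Qed.

Definition noeth := forall I : R^o -> Prop, submod I -> fgsub I.

(** Induction on the generators. The coefficients at v of the elements of N form an ideal; lifts to
    N of its generators, together with generators of the part of N spanned by s, generate N. *)
Lemma noeth_mspan (V : lmodType R) (s : seq V) (N : V -> Prop) : noeth ->
  submod N -> (forall u, N u -> mspan s u) -> fgsub N.
Proof.
move=> nR; elim: s N => [|v s IH] N hN hs.
  by exists [::]; split.
have E (a b1 b2 : R) (n1 n2 : V) :
    a *: n1 + n2 - (a * b1 + b2) *: v = a *: (n1 - b1 *: v) + (n2 - b2 *: v).
  by rewrite scalerDl -scalerA opprD addrACA -scalerBr.
pose I (a : R^o) := exists2 n, N n & mspan s (n - (a : R) *: v).
have hI : submod I.
  split; first by exists 0; rewrite ?scale0r ?subr0; [exact: hN.1 | exact: (mspan_submod _).1].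
  move=> a b1 b2 [n1 N1 h1] [n2 N2 h2]; exists (a *: n1 + n2); first exact: hN.2.
  by have := (mspan_submod s).2 a _ _ h1 h2; rewrite -E.
have [t [tI It]] := nR I hI.
have [ns [Nn hn]] : exists ns : seq V, (forall n, n \in ns -> N n) /\
    forall a, a \in t -> exists2 n, mspan ns n & mspan s (n - (a : R) *: v).
  elim: t tI {It} => [|a t IHt] tI; first by exists [::].
  have [ns [Nn hn]] := IHt (fun b bt => tI b (@mem_behead _ (a :: t) b bt)).
  have [n N1 h1] := tI a (mem_head _ _).
  exists (n :: ns); split=> [m|b]; rewrite inE => /orP[/eqP ->|] //; first exact: Nn.
    by exists n => //; apply: mem_mspan; rewrite mem_head.
  move=> /hn[m hm h]; exists m => //; apply: mspan_sub hm => w ws; apply: mem_mspan.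
  by rewrite inE ws orbT.
have nsN u : mspan ns u -> N u by apply=> // n /Nn.
have [||r [rN hr]] := IH (fun u => N u /\ mspan s u); last 1 first; [|split|by move=> u []].
  3: by move=> a u w [h1 h2] [h3 h4]; split; [exact: hN.2 | exact: (mspan_submod _).2].
  2: by split; [exact: hN.1 | exact: (mspan_submod _).1].
exists (ns ++ r); split=> [w|u Nu]; first by rewrite mem_cat => /orP[/Nn|/rN[]].
have [a ha] := mspan_cons (hs u Nu).
have [n hn1 hn2] : exists2 n, mspan ns n & mspan s (n - a *: v).
  have /It : I a by exists u.
  move=> /(_ (fun a : R => exists2 n, mspan ns n & mspan s (n - a *: v))).
  apply; last by move=> b /hn.
  split; first by exists 0; rewrite ?scale0r ?subr0; exact: (mspan_submod _).1.
  move=> b b1 b2 [n1 N1 h1] [n2 N2 h2]; exists (b *: n1 + n2); first exact: (mspan_submod _).2.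
  by have := (mspan_submod s).2 b _ _ h1 h2; rewrite -E.
rewrite -[u](subrK n); apply: (submodD (mspan_submod (ns ++ r))).
  have : mspan r (u - n).
    apply: hr; split; first by apply: submodB => //; exact: nsN.
    have -> : u - n = (u - a *: v) - (n - a *: v) by rewrite opprB addrA subrK.
    by apply: (submodB (mspan_submod s)).
  by apply: mspan_sub => w wr; apply: mem_mspan; rewrite mem_cat wr orbT.
by apply: mspan_sub hn1 => w wr; apply: mem_mspan; rewrite mem_cat wr.
Qed.

Lemma noeth_fg (V : lmodType R) (s : seq V) (N : V -> Prop) : noeth ->
  (forall u, mspan s u) -> submod N -> fgsub N.
Proof. by move=> nR hs hN; apply: (noeth_mspan (s := s)). Qed.
End Noetherian.

Section HilbertBasis.
Variable R : comNzRingType.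
Local Notation RX := {poly R}.

Lemma Hilbert_basis : noeth R -> noeth RX.
Proof.
move=> nR I [I0 Il].
have IM a f : I f -> I (a * f).
  by move=> hf; rewrite -[a * f]addr0; apply: (Il a f 0).
have IB f g : I f -> I g -> I (f - g) by exact: (submodB (conj I0 Il)).
(* The ideals of coefficients of X^d of the elements of I of degree at most d increase with d, hence
   are constant from some D on; generators are needed only in degrees up to D. *)
pose Ld d (a : R^o) := exists2 f, I f & (size f <= d.+1)%N /\ f`_d = a.
have hLd d : submod (Ld d).
  split; first by exists 0; rewrite ?size_poly0 ?coef0.
  move=> a b1 b2 [f1 h1 [s1 e1]] [f2 h2 [s2 e2]]; exists (a%:P * f1 + f2); first exact: Il.
  rewrite coefD coefCM e1 e2; split=> //; apply: leq_trans (size_polyD _ _) _.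
  rewrite geq_max s2 andbT; apply: leq_trans s1.
  by rewrite mul_polyC size_scale_leq.
have Ld_le d e a : (d <= e)%N -> Ld d a -> Ld e a.
  move=> /subnKC <- [f hf [sf ef]]; exists (f * 'X^(e - d)); first by rewrite mulrC; exact: IM.
  rewrite coefMXn ltnNge leq_addl /= addnK; split=> //.
  have [->|f0] := eqVneq f 0; first by rewrite mul0r size_poly0.
  by rewrite size_mulXn //; move: sf; move: (size f) => z; lia.
have step d : exists s : seq RX, (forall f, f \in s -> I f) /\
    forall a, Ld d a -> exists2 g, mspan (V := RX^o) s g & (size g <= d.+1)%N /\ g`_d = a.
  have [t [tL Lt]] := nR _ (hLd d).
  have [s [sI hs]] : exists s : seq RX, (forall f, f \in s -> I f) /\
      forall a, a \in t -> exists2 g, g \in s & (size g <= d.+1)%N /\ g`_d = a.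
    elim: t tL {Lt} => [|a t IHt] tL; first by exists [::].
    have [s [sI hs]] := IHt (fun b bt => tL b (@mem_behead _ (a :: t) b bt)).
    have [f hf h] := tL a (mem_head _ _).
    exists (f :: s); split=> [g|b]; rewrite inE => /orP[/eqP ->|] //; first exact: sI.
      by exists f => //; exact: mem_head.
    by move=> /hs[g gs hg]; exists g => //; rewrite inE gs orbT.
  exists s; split=> // a /Lt.
  move=> /(_ (fun a => exists2 g, mspan (V := RX^o) s g & (size g <= d.+1)%N /\ g`_d = a)).
  apply; last first.
    by move=> b /hs[g gs hg]; exists g => //; exact: mem_mspan.
  split; first by exists 0; rewrite ?size_poly0 ?coef0 //; exact: (mspan_submod _).1.
  move=> c b1 b2 [f1 h1 [s1 e1]] [f2 h2 [s2 e2]]; exists (c%:P * f1 + f2).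
    exact: (mspan_submod (V := RX^o) s).2.
  rewrite coefD coefCM e1 e2; split=> //; apply: leq_trans (size_polyD _ _) _.
  rewrite geq_max s2 andbT; apply: leq_trans s1.
  by rewrite mul_polyC size_scale_leq.
have [D hD] : exists D, forall d a, Ld d a -> Ld D a.
  pose LL (a : R^o) := exists d, Ld d a.
  have [|t [tL Lt]] := nR LL.
    split; first by exists 0%N; exact: (hLd _).1.
    move=> c a b [d1 h1] [d2 h2]; exists (maxn d1 d2); apply: (hLd _).2.
      exact: Ld_le (leq_maxl _ _) h1.
    exact: Ld_le (leq_maxr _ _) h2.
  have [D hD] : exists D, forall a, a \in t -> Ld D a.
    elim: t tL {Lt} => [|a t IHt] tL; first by exists 0%N.
    have [D hD] := IHt (fun b bt => tL b (@mem_behead _ (a :: t) b bt)).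
    have [d hd] := tL a (mem_head _ _); exists (maxn d D) => b.
    rewrite inE => /orP[/eqP ->|/hD h]; first exact: Ld_le (leq_maxl _ _) hd.
    exact: Ld_le (leq_maxr _ _) h.
  by exists D => d a h; have /Lt : LL a by [exists d]; apply.
have [G [GI hG]] : exists s : seq RX, (forall f, f \in s -> I f) /\
    forall d a, (d <= D)%N -> Ld d a ->
      exists2 g, mspan (V := RX^o) s g & (size g <= d.+1)%N /\ g`_d = a.
  elim: D {hD} => [|D [s [sI hs]]].
    by have [s [sI hs]] := step 0%N; exists s; split=> // d a; rewrite leqn0 => /eqP ->; exact: hs.
  have [r [rI hr]] := step D.+1; exists (s ++ r); split.
    by move=> f; rewrite mem_cat => /orP[/sI|/rI].
  move=> d a; rewrite leq_eqVlt => /orP[/eqP -> /hr|/hs h /h] [g gs hg]; exists g => //;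
    by apply: mspan_sub gs => w ws; apply: mem_mspan; rewrite mem_cat ws ?orbT.
exists G; split=> // f hf.
have [n] := ubnP (size f); elim: n f hf => // n IH f hf; rewrite ltnS => sf.
have [->|f0] := eqVneq f 0; first exact: (mspan_submod _).1.
set d := (size f).-1; have sd : size f = d.+1 by rewrite prednK // lt0n size_poly_eq0.
have hLf : Ld d f`_d by exists f => //; rewrite sd.
suff [g gG [sg eg]] : exists2 g, mspan (V := RX^o) G g & (size g <= d.+1)%N /\ g`_d = f`_d.
  have gI : I g by apply: gG => // h /GI.
  rewrite -[f](subrK g); apply: (submodD (mspan_submod _)) => //; apply: IH; first exact: IB.
  apply: leq_trans sf; rewrite sd ltnS; apply/leq_sizeP => j dj; rewrite coefB.
  have [->|jd] := eqVneq j d; first by rewrite eg subrr.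
  have dj' : (d < j)%N by rewrite ltn_neqAle eq_sym jd.
  by rewrite !nth_default ?subrr // ?sd //; apply: leq_trans sg _.
have [dD|Dd] := leqP d D; first exact: hG.
have [g gG [sg eg]] := hG D _ (leqnn D) (hD _ _ hLf).
exists ('X^(d - D) * g); first exact: (submodZ 'X^(d - D) (mspan_submod (V := RX^o) G)).
rewrite mulrC coefMXn ltnNge leq_subr /= subKn ?(ltnW Dd) //; split=> //.
have [->|g0] := eqVneq g 0; first by rewrite mul0r size_poly0.
rewrite size_mulXn //; move: sg; rewrite -(leq_add2l (d - D)) => h; apply: leq_trans h _.
by rewrite addnS subnK // ltnW.
Qed.
End HilbertBasis.

Lemma noeth_field (k : fieldType) : noeth k.
Proof.
move=> I [I0 Il].
have [[x Ix x0]|h] := EM (exists2 x, I x & x != 0).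
  exists [:: x]; split=> [v|u _]; first by rewrite inE => /eqP ->.
  rewrite -[u](divfK x0); exact: (submodZ (u / x) (mspan_submod (V := k^o) _) (mem_mspan (mem_head _ _))).
exists [::]; split=> // u Iu; have -> : u = 0.
  by apply/eqP; apply: contrapT => /negP u0; apply: h; exists u.
exact: (mspan_submod _).1.
Qed.

Lemma noeth_surj (R S : comNzRingType) (f : {rmorphism R -> S}) :
  (forall y, exists x, f x = y) -> noeth R -> noeth S.
Proof.
move=> fs nR I [I0 Il].
have [|s [sI hs]] := nR (fun x => I (f x)).
  split=> [|a u v hu hv]; first by rewrite rmorph0.
  by rewrite rmorphD rmorphM; exact: Il.
exists (map f s); split=> [v /mapP[x /sI h ->] //|u Iu].
have [x e] := fs u; rewrite -e in Iu *.
apply: (hs x Iu (fun x => mspan (V := S^o) (map f s) (f x))) => [|v vs]; last first.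
  by apply: mem_mspan; exact: map_f.
split=> [|a v w hv hw]; first by rewrite rmorph0; exact: (mspan_submod _).1.
by rewrite rmorphD rmorphM; exact: (mspan_submod (V := S^o) _).2.
Qed.

Section CoordinateNoetherian.
Variables (k : fieldType) (p : weights).
Local Notation A := (coordA k p).
Local Notation X := (Xvar k p).

Lemma scalA_zmod : zmod_morphism (scalA p : k -> A).
Proof. by move=> a b; rewrite scalAD scalAN. Qed.
Lemma scalA_monoid : monoid_morphism (scalA p : k -> A).
Proof. by split; [exact: scalA1 | exact: scalAM]. Qed.
HB.instance Definition _ := GRing.isZmodMorphism.Build k A (scalA p) scalA_zmod.
HB.instance Definition _ := GRing.isMonoidMorphism.Build k A (scalA p) scalA_monoid.

Lemma commrA (R : comNzRingType) (f : {rmorphism R -> A}) (u : A) : commr_rmorph f u.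
Proof. by move=> x; exact: mulrC. Qed.

(** A as a quotient of k[x][y][z], to which [Hilbert_basis] applies three times. *)
Definition ev1 : {poly k} -> A := horner_morph (commrA (scalA p) (X 0)).
HB.instance Definition _ := GRing.RMorphism.on ev1.
Definition ev2 : {poly {poly k}} -> A := horner_morph (commrA ev1 (X 1)).
HB.instance Definition _ := GRing.RMorphism.on ev2.
Definition ev3 : {poly {poly {poly k}}} -> A := horner_morph (commrA ev2 (X 2%:R)).
HB.instance Definition _ := GRing.RMorphism.on ev3.

Lemma noeth_coordA : noeth A.
Proof.
apply: (@noeth_surj _ _ ev3); last by do 3 apply: Hilbert_basis; exact: noeth_field.
move=> a; have [f ->] := piA_surj a.
elim/mpolyind: f => [|c m f _ _ [x ex]]; first by exists 0; rewrite rmorph0 /piA raddf0.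
suff [y ey] : exists y, ev3 y = piA p 'X_[m].
  exists ((c%:P)%:P%:P * y + x); rewrite rmorphD rmorphM /= ey ex piAD -mul_mpolyC piAM.
  by rewrite /ev3 horner_morphC /= /ev2 horner_morphC /= /ev1 horner_morphC.
rewrite piA_monX.
have hX t : exists y, ev3 y = X t.
  case: t => -[|[|[|//]]] ht.
  - exists ('X%:P)%:P; rewrite /ev3 horner_morphC /= /ev2 horner_morphC /= /ev1 horner_morphX.
    by congr X; exact: val_inj.
  - exists 'X%:P; rewrite /ev3 horner_morphC /= /ev2 horner_morphX.
    by congr X; exact: val_inj.
  - exists 'X; rewrite /ev3 horner_morphX; by congr X; exact: val_inj.
apply: (big_ind (fun z => exists y, ev3 y = z)) => [|z1 z2 [y1 <-] [y2 <-]|t _].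
- by exists 1; rewrite rmorph1.
- by exists (y1 * y2); rewrite rmorphM.
- by have [y ey] := hX t; exists (y ^+ m t); rewrite rmorphXn /= ey.
Qed.
End CoordinateNoetherian.

(** * Torsion and finite length *)

Section Torsion.
Variables (k : fieldType) (p : weights).
Local Notation L := (Lgrp p).
Local Notation A := (coordA k p).
Local Notation X := (Xvar k p).
Local Notation grmod := (grmod k p).

Lemma gsub_submod (M : grmod) (P : set M) : is_gsub P -> submod P.
Proof. by case=> h0 hl _; split. Qed.

Lemma hcB (M : grmod) x (u v : M) : hc x (u - v) = hc x u - hc x v.
Proof. by apply: (@addIr _ (hc x v)); rewrite -hcD !subrK. Qed.

Lemma hc_bigsum (M : grmod) x (I : Type) (s : seq I) (F : I -> M) :
  hc x (\sum_(i <- s) F i) = \sum_(i <- s) hc x (F i).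
Proof. by elim: s => [|i s IH]; rewrite ?big_nil ?hc0 // !big_cons hcD IH. Qed.

Lemma hcid (M : grmod) x (u : M) : hc x (hc x u) = hc x u.
Proof. by rewrite hc_hc eqxx. Qed.

Lemma hc_scale (M : grmod) w x a (u : M) : hc x u = u -> hc w (a *: u) = Acomp (w - x) a *: u.
Proof.
move=> hu; have [s [us es]] := A_hc_sum a.
rewrite {1}es scaler_suml hc_bigsum.
have E y : hc w (Acomp y a *: u) = if w - x == y then Acomp y a *: u else 0.
  rewrite -{1}[w](subrK y) -[w - y + y]addrC -{1}hu.
  rewrite hcZ; last exact: Acomp_homog.
  rewrite hc_hc; case: eqP => [e|e].
    by rewrite hu -e (_ : w - (w - y) = y) ?eqxx //; abel.
  case: eqP => [e'|]; last by rewrite scaler0.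
  by case: e; rewrite -e'; abel.
under eq_bigr do rewrite E.
have [ws|ws] := boolP (w - x \in s).
  rewrite (bigD1_seq (w - x)) //= eqxx big1 ?addr0 // => y yx.
  by rewrite eq_sym (negPf yx).
rewrite big_seq big1 => [|y ys]; last first.
  by case: eqP => // e; rewrite e ys in ws.
have -> : Acomp (w - x) a = 0; last by rewrite scale0r.
rewrite es Acomp_sum big_seq big1 // => y ys.
have := A_hc_hc (w - x) y a; case: eqP => [e|_ -> //].
by rewrite e ys in ws.
Qed.

Lemma hc_scaleX (M : grmod) x t n (u : M) :
  hc (xvec p t *~ n%:Z + x) (X t ^+ n *: u) = X t ^+ n *: hc x u.
Proof. by rewrite hcZ //; exact: AhomogX. Qed.

(** The saturation of P with respect to the irrelevant ideal. By [flen_tors] and [tors_flen], for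
    graded submodules P <= R the quotient R/P has finite length if and only if R is contained in
    [tors P]. *)
Definition tors (M : grmod) (P : set M) (u : M) := exists N, forall t, P (X t ^+ N *: u).

Lemma tors_le (M : grmod) (P : set M) t m n u : is_gsub P -> (m <= n)%N ->
  P (X t ^+ m *: u) -> P (X t ^+ n *: u).
Proof. by move=> hP /subnK <- h; rewrite exprD -scalerA; exact: gsubZ. Qed.

Lemma ord3P (Q : 'I_3 -> Prop) : Q 0 -> Q 1 -> Q 2%:R -> forall t, Q t.
Proof.
move=> h0 h1 h2 [[|[|[|//]]] ht].
- by rewrite (_ : Ordinal ht = 0) //; exact: val_inj.
- by rewrite (_ : Ordinal ht = 1) //; exact: val_inj.
- by rewrite (_ : Ordinal ht = 2%:R) //; exact: val_inj.
Qed.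

Lemma torsP (M : grmod) (P : set M) u : is_gsub P ->
  (forall t, exists n, P (X t ^+ n *: u)) -> tors P u.
Proof.
move=> hP h; have [[a ha] [[b hb] [c hc]]] := (h 0, (h 1, h 2%:R)).
by exists (a + b + c)%N; apply: ord3P; [apply: tors_le ha|apply: tors_le hb|apply: tors_le hc] => //; lia.
Qed.

Lemma tors_in (M : grmod) (P : set M) u : P u -> tors P u.
Proof. by exists 0%N => t; rewrite expr0 scale1r. Qed.

Lemma tors_gsub (M : grmod) (P : set M) : is_gsub P -> is_gsub (tors P).
Proof.
move=> hP; split; first by apply: tors_in; exact: gsub0.
  move=> a u v [m hu] [n hv]; exists (m + n)%N => t.
  rewrite scalerDr scalerA mulrC -scalerA; apply: gsub_lin => //.
    by apply: tors_le (hu t) => //; lia.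
  by apply: tors_le (hv t) => //; lia.
move=> x u [n hu]; exists n => t.
by rewrite -hc_scaleX; apply: gsub_hc.
Qed.

Lemma tors_trans (M : grmod) (P Q : set M) u : is_gsub Q ->
  (forall v, P v -> tors Q v) -> tors P u -> tors Q u.
Proof.
move=> hQ h [n hn]; apply: torsP => // t; have [m hm] := h _ (hn t).
by exists (m + n)%N; rewrite exprD -scalerA.
Qed.

Lemma tors_sub (M : grmod) (P Q : set M) u : (forall v, P v -> Q v) -> tors P u -> tors Q u.
Proof. by move=> h [n hn]; exists n => t; apply: h. Qed.

Lemma Acomp_Nx t (a : A) : Acomp (- xvec p t *~ 1) a = 0.
Proof.
apply: (Ahomog_lev (Acomp_homog _ _)); rewrite mulNrz -mulrNz.
rewrite -[_ *~ _]add0r llevDx llev0 lres0 !add0r ltz_divLR ?wt_gt0 //; lia.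
Qed.

Definition gcyc (M : grmod) (P : set M) (u : M) : set M := [set v | exists a, P (v - a *: u)].

Lemma gcyc_gsub (M : grmod) (P : set M) x u : is_gsub P -> hc x u = u -> is_gsub (gcyc P u).
Proof.
move=> hP hu; split.
- by exists 0; rewrite scale0r subr0; exact: gsub0.
- move=> a v w [b hb] [c hc]; exists (a * b + c).
  by rewrite scalerDl -scalerA opprD addrACA -scalerBr; apply: gsub_lin.
- move=> w v [a ha]; exists (Acomp (w - x) a).
  by rewrite -(hc_scale _ _ hu) -hcB; apply: gsub_hc.
Qed.

Lemma gcyc_sub (M : grmod) (P : set M) u v : P v -> gcyc P u v.
Proof. by move=> h; exists 0; rewrite scale0r subr0. Qed.
Lemma gcyc_mem (M : grmod) (P : set M) u : is_gsub P -> gcyc P u u.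
Proof. by move=> h; exists 1; rewrite scale1r subrr; exact: gsub0. Qed.
Lemma gcyc_min (M : grmod) (P R : set M) u : is_gsub R -> (forall v, P v -> R v) -> R u ->
  forall v, gcyc P u v -> R v.
Proof.
move=> hR h hu v [a ha]; rewrite -[v](subrK (a *: u)); apply: gsubD => //; first exact: h.
exact: gsubZ.
Qed.

Lemma gsub_comp (M : grmod) (P : set M) u : is_gsub P -> (forall x, P (hc x u)) -> P u.
Proof.
move=> hP h; have [s [_ ->]] := hc_sum u.
by elim: s => [|x s IH]; rewrite ?big_nil ?big_cons; [exact: gsub0 | exact: gsubD].
Qed.

(** X_t kills every simple factor S/Q: otherwise Q + A X_t u = S for some homogeneous u in S, so u
    is congruent to a X_t u for some a; comparing degrees, only the component of a of degree - x_t
    counts, and it is 0. *)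
Lemma flen_tors (M : grmod) (P R : set M) : is_gsub P -> flen P R ->
  forall u, R u -> tors P u.
Proof.
move=> hP; elim=> [u|Q S hPQ IH gS QS simp u Su]; first exact: tors_in.
have gQ := flen_gsub hP hPQ.
suff h t v : S v -> Q (X t *: v).
  apply: (tors_trans (P := Q)) => //; exists 1%N => t; rewrite expr1; exact: h.
move=> {u Su} Sv.
have [//|nQ] := EM (Q (X t *: v)); exfalso.
have [x nx] : exists x, ~ Q (X t *: hc x v).
  apply: contrapT => /forallNP h; apply: nQ; apply: (gsub_comp gQ) => x.
  rewrite -(subrK (xvec p t *~ 1) x) addrC -[X t]expr1 hc_scaleX expr1.
  exact: contrapT (h _).
set u := hc x v in nx *; have Su : S u by exact: gsub_hc.
have hu : hc x u = u by exact: hcid.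
have hXu : hc (xvec p t *~ 1 + x) (X t *: u) = X t *: u.
  by rewrite -[X t]expr1 hc_scaleX hu.
have [e|e] := simp _ (gcyc_gsub gQ hXu) (@gcyc_sub _ Q _)
   (gcyc_min gS QS (gsubZ gS _ Su)).
  by apply: nx; rewrite -e; exact: gcyc_mem.
have : S u by []; rewrite -e => -[a /(gsub_hc gQ x)].
rewrite hcB hu scalerA (hc_scale _ _ hu) subrr.
have := AcompM (- xvec p t *~ 1) a (AhomogX k p t 1).
rewrite mulNrz subrr expr1 [X t * a]mulrC => ->.
rewrite -mulNrz Acomp_Nx mulr0 scale0r subr0 => Qu.
by apply: nx; exact: gsubZ.
Qed.

Lemma A_aug (a : A) : exists c b, a = scalA p c + \sum_t X t * b t.
Proof.
have [f ->] := piA_surj a; elim/mpolyind: f => [|c m f _ _ [c' [b e]]].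
  exists 0, (fun=> 0); rewrite scalA0 big1 ?addr0 /piA ?raddf0 // => t _; exact: mulr0.
rewrite piAD {}e -mul_mpolyC piAM piA_monX.
have [m0|[t mt]] : (forall t, m t = 0%N) \/ exists t, (0 < m t)%N.
  have [h|/existsNP[t ht]] := EM (forall t, m t = 0%N); [by left | right; exists t].
  by rewrite lt0n; apply/eqP.
  exists (c + c'), b; rewrite big1 ?mulr1 ?scalAD ?addrA // => t _; by rewrite m0 expr0.
exists c', (fun s => (if s == t then scalA p c * (X t ^+ (m t).-1 * \prod_(s | s != t) X s ^+ m s) else 0) + b s).
rewrite addrCA; congr (_ + _); under [RHS]eq_bigr do rewrite mulrDr.
rewrite [RHS]big_split /=; congr (_ + _).
rewrite [RHS](bigD1 t) //= eqxx [X in _ = _ + X]big1 ?addr0; last by move=> s /negPf ->; rewrite mulr0.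
transitivity (scalA p c * (X t ^+ (m t).-1.+1 * \prod_(s < 3 | s != t) X s ^+ m s)).
  by rewrite prednK // [in LHS](bigD1 t).
by rewrite exprS -mulrA mulrCA.
Qed.

(** Induction on the sum of the exponents. Adding X_1 u, X_2 u, X_3 u in turn takes cyclic steps in
    which one exponent is lowered; once they are all present, any nonzero scalar multiple of u
    generates what remains, so the last factor is simple. *)
Lemma flen_cyc (M : grmod) (P : set M) x u (e : 'I_3 -> nat) : is_gsub P -> hc x u = u ->
  (forall t, P (X t ^+ e t *: u)) -> flen P (gcyc P u).
Proof.
have [n] := ubnP (\sum_t e t); elim: n P x u e => // n IH P x u e hn hP hu he.
have [Pu|nPu] := EM (P u).
  have -> : gcyc P u = P; last exact: flen_refl.
  by apply/seteqP; split=> [v|v]; [exact: gcyc_min|exact: gcyc_sub].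
have e0 t : (0 < e t)%N.
  by rewrite lt0n; apply/eqP => h; apply: nPu; have := he t; rewrite h expr0 scale1r.
have gS t Q : is_gsub Q -> is_gsub (gcyc Q (X t *: u)).
  by move=> hQ; apply: (@gcyc_gsub _ _ (xvec p t *~ 1 + x)); rewrite // -[X t]expr1 hc_scaleX hu.
have step t (Q : set M) : is_gsub Q -> P `<=` Q -> flen Q (gcyc Q (X t *: u)).
  move=> hQ PQ; apply: (IH _ (xvec p t *~ 1 + x) _ (fun s => (e s - (s == t))%N)) => //.
  - move: hn; rewrite [X in (X < _)%N](bigD1 t) //= (bigD1 t (P := predT)) //= eqxx.
    rewrite [X in _ -> (_ + X < _)%N](eq_bigr e) => [|s /negPf ->]; last by rewrite subn0.
    have := e0 t; move: (\sum_(s | _) _) => z; lia.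
  - by rewrite -[X t]expr1 hc_scaleX hu.
  - move=> s; apply: PQ; rewrite scalerA; case: eqP => [->|_].
      by rewrite -exprSr -subSn // subn1.
    by rewrite subn0 mulrC -scalerA; exact: gsubZ.
pose P1 := gcyc P (X 0 *: u); pose P2 := gcyc P1 (X 1 *: u); pose P3 := gcyc P2 (X 2%:R *: u).
have g1 : is_gsub P1 by exact: gS. have g2 : is_gsub P2 by exact: gS.
have g3 : is_gsub P3 by exact: gS.
have s1 : P `<=` P1 by move=> v; exact: gcyc_sub.
have s2 : P `<=` P2 by move=> v /s1; exact: gcyc_sub.
have s3 : P `<=` P3 by move=> v /s2; exact: gcyc_sub.
have gu := gcyc_gsub hP hu.
have uu : gcyc P u u by exact: gcyc_mem.
have P3u : P3 `<=` gcyc P u.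
  have h t (Q : set M) : Q `<=` gcyc P u -> gcyc Q (X t *: u) `<=` gcyc P u.
    by move=> hQ; apply: gcyc_min => //; exact: gsubZ.
  by do 3 apply: (h); move=> v; exact: gcyc_sub.
apply: (@flen_step _ _ _ _ P3) => //.
  by apply: (flen_trans (step 0 P hP _)) => //; apply: (flen_trans (step 1 P1 g1 s1)); exact: step.
have X3 t : P3 (X t *: u).
  move: t; apply: ord3P; rewrite /P3 /P2 /P1.
  - by do 2 apply: gcyc_sub; exact: gcyc_mem.
  - by apply: gcyc_sub; exact: gcyc_mem.
  - exact: gcyc_mem.
move=> Y gY P3Y Yu; have [h|/existsNP[y /not_implyP[Yy nP]]] := EM (forall y, Y y -> P3 y).
  by left; apply/seteqP.
right; apply/seteqP; split=> //; apply: gcyc_min => //; first by move=> v /s3/P3Y.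
have [a ha] := Yu _ Yy; have [c [b eb]] := A_aug a.
have h3 : P3 (y - scalA p c *: u).
  have -> : y - scalA p c *: u = (y - a *: u) + \sum_t b t *: (X t *: u).
    have -> : \sum_t b t *: (X t *: u) = (\sum_t X t * b t) *: u.
      by rewrite scaler_suml; apply: eq_bigr => t _; rewrite scalerA mulrC.
    by rewrite eb scalerDl opprD addrA subrK.
  apply: gsubD => //; first exact: s3.
  by apply: big_ind => [|v w|t _]; [exact: gsub0 | exact: gsubD | exact: gsubZ].
have c0 : c != 0 by apply/eqP => c0; apply: nP; move: h3; rewrite c0 scalA0 scale0r subr0.
have : Y (scalA p c *: u) by rewrite -[_ *: u](subKr y); apply: gsubB => //; exact: P3Y.
move=> /(gsubZ gY (scalA p c^-1)); rewrite scalerA -scalAM mulVf // scalA1 scale1r //.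
Qed.

Lemma grmod_mspan (M : grmod) : exists s : seq M, forall u, mspan s u.
Proof.
have [s hs] := gfg M; exists s => u N hN h; have [c ->] := hs u.
exact: (submod_sum _ hN (fun t _ => submodZ (c t) hN (h _ (mem_nth 0 (ltn_ord t))))).
Qed.

Lemma gsub_fg (M : grmod) (R : set M) : is_gsub R -> exists s : seq (L * M),
  (forall v, v \in s -> hc v.1 v.2 = v.2 /\ R v.2) /\ forall u, R u -> mspan (map snd s) u.
Proof.
move=> gR; have [s0 hs0] := grmod_mspan M.
have [s [sR hs]] := noeth_fg (@noeth_coordA k p) hs0 (gsub_submod gR).
suff [t [ht1 ht2]] : exists t : seq (L * M),
    (forall v, v \in t -> hc v.1 v.2 = v.2 /\ R v.2) /\ forall u, u \in s -> mspan (map snd t) u.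
  by exists t; split=> // u /hs; apply: mspan_sub => v; exact: ht2.
elim: s sR {hs} => [|u s IH] sR; first by exists [::].
have [t [ht1 ht2]] := IH (fun v vs => sR v (@mem_behead _ (u :: s) v vs)).
have [l [_ el]] := hc_sum u.
exists ([seq (x, hc x u) | x <- l] ++ t); split.
  move=> v; rewrite mem_cat => /orP[/mapP[x _ ->]|/ht1 //] /=.
  by split; [exact: hcid | apply: gsub_hc => //; apply: sR; exact: mem_head].
move=> v; rewrite inE => /orP[/eqP ->|/ht2]; last first.
  by apply: mspan_sub => w wt; apply: mem_mspan; rewrite map_cat mem_cat wt orbT.
rewrite [X in mspan _ X]el map_cat -map_comp /= big_seq.
apply: (submod_sum _ (mspan_submod _)) => x xl.
by apply: mem_mspan; rewrite mem_cat; apply/orP; left; apply/mapP; exists x.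
Qed.

Lemma tors_flen (M : grmod) (P R : set M) : is_gsub P -> is_gsub R -> P `<=` R ->
  (forall u, R u -> tors P u) -> flen P R.
Proof.
move=> gP gR PR hR; have [s [hs1 hs2]] := gsub_fg gR.
suff [Q [gQ PQ [QR hQ]]] : exists Q, [/\ is_gsub Q, flen P Q & Q `<=` R /\ forall v, v \in s -> Q v.2].
  have -> : R = Q; last by [].
  apply/seteqP; split=> // u /hs2; apply; first exact: gsub_submod.
  by move=> v /mapP[w ws ->]; exact: hQ.
elim: s hs1 {hs2} => [|v s IH] hs1; first by exists P; split=> //; exact: flen_refl.
have [Q [gQ PQ [QR hQ]]] := IH (fun w ws => hs1 w (@mem_behead _ (v :: s) w ws)).
have [hv Rv] := hs1 v (mem_head _ _).
exists (gcyc Q v.2); split; [exact: gcyc_gsub hv | | split].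
- have [n hn] := hR _ Rv; apply: (flen_trans PQ).
  by apply: (flen_cyc (e := fun=> n) gQ hv) => t; exact: (flen_le PQ).
- exact: gcyc_min.
- move=> w; rewrite inE => /orP[/eqP ->|/hQ]; [exact: gcyc_mem | exact: gcyc_sub].
Qed.

(** Fixed powers of X_1 and X_2 send the finitely many generators of R into P, and by [Ahomog_dec]
    every coefficient of large level lies in the ideal of these powers. Equalities up to torsion
    thus become equalities in high degrees. *)
Lemma tors_high (M : grmod) (P R : set M) (x : L) : is_gsub P -> is_gsub R ->
  (forall u, R u -> tors P u) ->
  exists l0 : nat, forall l : nat, (l0 <= l)%N -> forall u, R u -> hc (x + cvec p *~ l%:Z) u = u -> P u.
Proof.
move=> gP gR hR; have [s [hs1 hs2]] := gsub_fg gR.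
have [l0 hl0] : exists l0 : nat, forall v, v \in s -> forall l : nat, (l0 <= l)%N ->
    forall a, P (Acomp (x + cvec p *~ l%:Z - v.1) a *: v.2).
  elim: s hs1 {hs2} => [|v s IH] hs1; first by exists 0%N.
  have [l0 hl0] := IH (fun w ws => hs1 w (@mem_behead _ (v :: s) w ws)).
  have [hv Rv] := hs1 v (mem_head _ _); have [n hn] := hR _ Rv.
  exists (l0 + absz (llev (x - v.1)%R) + 2 * n)%N => w.
  rewrite inE => /orP[/eqP ->|ws] l hl a; last by apply: hl0 => //; lia.
  have := Acomp_homog (x + cvec p *~ l%:Z - v.1) a; move: (Acomp _ _) => b hb.
  have [|b1 [b2 [_ _ ->]]] := @Ahomog_dec k p _ b 0 1 2%:R n isT isT isT hb.
    by rewrite addrAC llevDc; move: hl; move: (llev (x - v.1)) => z; lia.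
  rewrite scalerDl; apply: gsubD => //; rewrite mulrC -scalerA; apply: gsubZ => //.
    by apply: tors_le (hn _) => //; rewrite leq_pmull //; have := wt_ge2 p 0; lia.
  by apply: tors_le (hn _) => //; rewrite leq_pmull //; have := wt_ge2 p 1; lia.
exists l0 => l hl u /hs2 hm hu; rewrite -hu -[X in hc _ X]scale1r.
set w := x + _; move: hm => /(_ (fun v => forall a, P (hc w (a *: v)))); apply; last first.
  move=> v /mapP[v' vs ->] b; have [hw _] := hs1 _ vs.
  by rewrite (hc_scale _ _ hw); exact: hl0.
split=> [a|a v v' hv hw b]; first by rewrite scaler0 hc0; exact: gsub0.
by rewrite scalerDr hcD scalerA; apply: gsubD.
Qed.
End Torsion.

(** * Morphisms of the quotient category *)

Section GradedConstructions.
Variables (k : fieldType) (p : weights).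
Local Notation L := (Lgrp p).
Local Notation A := (coordA k p).
Local Notation X := (Xvar k p).
Local Notation grmod := (grmod k p).

Section Sub.
Variables (M : grmod) (R : set M).

(** The proof is an argument of the predicate so that the submodule structure can be inferred from
    the predicate alone. *)
Definition spred (gR : is_gsub R) : {pred M} := [pred u | `[< R u >]].

Variable gR : is_gsub R.

Lemma spred_closed : submod_closed (spred gR).
Proof.
split=> [|a u v /asboolP hu /asboolP hv]; apply/asboolP; first exact: gsub0.
exact: gsub_lin.
Qed.
HB.instance Definition _ := GRing.isSubmodClosed.Build A M (spred gR) spred_closed.

Record gsub_type := GSubT { gsval :> M; gsvalP : gsval \in spred gR }.
HB.instance Definition _ := [isSub for gsval].
HB.instance Definition _ := [Choice of gsub_type by <:].
HB.instance Definition _ := [SubChoice_isSubLmodule of gsub_type by <:].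

Lemma gsvalR (u : gsub_type) : R (gsval u).
Proof. by case: u => u /= /asboolP. Qed.

Definition mksub (u : M) (h : R u) : gsub_type := @GSubT u (asboolT h).

Lemma gsvalD (u v : gsub_type) : gsval (u + v) = gsval u + gsval v.
Proof. exact: (raddfD (val : gsub_type -> M)). Qed.
Lemma gsvalZ (a : A) (u : gsub_type) : gsval (a *: u) = a *: gsval u.
Proof. first [exact: GRing.valZ | exact: linearZ | by rewrite -[gsval _]/(val _) linearZ | by rewrite -[gsval _]/(val _) GRing.valZ]. Qed.
Lemma gsval0 : gsval 0 = 0.
Proof. exact: (raddf0 (val : gsub_type -> M)). Qed.

Definition shc x (u : gsub_type) : gsub_type := mksub (gsub_hc gR x (gsvalR u)).

Lemma gsval_inj (u v : gsub_type) : gsval u = gsval v -> u = v.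
Proof. exact: val_inj. Qed.
Lemma gsval_shc x (u : gsub_type) : gsval (shc x u) = hc x (gsval u).
Proof. by []. Qed.

Lemma shcD x (u v : gsub_type) : shc x (u + v) = shc x u + shc x v.
Proof.
by apply: gsval_inj; rewrite gsvalD !gsval_shc gsvalD hcD.
Qed.
Lemma shc_hc x y (u : gsub_type) : shc x (shc y u) = if x == y then shc y u else 0.
Proof. by apply: val_inj; rewrite /= hc_hc; case: ifP => //; rewrite gsval0. Qed.
Lemma shc_sum (u : gsub_type) : exists s : seq L, uniq s /\ u = \sum_(x <- s) shc x u.
Proof.
have [s [us es]] := hc_sum (gsval u); exists s; split=> //; apply: val_inj => /=.
rewrite [LHS]es; elim: s {us es} => [|x s IH]; first by rewrite !big_nil gsval0.
by rewrite !big_cons gsvalD IH.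
Qed.
Lemma shcZ y x a (u : gsub_type) : Ahomog y a -> shc (y + x) (a *: u) = a *: shc x u.
Proof.
by move=> h; apply: gsval_inj; rewrite gsvalZ !gsval_shc gsvalZ hcZ.
Qed.
Lemma sub_fg : exists s : seq gsub_type, forall u, exists c : 'I_(size s) -> A,
  u = \sum_i c i *: s`_i.
Proof.
have [s [hs1 hs2]] := gsub_fg gR.
have [t et] : exists t : seq gsub_type, map gsval t = map snd s.
  elim: s hs1 {hs2} => [|v s IH] hs1; first by exists [::].
  have [t et] := IH (fun w ws => hs1 w (@mem_behead _ (v :: s) w ws)).
  have [_ Rv] := hs1 v (mem_head _ _).
  by exists (mksub Rv :: t); rewrite /= et.
exists t => u; have /hs2 := gsvalR u; rewrite -et.
move=> /(_ (fun v => exists c : 'I_(size t) -> A, v = gsval (\sum_i c i *: t`_i))).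
case.
- split; first by exists (fun=> 0); rewrite big1 ?gsval0 // => i _; rewrite scale0r.
  move=> a v w [c ->] [d ->]; exists (fun i => a * c i + d i).
  rewrite -gsvalZ -gsvalD; congr gsval; rewrite scaler_sumr -big_split.
  by apply: eq_bigr => i _ /=; rewrite scalerA -scalerDl.
- move=> v /(nthP 0)[n]; rewrite size_map => nt <-.
  exists (fun i => (i == Ordinal nt)%:R); rewrite (bigD1 (Ordinal nt)) //= eqxx scale1r.
  rewrite big1 ?addr0; last by move=> i /negPf ->; rewrite scale0r.
  by rewrite (nth_map 0).
- by move=> c e; exists c; apply: val_inj.
Qed.

Definition gsubm : grmod := GrMod shcD shc_hc shc_sum shcZ sub_fg.
End Sub.

Section Quotient.
Variables (M : grmod) (P : set M).

Definition qrel (gP : is_gsub P) (u v : M) : bool := `[< P (u - v) >].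

Variable gP : is_gsub P.

Lemma qrel_refl : reflexive (qrel gP).
Proof. by move=> u; apply/asboolP; rewrite subrr; exact: gsub0. Qed.
Lemma qrel_sym : ssrbool.symmetric (qrel gP).
Proof.
by move=> u v; apply/asboolP/asboolP => h; rewrite -opprB -sub0r; apply: gsubB => //; exact: gsub0.
Qed.
Lemma qrel_trans : transitive (qrel gP).
Proof.
move=> v u w /asboolP h1 /asboolP h2; apply/asboolP; rewrite -[u](subrK v) -addrA.
exact: gsubD.
Qed.
Canonical qrel_equiv := EquivRel (qrel gP) qrel_refl qrel_sym qrel_trans.

Definition gquoT := {eq_quot qrel_equiv}.
HB.instance Definition _ := Choice.on gquoT.

Definition gpi (u : M) : gquoT := \pi_gquoT u.
Definition grepr (u : gquoT) : M := repr u.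
Lemma greprK u : gpi (grepr u) = u. Proof. exact: reprK. Qed.
Lemma gpiP u v : gpi u = gpi v <-> P (u - v).
Proof. by split=> [/eqmodP/asboolP //|h]; apply/eqmodP; exact/asboolP. Qed.

Definition gqadd (u v : gquoT) := gpi (grepr u + grepr v).
Definition gqopp (u : gquoT) := gpi (- grepr u).
Definition gqscale (a : A) (u : gquoT) := gpi (a *: grepr u).
Definition gqhc x (u : gquoT) := gpi (hc x (grepr u)).

Lemma grepr_pi u : P (grepr (gpi u) - u).
Proof. by apply/gpiP; rewrite greprK. Qed.
Lemma gqaddE u v : gqadd (gpi u) (gpi v) = gpi (u + v).
Proof. by apply/gpiP; rewrite opprD addrACA; apply: gsubD => //; exact: grepr_pi. Qed.
Lemma gqoppE u : gqopp (gpi u) = gpi (- u).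
Proof. by apply/gpiP; rewrite -opprD -sub0r; apply: gsubB => //; [exact: gsub0 | exact: grepr_pi]. Qed.
Lemma gqscaleE a u : gqscale a (gpi u) = gpi (a *: u).
Proof. by apply/gpiP; rewrite -scalerBr; apply: gsubZ => //; exact: grepr_pi. Qed.
Lemma gqhcE x u : gqhc x (gpi u) = gpi (hc x u).
Proof. by apply/gpiP; rewrite -hcB; apply: gsub_hc => //; exact: grepr_pi. Qed.

Lemma gqaddC : commutative gqadd.
Proof. by move=> u v; rewrite /gqadd addrC. Qed.
Lemma gqaddA : associative gqadd.
Proof. by move=> u v w; rewrite -(greprK u) -(greprK v) -(greprK w) !gqaddE addrA. Qed.
Lemma gqadd0 : left_id (gpi 0) gqadd.
Proof. by move=> u; rewrite -(greprK u) gqaddE add0r. Qed.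
Lemma gqaddN : left_inverse (gpi 0) gqopp gqadd.
Proof. by move=> u; rewrite -(greprK u) gqoppE gqaddE addNr. Qed.
HB.instance Definition _ := GRing.isZmodule.Build gquoT gqaddA gqaddC gqadd0 gqaddN.

Lemma gqscaleA a b (u : gquoT) : gqscale a (gqscale b u) = gqscale (a * b) u.
Proof. by rewrite -(greprK u) !gqscaleE scalerA. Qed.
Lemma gqscale1 : left_id 1 gqscale.
Proof. by move=> u; rewrite -(greprK u) gqscaleE scale1r. Qed.
Lemma gqscaleDr : right_distributive gqscale +%R.
Proof.
move=> a u v; rewrite -(greprK u) -(greprK v) [X in gqscale _ X]gqaddE !gqscaleE.
by rewrite [RHS]gqaddE scalerDr.
Qed.
Lemma gqscaleDl u : {morph gqscale^~ u : a b / a + b}.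
Proof. by move=> a b; rewrite -(greprK u) !gqscaleE [RHS]gqaddE scalerDl. Qed.
HB.instance Definition _ :=
  GRing.Zmodule_isLmodule.Build A gquoT gqscaleA gqscale1 gqscaleDr gqscaleDl.

Lemma gpiD u v : gpi (u + v) = gpi u + gpi v. Proof. by rewrite -gqaddE. Qed.
Lemma gpiZ a u : gpi (a *: u) = a *: gpi u. Proof. by rewrite -gqscaleE. Qed.

Lemma gqhcD x (u v : gquoT) : gqhc x (u + v) = gqhc x u + gqhc x v.
Proof. by rewrite -(greprK u) -(greprK v) -gpiD !gqhcE hcD gpiD. Qed.
Lemma gqhc_hc x y (u : gquoT) : gqhc x (gqhc y u) = if x == y then gqhc y u else 0.
Proof. by rewrite -(greprK u) !gqhcE hc_hc; case: ifP. Qed.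
Lemma gqhc_sum (u : gquoT) : exists s : seq L, uniq s /\ u = \sum_(x <- s) gqhc x u.
Proof.
rewrite -(greprK u); have [s [us es]] := hc_sum (grepr u); exists s; split=> //.
rewrite [LHS](congr1 gpi es); elim: s {us es} => [|x s IH]; first by rewrite !big_nil.
by rewrite !big_cons gpiD IH gqhcE.
Qed.
Lemma gqhcZ y x a (u : gquoT) : Ahomog y a -> gqhc (y + x) (a *: u) = a *: gqhc x u.
Proof. by move=> h; rewrite -(greprK u) -gpiZ !gqhcE hcZ // gpiZ. Qed.
Lemma quo_fg : exists s : seq gquoT, forall u, exists c : 'I_(size s) -> A,
  u = \sum_i c i *: s`_i.
Proof.
have [s hs] := gfg M; exists (map gpi s) => u; have [c ec] := hs (grepr u).
have e : size (map gpi s) = size s by rewrite size_map.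
exists (fun i => c (cast_ord e i)); rewrite -(greprK u) ec.
have -> : gpi (\sum_i c i *: s`_i) = \sum_i c i *: gpi s`_i.
  elim: (index_enum _) => [|i r IH]; first by rewrite !big_nil.
  by rewrite !big_cons gpiD IH gpiZ.
rewrite (reindex (cast_ord e)) /=; last first.
  by exists (cast_ord (esym e)) => i _; rewrite ?cast_ordK ?cast_ordKV.
by apply: eq_bigr => i _ /=; rewrite (nth_map 0) //; rewrite -e.
Qed.

Definition gquo : grmod := GrMod gqhcD gqhc_hc gqhc_sum gqhcZ quo_fg.
End Quotient.

Section DirectSum.
Variables M N : grmod.
Local Notation V := (gcar M * gcar N)%type.

Definition dhc x (u : V) : V := (hc x u.1, hc x u.2).
Lemma dhcD x (u v : V) : dhc x (u + v) = dhc x u + dhc x v.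
Proof. by rewrite /dhc /= !hcD. Qed.
Lemma dhc_hc x y (u : V) : dhc x (dhc y u) = if x == y then dhc y u else 0.
Proof. by rewrite /dhc /= !hc_hc; case: ifP. Qed.
Lemma dhc_sum (u : V) : exists s : seq L, uniq s /\ u = \sum_(x <- s) dhc x u.
Proof.
(* The two coordinates may have different supports; each sum can be taken over any larger list. *)
have H (K : grmod) (v : K) : exists s : seq L, forall t : seq L, uniq t ->
    (forall x, x \in s -> x \in t) -> v = \sum_(x <- t) hc x v.
  have [s [us es]] := hc_sum v; exists s => t ut st.
  have h x : x \notin s -> hc x v = 0.
    move=> xs; rewrite es hc_bigsum big_seq big1 // => y ys; rewrite hc_hc.
    by case: eqP => // e; rewrite e ys in xs.
  rewrite (bigID (mem s)) /= [X in _ + X]big1 ?addr0 // -big_filter {1}es.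
  apply: perm_big; apply: uniq_perm => //; first exact: filter_uniq.
  by move=> x; rewrite mem_filter; case: (boolP (x \in s)) => //= /st ->.
have [s1 h1] := H M u.1; have [s2 h2] := H N u.2.
exists (undup (s1 ++ s2)); split; first exact: undup_uniq.
rewrite (surjective_pairing u) {1}(h1 (undup (s1 ++ s2))) ?undup_uniq //; last first.
  by move=> x; rewrite mem_undup mem_cat => ->.
rewrite {1}(h2 (undup (s1 ++ s2))) ?undup_uniq //; last first.
  by move=> x; rewrite mem_undup mem_cat orbC => ->.
elim: (undup _) => [|x s IH]; first by rewrite !big_nil.
by rewrite !big_cons -IH.
Qed.
Lemma dhcZ y x a (u : V) : Ahomog y a -> dhc (y + x) (a *: u) = a *: dhc x u.
Proof. by move=> h; rewrite /dhc /= !hcZ. Qed.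
Lemma dsum_fg : exists s : seq V, forall u, exists c : 'I_(size s) -> A,
  u = \sum_i c i *: s`_i.
Proof.
have sc a (u : M) (v : N) : a *: ((u, v) : V) = (a *: u, a *: v) by [].
have ad (u u' : M) (v v' : N) : ((u, v) : V) + (u', v') = (u + u', v + v') by [].
have [s hs] := gfg M; have [t ht] := gfg N.
pose r := map (fun v => (v, 0 : N)) s ++ map (fun v => (0 : M, v)) t.
have er : size r = (size s + size t)%N by rewrite size_cat !size_map.
exists r => u; have [c ec] := hs u.1; have [d ed] := ht u.2.
exists (fun i => match split (cast_ord er i) with inl j => c j | inr j => d j end).
rewrite (reindex (cast_ord (esym er))) /=; last first.
  by exists (cast_ord er) => i _; rewrite ?cast_ordK ?cast_ordKV.
rewrite big_split_ord /= (eq_bigr (fun i => (c i *: s`_i, 0))) => [|i _]; last first.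
  rewrite cast_ordKV; case: splitP => [j /= /val_inj <-|j /= e]; last by have := ltn_ord i; lia.
  by rewrite nth_cat size_map ltn_ord (nth_map 0) // sc scaler0.
rewrite (eq_bigr (fun i => (0, d i *: t`_i))) => [|i _]; last first.
  rewrite cast_ordKV; case: splitP => [j /= e|j /= /eqP]; first by have := ltn_ord j; lia.
  rewrite eqn_add2l => /eqP/val_inj <-.
  rewrite nth_cat size_map ltnNge leq_addr /= addKn (nth_map 0) // sc scaler0 //.
have h1 n (F : 'I_n -> M) : \sum_i (F i, 0 : N) = (\sum_i F i, 0).
  by elim: (index_enum _) => [|i q IH]; rewrite ?big_nil // !big_cons IH ad addr0.
have h2 n (F : 'I_n -> N) : \sum_i (0 : M, F i) = (0, \sum_i F i).
  by elim: (index_enum _) => [|i q IH]; rewrite ?big_nil // !big_cons IH ad addr0.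
by rewrite h1 h2 -ec -ed [u]surjective_pairing ad addr0 add0r.
Qed.

Definition dsum : grmod := GrMod dhcD dhc_hc dhc_sum dhcZ dsum_fg.
End DirectSum.
End GradedConstructions.

(** * Linear categories *)

Section LinearCategory.
Variables (k : fieldType) (C : lincat k).
Implicit Types X Y Z W : C.

Lemma comp0r X Y Z (g : Mor Y Z) : compm g (0 : Mor X Y) = 0.
Proof.
have := comp_linr g 1 (0 : Mor X Y) 0; rewrite !scale1r addr0 => e.
by apply: (@addIr _ (compm g 0)); rewrite -e add0r.
Qed.
Lemma comp0l X Y Z (f : Mor X Y) : compm (0 : Mor Y Z) f = 0.
Proof.
have := comp_linl (0 : Mor Y Z) 0 1 f; rewrite !scale1r addr0 => e.
by apply: (@addIr _ (compm 0 f)); rewrite -e add0r.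
Qed.
Lemma compDr X Y Z (g : Mor Y Z) (f1 f2 : Mor X Y) : compm g (f1 + f2) = compm g f1 + compm g f2.
Proof. by have := comp_linr g 1 f1 f2; rewrite !scale1r. Qed.
Lemma compDl X Y Z (g1 g2 : Mor Y Z) (f : Mor X Y) : compm (g1 + g2) f = compm g1 f + compm g2 f.
Proof. by have := comp_linl g1 g2 1 f; rewrite !scale1r. Qed.
Lemma compZr X Y Z (g : Mor Y Z) a (f : Mor X Y) : compm g (a *: f) = a *: compm g f.
Proof. by have := comp_linr g a f 0; rewrite comp0r !addr0. Qed.
Lemma compZl X Y Z (g : Mor Y Z) a (f : Mor X Y) : compm (a *: g) f = a *: compm g f.
Proof. by have := comp_linl g 0 a f; rewrite comp0l !addr0. Qed.
Lemma compNr X Y Z (g : Mor Y Z) (f : Mor X Y) : compm g (- f) = - compm g f.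
Proof. by rewrite -scaleN1r compZr scaleN1r. Qed.
Lemma compNl X Y Z (g : Mor Y Z) (f : Mor X Y) : compm (- g) f = - compm g f.
Proof. by rewrite -scaleN1r compZl scaleN1r. Qed.
Lemma compBr X Y Z (g : Mor Y Z) (f1 f2 : Mor X Y) : compm g (f1 - f2) = compm g f1 - compm g f2.
Proof. by rewrite compDr compNr. Qed.
Lemma compBl X Y Z (g1 g2 : Mor Y Z) (f : Mor X Y) : compm (g1 - g2) f = compm g1 f - compm g2 f.
Proof. by rewrite compDl compNl. Qed.

Lemma iso_sym X Y : isomorphic X Y -> isomorphic Y X.
Proof. by move=> [f [g [e1 e2]]]; exists g, f. Qed.
Lemma iso_comp X Y Z (g : Mor Y Z) (f : Mor X Y) : is_iso f -> is_iso g -> is_iso (compm g f).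
Proof.
move=> [f' [e1 e2]] [g' [e3 e4]]; exists (compm f' g'); split.
  by rewrite compA -(compA f') e3 compf1 e1.
by rewrite compA -(compA g) e2 compf1 e4.
Qed.
Lemma iso_trans X Y Z : isomorphic X Y -> isomorphic Y Z -> isomorphic X Z.
Proof. by move=> [f hf] [g hg]; exists (compm g f); exact: iso_comp. Qed.
Lemma iso_mono X Y (f : Mor X Y) : is_iso f -> mono f.
Proof.
by move=> [g [e _]] W a b /(congr1 (compm g)); rewrite !compA e !comp1f.
Qed.
Lemma mono_comp X Y Z (g : Mor Y Z) (f : Mor X Y) : mono f -> mono g -> mono (compm g f).
Proof. by move=> hf hg W a b; rewrite -!compA => /hg/hf. Qed.
Lemma mono0 X Y W (f : Mor X Y) (g : Mor W X) : mono f -> compm f g = 0 -> g = 0.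
Proof. by move=> hf e; apply: hf; rewrite e comp0r. Qed.

Lemma cokernel_unique X Y Z Z' (f : Mor X Y) (g : Mor Y Z) (g' : Mor Y Z') :
  is_cokernel g f -> is_cokernel g' f ->
  exists2 u : Mor Z Z', is_iso u & compm u g = g'.
Proof.
move=> [e h] [e' h']; have [u [hu uu]] := h _ _ e'; have [v [hv uv]] := h' _ _ e.
exists u => //; exists v; split.
  have [w [_ hw]] := h _ _ e; rewrite -(hw (idm Z)) ?comp1f //.
  by apply/esym/hw; rewrite -compA hu.
have [w [_ hw]] := h' _ _ e'; rewrite -(hw (idm Z')) ?comp1f //.
by apply/esym/hw; rewrite -compA hv.
Qed.

Lemma cokernel_iso_r X Y Z Z' (f : Mor X Y) (g : Mor Y Z) (u : Mor Z Z') :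
  is_cokernel g f -> is_iso u -> is_cokernel (compm u g) f.
Proof.
move=> [e h] [v [e1 e2]]; split; first by rewrite -compA e comp0r.
move=> W x ex; have [y [hy uy]] := h _ _ ex; exists (compm y v); split.
  by rewrite compA -(compA y) e1 compf1.
by move=> z hz; rewrite (uy (compm z u)) -?compA // e2 compf1.
Qed.

Lemma cokernel_iso_l X X' Y Z (f : Mor X Y) (g : Mor Y Z) (u : Mor X' X) :
  is_cokernel g f -> is_iso u -> is_cokernel g (compm f u).
Proof.
move=> [e h] [v [e1 e2]]; split; first by rewrite compA e comp0l.
by move=> W x ex; apply: h; rewrite -[f]compf1 -e2 2!compA -[compm (compm x f) u]compA ex comp0l.
Qed.

Lemma cokernel_iso_m X Y Y' Z (f : Mor X Y) (g : Mor Y Z) (u : Mor Y Y') (v : Mor Y' Y) :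
  compm v u = idm Y -> compm u v = idm Y' ->
  is_cokernel g f -> is_cokernel (compm g v) (compm u f).
Proof.
move=> e1 e2 [e h]; split; first by rewrite compA -(compA g) e1 compf1.
move=> W x ex; rewrite compA in ex; have [y [hy uy]] := h _ _ ex; exists y; split.
  by rewrite compA hy -compA e2 compf1.
by move=> z hz; apply: uy; rewrite -hz -!compA e1 compf1.
Qed.
End LinearCategory.

(** * Graphs, elements and torsion in the quotient category *)

Section QuotientCalculus.
Variables (k : fieldType) (p : weights).
Local Notation L := (Lgrp p).
Local Notation A := (coordA k p).
Local Notation X := (Xvar k p).
Local Notation grmod := (grmod k p).
Local Notation coh := (cohX k p).
Local Notation tors0 := (tors [set 0]).
Implicit Types M N Q : grmod.

Lemma tors0_gsub M : is_gsub (tors0 : set M).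
Proof. exact/tors_gsub/gsub_set0. Qed.

Lemma tors0_tors M (u : M) : tors tors0 u -> tors0 u.
Proof. by apply: tors_trans => //; exact: gsub_set0. Qed.

Lemma tors00 M : tors0 (0 : M). Proof. exact: tors_in. Qed.
Lemma tors0D M (u v : M) : tors0 u -> tors0 v -> tors0 (u + v).
Proof. exact: gsubD (@tors0_gsub M) _ _. Qed.
Lemma tors0Z M a (u : M) : tors0 u -> tors0 (a *: u).
Proof. exact: gsubZ (@tors0_gsub M) _ _. Qed.

Lemma fdomT M N (f : frac M N) m : tors (rdom f) m.
Proof. exact: (flen_tors (fdom_gsub f) (fdom_cofin f)). Qed.
Lemma findT M N (f : frac M N) n : f 0 n -> tors0 n.
Proof. exact: (flen_tors (@gsub_set0 _ _ N) (find_fin f)). Qed.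

Lemma fracB M N (f : frac M N) m n n' : f m n -> f m n' -> tors0 (n - n').
Proof. by move=> h h'; apply: findT; exact: frac_sub h h'. Qed.
Lemma fracZ M N (f : frac M N) a m n : f m n -> f (a *: m) (a *: n).
Proof.
move=> h; rewrite -[a *: m]addr0 -[a *: n]addr0; apply: (grel_lin (fgrP f)) => //.
exact: grel0 (fgrP f).
Qed.

Section MkFrac.
Variables (M N : grmod) (r : M -> N -> Prop).
Hypotheses (hr : is_grel r) (hd : forall m, tors (rdom r) m) (hi : forall n, r 0 n -> tors0 n).
Lemma mkfrac_dom : flen (rdom r) setT.
Proof. by apply: tors_flen => //; exact: rdom_gsub. Qed.
Lemma mkfrac_ind : flen [set 0] (r 0).
Proof.
apply: tors_flen => //; [exact: gsub_set0 | exact: rind_gsub |].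
by move=> n ->; exact: grel0.
Qed.
Definition mkfrac : frac M N := Frac hr mkfrac_dom mkfrac_ind.
End MkFrac.

(** The submodules that witness an identification can be taken as large as possible: the common
    domain, and the whole torsion of N. *)
Lemma qpiE M N (f g : frac M N) :
  qpi f = qpi g <-> forall m n n', f m n -> g m n' -> tors0 (n - n').
Proof.
split=> [/qpiP[D [T [[gD gT] [fD fT] D1 T1 H]]] m n n' hf hg|h].
  apply: tors0_tors; have [a ha] := flen_tors gD fD (u := m) I.
  exists a => t; rewrite scalerBr; apply: (flen_tors (@gsub_set0 _ _ N) fT).
  by apply: H (ha t) _ _; exact: fracZ.
apply/qpiP; exists (rdom f `&` rdom g), tors0; split.
- by split; [apply: gsubI; exact: fdom_gsub | exact: tors0_gsub].
- split; first by apply: flen_setI; try exact: fdom_gsub; exact: fdom_cofin.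
  apply: tors_flen => //; [exact: gsub_set0 | exact: tors0_gsub |].
  by move=> n ->; exact: tors00.
- by [].
- by move=> n [|]; exact: findT.
- by move=> m n n' _; exact: h.
Qed.

Lemma qpi0E M N (f : frac M N) : qpi f = 0 <-> forall m n, f m n -> tors0 n.
Proof.
rewrite [0](_ : _ = qpi (fzero M N)) // qpiE; split=> [h m n hf|h m n n' hf ->].
  by rewrite -[n]subr0; exact: h hf (erefl _).
by rewrite subr0; exact: h hf.
Qed.

Lemma qW M N (u : @Mor k coh M N) : exists f : frac M N, u = qpi f.
Proof. by exists (qrepr u); rewrite qreprK. Qed.

Lemma compE M N Q (g : frac N Q) (f : frac M N) :
  @compm k coh M N Q (qpi g) (qpi f) = qpi (fcomp g f).
Proof. exact: qcompE. Qed.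

Lemma qpi_sym M N (f g : frac M N) : (forall m n, f m n -> exists2 n', g m n' & tors0 (n - n')) ->
  qpi f = qpi g.
Proof.
move=> h; apply/qpiE => m n n' hf hg; have [n2 hg2 t2] := h _ _ hf.
by rewrite -[n](subrK n2) -addrA; apply: tors0D => //; exact: fracB hg2 hg.
Qed.

Record ghom M N := GHom {
  gfun :> M -> N;
  ghom_lin : forall (a : A) u v, gfun (a *: u + v) = a *: gfun u + gfun v;
  ghom_hc : forall x u, gfun (hc x u) = hc x (gfun u) }.

Section Ghom.
Variables (M N : grmod) (f : ghom M N).
Lemma ghom0 : f 0 = 0.
Proof. by apply: (@addIr _ (f 0)); have := ghom_lin f 1 0 0; rewrite !scale1r addr0 => <-; rewrite add0r. Qed.
Lemma ghomZ a u : f (a *: u) = a *: f u.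
Proof. by rewrite -[a *: u]addr0 ghom_lin ghom0 !addr0. Qed.

Lemma ghom_grel : is_grel (fun m n => n = f m).
Proof.
split; first by rewrite ghom0.
  by move=> a m m' n n' -> ->; rewrite ghom_lin.
by move=> x m n ->; rewrite ghom_hc.
Qed.
Lemma ghom_dom m : tors (rdom (fun m n => n = f m)) m.
Proof. by apply: tors_in; exists (f m). Qed.
Lemma ghom_ind n : n = f 0 -> tors0 n.
Proof. by rewrite ghom0 => ->; exact: tors00. Qed.
Definition gfrac : frac M N := mkfrac ghom_grel ghom_dom ghom_ind.
Definition gmor : @Mor k coh M N := qpi gfrac.
End Ghom.

Lemma gmor_eq M N (f g : ghom M N) : gmor f = gmor g <-> forall m, tors0 (f m - g m).
Proof.
rewrite /gmor qpiE; split=> [h m|h m n n' -> ->]; [exact: h|exact: h].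
Qed.
Lemma gmor0 M N (f : ghom M N) : gmor f = 0 <-> forall m, tors0 (f m).
Proof. by rewrite /gmor qpi0E; split=> [h m|h m n ->]; [exact: h (erefl _)|exact: h]. Qed.

Lemma frac_gmor M N Q (g : frac N Q) (f : ghom M N) (h : frac M Q) :
  (forall m q, g (f m) q -> exists2 q', h m q' & tors0 (q - q')) ->
  @compm k coh M N Q (qpi g) (gmor f) = qpi h.
Proof. by move=> H; rewrite /gmor compE; apply: qpi_sym => m q [n -> /H]. Qed.

Lemma gmor_comp M N Q (g : ghom N Q) (f : ghom M N) (h : ghom M Q) :
  (forall m, h m = g (f m)) -> @compm k coh M N Q (gmor g) (gmor f) = gmor h.
Proof.
move=> e; apply: frac_gmor => m q ->; exists (h m) => //.
by rewrite -e subrr; exact: tors00.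
Qed.

Lemma iso_frac M N (f : frac M N) : (forall m, f m 0 -> tors0 m) ->
  (forall n, tors (rimg f setT) n) -> @is_iso k coh M N (qpi f).
Proof.
move=> hm hn.
have hd n : tors (rdom (fun n m => f m n)) n by apply: tors_sub (hn n) => v [m _ h]; exists m.
exists (qpi (mkfrac (rinv_grel (fgrP f)) hd hm)); split; rewrite compE;
  rewrite [idm _](_ : _ = qpi (fid _)) //; apply/qpiE => m n n' [x h1 h2] ->.
  by apply: (hm); rewrite -[0](subrr x); exact: (grelB (fgrP f)).
exact: fracB h2 h1.
Qed.

Lemma iso_gmor M N (f : ghom M N) : (forall m, f m = 0 -> tors0 m) ->
  (forall n, tors (range f) n) -> is_iso (gmor f).
Proof.
move=> h1 h2; apply: iso_frac => [m /esym /h1 //|n].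
by apply: tors_sub (h2 n) => v [m _ e]; exists m.
Qed.

Lemma gincl_lin M (R : set M) (gR : is_gsub R) (a : A) (u v : gsubm gR) :
  gsval (a *: u + v) = a *: gsval u + gsval v.
Proof. by rewrite gsvalD gsvalZ. Qed.
Definition gincl M (R : set M) (gR : is_gsub R) : ghom (gsubm gR) M :=
  @GHom (gsubm gR) M (@gsval _ _ M R gR) (gincl_lin (gR := gR)) (fun x u => erefl).

Definition gproj M (P : set M) (gP : is_gsub P) : ghom M (gquo gP) :=
  @GHom M (gquo gP) (gpi gP) (fun a u v => etrans (gpiD gP _ _) (congr1 (fun z => z + gpi gP v) (gpiZ gP a u)))
    (fun x u => esym (gqhcE gP x u)).

Lemma gproj_tors M (P : set M) (gP : is_gsub P) u : tors0 (gproj gP u) <-> tors P u.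
Proof.
split=> -[n hn]; exists n => t.
  have := hn t; rewrite /= -gpiZ => /(gpiP gP); by rewrite subr0.
by rewrite /= -gpiZ; apply/(gpiP gP); rewrite subr0.
Qed.

Lemma gsub_tors M (R : set M) (gR : is_gsub R) (u : gsubm gR) : tors0 u <-> tors0 (gsval u).
Proof.
split=> -[n hn]; exists n => t.
  by rewrite -gsvalZ (hn t) gsval0.
by apply: gsval_inj; rewrite gsvalZ (hn t) gsval0.
Qed.

Definition OO (z : L) : coh := shift (strA k p) z.

Lemma elm_hc z M (u : M) (x : L) (a : OO z) :
  Acomp (z + x) a *: hc (- z) u = hc x ((a : A) *: hc (- z) u).
Proof. by rewrite (hc_scale x (x := - z)) ?hcid // opprK addrC. Qed.
(** In O(z) the element 1 has degree - z, hence the component of u of that degree. These morphisms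
    serve as the elements of M in the quotient category. *)
Definition elh z M (u : M) : ghom (OO z) M :=
  @GHom (OO z) M (fun a => (a : A) *: hc (- z) u)
    (fun a u' v => etrans (scalerDl _ _ _) (congr1 (fun w => w + _) (esym (scalerA _ _ _))))
    (elm_hc (z := z) u).
Definition elm z M (u : M) : @Mor k coh (OO z) M := gmor (elh z u).

Lemma elm0 z M (u : M) : elm z u = 0 <-> tors0 (hc (- z) u).
Proof.
rewrite /elm gmor0; split=> [/(_ (1 : A))|h a]; first by rewrite /= scale1r.
exact: tors0Z.
Qed.

Lemma elmD z M (u v : M) : elm z (u + v) = elm z u + elm z v.
Proof.
rewrite /elm /gmor; apply/esym; rewrite -[X in X + _]scale1r qlinE; apply: qpi_sym.
move=> a n [n1 [n2 [[n3 -> ->] -> ->]]]; exists (elh z (u + v) a) => //.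
by rewrite scalA1 scale1r /= hcD scalerDr subrr; exact: tors00.
Qed.

Lemma comp_elm z M N (f : frac M N) (u : M) (n : N) :
  f (hc (- z) u) n -> compm (qpi f : @Mor k coh M N) (elm z u) = elm z n.
Proof.
move=> h; have h' : f (hc (- z) u) (hc (- z) n).
  by have := grel_hc (fgrP f) (- z) h; rewrite hcid.
apply: frac_gmor => a q hq; exists (elh z n a) => //.
by apply: fracB hq _; exact: fracZ.
Qed.

Lemma gmor_elm z M N (f : ghom M N) (u : M) : compm (gmor f) (elm z u) = elm z (f u).
Proof. by apply: gmor_comp => a /=; rewrite ghomZ ghom_hc. Qed.

Lemma elm_sep M N (f : @Mor k coh M N) : (forall z u, compm f (elm z u) = 0) -> f = 0.
Proof.
have [r ->] := qW f => h; apply/qpi0E => m n hr.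
apply: (gsub_comp (@tors0_gsub N)) => x.
have hx := grel_hc (fgrP r) x hr.
have := h (- x) m; rewrite (comp_elm (n := hc x n)) ?opprK // => /elm0.
by rewrite opprK hcid.
Qed.

(** Torsion elements are the zero morphisms from line bundles; testing a monomorphism on these gives
    the direct implication. *)
Lemma monoP M N (f : frac M N) : @mono k coh M N (qpi f) <->
  forall m n, f m n -> tors0 n -> tors0 m.
Proof.
split=> [hf m n h tn|h W a b].
  apply: (gsub_comp (@tors0_gsub M)) => x.
  have hx := grel_hc (fgrP f) x h.
  have e : compm (qpi f : @Mor k coh M N) (elm (- x) m) = 0.
    rewrite (comp_elm (n := hc x n)) ?opprK //; apply/elm0; rewrite opprK.
    by apply: (gsub_hc (@tors0_gsub N)); exact: (gsub_hc (@tors0_gsub N)).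
  by have /elm0 := mono0 hf e; rewrite opprK.
have [a' ->] := qW a; have [b' ->] := qW b; rewrite !compE => /qpiE H.
apply/qpiE => w m m' ha hb; apply: tors0_tors.
have [c hc] := fdomT f (m - m'); exists c => t; have [n hn] := hc t.
have gm := fdomT f m; apply: (h _ _ hn).
apply: tors0_tors; have [d1 hd1] := fdomT f m; have [d2 hd2] := fdomT f m'.
exists (d1 + d2)%N => s.
have [n1 hn1] := tors_le (fdom_gsub f) (leq_addr d2 d1) (hd1 s).
have [n2 hn2] := tors_le (fdom_gsub f) (leq_addl d1 d2) (hd2 s).
have t12 : tors0 (n1 - n2).
  apply: (H (X s ^+ (d1 + d2) *: w)); [exists (X s ^+ (d1 + d2) *: m) => // | exists (X s ^+ (d1 + d2) *: m') => //];
    exact: fracZ.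
have h1 : f (X s ^+ (d1 + d2) *: (X t ^+ c *: (m - m'))) (X t ^+ c *: (n1 - n2)).
  rewrite scalerA mulrC -scalerA; apply: fracZ; rewrite scalerBr.
  exact: (grelB (fgrP f)).
have := fracB (fracZ (X s ^+ (d1 + d2)) hn) h1 => t3.
by rewrite -[_ *: n](subrK (X t ^+ c *: (n1 - n2))); apply: tors0D => //; exact: tors0Z.
Qed.
End QuotientCalculus.

(** * Short exact sequences on graphs *)

Section Exactness.
Variables (k : fieldType) (p : weights).
Local Notation L := (Lgrp p).
Local Notation A := (coordA k p).
Local Notation X := (Xvar k p).
Local Notation grmod := (grmod k p).
Local Notation coh := (cohX k p).
Local Notation tors0 := (tors [set 0]).
Local Notation OO := (OO k).
Implicit Types (M N Q : grmod) (z : L) (i j : 'I_3).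

Lemma tors_idem M (P : set M) u : is_gsub P -> tors (tors P) u -> tors P u.
Proof. by move=> gP; apply: tors_trans. Qed.

Lemma rimgT_gsub M N (f : frac M N) : is_gsub (rimg f setT).
Proof. exact: rimg_gsub (fgrP f) (@gsubT _ _ M). Qed.

Lemma proj_rimg0 M N (f : frac M N) :
  compm (gmor (gproj (rimgT_gsub f))) (qpi f : @Mor k coh M N) = 0.
Proof.
rewrite /gmor compE; apply/qpi0E => m q [n h ->]; apply/gproj_tors.
by apply: tors_in; exists m.
Qed.

(** Apply the hypothesis to the projection modulo the image, which f annihilates. *)
Lemma epi_surj M N (f : frac M N) :
  (forall W (h : @Mor k coh N W), compm h (qpi f) = 0 -> h = 0) -> forall n, tors (rimg f setT) n.
Proof. by move=> h n; have /gmor0/(_ n)/gproj_tors := h _ _ (proj_rimg0 f). Qed.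

Lemma surj_epi M N (f : frac M N) : (forall n, tors (rimg f setT) n) ->
  forall W (h : @Mor k coh N W), compm h (qpi f) = 0 -> h = 0.
Proof.
move=> hf W h; have [r ->] := qW h; rewrite compE => /qpi0E H; apply/qpi0E => n w hr.
apply: tors0_tors; have [a ha] := hf n; exists a => t.
by have [m _ hm] := ha t; apply: (H m); exists (X t ^+ a *: n) => //; exact: fracZ.
Qed.

Lemma cokernel_epi M N Q (f : @Mor k coh M N) (g : @Mor k coh N Q) : is_cokernel g f ->
  forall W (h : @Mor k coh Q W), compm h g = 0 -> h = 0.
Proof.
move=> [e H] W h eh; have [u [_ uu]] := H W 0 (comp0l _ _).
by rewrite -(uu h) // -(uu 0) // comp0l.
Qed.

Lemma iso_surj M N (f : frac M N) : @is_iso k coh M N (qpi f) -> forall n, tors (rimg f setT) n.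
Proof.
move=> [g [_ e]]; apply: epi_surj => W h eh.
by rewrite -[h]compf1 -e compA eh comp0l.
Qed.

(** By [short_exact_elim] and [short_exact_intro] this elementwise form, in which every condition
    holds up to torsion, is equivalent to the categorical one. *)
Definition gexact M N Q (f : frac M N) (g : frac N Q) :=
  [/\ forall m n, f m n -> tors0 n -> tors0 m,
      forall m n q, f m n -> g n q -> tors0 q,
      forall n q, g n q -> tors0 q -> tors (rimg f setT) n &
      forall q, tors (rimg g setT) q].

Lemma short_exact_elim M N Q (f : frac M N) (g : frac N Q) :
  @short_exact k coh M N Q (qpi f) (qpi g) -> gexact f g.
Proof.
move=> [[e K] hcok]; split; last exact: epi_surj (cokernel_epi hcok).
- apply/monoP => W a b eab.
  have [|u [_ uu]] := K W (compm (qpi f : @Mor k coh M N) a); first by rewrite compA e comp0l.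
  by rewrite -(uu a) // -(uu b).
- move=> m n q hf hg; move: e; rewrite compE => /qpi0E/(_ m q); apply; by exists n.
(* A homogeneous n with torsion image is a morphism from a line bundle annihilated by g; its
   factorization through f yields preimages of n up to torsion. *)
- move=> n q hg tq.
  have gK : is_gsub (tors (rimg f setT)) by exact/tors_gsub/rimgT_gsub.
  apply: (gsub_comp gK) => x; have hx := grel_hc (fgrP g) x hg.
  have e0 : compm (qpi g : @Mor k coh N Q) (elm (- x) n) = 0.
    rewrite (comp_elm (n := hc x q)) ?opprK //; apply/elm0; rewrite opprK.
    by apply: (gsub_hc (@tors0_gsub _ _ Q)); exact: (gsub_hc (@tors0_gsub _ _ Q)).
  have [u [hu _]] := K _ _ e0; have [r er] := qW u; move: hu; rewrite er compE => /qpiE H.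
  have gI := rimgT_gsub f; apply: tors_idem => //.
  have [a ha] := fdomT r (1 : A); exists a => t; have [m hm] := ha t.
  apply: tors_idem => //; have [b hb] := fdomT f m; exists b => s; have [n' hn'] := hb s.
  have := H _ n' (elh (- x) n (X s ^+ b * (X t ^+ a * 1))) _ (erefl _).
  move=> /(_ (ex_intro2 _ _ _ (fracZ (X s ^+ b) hm) hn')); rewrite /= opprK mulr1 -scalerA => tn.
  have -> : X s ^+ b *: (X t ^+ a *: hc x n) = n' - (n' - X s ^+ b *: (X t ^+ a *: hc x n)).
    by rewrite subKr.
  apply: (gsubB gK); first by apply: tors_in; exists (X s ^+ b *: m).
  by apply: tors_sub tn => v ->; exact: gsub0 gI.
Qed.

(** Kernel lifts and cokernel factorizations are composites with the inverse graph of f or of g; the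
    hypotheses say that these are defined and single-valued up to torsion. *)
Lemma short_exact_intro M N Q (f : frac M N) (g : frac N Q) :
  gexact f g -> @short_exact k coh M N Q (qpi f) (qpi g).
Proof.
move=> [h1 h2 h3 h4]; have gf0 : compm (qpi g : @Mor k coh N Q) (qpi f) = 0.
  by rewrite compE; apply/qpi0E => m q [n hf hg]; exact: h2 hf hg.
have hm : @mono k coh M N (qpi f) by apply/monoP.
split; split=> // W h.
- have [r ->] := qW h; rewrite compE => /qpi0E H.
  pose u (w : W) (m : M) := exists2 n, r w n & f m n.
  have gu : is_grel u.
    split; first by exists 0; exact: (grel0 (fgrP _)).
      move=> a w w' m m' [n hr hf] [n' hr' hf']; exists (a *: n + n'); exact: (grel_lin (fgrP _)).
    by move=> x w m [n hr hf]; exists (hc x n); exact: (grel_hc (fgrP _)).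
  have gd : is_gsub (rdom u) by exact: rdom_gsub.
  have hd w : tors (rdom u) w.
    apply: tors_idem => //; have [a ha] := fdomT r w; exists a => t; have [n hn] := ha t.
    apply: tors_idem => //; have [b hb] := fdomT g n; exists b => s; have [q hq] := hb s.
    have tq : tors0 q.
      by apply: (H (X s ^+ b *: (X t ^+ a *: w))); exists (X s ^+ b *: n) => //; exact: fracZ.
    have [c hc] := h3 _ _ hq tq; exists c => v; have [m _ hm'] := hc v.
    by exists m, (X v ^+ c *: (X s ^+ b *: n)) => //; do 2 apply: fracZ.
  have hi m : u 0 m -> tors0 m by move=> [n hr hf]; apply: h1 hf _; exact: findT hr.
  exists (qpi (mkfrac gu hd hi)); split.
    rewrite compE; apply/qpiE => w n n' [m [n2 hr hf] hf'] hr'.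
    by rewrite -[n](subrK n2) -addrA; apply: tors0D; [exact: fracB hf' hf | exact: fracB hr hr'].
  move=> v ev; apply: hm; rewrite ev compE; apply/qpiE => w n n' [m [n2 hr hf] hf'] hr'.
  by rewrite -[n](subrK n2) -addrA; apply: tors0D; [exact: fracB hf' hf | exact: fracB hr hr'].
- have [r ->] := qW h; rewrite compE => /qpi0E H.
  pose u (q : Q) (w : W) := exists2 n, g n q & r n w.
  have gu : is_grel u.
    split; first by exists 0; exact: (grel0 (fgrP _)).
      move=> a w w' m m' [n hr hf] [n' hr' hf']; exists (a *: n + n'); exact: (grel_lin (fgrP _)).
    by move=> x w m [n hr hf]; exists (hc x n); exact: (grel_hc (fgrP _)).
  have gd : is_gsub (rdom u) by exact: rdom_gsub.
  have hd q : tors (rdom u) q.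
    apply: tors_idem => //; have [a ha] := h4 q; exists a => t; have [n _ hn] := ha t.
    have [b hb] := fdomT r n; exists b => s; have [w hw] := hb s.
    by exists w, (X s ^+ b *: n) => //; exact: fracZ.
  have hi w : u 0 w -> tors0 w.
    move=> [n hg hr]; apply: tors0_tors; have [a ha] := h3 _ _ hg (@tors00 _ _ Q).
    exists a => t; have [m _ hm'] := ha t; apply: (H m); exists (X t ^+ a *: n) => //; exact: fracZ.
  have e : compm (qpi (mkfrac gu hd hi) : @Mor k coh Q W) (qpi g) = qpi r.
    rewrite compE; apply/qpiE => n w w' [q hg [n2 hg2 hr2]] hr.
    have : u 0 (w - w').
      exists (n2 - n); last exact: (grelB (fgrP r)).
      by rewrite -[0](subrr q); exact: (grelB (fgrP g)).
    exact: hi.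
  exists (qpi (mkfrac gu hd hi)); split=> // v ev.
  apply/eqP; rewrite -subr_eq0; apply/eqP; apply: (surj_epi h4).
  by rewrite compBl e ev subrr.
Qed.

Lemma short_exactW M N Q (f : @Mor k coh M N) (g : @Mor k coh N Q) : short_exact f g ->
  exists (f' : frac M N) (g' : frac N Q), [/\ f = qpi f', g = qpi g' & gexact f' g'].
Proof.
have [f' ->] := qW f; have [g' ->] := qW g => h; exists f', g'; split=> //.
exact: short_exact_elim.
Qed.

Lemma gproj_cokernel M (P : set M) (gP : is_gsub P) :
  @short_exact k coh _ _ _ (gmor (gincl gP)) (gmor (gproj gP)).
Proof.
apply: short_exact_intro; split.
- by move=> m n -> tn; apply/gsub_tors.
- move=> m n q -> ->; apply/gproj_tors; apply: tors_in; exact: gsvalR.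
- move=> n q -> /gproj_tors tn; apply: tors_sub tn => v hv.
  by exists (mksub gP hv).
- move=> q; apply: tors_in; exists (grepr q) => //; exact/esym/greprK.
Qed.

(** * Line bundles *)

(** Powers of two of the variables generate an ideal that contains a power of the third, by
    [iunit_ideal]. Membership up to torsion can therefore be tested on two variables. *)
Lemma tors2 M (P : set M) i j m n u : is_gsub P -> i != j ->
  P (X i ^+ m *: u) -> P (X j ^+ n *: u) -> tors P u.
Proof.
move=> gP ij hi hj.
have uj : iunit i (X j ^+ n).
  by rewrite -[X j ^+ n]mulr1 => /(dvdX_cancelX ij); exact: dvdX1N.
have [N hN] := iunit_ideal m (AhomogX k p j n) uj; exists N => t.
have [b [d ->]] := hN t; rewrite scalerDl ![_ * b]mulrC ![_ * d]mulrC -!scalerA.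
by apply: gsubD => //; exact: gsubZ.
Qed.

Lemma hcX M z t n (u : M) : hc z u = u ->
  hc (xvec p t *~ n%:Z + z) (X t ^+ n *: u) = X t ^+ n *: u.
Proof. by move=> h; rewrite hc_scaleX h. Qed.

Lemma comp_elmA z z' M (a : A) (u : M) : Ahomog (z - z') a ->
  compm (elm z u) (elm z' (a : OO z)) = elm z' (a *: hc (- z) u).
Proof.
move=> /AhomogP ha; rewrite gmor_elm /=; congr elm.
Qed.

Lemma elm_hcE z M (u : M) : elm z (hc (- z) u) = elm z u.
Proof. by rewrite /elm; apply/gmor_eq => a /=; rewrite hcid subrr; exact: tors00. Qed.

Section Saturated.
Variable N : grmod.
(** No torsion, and depth two with respect to any two variables: N is the module of sections of its
    sheaf, in the sense of [sat_elm]. *)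
Definition saturated := (forall n : N, tors0 n -> n = 0) /\
  forall i j (a b : nat) (n1 n2 : N), i != j -> X j ^+ b *: n1 = X i ^+ a *: n2 ->
    exists n, X i ^+ a *: n = n1 /\ X j ^+ b *: n = n2.

Hypothesis hN : saturated.

Lemma sat_elm z (f : @Mor k coh (OO z) N) : exists2 n, hc (- z) n = n & f = elm z n.
Proof.
have [r ->] := qW f; have [a ha] := fdomT r (1 : A).
pose y t : L := xvec p t *~ a%:Z - z.
have hX t : exists n, r (X t ^+ a : A) n /\ hc (y t) n = n.
  have [n hn] := ha t; exists (hc (y t) n); rewrite hcid; split=> //.
  have := grel_hc (fgrP r) (y t) hn; rewrite [hc (y t) _](_ : _ = X t ^+ a) //=.
  rewrite /GRing.scale /= mulr1 /y addrC subrK; apply/AhomogP; exact: AhomogX.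
(* The values at X_1^a and X_2^a are compatible, and saturation glues them into a value at 1. *)
have [n1 [h1 g1]] := hX 0; have [n2 [h2 g2]] := hX 1.
have e : X 1 ^+ a *: n1 = X 0 ^+ a *: n2.
  apply/eqP; rewrite -subr_eq0; apply/eqP; apply: hN.1; apply: (fracB (f := r)).
    exact: fracZ h1.
  by have := fracZ (X 0 ^+ a) h2; rewrite /GRing.scale /= mulrC.
have [n [e1 e2]] := hN.2 0 1 a a n1 n2 isT e.
have H b q : r b q -> q = (b : A) *: n.
  move=> hr; apply/eqP; rewrite -subr_eq0; apply/eqP; apply: hN.1.
  apply: tors0_tors; apply: (@tors2 _ _ 0 1 a a) => //; first exact: tors0_gsub.
    rewrite scalerBr scalerA mulrC -scalerA e1; apply: (fracB (f := r)); first exact: fracZ hr.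
    by have := fracZ (b : A) h1; rewrite /GRing.scale /= mulrC.
  rewrite scalerBr scalerA mulrC -scalerA e2; apply: (fracB (f := r)); first exact: fracZ hr.
  by have := fracZ (b : A) h2; rewrite /GRing.scale /= mulrC.
have hn : hc (- z) n = n.
  apply/eqP; rewrite -subr_eq0; apply/eqP; apply: hN.1.
  apply: (@tors2 _ _ 0 1 a a) => //; first exact: gsub_set0.
    by rewrite /= scalerBr -hc_scaleX e1 g1 subrr.
  by rewrite /= scalerBr -hc_scaleX e2 g2 subrr.
exists n => //; apply/qpiE => b q q' hr ->; rewrite (H _ _ hr) /= hn subrr; exact: tors00.
Qed.
End Saturated.

Lemma saturated_OO z : saturated (OO z).
Proof.
split=> [n [N h]|i j a b n1 n2 ij e]; first exact: (Xpow_reg (h 0)).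
have [n en] : dvdX i a (n1 : A) by apply: (dvdX_cancelX ij); exists n2; exact: e.
exists n; split; first exact/esym.
move: e; rewrite en /GRing.scale /= mulrCA; exact: Xpow_inj.
Qed.

Lemma saturated_dsum M N : saturated M -> saturated N -> saturated (dsum M N).
Proof.
move=> [m1 m2] [n1 n2]; split=> [[u v] [a h]|i j a b [u v] [u' v'] ij e].
  congr pair; [apply: m1 | apply: n1]; exists a => t; by case: (h t).
case: e => e1 e2; have [x [x1 x2]] := m2 _ _ _ _ _ _ ij e1.
have [y [y1 y2]] := n2 _ _ _ _ _ _ ij e2; exists (x, y); split; congr pair => //.
Qed.

Lemma saturated_sub M (R : set M) (gR : is_gsub R) : saturated M ->
  (forall u, tors R u -> R u) -> saturated (gsubm gR).
Proof.
move=> [m1 m2] hR; split=> [u /gsub_tors/m1 h|i j a b u v ij e].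
  by apply: gsval_inj; rewrite h gsval0.
have [|n [e1 e2]] := m2 i j a b (gsval u) (gsval v) ij; first by rewrite -!gsvalZ e.
have Rn : R n by apply/hR/(tors2 gR ij (m := a) (n := b)); rewrite ?e1 ?e2; exact: gsvalR.
by exists (mksub gR Rn); split; apply: gsval_inj; rewrite gsvalZ.
Qed.

Lemma OO_elm z z' (f : @Mor k coh (OO z) (OO z')) : exists2 a : A, Ahomog (z' - z) a & f = elm z (a : OO z').
Proof.
have [a ha e] := sat_elm (saturated_OO z') f; exists a => //; exact/AhomogP.
Qed.

Lemma OO_hc z z' (a : A) : Ahomog (z' - z) a -> hc (- z) (a : OO z') = a.
Proof. by move=> /AhomogP. Qed.

(** Y_i = X_i^(p_i) has degree c for every i. For two indices the maps Y_i^N and Y_j^N play the role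
    of an open covering, with O(z - 2Nc) as the overlap. *)
Definition Ym (z : L) i (N : nat) : @Mor k coh (OO (z - cvec p *~ N%:Z)) (OO z) :=
  elm (z - cvec p *~ N%:Z) (X i ^+ (p i * N) : OO z).

Lemma AhomogY i (N : nat) : Ahomog (cvec p *~ N%:Z) (X i ^+ (p i * N)).
Proof. by rewrite (cvec_xvec p i) -mulrzA -PoszM; exact: AhomogX. Qed.

Lemma Ym_hc z i (N : nat) : hc (- (z - cvec p *~ N%:Z)) (X i ^+ (p i * N) : OO z) = X i ^+ (p i * N).
Proof. by apply: OO_hc; rewrite subKr; exact: AhomogY. Qed.

Lemma elhY z i (N : nat) (a : A) :
  elh (z - cvec p *~ N%:Z) (X i ^+ (p i * N) : OO z) a = X i ^+ (p i * N) * a :> A.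
Proof. by rewrite -[LHS]/((a : A) *: hc _ (X i ^+ (p i * N) : OO z)) Ym_hc mulrC. Qed.

Lemma comp_Ym z M (f : frac (OO z) M) i (N : nat) m : f (X i ^+ (p i * N) : A) m ->
  compm (qpi f : @Mor k coh _ M) (Ym z i N) = elm (z - cvec p *~ N%:Z) m.
Proof. by move=> h; apply: comp_elm; rewrite Ym_hc. Qed.

Lemma elm_Ym z M (u : M) i (N : nat) : hc (- z) u = u ->
  compm (elm z u) (Ym z i N) = elm (z - cvec p *~ N%:Z) (X i ^+ (p i * N) *: u).
Proof. by move=> hu; rewrite [elm z u]/gmor; apply: comp_Ym; rewrite /= hu. Qed.

Lemma YmC z i j (N : nat) : compm (Ym z i N) (Ym (z - cvec p *~ N%:Z) j N) =
  compm (Ym z j N) (Ym (z - cvec p *~ N%:Z) i N).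
Proof.
by rewrite !elm_Ym ?Ym_hc //; congr elm; rewrite /GRing.scale /= mulrC.
Qed.

Lemma Ym_sep z M (f : @Mor k coh (OO z) M) i j (N : nat) : i != j ->
  compm f (Ym z i N) = 0 -> compm f (Ym z j N) = 0 -> f = 0.
Proof.
have [r ->] := qW f => ij; rewrite !compE => /qpi0E hi /qpi0E hj; apply/qpi0E => a m hr.
apply: tors0_tors; apply: (tors2 (@tors0_gsub _ _ M) ij (m := (p i * N)%N) (n := (p j * N)%N)).
  by apply: (hi a); exists (X i ^+ (p i * N) *: a); [exact/esym/elhY | exact: fracZ].
by apply: (hj a); exists (X j ^+ (p j * N) *: a); [exact/esym/elhY | exact: fracZ].
Qed.

(** The map g is onto up to torsion, so the image of 1 acquires a preimage after multiplication by a
    large power of each Y_i. *)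
Lemma lift_Ym M N (g : frac M N) z (c : @Mor k coh (OO z) N) : (forall n, tors (rimg g setT) n) ->
  exists n0, forall n, (n0 <= n)%N -> forall i, exists b : @Mor k coh (OO (z - cvec p *~ n%:Z)) M,
    compm (qpi g : @Mor k coh M N) b = compm c (Ym z i n).
Proof.
move=> hg; have [r ->] := qW c; pose T := rimg (fun n a => r a n) (rimg g setT).
have gT : is_gsub T by apply: rimg_gsub; [exact/rinv_grel/fgrP | exact: rimgT_gsub].
have [n0 h0] : tors T (1 : A).
  apply: tors_idem => //; have [a ha] := fdomT r (1 : A); exists a => t; have [q hq] := ha t.
  have [b hb] := hg q; exists b => s; exists (X s ^+ b *: q) => //; exact: fracZ.
exists n0 => n hn i.
have [q [m _ hm] hq] : T (X i ^+ (p i * n) *: ((1 : A) : OO z)).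
  apply: (tors_le gT _ (h0 i)); apply: leq_trans hn _; rewrite leq_pmull //.
  by have := wt_ge2 p i; lia.
rewrite /GRing.scale /= mulr1 in hq.
set w := z - cvec p *~ n%:Z.
have hm' := grel_hc (fgrP g) (- w) hm.
exists (elm w m); rewrite (comp_elm hm') (comp_Ym hq) elm_hcE //.
Qed.

(** The graph lives on the submodule generated by Y_i^N and Y_j^N, which is everything up to
    torsion. These two elements form a regular sequence, so the only ambiguity of a decomposition is
    the one that the hypothesis controls. *)
Lemma glue_Ym z M i j (N : nat) (b0 b1 : @Mor k coh (OO (z - cvec p *~ N%:Z)) M) : i != j ->
  compm b0 (Ym _ j N) = compm b1 (Ym _ i N) ->
  exists b : @Mor k coh (OO z) M, compm b (Ym z i N) = b0 /\ compm b (Ym z j N) = b1.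
Proof.
have [f0 ->] := qW b0; have [f1 ->] := qW b1 => ij; rewrite !compE => /qpiE H.
pose Yi := X i ^+ (p i * N); pose Yj := X j ^+ (p j * N).
pose r (a : OO z) (m : M) := exists (a0 a1 : A) (m0 m1 : M),
  [/\ a = Yi * a0 + Yj * a1, f0 a0 m0, f1 a1 m1 & m = m0 + m1].
have gr : is_grel r.
  split.
  - exists 0, 0, 0, 0; split; rewrite ?mulr0 ?addr0 //; exact: (grel0 (fgrP _)).
  - move=> c a a' m m' [a0 [a1 [m0 [m1 [-> h0 h1 ->]]]]] [a0' [a1' [m0' [m1' [-> h0' h1' ->]]]]].
    exists (c * a0 + a0'), (c * a1 + a1'), (c *: m0 + m0'), (c *: m1 + m1'); split.
    + by rewrite /GRing.scale /=; ring.
    + exact: (grel_lin (fgrP f0) c h0 h0').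
    + exact: (grel_lin (fgrP f1) c h1 h1').
    + by rewrite scalerDr addrACA.
  - move=> x a m [a0 [a1 [m0 [m1 [-> h0 h1 ->]]]]].
    have h0' := grel_hc (fgrP f0) x h0; have h1' := grel_hc (fgrP f1) x h1.
    exists (Acomp (z - cvec p *~ N%:Z + x) a0), (Acomp (z - cvec p *~ N%:Z + x) a1), (hc x m0), (hc x m1).
    split=> //; last by rewrite hcD.
    rewrite /= A_hcD -(AcompM _ a0 (AhomogY i N)) -(AcompM _ a1 (AhomogY j N)).
    by congr (Acomp _ _ + Acomp _ _); abel.
have gd : is_gsub (rdom r) by exact: rdom_gsub.
have hd a : tors (rdom r) a.
  apply: tors_idem => //; apply: (tors2 (tors_gsub gd) ij (m := (p i * N)%N) (n := (p j * N)%N)).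
    have [n hn] := fdomT f0 (a : A); exists n => t; have [m hm] := hn t.
    exists m, (X t ^+ n * a), 0, m, 0; split=> //; rewrite ?addr0 //; last exact: (grel0 (fgrP _)).
    by rewrite mulr0 addr0 /GRing.scale /= mulrCA.
  have [n hn] := fdomT f1 (a : A); exists n => t; have [m hm] := hn t.
  exists m, 0, (X t ^+ n * a), 0, m; split=> //; rewrite ?add0r //; last exact: (grel0 (fgrP _)).
  by rewrite mulr0 add0r /GRing.scale /= mulrCA.
have hi m : r 0 m -> tors0 m.
  move=> [a0 [a1 [m0 [m1 [e h0 h1 ->]]]]].
  have [c ec] : dvdX i (p i * N) a1.
    apply: (dvdX_cancelX ij (m := (p j * N)%N)); exists (- a0).
    by apply/eqP; rewrite -subr_eq0 mulrN opprK addrC -e.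
  have e0 : a0 = - c * Yj.
    apply: (@Xpow_inj _ _ i (p i * N)); apply/eqP; rewrite -subr_eq0 -[X in _ == X]/(0 : OO z) e ec.
    by apply/eqP; rewrite /Yi; ring.
  have := H (- c) m0 (- m1); rewrite opprK; apply.
    by exists a0; [rewrite e0 mulrC; exact/esym/elhY | exact: h0].
  exists (- c * Yi); first by rewrite mulrC; exact/esym/elhY.
  by have := fracZ (-1 : A) h1; rewrite !scaleN1r ec mulNr mulrC.
exists (qpi (mkfrac gr hd hi)); split; rewrite compE; apply/qpiE => a m n' [b -> hr] hf;
  apply: (fracB hr); rewrite [elh _ _ a]elhY.
  exists a, 0, n', 0; split; rewrite ?addr0 ?mulr0 ?addr0 //; exact: (grel0 (fgrP _)).
exists 0, a, 0, n'; split; rewrite ?add0r ?mulr0 ?add0r //; exact: (grel0 (fgrP _)).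
Qed.

(** The vanishing of Ext^1(O(z), M) in Cech form: every cochain on the overlap is a coboundary. *)
Definition h1v (M : grmod) z := forall i j (N : nat), i != j ->
  forall c : @Mor k coh (OO (z - cvec p *~ N%:Z - cvec p *~ N%:Z)) M,
  exists c0 c1 : @Mor k coh (OO (z - cvec p *~ N%:Z)) M,
    c = compm c0 (Ym _ j N) - compm c1 (Ym _ i N).

Lemma elmN z M (u : M) : elm z (- u) = - elm z u.
Proof.
apply/eqP; rewrite -subr_eq0 opprK -elmD addNr; apply/eqP/elm0.
by rewrite hc0; exact: tors00.
Qed.

(** A cochain is an element of degree w - z + 2Nc, whose level is at least 2N - 1: exactly the bound
    of [Ahomog_dec]. *)
Lemma h1v_OO z (w : L) : -1 <= llev (w - z) -> h1v (OO w) z.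
Proof.
move=> hl i j N ij c; have [a ha ->] := OO_elm c.
have [l [il jl]] := other1 ij.
have E : w - (z - cvec p *~ N%:Z - cvec p *~ N%:Z) = w - z + cvec p *~ (2 * N%:Z) by abel.
have [|b [d [hb hd e]]] := Ahomog_dec (N := N) ij il jl ha; first by rewrite E llevDc; lia.
have E' : w - (z - cvec p *~ N%:Z - cvec p *~ N%:Z) - cvec p *~ N%:Z = w - (z - cvec p *~ N%:Z).
  by abel.
rewrite E' in hb hd.
exists (elm _ (d : OO w)), (- elm _ (b : OO w)).
rewrite compNl opprK !elm_Ym; try exact: OO_hc.
by rewrite -elmD e [X in elm _ X = _]addrC.
Qed.

Lemma short_exact_surj M N Q (f : @Mor k coh M N) (g : @Mor k coh N Q) (g' : frac N Q) :
  short_exact f g -> g = qpi g' -> forall q, tors (rimg g' setT) q.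
Proof. by move=> h e; apply: epi_surj; rewrite -e; exact: cokernel_epi h.2. Qed.

Lemma sub_swap (V : zmodType) (a b c d : V) : a - c = b - d -> a - b = c - d.
Proof. by move=> /eqP; rewrite subr_eq => /eqP ->; abel. Qed.

(** Lift c on the two pieces of the covering. The lifts differ on the overlap by a cochain with
    values in M; it is a coboundary, and correcting by it makes the lifts glue. *)
Lemma lift_h1 M N Q (f : @Mor k coh M N) (g : @Mor k coh N Q) z (c : @Mor k coh (OO z) Q) :
  short_exact f g -> h1v M z -> exists b : @Mor k coh (OO z) N, compm g b = c.
Proof.
move=> hfg hM; have [g' eg] := qW g.
have [n hn] := lift_Ym c (short_exact_surj hfg eg).
have [b0 e0] := hn n (leqnn n) 0; have [b1 e1] := hn n (leqnn n) 1; rewrite -eg in e0 e1.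
have [[gf K] _] := hfg.
have [|u [hu _]] := K _ (compm b0 (Ym _ 1 n) - compm b1 (Ym _ 0 n)).
  by rewrite compBr !compA e0 e1 -!compA YmC subrr.
have [u0 [u1 eu]] := hM 0 1 n isT u.
have [|b [hb0 hb1]] := @glue_Ym z N 0 1 n (b0 - compm f u0) (b1 - compm f u1) isT.
  rewrite !compBl -!compA; apply: sub_swap; rewrite -hu eu compBr !compA //.
exists b; apply/eqP; rewrite -subr_eq0; apply/eqP.
have Z x : compm g (compm f x) = 0 by rewrite compA gf comp0l.
apply: (@Ym_sep _ _ _ 0 1 n) => //; rewrite compBl -compA ?hb0 ?hb1 compBr Z subr0 ?e0 ?e1 subrr //.
Qed.

(** The cochains q0, q1 have source O(z - nc), so lifting them requires the vanishing for M at z -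
    nc; the vanishing at z then removes the remaining cochain with values in M. *)
Lemma h1v_ext M N Q (f : @Mor k coh M N) (g : @Mor k coh N Q) z :
  short_exact f g -> (forall n : nat, h1v M (z - cvec p *~ n%:Z)) -> h1v M z -> h1v Q z -> h1v N z.
Proof.
move=> hfg hM hM0 hQ i j n ij c.
have [q0 [q1 eq]] := hQ i j n ij (compm g c).
have [b0 e0] := lift_h1 q0 hfg (hM n); have [b1 e1] := lift_h1 q1 hfg (hM n).
have [[gf K] _] := hfg.
have [|u [hu _]] := K _ (c - (compm b0 (Ym _ j n) - compm b1 (Ym _ i n))).
  by rewrite !compBr !compA e0 e1 eq subrr.
have [u0 [u1 eu]] := hM0 i j n ij u.
exists (b0 + compm f u0), (b1 + compm f u1).
rewrite !compDl -!compA opprD addrACA -compBr -eu hu.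
by rewrite addrC subrK.
Qed.
End Exactness.

(** * Rank two lattices *)

Section Lattices.
Variables (k : fieldType) (p : weights).
Local Notation L := (Lgrp p).
Local Notation A := (coordA k p).
Local Notation X := (Xvar k p).
Local Notation grmod := (grmod k p).
Local Notation coh := (cohX k p).
Local Notation OO := (OO k).
Implicit Types (M N Q : grmod) (z d : L).

Lemma mono_epi_iso M N (f : @Mor k coh M N) :
  (forall W (h : @Mor k coh W M), compm f h = 0 -> h = 0) ->
  (forall W (h : @Mor k coh N W), compm h f = 0 -> h = 0) -> is_iso f.
Proof.
have [r ->] := qW f => h1 h2; apply: iso_frac; last exact: epi_surj.
have hm : @mono k coh M N (qpi r).
  move=> W a b e; apply/eqP; rewrite -subr_eq0; apply/eqP; apply: h1.
  by rewrite compBr e subrr.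
by move=> m hm0; apply: (monoP r).1 hm _ _ hm0 (@tors00 _ _ N).
Qed.

Lemma kernel_mono X Y Z (f : @Mor k coh X Y) (g : @Mor k coh Y Z) : is_kernel f g -> mono f.
Proof.
move=> [e K] W a b eab; have [|u [_ uu]] := K W (compm f a); first by rewrite compA e comp0l.
by rewrite -(uu a) // -(uu b).
Qed.

Lemma short_exact_iso X X' Y Z Z' (f : @Mor k coh X Y) (g : @Mor k coh Y Z)
    (i : @Mor k coh X' X) (j : @Mor k coh Z Z') :
  is_iso i -> is_iso j -> short_exact f g -> short_exact (compm f i) (compm j g).
Proof.
move=> hi hj [hk hc]; split; last exact/cokernel_iso_l/hi/cokernel_iso_r/hj.
have [i' [e1 e2]] := hi; have [j' [e3 e4]] := hj; split.
  by rewrite compA -(compA j) hk.1 comp0r comp0l.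
move=> W h eh; have [|u [hu uu]] := hk.2 W h.
  by rewrite -[g]comp1f -e3 -2!compA [compm j _]compA eh comp0r.
exists (compm i' u); split; first by rewrite compA -(compA f) e2 compf1.
move=> v hv; rewrite (uu (compm i v)) ?compA //; by rewrite e1 comp1f.
Qed.

Lemma short_exact_isom X Y Y' Z (f : @Mor k coh X Y) (g : @Mor k coh Y Z)
    (u : @Mor k coh Y Y') (v : @Mor k coh Y' Y) :
  compm v u = idm Y -> compm u v = idm Y' ->
  short_exact f g -> short_exact (compm u f) (compm g v).
Proof.
move=> e1 e2 [hk hc]; split; last exact: cokernel_iso_m hc.
split; first by rewrite compA -(compA g) e1 compf1 hk.1.
move=> W h eh; have [|x [hx ux]] := hk.2 W (compm v h); first by rewrite compA.
exists x; split; first by rewrite -compA hx compA e2 comp1f.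
by move=> y hy; apply: ux; rewrite -hy !compA e1 comp1f.
Qed.

Definition wedge (e f : A * A) : A := e.1 * f.2 - e.2 * f.1.

Lemma lincomb3 (R : pzRingType) (V : lmodType R) (x b c d b' c' d' : R) (u v w : V) :
  x *: (b *: u + (c *: v + d *: w)) + (b' *: u + (c' *: v + d' *: w)) =
  (x * b + b') *: u + ((x * c + c') *: v + (x * d + d') *: w).
Proof. by rewrite !scalerDr !scalerDl !scalerA; abel. Qed.

Lemma qpiDE M N (f g : frac M N) : (qpi f + qpi g : @Mor k coh M N) = qpi (fadd f g).
Proof. exact: qaddE. Qed.

Section Lat.
Variables (d1 d2 w : L) (i : 'I_3) (r : nat) (e : A * A).
Local Notation V := (dsum (OO d1) (OO d2)).

Definition lat : set V := [set f | dvdX i r (wedge e f)].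

Hypotheses (h1 : Ahomog (w + d1) e.1) (h2 : Ahomog (w + d2) e.2).

Lemma wedge_hc x (f : V) : wedge e (hc x f) = Acomp (w + d1 + d2 + x) (wedge e f).
Proof.
rewrite /wedge A_hcD; have -> : Acomp (w + d1 + d2 + x) (- (e.2 * f.1)) = - Acomp (w + d1 + d2 + x) (e.2 * f.1).
  by rewrite -mulN1r -[w + _ + _ + _]add0r (AcompM _ _ (AhomogN (Ahomog1 k p))) mulN1r add0r.
have -> : w + d1 + d2 + x = w + d1 + (d2 + x) by abel.
rewrite (AcompM _ _ h1); congr (_ - _).
have -> : w + d1 + (d2 + x) = w + d2 + (d1 + x) by abel.
by rewrite (AcompM _ _ h2).
Qed.

Lemma lat_gsub : is_gsub lat.
Proof.
split.
- by rewrite /lat /= /wedge !mulr0 subr0; exact: dvdX0.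
- move=> a u v hu hv; rewrite /lat /=.
  have -> : wedge e (a *: u + v) = a * wedge e u + wedge e v.
    by rewrite /wedge /= /GRing.scale /=; ring.
  by apply: dvdXD => //; exact: dvdX_M.
- by move=> x u hu; rewrite /lat /= wedge_hc; move/dvdX_comp: hu.
Qed.

Lemma lat_sat f : tors lat f -> lat f.
Proof.
move=> [n hn]; have [j [l [ij il jl]]] := other2 i.
apply: (dvdX_cancelX (m := n) ij); have := hn j.
by congr dvdX; rewrite /wedge /= /GRing.scale /=; ring.
Qed.

Lemma saturated_lat : saturated (gsubm lat_gsub).
Proof.
apply: saturated_sub; last exact: lat_sat.
by apply: saturated_dsum; exact: saturated_OO.
Qed.
End Lat.

(** The quotient is unique because X_i is regular; 0 is the default in the absence of
    divisibility. *)
Definition Xdiv i r (a : A) : A := xget 0 [set b | a = X i ^+ r * b].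
Lemma XdivE i r a : dvdX i r a -> X i ^+ r * Xdiv i r a = a.
Proof.
move=> [b hb]; rewrite /Xdiv; case: xgetP => [c _ -> //|] /(_ b) /=.
by move=> h; case: h.
Qed.
End Lattices.

(** * Extension bundles as lattices *)

Section ExtensionBundles.
Variables (k : fieldType) (p : weights).
Local Notation L := (Lgrp p).
Local Notation A := (coordA k p).
Local Notation X := (Xvar k p).
Local Notation grmod := (grmod k p).
Local Notation coh := (cohX k p).
Local Notation tors0 := (tors [set 0]).
Local Notation OO := (OO k).

Definition sbox (s : 'I_3 -> nat) := forall t, (0 < s t < p t)%N.
(** For x = l_1 x_1 + l_2 x_2 + l_3 x_3 and L = O(y), the bundle E_L<x> corresponds to s_t = p_t - 1
    - l_t and a = y + x - c. It is generated by the line bundles O(bb a s t), with a single relation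
    carried by O(a). *)
Definition vtop (a : L) (s : 'I_3 -> nat) : L := a + xs p (fun t => (s t)%:Z).
Definition ub1 a s : L := vtop a s - cvec p.
Definition ub2 (a : L) : L := a + cvec p.
Definition bb (a : L) (s : 'I_3 -> nat) t : L := a + xvec p t *~ (s t)%:Z.

(* E is the middle term of a nonsplit extension of O(u2) by O(u1); for
   E = E_L<x>, L = O(y), one has u1 = y + omega and u2 = y + x *)
Definition EB a s (E : coh) := exists (f : @Mor k coh (OO (ub1 a s)) E)
  (g : @Mor k coh E (OO (ub2 a))), short_exact f g /\ ~ split_epi g.

Definition Xs a s t : @Mor k coh (OO a) (OO (bb a s t)) := elm a (X t ^+ s t : OO (bb a s t)).

Section Roles.
Variables (i j l : 'I_3) (a : L) (s : 'I_3 -> nat).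
Hypotheses (ij : i != j) (il : i != l) (jl : j != l) (hs : sbox s).
Definition wd1 : L := vtop a s - xvec p j *~ (s j)%:Z.
Definition wd2 : L := vtop a s - xvec p l *~ (s l)%:Z.
Definition wvec : A * A := (X l ^+ s l, - X j ^+ s j).

Lemma vtopE : vtop a s = a + xvec p i *~ (s i)%:Z + xvec p j *~ (s j)%:Z + xvec p l *~ (s l)%:Z.
Proof. by rewrite /vtop /xs (sum3 _ ij il jl) !addrA. Qed.

Lemma wvec1 : Ahomog (- bb a s i + wd1) wvec.1.
Proof.
have -> : - bb a s i + wd1 = xvec p l *~ (s l)%:Z by rewrite /bb /wd1 vtopE; abel.
exact: AhomogX.
Qed.
Lemma wvec2 : Ahomog (- bb a s i + wd2) wvec.2.
Proof.
have -> : - bb a s i + wd2 = xvec p j *~ (s j)%:Z by rewrite /bb /wd2 vtopE; abel.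
by apply: AhomogN; exact: AhomogX.
Qed.

Definition Wm : coh := gsubm (lat_gsub i (s i) wvec1 wvec2).

Lemma Wm_sat : saturated Wm. Proof. exact: saturated_lat. Qed.

Lemma in_W (x y : A) : dvdX i (s i) (X j ^+ s j * x + X l ^+ s l * y) -> lat (d1 := wd1) (d2 := wd2) i (s i) wvec (x, y).
Proof. by rewrite /lat /= /wedge /= mulNr opprK addrC. Qed.

Lemma W_in (f : Wm) : dvdX i (s i) (X j ^+ s j * (gsval f).1 + X l ^+ s l * (gsval f).2).
Proof. by have := gsvalR f; rewrite /lat /= /wedge /= mulNr opprK addrC. Qed.

Definition mkW (x y : A) (h : dvdX i (s i) (X j ^+ s j * x + X l ^+ s l * y)) : Wm :=
  mksub (lat_gsub i (s i) wvec1 wvec2) (in_W h).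

Lemma kapi_in : dvdX i (s i) (X j ^+ s j * X l ^+ s l + X l ^+ s l * (- X j ^+ s j)).
Proof. by rewrite mulrN mulrC subrr; exact: dvdX0. Qed.
Lemma kapj_in : dvdX i (s i) (X j ^+ s j * 0 + X l ^+ s l * X i ^+ s i).
Proof. by rewrite mulr0 add0r; apply: dvdX_M; exact: dvdX_id. Qed.
Lemma kapl_in : dvdX i (s i) (X j ^+ s j * (- X i ^+ s i) + X l ^+ s l * 0).
Proof. by rewrite mulr0 addr0; apply: dvdX_M; apply: dvdXN; exact: dvdX_id. Qed.
(** [kapi] is the vector w itself, and [kapj], [kapl] are X_i^(s_i) times the basis vectors of V up
    to sign; the signs make the sum of their multiples by X_i^(s_i), X_j^(s_j), X_l^(s_l) vanish. *)
Definition kapi : Wm := mkW kapi_in.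
Definition kapj : Wm := mkW kapj_in.
Definition kapl : Wm := mkW kapl_in.

Lemma W_hc x (f : Wm) : gsval (hc x f) = (Acomp (wd1 + x) (gsval f).1, Acomp (wd2 + x) (gsval f).2).
Proof. by []. Qed.

Lemma W_eq (f g : Wm) : (gsval f).1 = (gsval g).1 -> (gsval f).2 = (gsval g).2 -> f = g.
Proof.
by move=> e1 e2; apply: gsval_inj; rewrite [gsval f]surjective_pairing e1 e2 -surjective_pairing.
Qed.

Lemma W_homog x (f : Wm) : Ahomog (wd1 + x) (gsval f).1 -> Ahomog (wd2 + x) (gsval f).2 -> hc x f = f.
Proof. by move=> /AhomogP h1 /AhomogP h2; apply: W_eq; rewrite W_hc. Qed.

Lemma kapi_hc : hc (- bb a s i) kapi = kapi.
Proof. by apply: W_homog; rewrite addrC; [exact: wvec1 | exact: wvec2]. Qed.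
Lemma kapj_hc : hc (- bb a s j) kapj = kapj.
Proof.
apply: W_homog; first exact: Ahomog0.
have -> : wd2 - bb a s j = xvec p i *~ (s i)%:Z by rewrite /wd2 /bb vtopE; abel.
exact: AhomogX.
Qed.
Lemma kapl_hc : hc (- bb a s l) kapl = kapl.
Proof.
apply: W_homog; last exact: Ahomog0.
have -> : wd1 - bb a s l = xvec p i *~ (s i)%:Z by rewrite /wd1 /bb vtopE; abel.
by apply: AhomogN; exact: AhomogX.
Qed.

Lemma W1 (b c d : A) : (gsval (b *: kapi + (c *: kapj + d *: kapl))).1 = b * X l ^+ s l - d * X i ^+ s i.
Proof. by rewrite !gsvalD !gsvalZ /= /GRing.scale /= mulr0 add0r mulrN. Qed.
Lemma W2 (b c d : A) : (gsval (b *: kapi + (c *: kapj + d *: kapl))).2 = c * X i ^+ s i - b * X j ^+ s j.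
Proof. by rewrite !gsvalD !gsvalZ /= /GRing.scale /= mulr0 addr0 mulrN addrC. Qed.

(* a Koszul-type relation shows that kapi, kapj, kapl span W up to torsion *)
Lemma W_span (f : Wm) : exists c : A,
  X j ^+ s j *: f = (- (gsval f).2) *: kapi + (0 *: kapj + (- c) *: kapl) /\
  X l ^+ s l *: f = (gsval f).1 *: kapi + (c *: kapj + 0 *: kapl).
Proof.
have [c hc] := W_in f; exists c; split; apply: W_eq; rewrite ?W1 ?W2 gsvalZ /= /GRing.scale /=.
- by rewrite mulNr mulNr opprK [c * _]mulrC -hc; ring.
- by ring.
- by ring.
- by rewrite [c * _]mulrC -hc; ring.
Qed.

Section FromW.
Variables (N : grmod) (n_i : @Mor k coh (OO (bb a s i)) N) (n_j : @Mor k coh (OO (bb a s j)) N)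
  (n_l : @Mor k coh (OO (bb a s l)) N).

Lemma Xs_val t (b : A) : elh a (X t ^+ s t : OO (bb a s t)) b = X t ^+ s t * b :> A.
Proof.
have h : hc (- a) (X t ^+ s t : OO (bb a s t)) = X t ^+ s t.
  apply: OO_hc; rewrite (_ : bb a s t - a = xvec p t *~ (s t)%:Z); first exact: AhomogX.
  by rewrite /bb; abel.
change ((b : A) *: hc (- a) (X t ^+ s t : OO (bb a s t)) = X t ^+ s t * b); rewrite h.
exact: mulrC.
Qed.

(** W is the cokernel of O(a) -> O(b_i) (+) O(b_j) (+) O(b_l): the relations among [kapi], [kapj],
    [kapl] are the multiples of (X_i^(s_i), X_j^(s_j), X_l^(s_l)), which the hypothesis
    annihilates. *)
Lemma W_out : compm n_i (Xs a s i) + (compm n_j (Xs a s j) + compm n_l (Xs a s l)) = 0 ->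
  exists f : @Mor k coh Wm N, [/\ compm f (elm (bb a s i) kapi) = n_i,
    compm f (elm (bb a s j) kapj) = n_j & compm f (elm (bb a s l) kapl) = n_l].
Proof.
have [fi ->] := qW n_i; have [fj ->] := qW n_j; have [fl ->] := qW n_l.
rewrite !compE => H.
have {}H c mi mj ml : fi (X i ^+ s i * c) mi -> fj (X j ^+ s j * c) mj -> fl (X l ^+ s l * c) ml ->
    tors0 (mi + (mj + ml)).
  move=> hi hj hl; move: H; rewrite [X in _ + X]qpiDE qpiDE => /qpi0E/(_ c); apply.
  exists mi, (mj + ml); split=> //.
    by exists (X i ^+ s i * c) => //; exact/esym/Xs_val.
  exists mj, ml; split=> //; first by exists (X j ^+ s j * c) => //; exact/esym/Xs_val.
  by exists (X l ^+ s l * c) => //; exact/esym/Xs_val.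
pose r (f : Wm) (m : N) := exists b c d mi mj ml,
  [/\ f = b *: kapi + (c *: kapj + d *: kapl), [/\ fi b mi, fj c mj & fl d ml] & m = mi + (mj + ml)].
have gr : is_grel r.
  split.
  - exists 0, 0, 0, 0, 0, 0; split; rewrite ?scale0r ?addr0 //.
    by split; exact: (grel0 (fgrP _)).
  - move=> x f f' m m' [b [c [d [mi [mj [ml [-> [h1 h2 h3] ->]]]]]]].
    move=> [b' [c' [d' [mi' [mj' [ml' [-> [h1' h2' h3'] ->]]]]]]].
    exists (x * b + b'), (x * c + c'), (x * d + d'), (x *: mi + mi'), (x *: mj + mj'), (x *: ml + ml').
    split; first exact: lincomb3.
      split; [exact: (grel_lin (fgrP fi) x h1 h1')|exact: (grel_lin (fgrP fj) x h2 h2')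
             |exact: (grel_lin (fgrP fl) x h3 h3')].
    by rewrite !scalerDr; abel.
  - move=> x f m [b [c [d [mi [mj [ml [-> [h1 h2 h3] ->]]]]]]].
    exists (Acomp (bb a s i + x) b), (Acomp (bb a s j + x) c), (Acomp (bb a s l + x) d), (hc x mi), (hc x mj), (hc x ml).
    split; last by rewrite !hcD.
      rewrite !hcD (hc_scale _ _ kapi_hc) (hc_scale _ _ kapj_hc) (hc_scale _ _ kapl_hc).
      by rewrite !opprK ![x + _]addrC.
    by split; [exact: (grel_hc (fgrP fi) x h1)|exact: (grel_hc (fgrP fj) x h2)|exact: (grel_hc (fgrP fl) x h3)].
have gd : is_gsub (rdom r) by exact: rdom_gsub.
have hspan (b c d : A) : tors (rdom r) (b *: kapi + (c *: kapj + d *: kapl)).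
  have [n1 h1] := fdomT fi b; have [n2 h2] := fdomT fj c; have [n3 h3] := fdomT fl d.
  exists (n1 + n2 + n3)%N => t.
  have [mi hi] : rdom fi (X t ^+ (n1 + n2 + n3) * b) by apply: (tors_le (fdom_gsub fi) _ (h1 t)); lia.
  have [mj hj] : rdom fj (X t ^+ (n1 + n2 + n3) * c) by apply: (tors_le (fdom_gsub fj) _ (h2 t)); lia.
  have [ml hl] : rdom fl (X t ^+ (n1 + n2 + n3) * d) by apply: (tors_le (fdom_gsub fl) _ (h3 t)); lia.
  exists (mi + (mj + ml)), (X t ^+ (n1 + n2 + n3) * b), (X t ^+ (n1 + n2 + n3) * c), (X t ^+ (n1 + n2 + n3) * d), mi, mj, ml.
  by rewrite !scalerDr !scalerA.
have hd f : tors (rdom r) f.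
  have [c [e1 e2]] := W_span f; apply: tors_idem => //.
  by apply: (tors2 (tors_gsub gd) jl (m := s j) (n := s l)); rewrite ?e1 ?e2; exact: hspan.
have hi m : r 0 m -> tors0 m.
  move=> [b [c [d [mi [mj [ml [e [h1 h2 h3] ->]]]]]]].
  have := W1 b c d; rewrite -e gsval0 /= => /esym/eqP; rewrite subr_eq0 => /eqP e1.
  have := W2 b c d; rewrite -e gsval0 /= => /esym/eqP; rewrite subr_eq0 => /eqP e2.
  have [x ex] : dvdX i (s i) b.
    by apply: (dvdX_cancelX (m := s l) il); rewrite mulrC e1 mulrC; exists d.
  have ed : d = X l ^+ s l * x by apply: (@Xpow_inj _ _ i (s i)); rewrite mulrC -e1 ex mulrAC mulrA.
  have ec : c = X j ^+ s j * x by apply: (@Xpow_inj _ _ i (s i)); rewrite mulrC e2 ex mulrAC mulrA.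
  by apply: (H x); rewrite -?ex -?ed -?ec.
exists (qpi (mkfrac gr hd hi)); split; rewrite /elm /gmor compE; apply/qpiE => b m m' [f -> hr] hf;
  apply: (fracB hr).
- exists b, 0, 0, m', 0, 0; rewrite !scale0r !addr0 -[elh _ _ _]/((b : A) *: hc _ kapi) kapi_hc.
  by split=> //; split=> //; exact: (grel0 (fgrP _)).
- exists 0, b, 0, 0, m', 0; rewrite !scale0r addr0 !add0r addr0 -[elh _ _ _]/((b : A) *: hc _ kapj) kapj_hc.
  by split=> //; split=> //; exact: (grel0 (fgrP _)).
- exists 0, 0, b, 0, 0, m'; rewrite !scale0r !add0r -[elh _ _ _]/((b : A) *: hc _ kapl) kapl_hc.
  by split=> //; split=> //; exact: (grel0 (fgrP _)).
Qed.

Lemma W_out_eq (f g : @Mor k coh Wm N) :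
  compm f (elm (bb a s i) kapi) = compm g (elm (bb a s i) kapi) ->
  compm f (elm (bb a s j) kapj) = compm g (elm (bb a s j) kapj) ->
  compm f (elm (bb a s l) kapl) = compm g (elm (bb a s l) kapl) -> f = g.
Proof.
move=> e1 e2 e3; apply/eqP; rewrite -subr_eq0; apply/eqP.
have {e1} : compm (f - g) (elm (bb a s i) kapi) = 0 by rewrite compBl e1 subrr.
have {e2} : compm (f - g) (elm (bb a s j) kapj) = 0 by rewrite compBl e2 subrr.
have {e3} : compm (f - g) (elm (bb a s l) kapl) = 0 by rewrite compBl e3 subrr.
have [r ->] := qW (f - g); rewrite /elm /gmor !compE => /qpi0E hl /qpi0E hj /qpi0E hi.
have ti b m : r (b *: kapi) m -> tors0 m.
  by move=> h; apply: (hi b); exists (b *: kapi) => //; rewrite /= -[RHS]/((b : A) *: hc _ kapi) kapi_hc.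
have tj b m : r (b *: kapj) m -> tors0 m.
  by move=> h; apply: (hj b); exists (b *: kapj) => //; rewrite /= -[RHS]/((b : A) *: hc _ kapj) kapj_hc.
have tl b m : r (b *: kapl) m -> tors0 m.
  by move=> h; apply: (hl b); exists (b *: kapl) => //; rewrite /= -[RHS]/((b : A) *: hc _ kapl) kapl_hc.
have tt (b c d : A) m : r (b *: kapi + (c *: kapj + d *: kapl)) m -> tors0 m.
  move=> h; apply: tors0_tors.
  have [n1 h1] := fdomT r (b *: kapi); have [n2 h2] := fdomT r (c *: kapj).
  have [n3 h3] := fdomT r (d *: kapl); exists (n1 + n2 + n3)%N => t.
  have [mi qi] := tors_le (fdom_gsub r) (leq_trans (leq_addr n2 n1) (leq_addr n3 _)) (h1 t).
  have [mj qj] := tors_le (fdom_gsub r) (leq_trans (leq_addl n1 n2) (leq_addr n3 _)) (h2 t).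
  have [ml ql] := tors_le (fdom_gsub r) (leq_addl (n1 + n2) n3) (h3 t).
  have q := grelD (fgrP r) qi (grelD (fgrP r) qj ql); rewrite -!scalerDr in q.
  have := fracB (fracZ (X t ^+ (n1 + n2 + n3)) h) q => tq.
  rewrite -[_ *: m](subrK (mi + (mj + ml))); apply: tors0D => //; apply: tors0D; last apply: tors0D.
  - by apply: (ti (X t ^+ (n1 + n2 + n3) * b)); rewrite -scalerA.
  - by apply: (tj (X t ^+ (n1 + n2 + n3) * c)); rewrite -scalerA.
  - by apply: (tl (X t ^+ (n1 + n2 + n3) * d)); rewrite -scalerA.
apply/qpi0E => f0 m hr; have [c [e1 e2]] := W_span f0; apply: tors0_tors.
apply: (tors2 (@tors0_gsub _ _ N) jl (m := s j) (n := s l)).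
  by have := fracZ (X j ^+ s j) hr; rewrite e1 => /tt.
by have := fracZ (X l ^+ s l) hr; rewrite e2 => /tt.
Qed.
End FromW.
End Roles.
End ExtensionBundles.

(** * Levels of degrees written in the three generators *)

Section Levels.
Variables (p : weights) (i j l : 'I_3).
Hypotheses (ij : i != j) (il : i != l) (jl : j != l).
Local Notation lin3 x y z m := (xvec p i *~ x + xvec p j *~ y + xvec p l *~ z + cvec p *~ m).

Lemma lin3_xs (x y z m : int) : lin3 x y z m =
  xs p (fun t => if t == i then x else if t == j then y else z) + cvec p *~ m.
Proof.
by rewrite /xs (sum3 _ ij il jl) /= eqxx [j == i]eq_sym [l == i]eq_sym (negPf ij) (negPf il) [l == j]eq_sym (negPf jl) eqxx ?addrA.
Qed.

Lemma llev3 (x y z m : int) : llev (lin3 x y z m) = (x %/ p i)%Z + (y %/ p j)%Z + (z %/ p l)%Z + m.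
Proof.
by rewrite lin3_xs llevDc llev_xs (sum3 _ ij il jl) /= eqxx [j == i]eq_sym [l == i]eq_sym (negPf ij) (negPf il) [l == j]eq_sym (negPf jl) eqxx ?addrA.
Qed.

Lemma lres3i (x y z m : int) : lres (lin3 x y z m) i = (x %% p i)%Z.
Proof. by rewrite lin3_xs lresDc lres_xs eqxx. Qed.
Lemma lres3j (x y z m : int) : lres (lin3 x y z m) j = (y %% p j)%Z.
Proof. by rewrite lin3_xs lresDc lres_xs eq_sym (negPf ij) eqxx. Qed.
End Levels.

Lemma divz_box (x d : int) : 0 <= x -> x < d -> (x %/ d)%Z = 0.
Proof. by move=> h1 h2; rewrite divz_small //; lia. Qed.
Lemma divz_box1 (x d : int) : 0 < x -> x <= d -> (- x %/ d)%Z = -1.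
Proof.
move=> h1 h2; have -> : - x = -1 * d + (d - x) by lia.
by rewrite divzMDl ?divz_small ?addr0 //; lia.
Qed.

Section ExtensionBundlesW.
Variables (k : fieldType) (p : weights).
Local Notation L := (Lgrp p).
Local Notation A := (coordA k p).
Local Notation X := (Xvar k p).
Local Notation coh := (cohX k p).
Local Notation OO := (OO k).
Local Notation cc := (relc k).

Section Roles.
Variables (i j l : 'I_3) (a : L) (s : 'I_3 -> nat).
Hypotheses (ij : i != j) (il : i != l) (jl : j != l) (hs : sbox p s).
Local Notation W := (@Wm k p i j l a s ij il jl).
Local Notation D1 := (@wd1 p j a s).
Local Notation D2 := (@wd2 p l a s).
Local Notation kj := (@kapj k p i j l a s ij il jl).
Local Notation kl := (@kapl k p i j l a s ij il jl).

Section SubLine.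
Variables (e : A * A) (u u' : L) (t1 t2 : 'I_3) (m1 m2 : nat) (al be : k).
Hypotheses (he1 : Ahomog (D1 - u) e.1) (he2 : Ahomog (D2 - u) e.2)
  (hin : dvdX i (s i) (X j ^+ s j * e.1 + X l ^+ s l * e.2))
  (hu' : u' = D1 + D2 - u - xvec p i *~ (s i)%:Z)
  (e1E : e.1 = scalA p al * X t1 ^+ m1) (e2E : e.2 = scalA p be * X t2 ^+ m2)
  (al0 : al != 0) (be0 : be != 0) (t12 : t1 != t2).

Definition subv : W := mkW a ij il jl hin.
Lemma subv_hc : hc (- u) subv = subv.
Proof. exact: W_homog. Qed.

Lemma subv_elh (b : A) : elh u subv b = b *: subv.
Proof. by rewrite -[LHS]/(b *: hc (- u) subv) subv_hc. Qed.

(** Modulo X_i^(s_i) all elements of W are proportional to w, so the wedge of any two of them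
    vanishes there. *)
Lemma wedge_dvd (f : W) : dvdX i (s i) (wedge e (gsval f)).
Proof.
apply: (dvdX_cancelX (m := s l) il).
have -> : X l ^+ s l * wedge e (gsval f) =
    e.1 * (X j ^+ s j * (gsval f).1 + X l ^+ s l * (gsval f).2)
    - (gsval f).1 * (X j ^+ s j * e.1 + X l ^+ s l * e.2).
  by rewrite /wedge; ring.
by apply: dvdXB; apply: dvdX_M => //; exact: W_in.
Qed.

(** The projection of W along the line of e. Dividing the wedge by X_i^(s_i), which occurs in all
    wedges of elements of W, makes it onto up to torsion. *)
Definition wquo (f : W) : OO u' := Xdiv i (s i) (wedge e (gsval f)).
Lemma wquoE f : X i ^+ s i * wquo f = wedge e (gsval f).
Proof. exact/XdivE/wedge_dvd. Qed.
Lemma wquo_lin (b : A) (f g : W) : wquo (b *: f + g) = b *: wquo f + wquo g.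
Proof.
apply: (@Xpow_inj _ _ i (s i)); rewrite mulrDr wquoE (_ : b *: wquo f = b * wquo f) // mulrCA !wquoE.
by rewrite gsvalD gsvalZ /wedge /= /GRing.scale /=; ring.
Qed.
Lemma wquo_hc x (f : W) : wquo (hc x f) = Acomp (u' + x) (wquo f).
Proof.
apply: (@Xpow_inj _ _ i (s i)); rewrite wquoE -(AcompM _ _ (AhomogX k p i (s i))) wquoE.
have := @wedge_hc k p D1 D2 (- u) e _ _ x (gsval f); rewrite ![- u + _]addrC => ->//.
by congr Acomp; rewrite hu'; abel.
Qed.
Definition wquoh : ghom W (OO u') := GHom wquo_lin wquo_hc.

Lemma subv_kernel (f : W) : wedge e (gsval f) = 0 -> exists h : A, f = h *: subv.
Proof.
move=> /eqP; rewrite subr_eq0 e1E e2E => /eqP E.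
have sa : scalA p al * scalA p al^-1 = 1 := scalA_unit p al0.
have sb : scalA p be * scalA p be^-1 = 1 := scalA_unit p be0.
have [h eh] : dvdX t1 m1 (gsval f).1.
  apply: (dvdX_scal be0); apply: (dvdX_cancelX (m := m2) t12).
  by rewrite mulrCA mulrA -E; exists (scalA p al * (gsval f).2); rewrite mulrCA mulrA.
exists (scalA p al^-1 * h); apply: W_eq; rewrite gsvalZ /= /GRing.scale /= ?e1E ?e2E.
  rewrite eh [RHS](_ : _ = scalA p al * scalA p al^-1 * (X t1 ^+ m1 * h)); last by ring.
  by rewrite sa mul1r.
apply: (@Xpow_inj _ _ t1 m1); have := congr1 (fun z => scalA p al^-1 * z) E; rewrite eh.
have -> : scalA p al^-1 * (scalA p al * X t1 ^+ m1 * (gsval f).2) =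
  scalA p al * scalA p al^-1 * (X t1 ^+ m1 * (gsval f).2) by ring.
by rewrite sa mul1r => ->; ring.
Qed.

Lemma subline_exact : @short_exact k coh _ _ _ (elm u subv) (gmor wquoh).
Proof.
apply: short_exact_intro; split.
- move=> b f ->; rewrite subv_elh => /(Wm_sat k a s ij il jl).1/(congr1 (fun f : W => (gsval f).1)).
  rewrite gsvalZ gsval0 /= /GRing.scale /= e1E => E; apply: tors_in.
  apply: (@Xpow_reg _ _ t1 m1); have sa : scalA p al * scalA p al^-1 = 1 := scalA_unit p al0.
  rewrite -[LHS]mul1r -sa.
  have -> : scalA p al * scalA p al^-1 * (X t1 ^+ m1 * b) = scalA p al^-1 * (b * (scalA p al * X t1 ^+ m1)) by ring.
  by rewrite E mulr0.
- move=> b f q -> ->; apply: tors_in; rewrite subv_elh.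
  apply: (@Xpow_inj _ _ i (s i)); rewrite wquoE gsvalZ mulr0 /wedge /= /GRing.scale /=.
  by ring.
- move=> f q -> /(@saturated_OO k p u').1 hq; apply: tors_in.
  have [|h eh] := @subv_kernel f; first by rewrite -wquoE [wquo f]hq mulr0.
  by exists (h : A) => //; rewrite eh; exact/esym/subv_elh.
- move=> q.
  have gI := rimgT_gsub (gfrac wquoh).
  have Ej : wquo kj = e.1.
    by apply: (@Xpow_inj _ _ i (s i)); rewrite wquoE /wedge /= mulr0 subr0 mulrC.
  have El : wquo kl = e.2.
    by apply: (@Xpow_inj _ _ i (s i)); rewrite wquoE /wedge /= mulr0 sub0r mulrN opprK mulrC.
  have h t m (ga : k) (f : W) : ga != 0 -> wquo f = scalA p ga * X t ^+ m ->
      rimg (gfrac wquoh) setT (X t ^+ m *: q).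
    move=> ga0 ef; exists ((scalA p ga^-1 * q) *: f) => //; have := ghomZ wquoh (scalA p ga^-1 * q) f.
    have sg : scalA p ga * scalA p ga^-1 = 1 := scalA_unit p ga0.
    move=> E; suff : X t ^+ m *: q = wquoh ((scalA p ga^-1 * q) *: f) by [].
    rewrite E [wquoh f]ef /GRing.scale /= -[LHS]mul1r -sg; by ring.
  by apply: (tors2 gI t12 (m := m1) (n := m2)); [apply: (h _ _ al kj) | apply: (h _ _ be kl)];
    rewrite ?Ej ?El.
Qed.

(** A section would be a homogeneous element of W of degree - u'. Both coordinates then lie in
    components of negative level, so it is 0. *)
Lemma subline_nonsplit : llev (D1 - u') < 0 -> llev (D2 - u') < 0 -> ~ split_epi (gmor wquoh).
Proof.
move=> l1 l2 [f]; have [w hw ->] := sat_elm (Wm_sat k a s ij il jl) f.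
have -> : w = 0.
  rewrite -hw; apply: W_eq; rewrite W_hc gsval0 /=.
    exact: Ahomog_lev (Acomp_homog _ _) l1.
  exact: Ahomog_lev (Acomp_homog _ _) l2.
rewrite gmor_elm /=.
have -> : elm u' (wquo 0) = 0.
  apply/elm0; rewrite (_ : wquo 0 = 0) ?hc0; first exact: tors00.
  by apply: (@Xpow_inj _ _ i (s i)); rewrite wquoE gsval0 /wedge /= !mulr0 subr0.
move=> /esym; rewrite [qid _](_ : _ = qpi (fid _)) // => /qpi0E/(_ (1 : A) (1 : A) (erefl _)).
move=> /(@saturated_OO k p u').1 /eqP; by rewrite oner_eq0.
Qed.
End SubLine.

(** The scalars are those of the relation, which makes X_j^(s_j) e_1 + X_l^(s_l) e_2 a multiple of
    X_i^(p_i). This vector spans the sub line bundle O(ub1 a s) of W. *)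
Definition epsv : A * A := (scalA p (cc j) * X j ^+ (p j - s j), scalA p (cc l) * X l ^+ (p l - s l)).

Lemma cvec_minus t : cvec p - xvec p t *~ (s t)%:Z = xvec p t *~ (p t - s t)%N.
Proof. by rewrite (cvec_xvec p t); have /andP[_ /ltnW h] := hs t; rewrite -subzn // mulrzBr. Qed.

Lemma AhomogC (c : k) w (b : A) : Ahomog w b -> Ahomog w (scalA p c * b).
Proof. by move=> h; rewrite -[w]add0r; apply: AhomogM => //; exact: scalA_homog. Qed.

Lemma Xsplit t : X t ^+ s t * X t ^+ (p t - s t) = X t ^+ p t.
Proof. by rewrite -exprD subnKC //; have /andP[_ /ltnW] := hs t. Qed.

Lemma eps_in : dvdX i (s i) (X j ^+ s j * epsv.1 + X l ^+ s l * epsv.2).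
Proof.
rewrite /= mulrCA Xsplit mulrCA Xsplit.
have := XrelA k p ij il jl => E.
have -> : scalA p (cc j) * X j ^+ p j + scalA p (cc l) * X l ^+ p l = - (scalA p (cc i) * X i ^+ p i).
  by apply/eqP; rewrite -subr_eq0 opprK addrC addrA E.
by apply/dvdXN/dvdX_M/(@dvdX_le _ _ _ _ (p i)); [have /andP[_ /ltnW] := hs i | exact: dvdX_id].
Qed.

Lemma EB_W : EB a s W.
Proof.
have h1 : Ahomog (D1 - ub1 a s) epsv.1.
  have -> : D1 - ub1 a s = cvec p - xvec p j *~ (s j)%:Z by rewrite /ub1 /wd1; abel.
  by rewrite cvec_minus; apply/AhomogC/AhomogX.
have h2 : Ahomog (D2 - ub1 a s) epsv.2.
  have -> : D2 - ub1 a s = cvec p - xvec p l *~ (s l)%:Z by rewrite /ub1 /wd2; abel.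
  by rewrite cvec_minus; apply/AhomogC/AhomogX.
have hu : ub2 a = D1 + D2 - ub1 a s - xvec p i *~ (s i)%:Z.
  by rewrite /ub1 /ub2 /wd1 /wd2 (vtopE a s ij il jl); abel.
exists (elm _ (subv eps_in)), (gmor (wquoh h1 h2 eps_in hu)); split.
  by apply: (subline_exact (al := cc j) (be := cc l) h1 h2 eps_in hu (t1 := j) (t2 := l)) => //; exact: relc_neq0.
have hsi := hs i; have hsj := hs j; have hsl := hs l.
apply: subline_nonsplit.
  have -> : D1 - ub2 a = xvec p i *~ (s i)%:Z + xvec p j *~ 0 + xvec p l *~ (s l)%:Z + cvec p *~ (-1).
    by rewrite /ub2 /wd1 (vtopE a s ij il jl); abel.
  rewrite llev3 // !divz_box //; lia.
have -> : D2 - ub2 a = xvec p i *~ (s i)%:Z + xvec p j *~ (s j)%:Z + xvec p l *~ 0 + cvec p *~ (-1).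
  by rewrite /ub2 /wd2 (vtopE a s ij il jl); abel.
rewrite llev3 // !divz_box //; lia.
Qed.

(** [kapi] also spans a sub line bundle of W, namely O(bb a s i). Taken as the first term of an
    extension, it gives the same W with new data, in which s_i is kept and s_j, s_l are replaced by
    their complements. *)
Definition sflip t : nat := if t == i then s t else (p t - s t)%N.
Definition aflip : L := a + xvec p j *~ (s j)%:Z + xvec p l *~ (s l)%:Z - cvec p.

Lemma vflip : vtop aflip sflip = a + xvec p i *~ (s i)%:Z + cvec p.
Proof.
rewrite /vtop /xs (sum3 _ ij il jl) /sflip eqxx [j == i]eq_sym [l == i]eq_sym (negPf ij) (negPf il).
by rewrite -!cvec_minus /aflip; abel.
Qed.

Lemma EB_W_flip : EB aflip sflip W.
Proof.
have h1 : Ahomog (D1 - bb a s i) (wvec k p j l s).1 by rewrite addrC; exact: wvec1.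
have h2 : Ahomog (D2 - bb a s i) (wvec k p j l s).2 by rewrite addrC; exact: wvec2.
have hin : dvdX i (s i) (X j ^+ s j * (wvec k p j l s).1 + X l ^+ s l * (wvec k p j l s).2).
  exact: kapi_in.
have hu : ub2 aflip = D1 + D2 - bb a s i - xvec p i *~ (s i)%:Z.
  by rewrite /bb /ub2 /aflip /wd1 /wd2 (vtopE a s ij il jl); abel.
have e : ub1 aflip sflip = bb a s i by rewrite /ub1 vflip /bb; abel.
rewrite /EB e.
exists (elm _ (subv hin)), (gmor (wquoh h1 h2 hin hu)); split.
  apply: (subline_exact (al := 1) (be := -1) h1 h2 hin hu (t1 := l) (t2 := j)); rewrite ?oppr_eq0 ?oner_eq0 1?eq_sym //=.
    by rewrite scalA1 mul1r.
  by rewrite scalAN scalA1 mulN1r.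
have hsi := hs i; have hsj := hs j; have hsl := hs l.
apply: subline_nonsplit.
  have -> : D1 - ub2 aflip = xvec p i *~ (s i)%:Z + xvec p j *~ (- (s j)%:Z) + xvec p l *~ 0 + cvec p *~ 0.
    by rewrite /ub2 /aflip /wd1 (vtopE a s ij il jl); abel.
  rewrite llev3 // divz_box1 ?divz_box //; lia.
have -> : D2 - ub2 aflip = xvec p i *~ (s i)%:Z + xvec p j *~ 0 + xvec p l *~ (- (s l)%:Z) + cvec p *~ 0.
  by rewrite /ub2 /aflip /wd2 (vtopE a s ij il jl); abel.
rewrite llev3 // [(- _ %/ _)%Z]divz_box1 ?divz_box //; lia.
Qed.

Lemma sflip_box : sbox p sflip.
Proof. by move=> t; rewrite /sflip; case: ifP => _ //; have := hs t; lia. Qed.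
End Roles.
End ExtensionBundlesW.

(** * Presentations of extension bundles *)

Section BundleClassification.
Variables (k : fieldType) (p : weights).
Local Notation L := (Lgrp p).
Local Notation A := (coordA k p).
Local Notation X := (Xvar k p).
Local Notation grmod := (grmod k p).
Local Notation coh := (cohX k p).
Local Notation OO := (OO k).
Implicit Types (M N Q : grmod) (z d a : L) (E : coh).

Lemma OO_mor0 z z' (f : @Mor k coh (OO z) (OO z')) : llev (z' - z) < 0 -> f = 0.
Proof.
move=> hl; have [b hb ->] := OO_elm f; rewrite (Ahomog_lev hb hl).
by apply/elm0; rewrite hc0; exact: tors00.
Qed.

Lemma elh_OO z z' (b x : A) : Ahomog (z' - z) b -> elh z (b : OO z') x = b * x :> A.
Proof.
move=> hb; change ((x : A) *: hc (- z) (b : OO z') = b * x :> A); rewrite (OO_hc hb).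
exact: mulrC.
Qed.

Lemma OO_end z (f : @Mor k coh (OO z) (OO z)) : exists c : k, f = c *: idm _.
Proof.
have [b hb ->] := OO_elm f; have hb0 := hb; rewrite subrr in hb0; have [c ec] := Ahomog00 hb0; exists c.
rewrite [idm _](_ : _ = qpi (fid _)) // [RHS]qscaleE; apply: qpi_sym => x y ->.
exists (scalA p c *: (x : OO z)); first by exists x.
rewrite (elh_OO x hb) ec subrr; exact: tors00.
Qed.

Lemma idm_OO_neq0 z : idm (OO z : coh) <> 0.
Proof.
rewrite [idm _](_ : _ = qpi (fid _)) // => /qpi0E/(_ (1 : A) (1 : A) (erefl _)).
by move=> /(@saturated_OO k p z).1 /eqP; rewrite oner_eq0.
Qed.

Lemma OO_mono z z' (f : @Mor k coh (OO z) (OO z')) : f <> 0 -> mono f.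
Proof.
have [b hb ->] := OO_elm f => b0.
have {}b0 : b <> 0.
  by move=> e; apply: b0; apply/elm0; rewrite e hc0; exact: tors00.
apply/monoP => m n -> /(@saturated_OO k p z').1 E; apply: tors_in.
by apply: (homog_reg hb b0); rewrite -[LHS](elh_OO m hb).
Qed.

Lemma short_exact_idm M N Q (f : @Mor k coh M N) (g : @Mor k coh N Q) :
  short_exact f g -> compm g f = 0.
Proof. by case=> -[]. Qed.

Section Roles.
Variables (a : L) (s : 'I_3 -> nat).
Hypothesis hs : sbox p s.

Lemma lev_u1b t : llev (ub1 a s - bb a s t) = -1.
Proof.
have [j [l [ij il jl]]] := other2 t; have hj := hs j; have hl := hs l.
have -> : ub1 a s - bb a s t = xvec p t *~ 0 + xvec p j *~ (s j)%:Z + xvec p l *~ (s l)%:Z + cvec p *~ (-1).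
  by rewrite /ub1 /bb (vtopE _ _ ij il jl); abel.
by rewrite llev3 // ?div0z !divz_box //; lia.
Qed.

Lemma lev_u1a : llev (ub1 a s - a) = -1.
Proof.
have [j [l [ij il jl]]] := other2 0; have hi := hs 0; have hj := hs j; have hl := hs l.
have -> : ub1 a s - a = xvec p 0 *~ (s 0)%:Z + xvec p j *~ (s j)%:Z + xvec p l *~ (s l)%:Z + cvec p *~ (-1).
  by rewrite /ub1 (vtopE _ _ ij il jl); abel.
by rewrite llev3 // ?div0z !divz_box //; lia.
Qed.

Lemma lev_u12 : llev (ub2 a - ub1 a s) = -1.
Proof.
have [j [l [ij il jl]]] := other2 0; have hi := hs 0; have hj := hs j; have hl := hs l.
have -> : ub2 a - ub1 a s = xvec p 0 *~ (- (s 0)%:Z) + xvec p j *~ (- (s j)%:Z) + xvec p l *~ (- (s l)%:Z) + cvec p *~ 2.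
  by rewrite /ub1 /ub2 (vtopE _ _ ij il jl); abel.
by rewrite llev3 // !divz_box1 //; lia.
Qed.

Lemma EB_transport E E' : isomorphic E E' -> EB a s E -> EB a s E'.
Proof.
move=> [u [v [e1 e2]]] [f [g [h hn]]]; exists (compm u f), (compm g v); split.
  exact: short_exact_isom e1 e2 h.
by move=> [t et]; apply: hn; exists (compm v t); rewrite compA.
Qed.

Lemma kap_rel (i j l : 'I_3) (ij : i != j) (il : i != l) (jl : j != l) :
  compm (elm (bb a s i) (kapi k a s ij il jl)) (Xs k a s i) +
  (compm (elm (bb a s j) (kapj k a s ij il jl)) (Xs k a s j) +
   compm (elm (bb a s l) (kapl k a s ij il jl)) (Xs k a s l)) = 0.
Proof.
have hX t : Ahomog (bb a s t - a) (X t ^+ s t).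
  have -> : bb a s t - a = xvec p t *~ (s t)%:Z by rewrite /bb; abel.
  exact: AhomogX.
rewrite /Xs !comp_elmA ?hX // kapi_hc kapj_hc kapl_hc -!elmD; apply/elm0.
suff -> : X i ^+ s i *: kapi k a s ij il jl + (X j ^+ s j *: kapj k a s ij il jl + X l ^+ s l *: kapl k a s ij il jl) = 0.
  by rewrite hc0; exact: tors00.
by apply: W_eq; rewrite ?W1 ?W2 gsval0 /=; ring.
Qed.

(** The three generators of W map to O(ub2 a) and lift to E, as Ext^1(O(bb a s t), O(ub1 a s)) = 0.
    The lifts satisfy the relation because Hom(O(a), O(ub1 a s)) = 0. The resulting map W -> E
    induces the identity on the quotients and a scalar c on the subobjects. *)
Lemma EB_iso (i j l : 'I_3) (ij : i != j) (il : i != l) (jl : j != l) E :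
  EB a s E -> isomorphic (Wm k a s ij il jl) E.
Proof.
move=> [f [g [hfg hn]]].
have [f0 [g0 [h0 hn0]]] := @EB_W k p i j l a s ij il jl hs.
have lft t (c : @Mor k coh (OO (bb a s t)) (OO (ub2 a))) : exists b, compm g b = c.
  by apply: (lift_h1 c hfg); apply: h1v_OO; rewrite lev_u1b.
have [ei Ei] := lft i (compm g0 (elm (bb a s i) (kapi k a s ij il jl))).
have [ej Ej] := lft j (compm g0 (elm (bb a s j) (kapj k a s ij il jl))).
have [el El] := lft l (compm g0 (elm (bb a s l) (kapl k a s ij il jl))).
have [[gf K] [_ C]] := hfg; have [[gf0 K0] [_ C0]] := h0.
have Z : compm ei (Xs k a s i) + (compm ej (Xs k a s j) + compm el (Xs k a s l)) = 0.
  set x := (X in X = 0); have [|u [hu _]] := K _ x.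
    by rewrite /x !compDr !compA Ei Ej El -!compA -!compDr kap_rel comp0r.
  by rewrite -hu (@OO_mor0 _ _ u) ?comp0r // lev_u1a.
have [phi [P1 P2 P3]] := W_out ij il jl Z.
have gp : compm g phi = g0 by apply: W_out_eq; rewrite -compA ?P1 ?P2 ?P3.
have epi0 := cokernel_epi h0.2; have mon := kernel_mono hfg.1.
have [|la [hla _]] := K _ (compm phi f0); first by rewrite compA gp.
have [c ec] := OO_end la.
(* For c = 0 the map would factor through the quotient O(ub2 a) of W and give a section of g. *)
have c0 : c != 0.
  apply/eqP => c0; have [|psi [hpsi _]] := C0 _ phi; first by rewrite -hla ec c0 scale0r comp0r.
  apply: hn; exists psi; apply/eqP; rewrite -subr_eq0; apply/eqP; apply: epi0.
  by rewrite compBl comp1f -compA hpsi gp subrr.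
exists phi; apply: mono_epi_iso => W h eh.
  have [|u [hu _]] := K0 _ h; first by rewrite -gp -compA eh comp0r.
  have E0 : compm f (c *: u) = 0.
    by rewrite -[u]comp1f -compZl -ec compA hla -compA hu.
  have := mono0 mon E0 => /eqP; rewrite scaler_eq0 (negPf c0) /= => /eqP u0.
  by rewrite -hu u0 comp0r.
have [|y [hy _]] := C _ h.
  have : compm h (compm f la) = 0 by rewrite hla compA eh comp0l.
  rewrite ec compZr compf1 compZr => /eqP; by rewrite scaler_eq0 (negPf c0) => /eqP.
have y0 : y = 0 by apply: epi0; rewrite -gp compA hy.
by rewrite -hy y0 comp0l.
Qed.
End Roles.

Lemma EB_uniq a s E E' : sbox p s -> EB a s E -> EB a s E' -> isomorphic E E'.
Proof.
move=> hs h h'; have [j [l [ij il jl]]] := other2 0.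
exact: iso_trans (iso_sym (EB_iso hs ij il jl h)) (EB_iso hs ij il jl h').
Qed.

Lemma EB_flip (i j l : 'I_3) a s E : i != j -> i != l -> j != l -> sbox p s ->
  EB a s E -> EB (aflip j l a s) (sflip p i s) E.
Proof.
move=> ij il jl hs h; apply: EB_transport (EB_iso hs ij il jl h) _.
exact: EB_W_flip.
Qed.

(** If g vanishes on one summand, it is an isomorphism on the other and splits. Otherwise g is a
    monomorphism on both; but O(ub1 a s) -> O(d_t) -> O(ub2 a) is 0, since there are no nonzero maps
    between the ends, and so f = 0. *)
Lemma EB_not_biproduct a s E d1 d2 : sbox p s -> EB a s E ->
  @is_biproduct k coh E (OO d1) (OO d2) -> False.
Proof.
move=> hs [f [g [hfg hn]]] [i1 [i2 [p1 [p2 [e11 e22 e12 e21 e]]]]].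
have gf := short_exact_idm hfg.
have V (x : @Mor k coh (OO (ub1 a s)) (OO (ub2 a))) : x = 0 by apply: OO_mor0; rewrite lev_u12.
have fN : f <> 0.
  move=> f0; apply: (@idm_OO_neq0 (ub1 a s)); apply: (mono0 (kernel_mono hfg.1)).
  by rewrite f0 comp0l.
have epi := cokernel_epi hfg.2.
have key d d' (i1' : @Mor k coh (OO d) E) (i2' : @Mor k coh (OO d') E) p1' p2' :
    compm i1' p1' + compm i2' p2' = idm E -> compm g i1' = 0 -> False.
  move=> e' g1; have eg : g = compm (compm g i2') p2'.
    by rewrite -[LHS]compf1 -e' compDr !compA g1 comp0l add0r.
  have be : compm g i2' <> 0.
    move=> b0; apply: (@idm_OO_neq0 (ub2 a)); apply: epi; by rewrite comp1f eg b0 comp0l.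
  have [w [_ hw]] : is_iso (compm g i2').
    apply: mono_epi_iso => W h; first exact: (mono0 (OO_mono be)).
    by move=> eh; apply: epi; rewrite eg compA eh comp0l.
  by apply: hn; exists (compm i2' w); rewrite compA.
have [a0|aN] := pselect (compm g i1 = 0); first exact: key e a0.
have [b0|bN] := pselect (compm g i2 = 0); first by apply: (key _ _ i2 i1 p2 p1) b0; rewrite addrC.
apply: fN; rewrite -[f]comp1f -e compDl -!compA.
have -> : compm p1 f = 0 by apply: (mono0 (OO_mono aN)); exact: V.
have -> : compm p2 f = 0 by apply: (mono0 (OO_mono bN)); exact: V.
by rewrite !comp0r addr0.
Qed.

Definition isEB E := exists a s, sbox p s /\ EB a s E.

Lemma isEB_iso E E' : isomorphic E E' -> isEB E -> isEB E'.
Proof. by move=> h [a [s [hs he]]]; exists a, s; split=> //; exact: EB_transport he. Qed.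

Lemma shift_shift M (x y : L) : @isomorphic k coh (shift (shift M x) y) (shift M (x + y)).
Proof.
pose f := @GHom k p (shift (shift M x) y) (shift M (x + y)) id (fun _ _ _ => erefl)
  (fun z u => congr1 (fun w => hc w (u : M)) (addrA x y z)).
exists (gmor f); apply: iso_gmor => [m e|n]; first exact: tors_in.
by apply: tors_in; exists n.
Qed.

Lemma extension_bundle_EB E : extension_bundle E -> isEB E.
Proof.
move=> [y [x [h0 hx [f [g [hfg hn]]]]]]; have [l [hl ex]] := Lle_box h0 hx.
pose s t := (p t - 1 - l t)%N; pose a := y + x - cvec p.
have hs : sbox p s by move=> t; rewrite /s; have := hl t; lia.
exists a, s; split=> //.
have e1 : ub1 a s = y + omega p.
  have E0 : xs p (fun t => (s t)%:Z) = cvec p *+ 3 - \sum_i xvec p i - x.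
    have -> : cvec p *+ 3 = \sum_(t < 3) cvec p by rewrite sumr_const card_ord.
    rewrite ex /xs -!sumrB; apply: eq_bigr => t _.
    have -> : (s t)%:Z = (p t)%:Z - 1 - (l t)%:Z by rewrite /s; have := hl t; lia.
    by rewrite !mulrzBr mulr1z (cvec_xvec p t).
  by rewrite /ub1 /vtop E0 /a /omega mulrS mulrS mulrS mulr0n; abel.
have e2 : ub2 a = y + x by rewrite /ub2 /a; abel.
rewrite /EB e1 e2.
have [i1 hi1] := iso_sym (shift_shift (strA k p) y (omega p)).
have [i2 hi2] := shift_shift (strA k p) y x.
exists (compm f i1), (compm i2 g); split; first exact: short_exact_iso.
move=> [t et]; apply: hn; have [i3 [h3 h4]] := hi2; exists (compm t i2).
by rewrite -[g]comp1f -h3 -[compm (compm i3 i2) g]compA -compA [compm (compm i2 g) _]compA et comp1f.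
Qed.

Section DirectSum.
Variables M N : grmod.
Lemma ds_in1_lin (a : A) (u v : M) : ((a *: u + v, 0) : dsum M N) = a *: ((u, 0) : dsum M N) + (v, 0).
Proof. by rewrite [RHS](_ : _ = (a *: u + v, a *: 0 + 0)) // scaler0 addr0. Qed.
Lemma ds_in1_hc x (u : M) : ((hc x u, 0) : dsum M N) = hc x ((u, 0) : dsum M N).
Proof. by congr pair; rewrite hc0. Qed.
Definition ds_in1 : ghom M (dsum M N) := GHom ds_in1_lin ds_in1_hc.
Lemma ds_in2_lin (a : A) (u v : N) : ((0, a *: u + v) : dsum M N) = a *: ((0, u) : dsum M N) + (0, v).
Proof. by rewrite [RHS](_ : _ = (a *: 0 + 0, a *: u + v)) // scaler0 addr0. Qed.
Lemma ds_in2_hc x (u : N) : ((0, hc x u) : dsum M N) = hc x ((0, u) : dsum M N).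
Proof. by congr pair; rewrite hc0. Qed.
Definition ds_in2 : ghom N (dsum M N) := GHom ds_in2_lin ds_in2_hc.
Definition ds_out1 : ghom (dsum M N) M := @GHom k p (dsum M N) M fst (fun _ _ _ => erefl) (fun _ _ => erefl).
Definition ds_out2 : ghom (dsum M N) N := @GHom k p (dsum M N) N snd (fun _ _ _ => erefl) (fun _ _ => erefl).

Lemma gmor_compE (M1 M2 M3 : grmod) (g : ghom M2 M3) (f : ghom M1 M2) (h : frac M1 M3) :
  (forall m, h m (g (f m))) -> compm (gmor g) (gmor f) = qpi h.
Proof.
move=> H; apply: frac_gmor => m q ->; exists (g (f m)) => //; rewrite subrr; exact: tors00.
Qed.

Lemma dsum_biproduct : @is_biproduct k coh (dsum M N) M N.
Proof.
exists (gmor ds_in1), (gmor ds_in2), (gmor ds_out1), (gmor ds_out2); split.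
- exact: (gmor_compE (h := fid M)).
- exact: (gmor_compE (h := fid N)).
- exact: (gmor_compE (h := fzero N M)).
- exact: (gmor_compE (h := fzero M N)).
rewrite /gmor !compE qpiDE; apply: (qpi_sym (g := fid _)) => -[m n] q [q1 [q2 [[? -> ->] [? -> ->] ->]]].
exists (m, n) => //; apply: tors_in; have e1 : m + 0 - m = 0 by rewrite addr0 subrr.
have e2 : 0 + n - n = 0 by rewrite add0r subrr.
exact: etrans (congr1 (fun x => (x, _)) e1) (congr1 (fun x => (0, x)) e2).
Qed.
End DirectSum.

Lemma biproduct_iso M M' N Q : @isomorphic k coh M M' -> @is_biproduct k coh M N Q -> @is_biproduct k coh M' N Q.
Proof.
move=> [u [v [e1 e2]]] [i1 [i2 [p1 [p2 [h1 h2 h3 h4 h5]]]]].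
exists (compm u i1), (compm u i2), (compm p1 v), (compm p2 v).
have H Y Z (pp : @Mor k coh M Z) (ii : @Mor k coh Y M) : compm (compm pp v) (compm u ii) = compm pp ii.
  by rewrite -compA [compm v _]compA e1 comp1f.
rewrite !H; split=> //.
by rewrite -!compA -compDr ![compm _ (compm _ v)]compA -compDl h5 comp1f.
Qed.

(** S is presented as O(z)/X_i^n O(z), the form in which its Hilbert function is visible. Only the
    residue of z at i matters, by [SSm_iso]. *)
Definition isSS (i : 'I_3) (n : nat) z (S : coh) := exists g : @Mor k coh (OO z) S,
  short_exact (elm (z - xvec p i *~ n%:Z) (X i ^+ n : OO z)) g.
End BundleClassification.

(** * Counting *)

Section Cardinals.

(** Finite counts on arbitrary types: the submodules, vectors and morphisms counted here carry no
    finite type structure. *)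
Definition hcard (T : Type) (P : T -> Prop) (n : nat) := exists (F : finType) (f : F -> T),
  [/\ #|F| = n, injective f & forall x, P x <-> exists u, f u = x].

Lemma hcard_le (T T' : Type) (P : T -> Prop) (Q : T' -> Prop) m n (g : T -> T') :
  hcard P m -> hcard Q n -> (forall x, P x -> Q (g x)) ->
  (forall x y, P x -> P y -> g x = g y -> x = y) -> (m <= n)%N.
Proof.
move=> [F [f [<- fi fP]]] [G [h [<- hi hQ]]] gQ gi.
have H u : exists v, h v = g (f u) by apply/hQ/gQ/fP; exists u.
have [e he] := choice H; apply: (@leq_card _ _ e) => u v euv.
by apply: fi; apply: gi; [apply/fP; exists u | apply/fP; exists v | rewrite -!he euv].
Qed.

Lemma hcard_uniq (T : Type) (P : T -> Prop) m n : hcard P m -> hcard P n -> m = n.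
Proof.
by move=> h h'; apply/eqP; rewrite eqn_leq; apply/andP; split;
  [apply: (hcard_le (g := id) h h') | apply: (hcard_le (g := id) h' h)].
Qed.

Lemma hcard_iff (T : Type) (P Q : T -> Prop) n : (forall x, P x <-> Q x) -> hcard P n -> hcard Q n.
Proof.
by move=> e [F [f [h1 h2 h3]]]; exists F, f; split=> // x; rewrite -h3; split=> /e.
Qed.

Lemma hcard0 (T : Type) (P : T -> Prop) : (forall x, ~ P x) -> hcard P 0.
Proof.
move=> h; exists void, (fun u : void => match u with end); split; first exact: card_void.
  by case.
by move=> x; split=> [/h|[[]]].
Qed.

Lemma hcard1 (T : Type) (P : T -> Prop) x0 : (forall x, P x <-> x = x0) -> hcard P 1.
Proof.
move=> h; exists unit, (fun=> x0); split; [exact: card_unit | by case; case |].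
by move=> x; rewrite h; split=> [->|[_ ->]]; [exists tt|].
Qed.

Lemma hcard_im (T T' : Type) (P : T -> Prop) (g : T -> T') n :
  (forall x y, P x -> P y -> g x = g y -> x = y) -> hcard P n ->
  hcard (fun y => exists x, P x /\ y = g x) n.
Proof.
move=> gi [F [f [h1 h2 h3]]]; exists F, (g \o f); split=> //.
  by move=> u v /= e; apply: h2; apply: gi e; apply/h3; [exists u | exists v].
move=> y; split=> [[x [/h3[u <-] ->]]|[u <-]]; first by exists u.
by exists (f u); split=> //; apply/h3; exists u.
Qed.

Lemma hcard_sum (T : Type) (I : finType) (c : pred I) (P : I -> T -> Prop) (n : I -> nat) :
  (forall i, c i -> hcard (P i) (n i)) ->
  (forall i j x, c i -> c j -> P i x -> P j x -> i = j) ->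
  hcard (fun x => exists2 i, c i & P i x) (\sum_(i | c i) n i)%N.
Proof.
move=> h d.
have h' i : hcard (fun x => c i /\ P i x) (if c i then n i else 0%N).
  case: ifP => ci; last by apply: hcard0 => x [].
  by apply: hcard_iff (h i ci) => x; split=> [|[]].
pose F i := projT1 (cid (h' i)); pose HF i := projT2 (cid (h' i)).
pose f i := projT1 (cid (HF i)); pose Hf i := projT2 (cid (HF i)).
exists {i : I & F i}, (fun u => f (tag u) (tagged u)); split.
- rewrite card_tagged sumnE big_map big_enum /= [RHS]big_mkcond /=.
  by apply: eq_bigr => i _; case: (Hf i).
- move=> [i u] [j v] /= e; have [_ hi Hi] := Hf i; have [_ hj Hj] := Hf j.
  have [ci Pi] : c i /\ P i (f i u) by apply/Hi; exists u.
  have [cj Pj] : c j /\ P j (f j v) by apply/Hj; exists v.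
  have eij : i = j by apply: d ci cj Pi _; rewrite e.
  by subst j; congr Tagged; exact: hi.
- move=> x; split=> [[i ci Pi]|[[i u] /= <-]].
    have [_ _ Hi] := Hf i; have [u hu] := (Hi x).1 (conj ci Pi).
    by exists (Tagged F u).
  by have [_ _ Hi] := Hf i; have [] := (Hi (f i u)).2 (ex_intro _ u erefl); exists i.
Qed.

Lemma hcard_prod (T T' U : Type) (P : T -> Prop) (Q : T' -> Prop) (R : U -> Prop) (g : T -> T' -> U) m n :
  (forall x y x' y', P x -> Q y -> P x' -> Q y' -> g x y = g x' y' -> x = x' /\ y = y') ->
  (forall u, R u <-> exists x y, [/\ P x, Q y & u = g x y]) ->
  hcard P m -> hcard Q n -> hcard R (m * n).
Proof.
move=> gi hR [F [f [<- fi hF]]] [G [h [<- hi hG]]].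
have PF u : P (f u) by apply/hF; exists u.
have QG u : Q (h u) by apply/hG; exists u.
exists (F * G)%type, (fun u => g (f u.1) (h u.2)); split; first exact: card_prod.
  by move=> [a b] [a' b'] /= /gi[] // /fi -> /hi ->.
move=> u; rewrite hR; split=> [[x [y [/hF[a <-] /hG[b <-] ->]]]|[[a b] <-]]; first by exists (a, b).
by exists (f a), (h b).
Qed.
End Cardinals.

(** * The tree of lattices *)

Section Matrices.
Variables (k : fieldType) (p : weights) (i : 'I_3).
Local Notation L := (Lgrp p).
Local Notation A := (coordA k p).
Local Notation X := (Xvar k p).
Local Notation OO := (OO k).
Local Notation V d1 d2 := (dsum (OO d1) (OO d2)).
Implicit Types (d w : L) (e f : A * A).

Definition prim e := iunit i e.1 \/ iunit i e.2.

(** Residue 0 at i in both coordinates: e modulo X_i is then a point of P^1(k), and the wedge of two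
    such vectors is divisible by X_i^(p_i) as soon as it is divisible by X_i. *)
Record isvec d1 d2 w e : Prop := IsVec {
  vec1 : Ahomog (w + d1) e.1;
  vec2 : Ahomog (w + d2) e.2;
  vres1 : lres (w + d1) i = 0;
  vres2 : lres (w + d2) i = 0;
  vprim : prim e }.

Definition latA r e : set (A * A) := [set f | dvdX i r (wedge e f)].

Lemma wedgeC e f : wedge f e = - wedge e f.
Proof. by rewrite /wedge; ring. Qed.
Lemma dvd_wedgeC r e f : dvdX i r (wedge e f) -> dvdX i r (wedge f e).
Proof. by move=> h; rewrite wedgeC; exact: dvdXN. Qed.

(** The three-term relation between wedges expresses e_1 (f /\ g) and e_2 (f /\ g) by e /\ f and e
    /\ g, and one coordinate of e can be cancelled. *)
Lemma wedge_trans d1 d2 w r e f g : isvec d1 d2 w e ->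
  dvdX i r (wedge e f) -> dvdX i r (wedge e g) -> dvdX i r (wedge f g).
Proof.
move=> [h1 h2 _ _ [u|u]] hf hg.
  apply: (iunit_cancel h1 u).
  have -> : e.1 * wedge f g = f.1 * wedge e g - g.1 * wedge e f by rewrite /wedge; ring.
  by apply: dvdXB; exact: dvdX_M.
apply: (iunit_cancel h2 u).
have -> : e.2 * wedge f g = f.2 * wedge e g - g.2 * wedge e f by rewrite /wedge; ring.
by apply: dvdXB; exact: dvdX_M.
Qed.

Lemma lres_add0 (x y : L) : lres x i = 0 -> lres y i = 0 -> lres (x + y) i = 0.
Proof. by move=> hx hy; rewrite (Lnorm y) addrA lresDc lresD hx hy addr0 mod0z. Qed.
Lemma lres_opp0 (x : L) : lres x i = 0 -> lres (- x) i = 0.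
Proof.
move=> hx; rewrite (Lnorm x) opprD -mulrNz addrC xsN.
have -> : cvec p *~ (- llev x) + xs p (fun t => - lres x t) = xs p (fun t => - lres x t) + cvec p *~ (- llev x).
  by rewrite addrC.
by rewrite lresDc lres_xs hx oppr0 mod0z.
Qed.

(** After division by X_i^m with 0 < m < p_i the degree has residue p_i - m > 0, which forces one
    more factor X_i. *)
Lemma dvdX_res w (a : A) : Ahomog w a -> lres w i = 0 -> dvdX i 1 a -> dvdX i (p i) a.
Proof.
move=> ha hr h1.
suff H m : (m < p i)%N -> dvdX i m.+1 a.
  by have := H (p i).-1; have := wt_ge2 p i; case: (p i : nat) => // n _; apply; lia.
elim: m => [//|m IH] hm; have [|b hb] := IH; first lia.
have hbw : Ahomog (w - xvec p i *~ m.+1%:Z) b by apply: Ahomog_divX; rewrite -hb.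
have [c hc] : dvdX i 1 b.
  apply: (Ahomog_dvdX hbw); rewrite -mulrNz lresDx eqxx hr add0r.
  have -> : - m.+1%:Z = -1 * (p i)%:Z + ((p i)%:Z - m.+1%:Z) by lia.
  by rewrite modzMDl modz_small; lia.
by exists c; rewrite hb hc expr1 mulrA -exprSr.
Qed.

Lemma wedge_homog d1 d2 w w' e f : isvec d1 d2 w e -> isvec d1 d2 w' f ->
  Ahomog (w + w' + d1 + d2) (wedge e f).
Proof.
move=> [h1 h2 _ _ _] [h1' h2' _ _ _]; apply: AhomogD.
  by rewrite (_ : w + w' + d1 + d2 = (w + d1) + (w' + d2)); [exact: AhomogM | by abel].
by apply: AhomogN; rewrite (_ : w + w' + d1 + d2 = (w + d2) + (w' + d1)); [exact: AhomogM | by abel].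
Qed.

Lemma wedge_res d1 d2 w w' e f : isvec d1 d2 w e -> isvec d1 d2 w' f ->
  dvdX i 1 (wedge e f) -> dvdX i (p i) (wedge e f).
Proof.
move=> he hf; apply: dvdX_res (wedge_homog he hf) _.
have -> : w + w' + d1 + d2 = (w + d1) + (w' + d2) by abel.
by apply: lres_add0; [exact: vres1 he | exact: vres2 hf].
Qed.

Lemma latA_eq d1 d2 w w' r e f : isvec d1 d2 w e -> isvec d1 d2 w' f ->
  dvdX i r (wedge e f) -> latA r e = latA r f.
Proof.
move=> he hf h; apply/seteqP; split=> g /= hg; first exact: wedge_trans he h hg.
exact: wedge_trans hf (dvd_wedgeC h) hg.
Qed.

(** The matrix with columns c1, c2. When its determinant is X_i^R up to a scalar and its columns are
    proportional to l modulo X_i^R, it identifies O(d1') (+) O(d2') with the lattice of exponent R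
    along l. *)
Definition thmx (c1 c2 f : A * A) : A * A := (c1.1 * f.1 + c2.1 * f.2, c1.2 * f.1 + c2.2 * f.2).

Lemma wedge_thmx c1 c2 f g : wedge (thmx c1 c2 f) (thmx c1 c2 g) = wedge c1 c2 * wedge f g.
Proof. by rewrite /wedge /thmx /=; ring. Qed.

Section Theta.
Variables (d1 d2 d1' d2' : L) (c1 c2 : A * A) (R : nat) (nu : k).
Hypotheses (h11 : Ahomog (d1 - d1') c1.1) (h12 : Ahomog (d2 - d1') c1.2)
  (h21 : Ahomog (d1 - d2') c2.1) (h22 : Ahomog (d2 - d2') c2.2)
  (hdet : wedge c1 c2 = scalA p nu * X i ^+ R) (nu0 : nu != 0).
Local Notation th := (thmx c1 c2).

Lemma th_lin (b : A) (f g : V d1' d2') : (th (b *: f + g) : V d1 d2) = b *: (th f : V d1 d2) + th g.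
Proof. by congr pair; rewrite /= /GRing.scale /=; ring. Qed.

Lemma th_homog1 x (f : A * A) (d d' dd : L) a b : Ahomog (dd - d) a -> Ahomog (dd - d') b ->
  a * Acomp (d + x) f.1 + b * Acomp (d' + x) f.2 = Acomp (dd + x) (a * f.1 + b * f.2).
Proof.
move=> ha hb; rewrite A_hcD; congr (_ + _).
  by rewrite -(AcompM _ _ ha); congr Acomp; abel.
by rewrite -(AcompM _ _ hb); congr Acomp; abel.
Qed.

Lemma th_hc x (f : V d1' d2') : (th (hc x f) : V d1 d2) = hc x (th f : V d1 d2).
Proof. by congr pair; exact: th_homog1. Qed.
Definition thh : ghom (V d1' d2') (V d1 d2) := GHom th_lin th_hc.

Lemma scalK (c : k) (a : A) : c != 0 -> scalA p c^-1 * (scalA p c * a) = a.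
Proof. by move=> h; rewrite mulrA [X in X * _]mulrC scalA_unit // mul1r. Qed.

Lemma det_reg a : wedge c1 c2 * a = 0 -> a = 0.
Proof.
rewrite hdet => E; apply: (@Xpow_reg _ _ i R).
by rewrite -[LHS](scalK _ nu0) [X in _ * X]mulrA E mulr0.
Qed.

Lemma th_inj : injective th.
Proof.
move=> f g e; have H u : wedge c1 c2 * (wedge u f - wedge u g) = 0.
  by rewrite mulrBr -!wedge_thmx e subrr.
have h1 := det_reg (H (0, 1)); have h2 := det_reg (H (1, 0)).
rewrite /wedge /= in h1 h2.
have e1 : f.1 = g.1.
  by apply/eqP; rewrite -subr_eq0 -oppr_eq0 -[X in _ == X]h1; apply/eqP; ring.
have e2 : f.2 = g.2 by apply/eqP; rewrite -subr_eq0 -[X in _ == X]h2; apply/eqP; ring.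
by rewrite [f]surjective_pairing e1 e2 -surjective_pairing.
Qed.

Section Line.
Variables (l : A * A) (wl : L).
Hypotheses (hl : isvec d1 d2 wl l) (hl1 : dvdX i R (wedge l c1)) (hl2 : dvdX i R (wedge l c2)).

(** Cramer's rule; the numerators are divisible by X_i^R because f, c1 and c2 are all proportional
    to l modulo X_i^R. *)
Lemma th_cramer f : dvdX i R (wedge l f) -> exists2 f', f = th f' &
  scalA p nu * X i ^+ R * f'.1 = wedge f c2 /\ scalA p nu * X i ^+ R * f'.2 = wedge c1 f.
Proof.
move=> hf; have [x ex] := wedge_trans hl hf hl2; have [y ey] := wedge_trans hl hl1 hf.
have Ex a : scalA p nu * X i ^+ R * (scalA p nu^-1 * a) = X i ^+ R * a.
  have := scalA_unit p nu0; move: (scalA p nu) (scalA p nu^-1) (X i ^+ R) => s s' t h.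
  by rewrite [LHS](_ : _ = s * s' * (t * a)); [rewrite h mul1r | ring].
exists (scalA p nu^-1 * x, scalA p nu^-1 * y); last by rewrite /= !Ex ex ey.
have H u : wedge c1 c2 * u.1 = wedge f c2 * c1.1 + wedge c1 f * c2.1 ->
  wedge c1 c2 * u.2 = wedge f c2 * c1.2 + wedge c1 f * c2.2 ->
  u = th (scalA p nu^-1 * x, scalA p nu^-1 * y).
  rewrite ex ey -!(Ex x) -!(Ex y) -hdet => H1 H2; rewrite [u]surjective_pairing /thmx /=.
  by congr pair; apply/eqP; rewrite -subr_eq0; apply/eqP; apply: det_reg; rewrite mulrBr ?H1 ?H2; ring.
by apply: H; rewrite /wedge; ring.
Qed.

Lemma th_in f : dvdX i R (wedge l (th f)).
Proof.
have -> : wedge l (th f) = f.1 * wedge l c1 + f.2 * wedge l c2 by rewrite /wedge /thmx /=; ring.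
by apply: dvdXD; exact: dvdX_M.
Qed.

Lemma latA_range : latA R l = range th.
Proof.
apply/seteqP; split=> [f /th_cramer[f' -> _]|f [f' _ <-]]; first by exists f'.
exact: th_in.
Qed.

Hypotheses (r1 : lres (d1 - d1') i = 0) (r2 : lres (d2 - d2') i = 0).

(** A vector in the direction of l is carried to the next vertex; the determinant X_i^R accounts for
    the drop of the exponent from R + r to r. *)
Lemma lat_step w e r : isvec d1 d2 w e -> dvdX i R (wedge e l) ->
  exists e', [/\ isvec d1' d2' w e', prim (th e'), e = th e' & latA (R + r) e = th @` latA r e'].
Proof.
move=> he hel; have [e' ee [E1 E2]] := th_cramer (dvd_wedgeC hel).
have hp : prim (th e') by rewrite -ee; exact: vprim he.
have H a x : Ahomog x (scalA p nu * X i ^+ R * a) -> Ahomog (x - xvec p i *~ R%:Z) a.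
  move=> h; apply: Ahomog_divX; rewrite -[X in Ahomog _ X](scalK _ nu0) [X in _ * X]mulrA.
  by rewrite -[x]add0r; apply: AhomogM => //; exact: scalA_homog.
have [h1 h2 q1 q2 pe] := he.
(* The determinant is nonzero and homogeneous of both degrees, so the two degrees agree. *)
have dR : d1 + d2 - d1' - d2' - xvec p i *~ R%:Z = 0 \/ wedge c1 c2 = 0.
  have [|hN] := pselect (wedge c1 c2 = 0); [by right | left].
  have hd : Ahomog (d1 + d2 - d1' - d2') (wedge c1 c2).
    apply: AhomogD.
      by rewrite (_ : d1 + d2 - d1' - d2' = d1 - d1' + (d2 - d2')); [exact: AhomogM | by abel].
    by apply: AhomogN; rewrite (_ : d1 + d2 - d1' - d2' = d2 - d1' + (d1 - d2')); [exact: AhomogM | by abel].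
  have hd' : Ahomog (xvec p i *~ R%:Z) (wedge c1 c2).
    by rewrite hdet -[_ *~ _]add0r; apply: AhomogM; [exact: scalA_homog | exact: AhomogX].
  have [e0|ne] := eqVneq (xvec p i *~ R%:Z) (d1 + d2 - d1' - d2'); first by rewrite e0 subrr.
  have : Acomp (d1 + d2 - d1' - d2') (Acomp (xvec p i *~ R%:Z) (wedge c1 c2)) = 0.
    by rewrite A_hc_hc eq_sym (negPf ne).
  by rewrite (AhomogP _ _).1 // (AhomogP _ _).1.
have {}dR : d1 + d2 - d1' - d2' = xvec p i *~ R%:Z.
  case: dR => [/eqP|e0]; first by rewrite subr_eq0 => /eqP.
  by have := @det_reg 1; rewrite e0 mul0r => /(_ erefl)/eqP; rewrite oner_eq0.
have w1 : Ahomog (w + d1') e'.1.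
  have -> : w + d1' = (w + d1) + (d2 - d2') - xvec p i *~ R%:Z by rewrite -dR; abel.
  apply: H; rewrite E1; apply: AhomogD; first exact: AhomogM.
  apply: AhomogN; have -> : w + d1 + (d2 - d2') = w + d2 + (d1 - d2') by abel.
  exact: AhomogM.
have w2 : Ahomog (w + d2') e'.2.
  have -> : w + d2' = (d1 - d1') + (w + d2) - xvec p i *~ R%:Z by rewrite -dR; abel.
  apply: H; rewrite E2; apply: AhomogD; first exact: AhomogM.
  apply: AhomogN; have -> : d1 - d1' + (w + d2) = d2 - d1' + (w + d1) by abel.
  exact: AhomogM.
exists e'; split=> //.
- split=> //.
  + by rewrite (_ : w + d1' = w + d1 - (d1 - d1')); [by apply: lres_add0 => //; exact: lres_opp0 | by abel].
  + by rewrite (_ : w + d2' = w + d2 - (d2 - d2')); [by apply: lres_add0 => //; exact: lres_opp0 | by abel].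
  + have [u1|] := pselect (iunit i e'.1); first by left.
    move=> /contrapT v1; right=> v2; case: hp; apply => /=; apply: dvdXD; exact: dvdX_M.
- apply/seteqP; split=> [f hf|f [f' hf <-]].
    have hf' : dvdX i R (wedge e f) by apply: dvdX_le hf; exact: leq_addr.
    have [f' ef _] := th_cramer (wedge_trans he hel hf').
    exists f' => //; move: hf; rewrite /latA /= ee ef wedge_thmx hdet -mulrA.
    by move=> /(dvdX_scal nu0)/dvdXE.
  rewrite /latA /= ee wedge_thmx hdet -mulrA; apply: dvdX_M; exact/dvdXE.
Qed.

(** Converse of [lat_step]. Primitivity of the image is the condition that the path does not turn
    back. *)
Lemma lat_unstep w e' r : isvec d1' d2' w e' -> prim (th e') ->
  [/\ isvec d1 d2 w (th e'), dvdX i R (wedge (th e') l) & latA (R + r) (th e') = th @` latA r e'].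
Proof.
move=> he hp; have [h1 h2 q1 q2 pe] := he.
have Q1 : lres (w + d1) i = 0 by rewrite (_ : w + d1 = w + d1' + (d1 - d1')); [exact: lres_add0 | by abel].
have Q2 : lres (w + d2) i = 0 by rewrite (_ : w + d2 = w + d2' + (d2 - d2')); [exact: lres_add0 | by abel].
have hv : isvec d1 d2 w (th e').
  split=> //; apply: AhomogD.
  - by rewrite (_ : w + d1 = d1 - d1' + (w + d1')); [exact: AhomogM | by abel].
  - by rewrite (_ : w + d1 = d1 - d2' + (w + d2')); [exact: AhomogM | by abel].
  - by rewrite (_ : w + d2 = d2 - d1' + (w + d1')); [exact: AhomogM | by abel].
  - by rewrite (_ : w + d2 = d2 - d2' + (w + d2')); [exact: AhomogM | by abel].
have hd : dvdX i R (wedge (th e') l) by apply: dvd_wedgeC; exact: th_in.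
split=> //; have [e2 [_ _ ee ->]] := lat_step r hv hd.
by rewrite -(th_inj ee).
Qed.
End Line.
End Theta.
End Matrices.

Lemma ord3_eq (t i j l : 'I_3) : i != j -> i != l -> j != l -> [\/ t = i, t = j | t = l].
Proof.
move=> ij il jl; suff : [|| t == i, t == j | t == l].
  by case/or3P => /eqP; [exact: Or31 | exact: Or32 | exact: Or33].
move: ij il jl; rewrite -!val_eqE /=; have := (ltn_ord t, ltn_ord i, ltn_ord j, ltn_ord l).
by move=> [[[]]]; lia.
Qed.

Section LatticeCount.
Variables (k : finFieldType) (p : weights) (i j l : 'I_3).
Hypotheses (ij : i != j) (il : i != l) (jl : j != l).
Local Notation L := (Lgrp p).
Local Notation A := (coordA k p).
Local Notation X := (Xvar k p).
Local Notation grmod := (grmod k p).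
Local Notation coh := (cohX k p).
Local Notation OO := (OO k).
Local Notation V d1 d2 := (dsum (OO d1) (OO d2)).
Local Notation isvec := (isvec i).
Local Notation primi := (prim i).
Local Notation latAi := (latA i).
Implicit Types (d w : L) (e f : A * A).

Definition ebset (M : grmod) (U : set M) := exists gU : is_gsub U, isEB (gsubm gU).

Section ImageSub.
Variables (M N : grmod) (f : ghom M N).
Hypothesis fi : injective f.

Lemma gimg_gsub (U : set M) : is_gsub U -> is_gsub (f @` U).
Proof.
move=> gU; split; first by exists 0; [exact: gsub0 gU | exact: ghom0].
  by move=> a _ _ [u hu <-] [v hv <-]; exists (a *: u + v); [exact: gsub_lin gU _ _ _ hu hv | rewrite ghom_lin].
by move=> x _ [u hu <-]; exists (hc x u); [exact: gsub_hc gU _ _ hu | rewrite ghom_hc].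
Qed.

Lemma gpreim_gsub (U : set M) : is_gsub (f @` U) -> is_gsub U.
Proof.
move=> gU; have H u : (f @` U) (f u) -> U u by move=> [v hv /fi <-].
split; first by apply: H; rewrite ghom0; exact: gsub0 gU.
  by move=> a u v hu hv; apply: H; rewrite ghom_lin; apply: (gsub_lin gU); [exists u | exists v].
by move=> x u hu; apply: H; rewrite ghom_hc; apply: (gsub_hc gU); exists u.
Qed.

Lemma gimg_iso (U : set M) (gU : is_gsub U) (gV : is_gsub (f @` U)) :
  @isomorphic k coh (gsubm gU) (gsubm gV).
Proof.
have hin (u : gsubm gU) : (f @` U) (f (gsval u)) by exists (gsval u) => //; exact: gsvalR.
pose g (u : gsubm gU) : gsubm gV := mksub gV (hin u).
have gl (a : A) u v : g (a *: u + v) = a *: g u + g v.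
  by apply: gsval_inj; rewrite gsvalD gsvalZ; exact: ghom_lin.
have gh x u : g (hc x u) = hc x (g u).
  by apply: gsval_inj; rewrite gsval_shc /= ghom_hc.
exists (gmor (GHom gl gh)); apply: iso_gmor => [u e|v].
  have := congr1 (fun z : gsubm gV => gsval z) e; rewrite gsval0 /= -(ghom0 f) => /fi e'.
  by apply: tors_in; apply: gsval_inj; rewrite e' gsval0.
have [u hu ev] := gsvalR v.
by apply: tors_in; exists (mksub gU hu) => //; apply: gsval_inj.
Qed.

Lemma ebset_img (U : set M) : ebset U <-> ebset (f @` U).
Proof.
split=> -[gU h].
  by exists (gimg_gsub gU); apply: isEB_iso h; exact: gimg_iso.
exists (gpreim_gsub gU); apply: isEB_iso h; apply: iso_sym; exact: gimg_iso.
Qed.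
End ImageSub.

(** The end points of the paths that leave V along the line n. The exponent r counts powers of X_i,
    so that p_i units make one edge of the tree. *)
Definition Fam d1 d2 (n : A * A) r (U : set (A * A)) :=
  exists w e, [/\ isvec d1 d2 w e, dvdX i 1 (wedge e n) & U = latAi r e].

Definition cntr d1 d2 n r c := hcard (fun U => Fam d1 d2 n r U /\ ebset (U : set (V d1 d2))) c.

(** Modulo X_i a homogeneous component of A is at most a line over k, spanned by a monomial. For
    this reason the lines at a vertex are parametrized by k and one further point. *)
Lemma modline w (a b : A) : Ahomog w a -> Ahomog w b -> iunit i a -> exists c : k, dvdX i 1 (scalA p c * a - b).
Proof.
move=> ha hb ua; have [hr hl [c [c0 hc]]] := iunit_mod ij il jl ha ua.
have [d hd] := Ahomog_mod ij il jl hb hr hl; exists (d * c^-1).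
have -> : scalA p (d * c^-1) * a - b = scalA p (d * c^-1) * (a - scalA p c * Amono k w j l) - (b - scalA p d * Amono k w j l).
  rewrite mulrBr mulrA -scalAM -mulrA mulVf // mulr1.
  by move: (scalA p d * _) => z; ring.
by apply: dvdXB => //; apply: dvdX_M.
Qed.

Section Lines.
Variables (d1 d2 w0 : L) (g1 g2 : A).
Hypotheses (hg1 : Ahomog (w0 + d1) g1) (hg2 : Ahomog (w0 + d2) g2)
  (q1 : lres (w0 + d1) i = 0) (q2 : lres (w0 + d2) i = 0) (u1 : iunit i g1) (u2 : iunit i g2).

(** The q + 1 points of P^1(k), in coordinates adapted to the vertex by g1 and g2: [Some 0] is the
    first axis and [None] the second. *)
Definition line (io : option k) : A * A := if io is Some c then (g1, scalA p c * g2) else (0, 1).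

Lemma line_vec io : exists w, isvec d1 d2 w (line io).
Proof.
case: io => [c|]; [exists w0 | exists (- d2)]; split=> //=.
- by rewrite -[w0 + d2]add0r; apply: AhomogM => //; exact: scalA_homog.
- by left.
- exact: Ahomog0.
- by rewrite addNr; exact: Ahomog1.
- rewrite (_ : - d2 + d1 = w0 + d1 - (w0 + d2)); last by abel.
  by apply: lres_add0 => //; exact: lres_opp0.
- by rewrite addNr lres0.
- by right; exact: dvdX1N.
Qed.

Lemma line_class w e : isvec d1 d2 w e -> exists io, dvdX i 1 (wedge e (line io)).
Proof.
move=> [h1 h2 r1 r2 pe]; have [ue|/contrapT de] := pselect (iunit i e.1); last first.
  by exists None; rewrite /wedge /= mulr1 mulr0 subr0.
have [|||c hc] := @modline (w + d1 + (w0 + d2)) (e.1 * g2) (e.2 * g1).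
- exact: AhomogM.
- rewrite (_ : w + d1 + (w0 + d2) = w + d2 + (w0 + d1)); [exact: AhomogM | by abel].
- exact: iunitM h1 hg2 ue u2.
by exists (Some c); rewrite /wedge /= mulrCA.
Qed.

Lemma line_uniq w e io io' : isvec d1 d2 w e -> dvdX i 1 (wedge e (line io)) ->
  dvdX i 1 (wedge e (line io')) -> io = io'.
Proof.
move=> [h1 h2 r1 r2 pe].
have NS c : dvdX i 1 (wedge e (line None)) -> dvdX i 1 (wedge e (line (Some c))) -> False.
  rewrite /wedge /= mulr1 mulr0 subr0 => v1 v2; case: pe => [//|]; apply.
  apply: (iunit_cancel hg1 u1).
  rewrite (_ : g1 * e.2 = (scalA p c * g2) * e.1 - (e.1 * (scalA p c * g2) - e.2 * g1)); last by ring.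
  by apply: dvdXB => //; exact: dvdX_M.
case: io io' => [c|] [c'|] // => [v v'|v /NS/(_ v) //|/NS v /v //].
congr Some; apply/eqP; rewrite -subr_eq0; apply/negP => /negP cc.
have ue : iunit i e.1 by move=> v1; apply: (NS c) => //; rewrite /wedge /= mulr1 mulr0 subr0.
have := iunitM h1 hg2 ue u2; apply; apply: (dvdX_scal cc).
rewrite scalAD scalAN.
rewrite (_ : _ * _ = wedge e (line (Some c)) - wedge e (line (Some c'))); first exact: dvdXB.
by rewrite /wedge /=; ring.
Qed.

Lemma Fam_disj io io' r U : (0 < r)%N -> Fam d1 d2 (line io) r U -> Fam d1 d2 (line io') r U -> io = io'.
Proof.
move=> r0 [w [e [he h1 ->]]] [w' [e' [he' h1' E]]].
have hee : dvdX i 1 (wedge e e').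
  suff : latAi r e e' by apply: dvdX_le.
  by rewrite E /= /latA /= /wedge mulrC subrr; exact: dvdX0.
apply: (line_uniq he h1); exact: wedge_trans he' (dvd_wedgeC hee) h1'.
Qed.
End Lines.

Record thdata d1 d2 d1' d2' (c1 c2 : A * A) (R : nat) (nu : k) (n : A * A) : Prop := ThData {
  td11 : Ahomog (d1 - d1') c1.1;
  td12 : Ahomog (d2 - d1') c1.2;
  td21 : Ahomog (d1 - d2') c2.1;
  td22 : Ahomog (d2 - d2') c2.2;
  tddet : wedge c1 c2 = scalA p nu * X i ^+ R;
  tdnu : nu != 0;
  tdn1 : dvdX i R (wedge n c1);
  tdn2 : dvdX i R (wedge n c2) }.

(** One edge of the tree: the lattice of exponent p_i along n is the image of O(d1') (+) O(d2'), and
    its lines other than [back] are the ways to continue. Distinct lines lead to disjoint families,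
    so the counts add up. *)
Lemma count_step d1 d2 d1' d2' c1 c2 nu n wn w0 g1 g2 (back : option k) (cn : option k -> nat) r :
  thdata d1 d2 d1' d2' c1 c2 (p i) nu n -> isvec d1 d2 wn n ->
  lres (d1 - d1') i = 0 -> lres (d2 - d2') i = 0 ->
  Ahomog (w0 + d1') g1 -> Ahomog (w0 + d2') g2 -> lres (w0 + d1') i = 0 -> lres (w0 + d2') i = 0 ->
  iunit i g1 -> iunit i g2 ->
  (forall w e, isvec d1' d2' w e -> primi (thmx c1 c2 e) <-> ~ dvdX i 1 (wedge e (line g1 g2 back))) ->
  (0 < r)%N -> (forall io, cntr d1' d2' (line g1 g2 io) r (cn io)) ->
  cntr d1 d2 n (p i + r) (\sum_(io | io != back) cn io)%N.
Proof.
move=> [h11 h12 h21 h22 hdet nu0 n1 n2] hn r1 r2 hg1 hg2 q1 q2 u1 u2 hback r0 H.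
have thI := th_inj hdet nu0.
pose Q io U := Fam d1' d2' (line g1 g2 io) r U /\ ebset (U : set (V d1' d2')).
have S : hcard (fun U => exists2 io, io != back & Q io U) (\sum_(io | io != back) cn io)%N.
  apply: hcard_sum => [io _|io io' U _ _ [F _] [F' _]]; first exact: H.
  exact: (Fam_disj hg1 hg2 u1 u2 r0 F F' : io = io' :> option k).
have imI (U U' : set (A * A)) : thmx c1 c2 @` U = thmx c1 c2 @` U' -> U = U'.
  move=> E; apply/seteqP; split=> f hf.
    by have [g hg /thI <-] : (thmx c1 c2 @` U') (thmx c1 c2 f) by rewrite -E; exists f.
  by have [g hg /thI <-] : (thmx c1 c2 @` U) (thmx c1 c2 f) by rewrite E; exists f.
have := hcard_im (fun x y _ _ => @imI x y) S; apply: hcard_iff => U.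
have eb U' : ebset (U' : set (V d1' d2')) <-> ebset (thmx c1 c2 @` U' : set (V d1 d2)).
  exact: (@ebset_img _ _ (thh h11 h12 h21 h22)).
split=> [[U' [[io nb [[w [e [he hl ->]]] hU']] ->]]|[[w [e [he hel ->]]] hU]].
  have hp : primi (thmx c1 c2 e).
    apply/(hback _ _ he) => hb; move/eqP: nb; apply.
    exact: (line_uniq hg1 hg2 u1 u2 he hl hb).
  have [hv hd E] := lat_unstep h11 h12 h21 h22 hdet nu0 hn n1 n2 r1 r2 r he hp.
  rewrite -E; split; last by rewrite E; apply/eb.
  exists w, (thmx c1 c2 e); split=> //; apply: dvdX_le hd; have := wt_ge2 p i; lia.
have hel' := wedge_res he hn hel.
have [e' [he' hp ee E]] := lat_step h11 h12 h21 h22 hdet nu0 hn n1 n2 r1 r2 r he hel'.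
exists (latAi r e'); split; last exact: E.
have [io hio] := line_class hg1 hg2 u2 he'; exists io.
  by apply/negP => /eqP eb'; rewrite eb' in hio; case: ((hback _ _ he').1 hp).
by split; [exists w, e' | apply/eb; rewrite -E].
Qed.

Lemma gsubm_range (M N : grmod) (f : ghom M N) (U : set N) (gU : is_gsub U) :
  injective f -> U = range f -> @isomorphic k coh M (gsubm gU).
Proof.
move=> fi EU; have hin m : U (f m) by rewrite EU; exists m.
pose g m : gsubm gU := mksub gU (hin m).
have gl (a : A) u v : g (a *: u + v) = a *: g u + g v.
  by apply: gsval_inj; rewrite gsvalD !gsvalZ /= ghom_lin.
have gh x u : g (hc x u) = hc x (g u).
  by apply: gsval_inj; rewrite gsval_shc /= ghom_hc.
exists (gmor (GHom gl gh)); apply: iso_gmor => [u e|v].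
  have := congr1 (fun z : gsubm gU => gsval z) e; rewrite gsval0 /= -(ghom0 f) => /fi e'.
  by rewrite e'; exact: tors00.
have : range f (gsval v) by rewrite -EU; exact: gsvalR.
move=> [m _ em].
by apply: tors_in; exists m => //; apply: gsval_inj.
Qed.

(** Such a lattice is a direct sum of two line bundles. *)
Lemma not_ebset d1 d2 d1' d2' c1 c2 R nu n wn : thdata d1 d2 d1' d2' c1 c2 R nu n ->
  isvec d1 d2 wn n -> ~ ebset (latAi R n : set (V d1 d2)).
Proof.
move=> [h11 h12 h21 h22 hdet nu0 n1 n2] hn [gU [a [s [hs he]]]].
have E := latA_range hdet nu0 hn n1 n2.
apply: (EB_not_biproduct hs he); apply: (biproduct_iso _ (dsum_biproduct (OO d1') (OO d2'))).
exact: (@gsubm_range _ _ (thh h11 h12 h21 h22) _ gU (th_inj hdet nu0) E).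
Qed.

(** Vectors proportional to n modulo X_i are proportional to it modulo X_i^(p_i). For r at most p_i
    there is thus a single lattice. *)
Lemma cntr_base d1 d2 n wn r (b : bool) : isvec d1 d2 wn n -> (r <= p i)%N ->
  (ebset (latAi r n : set (V d1 d2)) <-> b) -> cntr d1 d2 n r b.
Proof.
move=> hn hr hb.
have F U : Fam d1 d2 n r U <-> U = latAi r n.
  split=> [[w [e [he h ->]]]|->].
    by apply: (latA_eq he hn); exact: dvdX_le hr (wedge_res he hn h).
  by exists wn, n; split=> //; rewrite /wedge mulrC subrr; exact: dvdX0.
case: b hb => hb.
  by apply: (hcard1 (x0 := latAi r n)) => U; rewrite F; split=> [[]|-> ] //; split=> //; apply/hb.
by apply: hcard0 => U [/F -> /hb].
Qed.

Lemma xvecpi : xvec p i *~ (p i)%:Z = cvec p. Proof. by rewrite (cvec_xvec p i). Qed.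

(** Outward step: along the first axis the difference d1 - d2 grows by R x_i, that is by c when R =
    p_i. *)
Lemma out_th d1 d2 (g1 g2 : A) R :
  thdata d1 d2 d1 (d2 - xvec p i *~ R%:Z) (1, 0) (0, X i ^+ R) R 1 (line g1 g2 (Some 0)).
Proof.
split=> /=; rewrite ?oner_eq0 //.
- by rewrite subrr; exact: Ahomog1.
- exact: Ahomog0.
- exact: Ahomog0.
- by rewrite subKr; exact: AhomogX.
- by rewrite /wedge /= scalA1 mul0r subr0.
- by rewrite /wedge /= scalA0 mulr0 mul0r mul0r subr0; exact: dvdX0.
- by rewrite /wedge /= scalA0 mul0r mul0r subr0; apply: dvdX_M; exact: dvdX_id.
Qed.

(** Along the second axis the summands change places, and the new difference is d2 - d1 + R x_i. *)
Lemma swap_th d1 d2 (g1 g2 : A) R :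
  thdata d1 d2 d2 (d1 - xvec p i *~ R%:Z) (0, 1) (X i ^+ R, 0) R (-1) (line g1 g2 None).
Proof.
split=> /=; rewrite ?oppr_eq0 ?oner_eq0 //.
- exact: Ahomog0.
- by rewrite subrr; exact: Ahomog1.
- by rewrite subKr; exact: AhomogX.
- exact: Ahomog0.
- by rewrite /wedge /= scalAN scalA1 mul0r sub0r mulN1r mul1r.
- by rewrite /wedge /= mulr0 mul0r subr0; exact: dvdX0.
- by rewrite /wedge /= mulr0 mul1r sub0r; apply: dvdXN; exact: dvdX_id.
Qed.

(** Inward step: a shear moves the line spanned by (h, 1) to the second axis, and d1 - d2 shrinks by
    R x_i. *)
Lemma in_th d1 d2 (h : A) R n : Ahomog (d1 - d2) h -> wedge n (h, 1) = 0 ->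
  thdata d1 d2 (d1 - xvec p i *~ R%:Z) d2 (X i ^+ R, 0) (h, 1) R 1 n.
Proof.
move=> hh en; split=> /=; rewrite ?oner_eq0 //.
- by rewrite subKr; exact: AhomogX.
- exact: Ahomog0.
- by rewrite subrr; exact: Ahomog1.
- by rewrite /wedge /= scalA1 mul1r mulr1 mul0r subr0.
- by rewrite /wedge /= mulr0 sub0r; apply/dvdXN/dvdX_M; exact: dvdX_id.
- by rewrite en; exact: dvdX0.
Qed.

Section GenericLine.
Variables (d1 d2 : L) (Dj Dl : nat) (c : k).
Hypotheses (hD : d1 - d2 = xvec p j *~ Dj%:Z + xvec p l *~ Dl%:Z - cvec p)
  (hj : (0 < Dj < p j)%N) (hl : (0 < Dl < p l)%N) (c0 : c != 0).
(** Chosen so that the determinant Y_j - c mu Y_l in [gen_th], where Y_t = X_t^(p_t), is a multiple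
    of Y_i by the relation. *)
Let mu : k := - (relc k l / relc k j) / c.

Lemma cXpow t (D : nat) : (D < p t)%N -> xvec p t *~ (p t - D)%N%:Z = cvec p - xvec p t *~ D%:Z.
Proof. by move=> h; rewrite (cvec_xvec p t) -subzn ?mulrzBr // ltnW. Qed.

Lemma gen_th : thdata d1 d2 (d1 - xvec p j *~ Dj%:Z) (d1 - xvec p l *~ Dl%:Z)
  (X j ^+ Dj, scalA p c * X l ^+ (p l - Dl)) (scalA p mu * X l ^+ Dl, X j ^+ (p j - Dj)) (p i)
  (- (relc k i / relc k j)) (line (X j ^+ Dj) (X l ^+ (p l - Dl)) (Some c)).
Proof.
have Ej : X j ^+ Dj * X j ^+ (p j - Dj) = X j ^+ p j by rewrite -exprD subnKC //; lia.
have El : X l ^+ Dl * X l ^+ (p l - Dl) = X l ^+ p l by rewrite -exprD subnKC //; lia.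
have [/andP[_ lj] /andP[_ ll]] := (hj, hl).
have det : wedge (X j ^+ Dj, scalA p c * X l ^+ (p l - Dl)) (scalA p mu * X l ^+ Dl, X j ^+ (p j - Dj)) =
    scalA p (- (relc k i / relc k j)) * X i ^+ p i.
  rewrite /wedge /= Ej mulrACA [X in _ * X]mulrC El -scalAM.
  have -> : c * mu = - (relc k l / relc k j) by rewrite /mu mulrCA divff ?mulr1.
  have := congr1 (fun z => scalA p (relc k j)^-1 * z) (XrelA k p ij il jl).
  rewrite mulr0 !mulrDr !mulrA -!scalAM mulVf ?relc_neq0 // scalA1 mul1r => E.
  rewrite !scalAN !mulNr opprK ![_ / relc k j]mulrC; apply/eqP; rewrite -subr_eq0 opprK -[X in _ == X]E.
  by apply/eqP; ring.
split=> //.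
- by rewrite subKr; exact: AhomogX.
- rewrite /= (_ : d2 - _ = 0 + xvec p l *~ (p l - Dl)%N%:Z); last first.
    by rewrite cXpow // -[d2](subKr d1) hD; abel.
  by apply: AhomogM; [exact: scalA_homog | exact: AhomogX].
- by rewrite /= subKr -[_ *~ _]add0r; apply: AhomogM; [exact: scalA_homog | exact: AhomogX].
- rewrite /= (_ : d2 - _ = xvec p j *~ (p j - Dj)%N%:Z); first exact: AhomogX.
  by rewrite cXpow // -[d2](subKr d1) hD; abel.
- by rewrite oppr_eq0 mulf_neq0 ?invr_eq0 ?relc_neq0.
- by rewrite /wedge /= mulrC subrr; exact: dvdX0.
- by rewrite [line _ _ _]/= det; apply/dvdX_M/dvdX_id.
Qed.

(** The second coordinate of the image of e is minus the wedge of e with the line [Some (- c)]. When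
    X_i divides it, X_i divides the first coordinate too, because it divides the determinant. *)
Lemma gen_back w e : isvec (d1 - xvec p j *~ Dj%:Z) (d1 - xvec p l *~ Dl%:Z) w e ->
  primi (thmx (X j ^+ Dj, scalA p c * X l ^+ (p l - Dl)) (scalA p mu * X l ^+ Dl, X j ^+ (p j - Dj)) e) <->
  ~ dvdX i 1 (wedge e (line (X j ^+ (p j - Dj)) (X l ^+ (p l - Dl)) (Some (- c)))).
Proof.
move=> he; rewrite /wedge /= scalAN.
have [_ _ _ _ det _ _ _] := gen_th.
have E2 : scalA p c * X l ^+ (p l - Dl) * e.1 + X j ^+ (p j - Dj) * e.2 =
  - (e.1 * (- scalA p c * X l ^+ (p l - Dl)) - e.2 * X j ^+ (p j - Dj)) by ring.
split=> [[h|h] v|v].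
- apply: h; apply: (dvdX_cancelX (m := (p j - Dj)%N) ij).
  have -> : X j ^+ (p j - Dj) * (thmx (X j ^+ Dj, scalA p c * X l ^+ (p l - Dl)) (scalA p mu * X l ^+ Dl, X j ^+ (p j - Dj)) e).1 =
    scalA p mu * X l ^+ Dl * (scalA p c * X l ^+ (p l - Dl) * e.1 + X j ^+ (p j - Dj) * e.2) +
    e.1 * wedge (X j ^+ Dj, scalA p c * X l ^+ (p l - Dl)) (scalA p mu * X l ^+ Dl, X j ^+ (p j - Dj)).
    by rewrite /wedge /=; ring.
  rewrite det E2; apply: dvdXD; apply: dvdX_M; first exact: dvdXN.
  by apply/dvdX_M/(@dvdX_le _ _ _ _ (p i)); [have := wt_ge2 p i; lia | exact: dvdX_id].
- by apply: h; rewrite /= E2; exact: dvdXN.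
- by right; rewrite /= E2 => h; apply: v; rewrite -[X in dvdX _ _ X]opprK; exact: dvdXN.
Qed.

(** Scaling the first coordinate by - 1/c carries W, with j and l exchanged and s_i = r, s_j = Dj,
    s_l = p_l - Dl, onto this lattice. *)
Lemma gen_EB r : (0 < r < p i)%N -> ebset (latAi r (line (X j ^+ Dj) (X l ^+ (p l - Dl)) (Some c)) : set (V d1 d2)).
Proof.
move=> hr; set n := line _ _ _.
pose s t : nat := if t == i then r else if t == j then Dj else (p l - Dl)%N.
pose a := d1 - xvec p i *~ r%:Z - xvec p j *~ Dj%:Z.
have si : s i = r by rewrite /s eqxx.
have sj : s j = Dj by rewrite /s eq_sym (negPf ij) eqxx.
have sl : s l = (p l - Dl)%N by rewrite /s eq_sym (negPf il) eq_sym (negPf jl).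
have hs : sbox p s.
  by move=> t; case: (ord3_eq t ij il jl) => ->; rewrite ?si ?sj ?sl; lia.
have lj : l != j by rewrite eq_sym.
have v : vtop a s = d1 + xvec p l *~ (p l - Dl)%N%:Z.
  by rewrite (vtopE a s ij il jl) si sj sl /a; abel.
have e1 : d1 = wd1 l a s by rewrite /wd1 v sl; abel.
have [_ ll] := andP hl.
have e2 : d2 = wd2 j a s.
  by rewrite /wd2 v sj cXpow // -[d2](subKr d1) hD; abel.
pose W := Wm k a s il ij lj.
have gn : is_gsub (latAi r n : set (V (wd1 l a s) (wd2 j a s))).
  apply: (lat_gsub (w := - bb a s i) (d1 := wd1 l a s) (d2 := wd2 j a s) i r (e := n)).
    rewrite /n /= -sj; exact: (wvec1 k a s il ij lj).
  have := @wvec2 k p i l j a s il ij lj; rewrite /n /= -sl => h.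
  have : Ahomog (- bb a s i + wd2 j a s) (- (- X l ^+ s l) : A) by apply: AhomogN.
  rewrite opprK => h'; rewrite -[_ + _]add0r; apply: AhomogM => //; exact: scalA_homog.
suff iso : @isomorphic k coh W (gsubm gn).
  rewrite e1 e2; exists gn; apply: isEB_iso iso _; exists a, s; split=> //; exact: EB_W.
have inW (f : W) : latAi r n (scalA p (- c^-1) * (gsval f).1, (gsval f).2).
  have h : dvdX i (s i) (wedge (wvec k p l j s) (gsval f)) := gsvalR f.
  move: h; rewrite /latA /=; case: (gsval f) => f1 f2 /=; rewrite /wedge /= sj sl si => h.
  suff -> : X j ^+ Dj * f2 - scalA p c * X l ^+ (p l - Dl) * (scalA p (- c^-1) * f1) =
    X j ^+ Dj * f2 - - X l ^+ (p l - Dl) * f1 by [].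
  have := scalA_unit p c0; rewrite scalAN; move: (scalA p c) (scalA p c^-1) (X l ^+ _) => x x' y E.
  rewrite (_ : x * y * _ = - (x * x') * (y * f1)); last by ring.
  by rewrite E; ring.
pose g (f : W) : gsubm gn := mksub gn (inW f).
have gk (f : W) : gsval (g f) = (scalA p (- c^-1) * (gsval f).1, (gsval f).2) by [].
have gl (b : A) u v' : g (b *: u + v') = b *: g u + g v'.
  apply: gsval_inj; rewrite [RHS]gsvalD gsvalZ !gk gsvalD gsvalZ.
  by congr pair; rewrite /= /GRing.scale /= mulrDr mulrCA.
have gh x u : g (hc x u) = hc x (g u).
  apply: gsval_inj; rewrite [RHS]gsval_shc !gk W_hc [RHS](_ : _ = (Acomp (wd1 l a s + x) (scalA p (- c^-1) * (gsval u).1), Acomp (wd2 j a s + x) (gsval u).2)) //.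
  by rewrite -[in RHS](add0r (wd1 l a s + x)) (AcompM _ _ (scalA_homog p (- c^-1))).
exists (gmor (GHom gl gh)); apply: iso_gmor => [u e|v'].
  have := congr1 (fun z : gsubm gn => gsval z) e; rewrite gsval0 => -[E1 E2]; apply: tors_in; apply: W_eq; rewrite gsval0 //=.
  rewrite -[(gsval u).1](@scalK k p c^-1) ?invr_eq0 //.
  by have := congr1 (fun z => scalA p c^-1^-1 * - z) E1; rewrite scalAN mulNr opprK oppr0 mulr0.
have := gsvalR v' => hv.
have hW : dvdX i (s i) (X l ^+ s l * (- scalA p c * (gsval v').1) + X j ^+ s j * (gsval v').2).
  move: hv; rewrite /latA /= /wedge /= si sj sl => hv.
  by rewrite (_ : _ + _ = X j ^+ Dj * (gsval v').2 - scalA p c * X l ^+ (p l - Dl) * (gsval v').1) //; ring.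
apply: tors_in; exists (mkW a il ij lj hW) => //; apply: gsval_inj.
rewrite [RHS]surjective_pairing; congr pair.
by rewrite /= scalAN mulrA mulNr mulrN opprK [X in X * _]mulrC scalA_unit // mul1r.
Qed.
End GenericLine.
End LatticeCount.

(** * The recursion for the number of paths *)

Section TreeNumbers.
Variable k : finFieldType.

(* number of continuations, in m more steps, of a path in the tree that leaves
   a lattice of depth h along the line io and ends at a generic line *)
Fixpoint cn (m h : nat) (io : option k) {struct m} : nat :=
  match m with
  | 0%N => if io is Some c then ((h == 0%N) && (c != 0) : nat) else 0%N
  | m'.+1 => match io with
      | Some c => if c == 0 then (\sum_(o | o != None) cn m' h.+1 o)%N
                  else if h is h'.+1 then (\sum_(o | o != Some 0%R) cn m' h' o)%N
                  else (\sum_(o | o != Some (- c)%R) cn m' 0 o)%N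
      | None => if h is h'.+1 then (\sum_(o | o != Some 0%R) cn m' h' o)%N
                else (\sum_(o | o != None) cn m' 1 o)%N
      end
  end.

Local Notation cG m := (cn m 0%N (Some 1%R)).
Local Notation cO m h := (cn m h (Some 0%R)).
Local Notation cI m h := (cn m h None).
Local Notation q := #|k|.

Lemma option_sum (F : option k -> nat) (x y z : nat) : F None = x -> F (Some 0) = y ->
  (forall c, c != 0 -> F (Some c) = z) -> (\sum_o F o = x + (y + (q - 1) * z))%N.
Proof.
move=> hx hy hz; rewrite (bigD1 None) //= hx; congr addn.
rewrite (reindex_omap Some id) => [|[c|] //] /=.
rewrite (eq_bigl xpredT) => [|c]; last by rewrite eqxx.
rewrite (bigD1 0) //= hy; congr addn.
rewrite (eq_bigr (fun=> z)) => [|c]; last exact: hz.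
rewrite sum_nat_const mulnC [RHS]mulnC; congr muln.
by rewrite (cardC1 (0 : k)) subn1.
Qed.

Lemma option_sum_but (F : option k -> nat) b (x y z t : nat) : F None = x -> F (Some 0) = y ->
  (forall c, c != 0 -> F (Some c) = z) -> F b = t ->
  (t + \sum_(o | o != b) F o = x + (y + (q - 1) * z))%N.
Proof. by move=> hx hy hz <-; rewrite -(option_sum hx hy hz) [RHS](bigD1 b). Qed.

(** At depth 0 the two axes have the same count, and so do all generic lines; at positive depth all
    lines but the first axis agree. Sums over the lines of a vertex thus collapse to a linear
    recursion in [cO], [cI] and [cG]. *)
Lemma cn_types m : [/\ forall c, c != 0 -> cn m 0%N (Some c) = cG m, cI m 0%N = cO m 0%N &
  forall h c, c != 0 -> cn m h.+1 (Some c) = cI m h.+1].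
Proof.
elim: m => [|m [H1 H2 H3]].
  by split=> [c c0||h c c0]; rewrite /= ?c0 ?oner_eq0 ?eqxx ?andbF.
split=> [c c0||h c c0].
- rewrite /= oner_eq0 (negPf c0).
  have n1 : - c != 0 by rewrite oppr_eq0.
  have n2 : - (1 : k) != 0 by rewrite oppr_eq0 oner_eq0.
  apply: (@addnI (cG m)).
  rewrite (option_sum_but (b := Some (- c)) H2 erefl H1 (H1 _ n1)).
  by rewrite (option_sum_but (b := Some (- 1)) H2 erefl H1 (H1 _ n2)).
- by rewrite /= eqxx.
- by rewrite /= (negPf c0).
Qed.

Lemma cG_rec m : (cG m + cG m.+1 = 2 * cO m 0%N + (q - 1) * cG m)%N.
Proof.
have [H1 H2 H3] := cn_types m; rewrite [cG m.+1]/= oner_eq0.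
have n2 : - (1 : k) != 0 by rewrite oppr_eq0 oner_eq0.
rewrite (option_sum_but (b := Some (- 1)) H2 erefl H1 (H1 _ n2)); lia.
Qed.
Lemma cO_rec m h : (cO m.+1 h = cO m h.+1 + (q - 1) * cI m h.+1)%N.
Proof.
have [H1 H2 H3] := cn_types m; rewrite [cO m.+1 h]/= eqxx.
apply: (@addnI (cI m h.+1)); exact: (option_sum_but (b := None) erefl erefl (H3 h) erefl).
Qed.
Lemma cI1_rec m : (cI m.+1 1%N = cO m 0%N + (q - 1) * cG m)%N.
Proof.
have [H1 H2 H3] := cn_types m; rewrite [cI m.+1 1%N]/=.
apply: (@addnI (cO m 0%N)); exact: (option_sum_but (b := Some 0) H2 erefl H1 erefl).
Qed.
Lemma q_gt0 : (0 < q)%N. Proof. by apply/card_gt0P; exists 0. Qed.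
Lemma cI_rec m h : (cI m.+1 h.+2 = q * cI m h.+1)%N.
Proof.
have [H1 H2 H3] := cn_types m; rewrite [cI m.+1 h.+2]/=.
apply: (@addnI (cO m h.+1)); rewrite (option_sum_but (b := Some 0) erefl erefl (H3 h) erefl).
rewrite addnCA -mulSn; have := q_gt0; case: q => // n _; by rewrite subn1.
Qed.

(** A path that starts outward one level deeper has one more inward step between positive depths,
    and such a step leaves q lines to choose from. *)
Lemma cO_shift m h : (cO m.+1 h.+1 = q * cO m h)%N.
Proof.
elim: m h => [|m IH] h; rewrite cO_rec; first by rewrite /= eqxx andbF !muln0.
by rewrite IH cI_rec cO_rec; lia.
Qed.

Local Notation Q := (#|k|%:Z : int).
Lemma cO0_rec m : (cO m.+2 0%N)%:Z = (Q - 1) * ((Q - 1) * (cG m)%:Z + (cO m 0%N)%:Z) + Q * (cO m 0%N)%:Z.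
Proof.
rewrite cO_rec cI1_rec cO_shift !(PoszD, PoszM) -subzn ?q_gt0 //.
by move: (cO m 0%N)%:Z (cG m)%:Z Q => x y z; ring.
Qed.

Lemma cGz_rec m : (cG m.+1)%:Z = (Q - 2) * (cG m)%:Z + 2 * (cO m 0%N)%:Z.
Proof.
have := congr1 Posz (cG_rec m); rewrite !(PoszD, PoszM) -subzn ?q_gt0 //.
move: (cO m 0%N)%:Z (cG m)%:Z (cG m.+1)%:Z Q => x y t z h.
by apply/eqP; rewrite -subr_eq0; apply/eqP; rewrite -[t](addKr y) h; ring.
Qed.

Lemma cO_cG m : (cO m 0%N)%:Z = (cG m)%:Z + (-1) ^+ m * (m%:Z * (Q - 1) - 1).
Proof.
suff : (cO m 0%N)%:Z = (cG m)%:Z + (-1) ^+ m * (m%:Z * (Q - 1) - 1) /\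
       (cO m.+1 0%N)%:Z = (cG m.+1)%:Z + (-1) ^+ m.+1 * (m.+1%:Z * (Q - 1) - 1) by case.
elim: m => [|m [IH1 IH2]].
  split; first by rewrite /= eqxx oner_eq0 mul0r sub0r expr0 mul1r subrr.
  rewrite cO_rec cGz_rec /= !eqxx oner_eq0 /= muln0 addn0.
  by move: Q => z; ring.
split=> //; rewrite cO0_rec !cGz_rec IH2 cGz_rec IH1 !exprS.
have -> : m.+2%:Z = m%:Z + 2 by lia.
have -> : m.+1%:Z = m%:Z + 1 by lia.
by move: (cG m)%:Z Q ((-1) ^+ m) m%:Z => x y z t; ring.
Qed.

Lemma fpol_rec n : (fpol n.+1%:Z).[Q] = Q * (fpol n%:Z).[Q] + (-1) ^+ n * (n%:Z * Q - n%:Z - 2).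
Proof.
(* For m = 0 the general formula also gives 1, so the separate value f_0 causes no case distinction
   afterwards. *)
have E m : (fpol m%:Z).[Q] = \sum_(1 <= i < m.+1) ((-1) ^+ (i - 1)%N * (2 * i - 1)%N%:Z * Q ^+ (m + 1 - i))
    + (-1) ^+ m * (m + 1)%N%:Z.
  case: m => [|m]; first by rewrite /= hornerC big_geq.
  rewrite [fpol _]/fpol hornerD hornerC horner_sum; congr (_ + _).
  by apply: eq_bigr => i _; rewrite hornerZ hornerXn.
rewrite !E big_nat_recr //= mulrDr mulr_sumr.
have -> : \sum_(1 <= i < n.+1) ((-1) ^+ (i - 1) * (2 * i - 1)%N%:Z * Q ^+ (n.+1 + 1 - i)) =
  \sum_(1 <= i < n.+1) (Q * ((-1) ^+ (i - 1) * (2 * i - 1)%N%:Z * Q ^+ (n + 1 - i))).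
  apply: eq_big_nat => i hi; rewrite (_ : (n.+1 + 1 - i)%N = (n + 1 - i).+1); last lia.
  by rewrite exprS mulrCA.
rewrite (_ : (n.+1 + 1 - n.+1)%N = 1%N); last lia.
rewrite (_ : (n.+1 - 1)%N = n); last lia.
have -> : (2 * n.+1 - 1)%N%:Z = 2 * n%:Z + 1 by lia.
have -> : (n.+1 + 1)%N%:Z = n%:Z + 2 by lia.
have -> : (n + 1)%N%:Z = n%:Z + 1 by lia.
rewrite expr1 [(-1) ^+ n.+1]exprS; set S := \sum_(1 <= i < n.+1) _; move: S ((-1) ^+ n) Q n%:Z => x y z t; ring.
Qed.

Lemma cG_fpol m : (cG m.+1)%:Z = (fpol m.+1%:Z).[Q] - (fpol m%:Z).[Q] + (-1) ^+ m.
Proof.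
elim: m => [|m IH].
  by rewrite fpol_rec cGz_rec cO_cG /= hornerC oner_eq0 /=; move: Q => z; ring.
rewrite fpol_rec cGz_rec cO_cG IH.
have -> : (fpol m%:Z).[Q] = (fpol m.+1%:Z).[Q] - (Q * (fpol m%:Z).[Q] - (fpol m%:Z).[Q]) - (-1) ^+ m * (m%:Z * Q - m%:Z - 2).
  by rewrite fpol_rec; move: (fpol m%:Z).[Q] Q ((-1) ^+ m) m%:Z => x y z t; ring.
rewrite fpol_rec exprS.
have -> : m.+1%:Z = m%:Z + 1 by lia.
by move: (fpol m%:Z).[Q] Q ((-1) ^+ m) m%:Z => x y z t; ring.
Qed.
End TreeNumbers.

(** * Lattices as paths in the tree *)

Section TreeCount.
Variables (k : finFieldType) (p : weights) (i j l : 'I_3) (r0 : nat).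
Hypotheses (ij : i != j) (il : i != l) (jl : j != l) (hr0 : (0 < r0 < p i)%N).
Local Notation L := (Lgrp p).
Local Notation A := (coordA k p).
Local Notation X := (Xvar k p).

(** Homogeneous [iunit] elements of matching degrees, as coordinates for the lines at a vertex of
    depth h. At positive depth the second is 1 and the first has degree d1 - d2, its multiple of c
    being carried by X_j. *)
Definition gg1 (h Dj Dl : nat) : A := if h is h'.+1 then X j ^+ (Dj + p j * h') * X l ^+ Dl else X j ^+ Dj.
Definition gg2 (h Dl : nat) : A := if h is h'.+1 then 1 else X l ^+ (p l - Dl).

(** The depth is one more than the level of d1 - d2. At depth 0 both d1 - d2 and d2 - d1 have level
    -1: there are no nonzero maps between the two summands in either direction. *)
Definition isst (h Dj Dl : nat) (d1 d2 : L) : Prop :=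
  [/\ (0 < Dj < p j)%N, (0 < Dl < p l)%N &
   d1 - d2 = xvec p j *~ Dj%:Z + xvec p l *~ Dl%:Z + cvec p *~ (h%:Z - 1)].

Lemma iunitX t m (b : A) : i != t -> iunit i b -> iunit i (X t ^+ m * b).
Proof. by move=> it u /(dvdX_cancelX it). Qed.
Lemma iunit1 : iunit i (1 : A). Proof. exact: dvdX1N. Qed.

Lemma lres_jl (x y m : int) : lres (xvec p j *~ x + xvec p l *~ y + cvec p *~ m) i = 0.
Proof.
have := lres3i p ij il jl 0 x y m; rewrite mulr0z add0r => ->; exact: mod0z.
Qed.

Lemma st_ok h Dj Dl d1 d2 : isst h Dj Dl d1 d2 -> exists w0,
  [/\ Ahomog (w0 + d1) (gg1 h Dj Dl), Ahomog (w0 + d2) (gg2 h Dl), lres (w0 + d1) i = 0,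
      lres (w0 + d2) i = 0 & iunit i (gg1 h Dj Dl) /\ iunit i (gg2 h Dl)].
Proof.
move=> [hj hl hD]; have [/andP[_ lj] /andP[_ ll]] := (hj, hl).
have uX t m : i != t -> iunit i (X t ^+ m) by move=> it; rewrite -[X t ^+ m]mulr1; apply: iunitX => //; exact: iunit1.
case: h hD => [|h] hD.
  exists (xvec p j *~ Dj%:Z - d1); rewrite subrK.
  have -> : xvec p j *~ Dj%:Z - d1 + d2 = xvec p l *~ (p l - Dl)%N%:Z.
    by rewrite cXpow // -[d2](subKr d1) hD; abel.
  have e1 := lres_jl Dj%:Z 0 0; have e2 := lres_jl 0 (p l - Dl)%N%:Z 0.
  rewrite !mulr0z ?addr0 ?add0r in e1 e2.
  by split=> //; rewrite ?e1 ?e2 //=; [exact: AhomogX | exact: AhomogX | split; exact: uX].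
exists (- d2); rewrite addNr [- d2 + _]addrC hD; split.
- rewrite /gg1 (_ : _ + _ = xvec p j *~ (Dj + p j * h)%N%:Z + xvec p l *~ Dl%:Z).
    by apply: AhomogM; exact: AhomogX.
  have -> : h.+1%:Z - 1 = h%:Z by lia.
  by rewrite (cvec_xvec p j) PoszD PoszM mulrzDr mulrzA; abel.
- exact: Ahomog1.
- exact: lres_jl.
- exact: lres0.
- by split; [apply/iunitX/uX | exact: iunit1].
Qed.

Lemma gg1_homog h Dj Dl d1 d2 : isst h.+1 Dj Dl d1 d2 -> Ahomog (d1 - d2) (gg1 h.+1 Dj Dl).
Proof.
move=> [hj hl ->]; rewrite /gg1 (_ : _ + _ = xvec p j *~ (Dj + p j * h)%N%:Z + xvec p l *~ Dl%:Z).
  by apply: AhomogM; exact: AhomogX.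
have -> : h.+1%:Z - 1 = h%:Z by lia.
  by rewrite (cvec_xvec p j) PoszD PoszM mulrzDr mulrzA; abel.
Qed.

(** At positive depth every line but the first axis is spanned by a vector (h, 1), the form that
    [in_th] requires. *)
Definition hin h Dj Dl (io : option k) : A := if io is Some c then scalA p c^-1 * gg1 h Dj Dl else 0.

Lemma hin_homog h Dj Dl d1 d2 io : isst h.+1 Dj Dl d1 d2 -> Ahomog (d1 - d2) (hin h.+1 Dj Dl io).
Proof.
move=> hst; case: io => [c|]; last exact: Ahomog0.
by rewrite -[d1 - d2]add0r; apply: AhomogM; [exact: scalA_homog | exact: gg1_homog].
Qed.

Lemma hin_line h Dj Dl io : io != Some 0 ->
  wedge (line (gg1 h.+1 Dj Dl) (gg2 h.+1 Dl) io) (hin h.+1 Dj Dl io, 1) = 0.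
Proof.
case: io => [c|] c0; rewrite /wedge /=; last by rewrite mulr0 mul0r subr0.
have {}c0 : c != 0 by apply: contra_neq c0 => ->.
rewrite !mulr1 [X in _ - X]mulrA scalA_unit // mul1r subrr //.
Qed.

Lemma lres_c m : lres (cvec p *~ m) i = 0.
Proof. by have := lresDc (0 : L) m i; rewrite add0r lres0. Qed.

(** The branches of [cn] correspond to the matrices: [out_th] on the first axis, [in_th] at positive
    depth, [swap_th] on the second axis and [gen_th] on generic lines at depth 0. With m = 0 only
    the last case yields an extension bundle. *)
Lemma tree_count m h Dj Dl d1 d2 (io : option k) : isst h Dj Dl d1 d2 ->
  cntr i d1 d2 (line (gg1 h Dj Dl) (gg2 h Dl) io) (p i * m + r0) (cn m h io).
Proof.
elim: m h Dj Dl d1 d2 io => [|m IH] h Dj Dl d1 d2 io hst;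
  have [w0 [hg1 hg2 q1 q2 [u1 u2]]] := st_ok hst; have [wn hn] := line_vec hg1 hg2 q1 q2 u1 io.
  rewrite muln0 add0n.
  have leR : (r0 <= p i)%N by lia.
  have nB d1' d2' c1 c2 nu : thdata i d1 d2 d1' d2' c1 c2 r0 nu (line (gg1 h Dj Dl) (gg2 h Dl) io) ->
      cntr i d1 d2 (line (gg1 h Dj Dl) (gg2 h Dl) io) r0 false.
    by move=> td; apply: (cntr_base hn) => //; split=> // /(not_ebset td hn).
  have [c0|c0] := eqVneq io (Some 0).
    by rewrite c0 [cn _ _ _]/= eqxx andbF in nB *; apply: nB; exact: out_th.
  case: h hst hg1 hg2 u1 u2 hn nB => [|h] hst hg1 hg2 u1 u2 hn nB; last first.
    have -> : cn 0 h.+1 io = false by case: (io).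
    by apply: nB; apply: in_th; [exact: hin_homog hst | exact: hin_line].
  case: io c0 hn nB => [c|] c0 hn nB; last by apply: nB; exact: swap_th.
  have {}c0 : c != 0 by apply: contra_neq c0 => ->.
  have -> : cn 0 0 (Some c) = true by rewrite /= c0.
  apply: (cntr_base hn) => //; split=> // _; have [hj hl hD] := hst; exact: gen_EB.
have r_gt0 : (0 < p i * m + r0)%N by lia.
rewrite mulnS -addnA.
have cK (x : L) : x - (x - xvec p i *~ (p i)%:Z) = cvec p *~ 1 by rewrite subKr xvecpi.
have lc1 : lres (cvec p *~ 1) i = 0 := lres_c 1.
have [hj hl hD] := hst; have [/andP[_ lj] /andP[_ ll]] := (hj, hl).
have [c0|c0] := eqVneq io (Some 0).
  rewrite c0 [cn _ _ _]/= eqxx in hn *.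
  have hst' : isst h.+1 Dj Dl d1 (d2 - xvec p i *~ (p i)%:Z).
    split=> //; rewrite xvecpi -[d2](subKr d1) hD; have -> : h.+1%:Z = h%:Z + 1 by lia.
    by abel.
  have [w0' [hg1' hg2' q1' q2' [u1' u2']]] := st_ok hst'.
  apply: (count_step ij il jl (@out_th k p i d1 d2 _ _ (p i)) hn _ _ hg1' hg2' q1' q2' u1' u2' _ r_gt0 (fun o => IH _ _ _ _ _ o hst')).
  - by rewrite subrr lres0.
  - by rewrite cK.
  - move=> w e _; rewrite /prim /wedge /= mulr1 mulr0 subr0 mul1r !mul0r addr0 add0r.
    split=> [[//|h1] _|h1]; last by left.
    by apply: h1; apply: dvdX_Ml; apply: (@dvdX_le _ _ _ _ (p i)); [have := wt_ge2 p i; lia | exact: dvdX_id].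
case: h hst hD hg1 hg2 u1 u2 hn => [|h] hst hD hg1 hg2 u1 u2 hn; last first.
  have -> : cn m.+1 h.+1 io = (\sum_(o : option k | o != Some (0%R : k)) cn m h o)%N.
    by case: (io) c0 => [c|//] c0 /=; case: ifP => // /eqP ec; rewrite ec eqxx in c0.
  have hst' : isst h Dj Dl (d1 - xvec p i *~ (p i)%:Z) d2.
    split=> //; rewrite xvecpi addrAC hD; have -> : h.+1%:Z = h%:Z + 1 by lia.
    by abel.
  have [w0' [hg1' hg2' q1' q2' [u1' u2']]] := st_ok hst'.
  have td := in_th i (p i) (hin_homog io hst) (hin_line h Dj Dl c0).
  apply: (count_step ij il jl td hn _ _ hg1' hg2' q1' q2' u1' u2' _ r_gt0 (fun o => IH _ _ _ _ _ o hst')).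
  - by rewrite cK.
  - by rewrite subrr lres0.
  - move=> w e _; rewrite /prim /wedge /= scalA0 !mul0r mulr0 sub0r add0r mul1r.
    split=> [h1 h2|h1].
      have h3 : dvdX i 1 e.2.
        by apply: (iunit_cancel hg1' u1'); rewrite mulrC -[X in dvdX _ _ X]opprK; exact: dvdXN.
      case: h1 => [h1|h1]; apply: h1 => //; apply: dvdXD; last exact: dvdX_M.
      by apply: dvdX_Ml; apply: (@dvdX_le _ _ _ _ (p i)); [have := wt_ge2 p i; lia | exact: dvdX_id].
    by right=> h2; apply: h1; apply/dvdXN/dvdX_Ml.
case: io c0 hn => [c|] c0 hn; last first.
  rewrite [cn _ _ _]/=.
  (* The opposite of a difference of level -1 has again level -1 here, and the additional c brings
     the depth to 1. *)
  have hst' : isst 1 (p j - Dj) (p l - Dl) d2 (d1 - xvec p i *~ (p i)%:Z).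
    split; try lia; rewrite !cXpow // xvecpi -[d2](subKr d1) hD; abel.
  have [w0' [hg1' hg2' q1' q2' [u1' u2']]] := st_ok hst'.
  apply: (count_step ij il jl (@swap_th k p i d1 d2 _ _ (p i)) hn _ _ hg1' hg2' q1' q2' u1' u2' _ r_gt0 (fun o => IH _ _ _ _ _ o hst')).
  - by rewrite hD; exact: lres_jl.
  - rewrite (_ : d2 - _ = - (d1 - d2) + cvec p *~ 1); last by rewrite xvecpi; abel.
    by apply: lres_add0 => //; apply: lres_opp0; rewrite hD; exact: lres_jl.
  - move=> w e _; rewrite /prim /wedge /= mulr1 mulr0 subr0 mul1r !mul0r addr0 add0r.
    split=> [[h1|//] _|h1]; last by right.
    by apply: h1; apply: dvdX_Ml; apply: (@dvdX_le _ _ _ _ (p i)); [have := wt_ge2 p i; lia | exact: dvdX_id].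
have {}c0 : c != 0 by apply: contra_neq c0 => ->.
rewrite [cn _ _ _]/= (negPf c0).
(* The new difference Dl x_l - Dj x_j has level -1: a generic step stays at depth 0. *)
have hst' : isst 0 (p j - Dj) Dl (d1 - xvec p j *~ Dj%:Z) (d1 - xvec p l *~ Dl%:Z).
  by split; try lia; rewrite cXpow //; abel.
have [w0' [hg1' hg2' q1' q2' [u1' u2']]] := st_ok hst'.
have hD' : d1 - d2 = xvec p j *~ Dj%:Z + xvec p l *~ Dl%:Z - cvec p by rewrite hD sub0r mulrN1z.
apply: (count_step ij il jl (gen_th ij il jl hD' hj hl c0) hn _ _ hg1' hg2' q1' q2' u1' u2' _ r_gt0 (fun o => IH _ _ _ _ _ o hst')).
- by rewrite subKr; have := lres_jl Dj%:Z 0 0; rewrite !mulr0z !addr0.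
- rewrite (_ : d2 - _ = - (d1 - d2) + xvec p l *~ Dl%:Z); last by abel.
  apply: lres_add0; first by apply: lres_opp0; rewrite hD; exact: lres_jl.
  by have := lres_jl 0 Dl%:Z 0; rewrite !mulr0z addr0 add0r.
- by move=> w e he; exact: (gen_back ij il jl hD' hj hl c0 he).
Qed.
End TreeCount.

(** * Hilbert functions *)

Section Hilbert.
Variables (k : finFieldType) (p : weights).
Local Notation L := (Lgrp p).
Local Notation A := (coordA k p).
Local Notation X := (Xvar k p).
Local Notation grmod := (grmod k p).
Local Notation coh := (cohX k p).
Local Notation tors0 := (tors [set 0]).
Local Notation OO := (OO k).
Local Notation q := #|k|.
Local Notation xl x l := ((x + cvec p *~ l%:Z)%R).
Implicit Types (M N Q : grmod) (w x y z : L).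

Lemma hcard_seq (T : eqType) (P : T -> Prop) (s : seq T) :
  (forall u, P u -> u \in s) -> exists n, hcard P n.
Proof.
move=> hs; pose s' := [seq u <- undup s | `[< P u >]].
have us : uniq s' by rewrite filter_uniq ?undup_uniq.
exists (size s'), 'I_(size s'), (fun u => tnth (in_tuple s') u); split.
- exact: card_ord.
- by apply/tuple_uniqP.
- move=> u; split=> [Pu|[v <-]].
    have : u \in in_tuple s' by rewrite mem_filter mem_undup hs // andbT; apply/asboolP.
    by move=> /tnthP[v ->]; exists v.
  by have := mem_tnth v (in_tuple s'); rewrite mem_filter => /andP[/asboolP].
Qed.

Lemma hcard_seqE (T : eqType) (P : T -> Prop) n : hcard P n -> exists s : seq T, forall u, P u -> u \in s.
Proof.
move=> [F [f [_ _ h]]]; exists [seq f u | u <- enum F] => u /h[v <-].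
by apply: map_f; rewrite mem_enum.
Qed.

Lemma Ahomog_dvdX_res i w (a : A) (m : nat) : Ahomog w a -> m%:Z <= lres w i -> dvdX i m a.
Proof.
move=> ha; elim: m => [|m IH] hm; first by exists a; rewrite expr0 mul1r.
have [|b hb] := IH; first lia.
have hbw : Ahomog (w - xvec p i *~ m%:Z) b by apply: Ahomog_divX; rewrite -hb.
have [c hc] : dvdX i 1 b.
  apply: (Ahomog_dvdX hbw); rewrite -mulrNz lresDx eqxx modz_small.
    by lia.
  by have := lres_lt w i; have := lres_ge0 w i; lia.
by exists c; rewrite hb hc expr1 mulrA -exprSr.
Qed.

Lemma card_Ahomog0 w : llev w < 0 -> hcard (@Ahomog k p w) 1.
Proof.
move=> hl; apply: (hcard1 (x0 := 0)) => a; split=> [ha|->]; last exact: Ahomog0.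
exact: Ahomog_lev ha hl.
Qed.

(** After division by a power of X_1 the residue is 0; then A_w is the sum of a line spanned by a
    monomial and of X_1^(p_1) A_(w - c), and the level drops by one. Level -1 is the zero space,
    where the induction starts. *)
Lemma card_Ahomog w : -1 <= llev w -> hcard (@Ahomog k p w) (q ^ absz (llev w + 1)).
Proof.
have [j [l [ij il jl]]] := other2 0.
have H n w' : lres w' 0 = 0 -> llev w' = n%:Z - 1 -> hcard (@Ahomog k p w') (q ^ n).
  elim: n w' => [|n IH] w' hr hl; first by apply: card_Ahomog0; lia.
  have hk : hcard (fun c : k => True) q by exists k, id; split=> // c; split=> // _; exists c.
  have h0 : 0 <= llev w' by lia.
  have hm := Amono_homog k ij il jl hr h0.
  have um : iunit 0 (Amono k w' j l) := Amono_iunit (w := w') ij il.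
  have hw : hcard (@Ahomog k p (w' - cvec p)) (q ^ n).
    by apply: IH; rewrite -mulrN1z ?lresDc ?llevDc //; lia.
  rewrite expnS.
  apply: (hcard_prod (g := fun c b => scalA p c * Amono k w' j l + X 0 ^+ p 0 * b) _ _ hk hw).
    move=> c b c' b' _ hb _ hb' e.
    have E : scalA p (c - c') * Amono k w' j l = X 0 ^+ p 0 * (b' - b).
      rewrite scalAD scalAN mulrBl mulrBr; apply/eqP; rewrite subr_eq addrAC eq_sym subr_eq; apply/eqP.
      by rewrite e addrC.
    have cc : c = c'.
      apply/eqP; rewrite -subr_eq0; apply/negP => /negP nz; apply: um; apply: (dvdX_scal nz).
      by rewrite E; apply: (@dvdX_le _ _ _ _ (p 0)); [have := wt_ge2 p 0; lia | exists (b' - b)].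
    split=> //; move: e; rewrite cc => /addrI; exact: Xpow_inj.
  move=> a; split=> [ha|[c [b [_ hb ->]]]].
    have [c hc] := Ahomog_mod ij il jl ha hr h0.
    have ha' : Ahomog w' (a - scalA p c * Amono k w' j l).
      apply: AhomogD => //; apply: AhomogN; rewrite -[w']add0r; apply: AhomogM; first exact: scalA_homog.
      by rewrite add0r.
    have [b eb] := dvdX_res ha' hr hc; exists c, b; split=> //.
      rewrite (cvec_xvec p 0); apply: Ahomog_divX; rewrite -eb //.
    by rewrite -eb addrC subrK.
  apply: AhomogD; first by rewrite -[w']add0r; apply: AhomogM; [exact: scalA_homog | rewrite add0r].
  have -> : w' = cvec p + (w' - cvec p) by rewrite addrC subrK.
  by apply: AhomogM => //; rewrite (cvec_xvec p 0); exact: AhomogX.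
move=> hl; pose r := absz (lres w 0); have hr : r%:Z = lres w 0 by rewrite gez0_abs ?lres_ge0.
have hw' : hcard (@Ahomog k p (w - xvec p 0 *~ r%:Z)) (q ^ absz (llev w + 1)).
  apply: H; rewrite hr -mulrNz ?lresDx ?eqxx ?llevDx subrr ?mod0z ?div0z //; lia.
have := hcard_im (g := fun b => X 0 ^+ r * b) (fun a b _ _ => @Xpow_inj _ _ 0 r a b) hw'.
apply: hcard_iff => a; split=> [[b [hb ->]]|ha].
  have -> : w = xvec p 0 *~ r%:Z + (w - xvec p 0 *~ r%:Z) by rewrite addrC subrK.
  by apply: AhomogM => //; exact: AhomogX.
have [|b eb] := @Ahomog_dvdX_res 0 w a r ha; first by rewrite hr.
by exists b; split=> //; apply: Ahomog_divX; rewrite -eb.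
Qed.

Lemma Ahomog_fin w : exists s : seq A, forall a, Ahomog w a -> a \in s.
Proof.
have [h|h] := ltP (llev w) (-1); last exact: hcard_seqE (card_Ahomog h).
by apply: hcard_seqE (card_Ahomog0 _); lia.
Qed.

Lemma comp_fin M y : exists s : seq M, forall u, hc y u = u -> u \in s.
Proof.
have [g [hg1 hg2]] := gsub_fg (@gsubT k p M).
have {}hg2 u : mspan (map snd g) u by exact: hg2.
suff [s hs] : exists s : seq M, forall u, mspan (map snd g) u -> hc y u \in s.
  by exists s => u <-; exact: hs.
elim: g hg1 {hg2} => [|v g IH] hg1.
  exists [:: 0] => u hu; have -> : u = 0.
    by apply: (hu (fun v => v = 0)) => //; split=> // a b c -> ->; rewrite scaler0 addr0.
  by rewrite hc0 mem_head.
have [s hs] := IH (fun v' h => hg1 v' (@mem_behead _ (v :: g) _ h)).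
have [t ht] := Ahomog_fin (y - v.1).
exists [seq a *: v.2 + b | a <- t, b <- s] => u hu.
have [a [b [hb ->]]] : exists a b, mspan (map snd g) b /\ u = a *: v.2 + b.
  apply: (hu (fun u => exists a b, mspan (map snd g) b /\ u = a *: v.2 + b)).
    split; first by exists 0, 0; split; [by case: (mspan_submod (map snd g)) | rewrite scale0r addr0].
    move=> c u1 u2 [a1 [b1 [h1 ->]]] [a2 [b2 [h2 ->]]]; exists (c * a1 + a2), (c *: b1 + b2); split.
      by case: (mspan_submod (map snd g)) => _; apply.
    by rewrite scalerDr scalerDl scalerA addrACA.
  move=> u1 /=; rewrite inE => /predU1P[->|h1].
    by exists 1, 0; split; [by case: (mspan_submod (map snd g)) | rewrite scale1r addr0].
  by exists 0, u1; split=> [N _ h|]; [exact: h | rewrite scale0r add0r].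
have [hv _] := hg1 v (mem_head _ _).
rewrite hcD (hc_scale y _ hv); apply: allpairs_f; last exact: hs.
by apply: ht; exact: Acomp_homog.
Qed.

(** The default value does not occur, since every component is finite by [comp_fin]. *)
Definition cardc M y : nat := xget 0%N [set n | hcard (fun u : M => hc y u = u) n].
Lemma cardcP M y : hcard (fun u : M => hc y u = u) (cardc M y).
Proof.
have [s hs] := comp_fin M y; have [n hn] := hcard_seq hs.
by rewrite /cardc; case: xgetP => [m -> //|/(_ n)].
Qed.
Lemma cardcE M y n : hcard (fun u : M => hc y u = u) n -> cardc M y = n.
Proof. exact: hcard_uniq (cardcP M y). Qed.
Lemma cardc_gt0 M y : (0 < cardc M y)%N.
Proof.
have [F [f [<- _ h]]] := cardcP M y; have [u _] := (h 0).1 (hc0 _ y).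
by apply/card_gt0P; exists u.
Qed.

Lemma cardc_OO z y : -1 <= llev (z + y) -> cardc (OO z) y = (q ^ absz (llev (z + y)%R + 1)%R)%N.
Proof.
move=> hl; apply: cardcE; apply: hcard_iff (card_Ahomog hl) => a; exact: AhomogP.
Qed.

(** In degrees x + lc with l large the torsion involved has disappeared and all partially defined
    maps are defined, so that exactness up to torsion becomes exactness. *)
Lemma cardc_exact M N Q (f : @Mor k coh M N) (g : @Mor k coh N Q) x : short_exact f g ->
  exists l0 : nat, forall l : nat, (l0 <= l)%N ->
    cardc N (xl x l) = (cardc M (xl x l) * cardc Q (xl x l))%N.
Proof.
move=> /short_exactW[f' [g' [_ _ [h1 h2 h3 h4]]]].
have [a0 ha0] := tors_high x (fdom_gsub f') (@gsubT k p M) (fun u _ => fdomT f' u).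
have [a1 ha1] := tors_high x (fdom_gsub g') (@gsubT k p N) (fun u _ => fdomT g' u).
have [a2 ha2] := tors_high x (rimgT_gsub g') (@gsubT k p Q) (fun u _ => h4 u).
have T0 M' : exists a : nat, forall l : nat, (a <= l)%N -> forall u : M', tors0 u ->
    hc (xl x l) u = u -> u = 0.
  exact: tors_high (@gsub_set0 k p M') (@tors0_gsub k p M') (fun u h => h).
have [a3 ha3] := T0 M; have [a4 ha4] := T0 N; have [a5 ha5] := T0 Q.
have [a6 ha6] := tors_high x (rimgT_gsub f') (tors_gsub (rimgT_gsub f')) (fun u h => h).
exists (a0 + a1 + a2 + a3 + a4 + a5 + a6)%N => l hl; apply: cardcE; set y := x + _.
have {}ha0 := ha0 l; have {}ha1 := ha1 l; have {}ha2 := ha2 l; have {}ha3 := ha3 l.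
have {}ha4 := ha4 l; have {}ha5 := ha5 l; have {}ha6 := ha6 l.
rewrite -/y in ha0 ha1 ha2 ha3 ha4 ha5 ha6.
have Phi u : exists n, hc y u = u -> f' u n /\ hc y n = n.
  have [hu|] := pselect (hc y u = u); last by exists 0.
  have [|n hn] := ha0 _ u I hu; first lia.
  by exists (hc y n) => _; rewrite hcid; split=> //; have := grel_hc (fgrP f') y hn; rewrite hu.
have [phi hphi] := choice Phi.
have Psi (z : Q) : exists n, hc y z = z -> g' n z /\ hc y n = n.
  have [hz|] := pselect (hc y z = z); last by exists 0.
  have [|n _ hn] := ha2 _ z I hz; first lia.
  by exists (hc y n) => _; rewrite hcid; split=> //; have := grel_hc (fgrP g') y hn; rewrite hz.
have [psi hpsi] := choice Psi.
have z4 (u : N) : tors0 u -> hc y u = u -> u = 0 by apply: ha4; lia.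
have z5 (u : Q) : tors0 u -> hc y u = u -> u = 0 by apply: ha5; lia.
have z3 (u : M) : tors0 u -> hc y u = u -> u = 0 by apply: ha3; lia.
have hB (M' : grmod) (u v : M') : hc y u = u -> hc y v = v -> hc y (u - v) = u - v.
  by move=> hu hv; rewrite hcB hu hv.
apply: (hcard_prod (g := fun u (z : Q) => phi u + psi z) _ _ (cardcP M y) (cardcP Q y)).
  move=> u z u' z' hu hz hu' hz' e.
  have [f1 e1] := hphi _ hu; have [f2 e2] := hphi _ hu'.
  have [g1 e3] := hpsi _ hz; have [g2 e4] := hpsi _ hz'.
  have E : phi u - phi u' = psi z' - psi z.
    by apply: (@addIr _ (phi u' + psi z)); rewrite addrA subrK e; abel.
  have ezz : z = z'.
    apply/eqP; rewrite -subr_eq0; apply/eqP; apply: z5; last exact: hB.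
    have gd := grelB (fgrP g') g2 g1; rewrite -E in gd.
    have := h2 _ _ _ (grelB (fgrP f') f1 f2) gd => t.
    by rewrite -opprB -scaleN1r; exact: tors0Z.
  split=> //; apply/eqP; rewrite -subr_eq0; apply/eqP; apply: z3; last exact: hB.
  apply: (h1 _ _ (grelB (fgrP f') f1 f2)).
  by rewrite E ezz subrr; exact: tors00.
move=> n; split=> [hn|[u [z [hu hz ->]]]]; last first.
  by rewrite hcD; have [_ ->] := hphi _ hu; have [_ ->] := hpsi _ hz.
have [|z gz] := ha1 _ n I hn; first lia.
have {}gz : g' n (hc y z) by have := grel_hc (fgrP g') y gz; rewrite hn.
have [gp hp] := hpsi _ (hcid y z).
have hd : hc y (n - psi (hc y z)) = n - psi (hc y z) by exact: hB.
have g0 : g' (n - psi (hc y z)) 0 by rewrite -(subrr (hc y z)); exact: (grelB (fgrP g')).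
have [|u _ hu] := ha6 _ _ (h3 _ _ g0 (@tors00 _ _ Q)) hd; first lia.
have {}hu : f' (hc y u) (n - psi (hc y z)) by have := grel_hc (fgrP f') y hu; rewrite hd.
exists (hc y u), (hc y z); split; [exact: hcid | exact: hcid |].
have [fu ph] := hphi _ (hcid y u).
have -> : phi (hc y u) = n - psi (hc y z).
  apply/eqP; rewrite -subr_eq0; apply/eqP; apply: z4; last exact: hB.
  exact: fracB fu hu.
by rewrite subrK.
Qed.

Local Notation p0 := (pdiv #|k|).
Lemma qgt1 : (1 < q)%N. Proof. by apply/card_gt1P; exists 0, 1; rewrite !inE eq_sym oner_eq0. Qed.

(** A logarithm with respect to a prime dividing q: it turns products of cardinalities into sums,
    and on line bundles in high degrees it is [e0] times the dimension. *)
Definition dlog M y : nat := logn p0 (cardc M y).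
Definition e0 : nat := logn p0 q.
Lemma e0_gt0 : (0 < e0)%N.
Proof. by rewrite /e0 logn_gt0 mem_primes pdiv_prime ?qgt1 ?pdiv_dvd // ltnW // qgt1. Qed.

Lemma dlog_exact M N Q (f : @Mor k coh M N) (g : @Mor k coh N Q) x : short_exact f g ->
  exists l0 : nat, forall l : nat, (l0 <= l)%N -> dlog N (xl x l) =
    (dlog M (xl x l) + dlog Q (xl x l))%N.
Proof.
move=> /(cardc_exact x)[l0 h]; exists l0 => l /h e.
by rewrite /dlog e lognM ?cardc_gt0.
Qed.

Lemma dlog_OO z x : exists l0 : nat, forall l : nat, (l0 <= l)%N ->
  (dlog (OO z) (xl x l))%:Z = e0%:Z * (llev (z + x) + l%:Z + 1).
Proof.
exists (absz (llev (z + x))) => l hl; rewrite /dlog.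
have e : llev (z + xl x l) = llev (z + x) + l%:Z by rewrite addrA llevDc.
rewrite cardc_OO e; last lia.
rewrite lognX mulnC PoszM gez0_abs //; lia.
Qed.

(** Classes of distinct objects are linearly independent, so a vanishing formal combination still
    vanishes when the objects are replaced by numbers. The map r selects one index for each object,
    which collects equal objects. *)
Lemma cls_eval (F : finType) (Y : F -> coh) (c : F -> int) (phi : coh -> int) :
  (forall W, \sum_i c i * cls (Y i) W = 0) -> \sum_i c i * phi (Y i) = 0.
Proof.
move=> h; pose r i := odflt i [pick j | `[< Y j = Y i >]].
have rY i : Y (r i) = Y i by rewrite /r; case: pickP => [j /asboolP|] //=.
have rE i j : Y i = Y j -> r i = r j.
  move=> e; rewrite /r e; case: pickP => [//|] /(_ j).
  by rewrite (_ : `[< _ >] = true) //; apply/asboolP.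
rewrite (partition_big r xpredT) //= big1 // => j _.
have [[i0 ri0]|no] := pselect (exists i, r i = j); last first.
  by rewrite big1 // => i /eqP ri; case: no; exists i.
have rj : r j = j by rewrite -{1}ri0 -[RHS]ri0; apply: rE; rewrite rY.
rewrite (eq_bigr (fun i => c i * phi (Y j))) => [|i /eqP ri]; last by rewrite -ri rY.
rewrite -mulr_suml (_ : \sum_(i | r i == j) c i = 0) ?mul0r // -[RHS](h (Y j)) big_mkcond /=.
symmetry; apply: eq_bigr => i _; rewrite /cls; case: asboolP => [e|e].
  by rewrite -(rE _ _ e) rj eqxx mulr1.
by rewrite mulr0; case: eqP => // ri; case: e; rewrite -[in LHS]ri rY.
Qed.

Definition tri (M N Q : coh) (t : 'I_3) : coh := if t == 0 then M else if t == 1 then N else Q.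
Definition tric (a b c : int) (t : 'I_3) : int := if t == 0 then a else if t == 1 then b else c.
Lemma tri_sum (M N Q : coh) (a b c : int) (phi : coh -> int) :
  \sum_t tric a b c t * phi (tri M N Q t) = a * phi M + b * phi N + c * phi Q.
Proof. by rewrite !big_ord_recr big_ord0 /= add0r. Qed.

(** Only finitely many short exact sequences enter an element of the relation group, so one
    threshold l0 serves all of them. *)
Lemma K0_dlog (u : coh -> int) x : @K0_rel k coh u -> exists (F : finType) (Y : F -> coh) (c : F -> int) (l0 : nat),
  (forall W, u W = \sum_i c i * cls (Y i) W) /\
  forall l : nat, (l0 <= l)%N -> \sum_i c i * (dlog (Y i) (xl x l))%:Z = 0.
Proof.
have step (M N Q : coh) (f : @Mor k coh M N) (g : @Mor k coh N Q) (u' : coh -> int) (e : int) : short_exact f g ->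
  (exists (F : finType) (Y : F -> coh) (c : F -> int) (l0 : nat), (forall W, u' W = \sum_i c i * cls (Y i) W) /\
    forall l : nat, (l0 <= l)%N -> \sum_i c i * (dlog (Y i) (xl x l))%:Z = 0) ->
  exists (F : finType) (Y : F -> coh) (c : F -> int) (l0 : nat),
    (forall W, u' W + e * (cls N W - cls M W - cls Q W) = \sum_i c i * cls (Y i) W) /\
    forall l : nat, (l0 <= l)%N -> \sum_i c i * (dlog (Y i) (xl x l))%:Z = 0.
  move=> /(dlog_exact x)[l1 h1] [F [Y [c [l0 [hu h0]]]]].
  exists (F + 'I_3)%type, (fun i => match i with inl i => Y i | inr t => tri M N Q t end),
    (fun i => match i with inl i => c i | inr t => tric (- e) e (- e) t end), (l0 + l1)%N; split=> [W|l hl].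
    rewrite big_sumType /= -hu (tri_sum M N Q _ _ _ (fun Y => cls Y W)).
    by congr (_ + _); move: (cls M W) (cls N W) (cls Q W) => a b d; ring.
  rewrite big_sumType /= (tri_sum M N Q _ _ _ (fun Y => (dlog Y (xl x l))%:Z)).
  rewrite h0 ?add0r ?h1; [|lia|lia]; rewrite PoszD; move: (dlog M _)%:Z (dlog Q _)%:Z => a b; ring.
elim=> [|M N Q f g {}u hfg _ /(step _ _ _ _ _ _ 1 hfg)[F [Y [c [l0 [h1 h2]]]]]|
  M N Q f g {}u hfg _ /(step _ _ _ _ _ _ (-1) hfg)[F [Y [c [l0 [h1 h2]]]]]].
- exists void, (fun v : void => match v with end), (fun=> 0), 0%N; split=> [W|l _]; by rewrite big1 // => -[].
- by exists F, Y, c, l0; split=> // W; rewrite -h1 mul1r.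
- by exists F, Y, c, l0; split=> // W; rewrite -h1 mulN1r.
Qed.

Lemma K0_eq_dlog (E E' S : coh) x : K0_eq (fun W => cls E' W + cls S W) (@cls k coh E) ->
  exists l0 : nat, forall l : nat, (l0 <= l)%N ->
  (dlog E' (xl x l) + dlog S (xl x l))%N = dlog E (xl x l).
Proof.
move=> /(K0_dlog x)[F [Y [c [l0 [hu h0]]]]]; exists l0 => l /h0 h.
have := @cls_eval (F + 'I_3)%type (fun i => match i with inl i => Y i | inr t => tri E' S E t end)
  (fun i => match i with inl i => c i | inr t => tric (-1) (-1) 1 t end) (fun Y => (dlog Y (xl x l))%:Z).
rewrite [X in _ -> X = 0]big_sumType /= h add0r (tri_sum E' S E _ _ _ (fun Y => (dlog Y (xl x l))%:Z)) => H; apply/eqP; rewrite -eqz_nat PoszD -subr_eq0 -oppr_eq0; apply/eqP.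
rewrite -[RHS]H => [|W]; first by move: (dlog _ _)%:Z (dlog _ _)%:Z (dlog _ _)%:Z => a b d; ring.
rewrite big_sumType /= -hu (tri_sum E' S E _ _ _ (fun Y => cls Y W)).
by move: (cls E' W) (cls S W) (cls E W) => a b d; ring.
Qed.

(** For l large, the component of E in degree x + lc has dimension [hilb a s x] + 2l + 2, by
    [dlog_EB]. *)
Definition hilb (a : L) (s : 'I_3 -> nat) x : int := llev (ub1 a s + x) + llev (ub2 a + x).

Lemma dlog_EB a s (E : coh) x : EB a s E -> exists l0 : nat, forall l : nat, (l0 <= l)%N ->
  (dlog E (xl x l))%:Z = e0%:Z * (hilb a s x + 2 * l%:Z + 2).
Proof.
move=> [f [g [/(dlog_exact x)[l0 h0] _]]].
have [l1 h1] := dlog_OO (ub1 a s) x; have [l2 h2] := dlog_OO (ub2 a) x.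
exists (l0 + l1 + l2)%N => l hl.
have [b0 b1 b2] : [/\ (l0 <= l)%N, (l1 <= l)%N & (l2 <= l)%N] by split; lia.
move: (h0 _ b0) (h1 _ b1) (h2 _ b2); rewrite /hilb.
move: (dlog E (xl x l)) (dlog (OO (ub1 a s)) (xl x l)) (dlog (OO (ub2 a)) (xl x l)) => t0 t1 t2 -> e1 e2.
rewrite PoszD e1 e2; move: (llev _) (llev _) l%:Z e0%:Z => u v t e; by ring.
Qed.

Lemma dlog_SS i n z (S : coh) x : isSS i n z S -> exists l0 : nat, forall l : nat, (l0 <= l)%N ->
  (dlog S (xl x l))%:Z = e0%:Z * (llev (z + x) - llev (z - xvec p i *~ n%:Z + x)).
Proof.
move=> [g /(dlog_exact x)[l0 h0]].
have [l1 h1] := dlog_OO z x; have [l2 h2] := dlog_OO (z - xvec p i *~ n%:Z) x.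
exists (l0 + l1 + l2)%N => l hl.
have [b0 b1 b2] : [/\ (l0 <= l)%N, (l1 <= l)%N & (l2 <= l)%N] by split; lia.
move: (h0 _ b0) (h1 _ b1) (h2 _ b2).
move: (dlog (OO z) (xl x l)) (dlog (OO (z - xvec p i *~ n%:Z)) (xl x l)) (dlog S (xl x l)) => t0 t1 t2 e e1 e2.
move/(congr1 Posz): e; rewrite PoszD e1 e2 => e.
have -> : t2%:Z = e0%:Z * (llev (z + x) + l%:Z + 1) - e0%:Z * (llev (z - xvec p i *~ n%:Z + x) + l%:Z + 1).
  by rewrite e; move: (llev _) t2%:Z e0%:Z l%:Z => u v t e'; ring.
by apply/eqP; rewrite -subr_eq0; apply/eqP; move: (llev _) (llev _) l%:Z e0%:Z => u v t e'; ring.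
Qed.

Lemma hilb_sum a s a' s' i n z (E E' S : coh) x : EB a s E -> EB a' s' E' -> isSS i n z S ->
  (exists l0 : nat, forall l : nat, (l0 <= l)%N ->
    (dlog E' (xl x l) + dlog S (xl x l))%N = dlog E (xl x l)) ->
  hilb a' s' x + (llev (z + x) - llev (z - xvec p i *~ n%:Z + x)) = hilb a s x.
Proof.
move=> hE hE' hS [l0 h0]; have [l1 h1] := dlog_EB x hE; have [l2 h2] := dlog_EB x hE'.
have [l3 h3] := dlog_SS x hS; pose l := (l0 + l1 + l2 + l3)%N.
have [b0 b1 b2 b3] : [/\ (l0 <= l)%N, (l1 <= l)%N, (l2 <= l)%N & (l3 <= l)%N] by rewrite /l; split; lia.
have := congr1 Posz (h0 _ b0); rewrite PoszD (h1 _ b1) (h2 _ b2) (h3 _ b3) -mulrDr => /mulfI H.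
have /H {H} : e0%:Z != 0 by have := e0_gt0; rewrite lt0n.
move: (hilb a' s' x) (hilb a s x) (llev _) (llev _) l%:Z => u v u' v' t h.
by apply: (@addIr _ (2 * t + 2)); rewrite !addrA in h *; rewrite -h; ring.
Qed.
End Hilbert.

(** * Extension bundles with the same Hilbert function *)

Section FloorFunctions.
Variable d : nat.
Hypothesis d0 : (0 < d)%N.
Local Notation D := (d%:Z).

Lemma divz_jump (z : int) : ((z + 1) %/ D)%Z = (z %/ D)%Z + (D %| z + 1)%Z%:R.
Proof.
have dn : D != 0 by lia.
have E := divz_eq z D; have h1 := modz_ge0 z dn; have h2 := ltz_pmod z (_ : 0 < D).
move: E h1 h2; set u := (z %/ D)%Z; set r := (z %% D)%Z => E h1 h2.
have {}h2 : r < D by apply: h2; lia.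
have [e|ne] := eqVneq (r + 1) D.
  have -> : z + 1 = (u + 1) * D by rewrite E -addrA e mulrDl mul1r.
  by rewrite dvdz_mull // mulzK.
have -> : z + 1 = u * D + (r + 1) by rewrite addrA -E.
rewrite divzMDl // [((r + 1) %/ _)%Z]divz_small ?addr0; last by lia.
rewrite (_ : (D %| _)%Z = false) ?addr0 //; apply/negP => /dvdzP[v ev].
have : (v - u) * D = r + 1 by rewrite mulrBl -ev; ring.
move=> ev'; have [h|h] := leP (v - u) 0; [|have : 1 <= v - u by lia]; nia.
Qed.

Definition phi (a s x : int) : int := ((a + s + x) %/ D)%Z + ((a + x) %/ D)%Z.

(** Modulo D the function [phi] jumps at - a and - a - s, and a function known up to a constant
    determines its jumps. The two jumps for b are distinct because 0 < s' < D, so b is congruent to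
    a or to a + s. *)
Lemma phi_jump (a b s s' C : int) : 0 < s' < D -> (forall x, phi b s' x = phi a s x + C) ->
  (exists u v, b = a + u * D /\ s = s' + v * D) \/ (exists u v, b = a + s + u * D /\ s = v * D - s').
Proof.
move=> hs H.
have J y : (D %| b + s' + y)%Z%:R + (D %| b + y)%Z%:R = (D %| a + s + y)%Z%:R + (D %| a + y)%Z%:R :> int.
  have := H y; have := H (y - 1); rewrite /phi.
  have E u : u + y = u + (y - 1) + 1 by ring.
  rewrite !E !divz_jump; move: (_ %/ _)%Z (_ %/ _)%Z (_ %/ _)%Z (_ %/ _)%Z.
  by move: (D %| _)%Z (D %| _)%Z (D %| _)%Z (D %| _)%Z => [] [] [] [] u v w z /=; lia.
have ns : ~~ (D %| s')%Z.
  by apply/negP => /dvdzP[v ev]; have [h|h] := leP v 0; [|have : 1 <= v by lia]; nia.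
have nsN : ~~ (D %| - s')%Z by rewrite -mulN1r dvdzE abszM mul1n -dvdzE.
have := J (- b); have := J (- b - s').
rewrite (_ : b + s' + (- b - s') = 0); last by ring.
rewrite (_ : b + (- b - s') = - s'); last by ring.
rewrite (_ : b + s' + - b = s'); last by ring.
rewrite subrr dvdz0 (negPf ns) (negPf nsN).
have [/dvdzP[u eu]|n1] := boolP (D %| a - b)%Z.
  have -> : a + (- b - s') = - s' + u * D by rewrite -eu; ring.
  rewrite (_ : (D %| - s' + u * D)%Z = false); last by rewrite rpredDr ?dvdz_mull // (negPf nsN).
  have [/dvdzP[v ev]|//] := boolP (D %| a + s + (- b - s'))%Z.
  move=> _ _; left; exists (- u), (v - u); rewrite mulNr mulrBl -ev -eu; split; ring.
have [/dvdzP[u eu]|//] := boolP (D %| a + s - b)%Z.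
have -> : a + s + (- b - s') = - s' + u * D by rewrite -eu; ring.
rewrite (_ : (D %| - s' + u * D)%Z = false); last by rewrite rpredDr ?dvdz_mull // (negPf nsN).
have [/dvdzP[v ev]|//] := boolP (D %| a + (- b - s'))%Z.
move=> _ _; right; exists (- u), (u - v); rewrite mulNr mulrBl -ev -eu; split; ring.
Qed.

Lemma phi_add (a s u x : int) : phi (a + u * D) s x = phi a s x + 2 * u.
Proof.
rewrite /phi (_ : a + u * D + s + x = u * D + (a + s + x)); last by ring.
rewrite (_ : a + u * D + x = u * D + (a + x)); last by ring.
by rewrite !divzMDl; lia.
Qed.
Lemma phi_adds (a s u x : int) : phi a (s + u * D) x = phi a s x + u.
Proof.
rewrite /phi (_ : a + (s + u * D) + x = u * D + (a + s + x)); last by ring.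
by rewrite !divzMDl; lia.
Qed.
Lemma phi_flip (a s x : int) : phi (a + s) (D - s) x = phi a s x + 1.
Proof.
rewrite /phi (_ : a + s + (D - s) + x = 1 * D + (a + x)); last by ring.
by rewrite divzMDl; lia.
Qed.
End FloorFunctions.

Section HilbertUnique.
Variables (k : finFieldType) (p : weights).
Local Notation coh := (cohX k p).

(** The Hilbert function is a sum of three functions of one coordinate each, so the exceptional
    points can be treated one at a time. *)
Lemma hilb_phi (al xi : 'I_3 -> int) (s : 'I_3 -> nat) :
  hilb (xs p al) s (xs p xi) = \sum_t phi (p t) (al t) (s t) (xi t).
Proof.
rewrite /hilb /ub1 /ub2 /vtop.
have -> : xs p al + xs p (fun t => (s t)%:Z) - cvec p + xs p xi =
  xs p (fun t => al t + (s t)%:Z + xi t) + cvec p *~ (-1).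
  by rewrite -!xsD; abel.
have -> : xs p al + cvec p + xs p xi = xs p (fun t => al t + xi t) + cvec p *~ 1.
  by rewrite -!xsD; abel.
by rewrite !llevDc !llev_xs /phi big_split /=; ring.
Qed.

Variables (i j l : 'I_3).
Hypotheses (ij : i != j) (il : i != l) (jl : j != l).

Lemma xs3 (al : 'I_3 -> int) : xs p al = xvec p i *~ al i + xvec p j *~ al j + xvec p l *~ al l.
Proof. by rewrite /xs (sum3 _ ij il jl). Qed.

Lemma xvec_cvec t (u : int) : xvec p t *~ (u * (p t)%:Z) = cvec p *~ u.
Proof. by rewrite mulrC mulrzA -(cvec_xvec p t). Qed.

(* E' is brought to a normal form relative to E; the integer m is the number of
   times r = s_i + n wraps around p_i *)
Lemma EB_normal (E' : coh) a s a' s' z (n m r0 : nat) : sbox p s -> sbox p s' -> EB a' s' E' ->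
  (forall x, hilb a' s' x + (llev (z + x) - llev (z - xvec p i *~ n%:Z + x)) = hilb a s x) ->
  lres z i = lres a i -> (s i + n = p i * m + r0)%N -> (r0 < p i)%N ->
  (0 < r0)%N /\
  EB (a - xvec p i *~ n%:Z + cvec p *~ (m./2)%:Z + (if odd m then xvec p i *~ r0%:Z else 0))
     (fun t => if t == i then if odd m then (p i - r0)%N else r0 else s t) E'.
Proof.
move=> hs hs' hE H hz hr hr0.
have [al ea] := xs_surj a; have [be eb] := xs_surj a'; have [ze ez] := xs_surj z.
have p0 t : (0 < p t)%N by have := wt_ge2 p t; lia.
have [ka eka] : exists u, ze i = al i + u * (p i)%:Z.
  move: hz; rewrite ez ea !lres_xs => hz; exists ((ze i %/ p i)%Z - (al i %/ p i)%Z).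
  by rewrite {1}(divz_eq (ze i) (p i)) {1}(divz_eq (al i) (p i)) hz; ring.
have wi : (p i)%:Z != 0 by rewrite eqz_nat -lt0n.
(* Subtracting the Hilbert function of S displaces by n the jump of E attached to al_i and leaves
   the other one in place. *)
have H1 xi : phi (p i) (be i) (s' i) (xi i) + phi (p j) (be j) (s' j) (xi j) + phi (p l) (be l) (s' l) (xi l) =
    phi (p i) (al i - n%:Z) (s i + n)%N%:Z (xi i) + phi (p j) (al j) (s j) (xi j) + phi (p l) (al l) (s l) (xi l).
  have := H (xs p xi); rewrite eb ea !hilb_phi !(sum3 _ ij il jl) ez.
  have -> : llev (xs p ze + xs p xi) - llev (xs p ze - xvec p i *~ n%:Z + xs p xi) =
      ((al i + xi i) %/ p i)%Z - ((al i - n%:Z + xi i) %/ p i)%Z.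
    rewrite -mulrNz xvecz_xs !xsD !llev_xs !(sum3 _ ij il jl) eqxx.
    rewrite [j == i]eq_sym [l == i]eq_sym (negPf ij) (negPf il) mulr1n mulr0n !addr0 eka.
    rewrite (_ : al i + ka * p i + xi i = ka * (p i)%:Z + (al i + xi i)); last by ring.
    rewrite (_ : al i + ka * p i + - n%:Z + xi i = ka * (p i)%:Z + (al i - n%:Z + xi i)); last by ring.
    by rewrite !divzMDl //; ring.
  rewrite /phi (_ : al i - n%:Z + (s i + n)%N%:Z + xi i = al i + (s i)%:Z + xi i); last by rewrite PoszD; ring.
  by move=> E; apply/eqP; rewrite -subr_eq0; move/eqP: E; rewrite -subr_eq0 => /eqP E; rewrite -[X in _ == X]E; apply/eqP; ring.
pose xi0 (t : 'I_3) (y : int) : 'I_3 -> int := fun t' => if t' == t then y else 0.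
have bx t : 0 < (s' t)%:Z < (p t)%:Z by have := hs' t; lia.
have nij : (j == i) = false by rewrite eq_sym (negPf ij).
have nil : (l == i) = false by rewrite eq_sym (negPf il).
have nlj : (l == j) = false by rewrite eq_sym (negPf jl).
have sol (u v w x y t : int) : u + v + w = x + y + t -> u = x + (y + t - v - w).
  lia.
have Ji : (exists u v, be i = al i - n%:Z + u * (p i)%:Z /\ (s i + n)%N%:Z = (s' i)%:Z + v * (p i)%:Z) \/
   (exists u v, be i = al i - n%:Z + (s i + n)%N%:Z + u * (p i)%:Z /\ (s i + n)%N%:Z = v * (p i)%:Z - (s' i)%:Z).
  apply: (phi_jump (p0 i) (bx i)) => x; have := H1 (xi0 i x); rewrite /xi0 eqxx nij nil; exact: sol.
have sol2 (u v w x y t : int) : u + v + w = x + y + t -> v = y + (x + t - u - w).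
  lia.
have Jj : (exists u v, be j = al j + u * (p j)%:Z /\ (s j)%:Z = (s' j)%:Z + v * (p j)%:Z) \/
   (exists u v, be j = al j + (s j)%:Z + u * (p j)%:Z /\ (s j)%:Z = v * (p j)%:Z - (s' j)%:Z).
  apply: (phi_jump (p0 j) (bx j)) => x; have := H1 (xi0 j x); rewrite /xi0 eqxx (negPf ij) nlj; exact: sol2.
have sol3 (u v w x y t : int) : u + v + w = x + y + t -> w = t + (x + y - u - v).
  lia.
have Jl : (exists u v, be l = al l + u * (p l)%:Z /\ (s l)%:Z = (s' l)%:Z + v * (p l)%:Z) \/
   (exists u v, be l = al l + (s l)%:Z + u * (p l)%:Z /\ (s l)%:Z = v * (p l)%:Z - (s' l)%:Z).
  apply: (phi_jump (p0 l) (bx l)) => x; have := H1 (xi0 l x); rewrite /xi0 eqxx (negPf il) (negPf jl); exact: sol3.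
have box1 t (u v : int) : (s t)%:Z = (s' t)%:Z + v * (p t)%:Z -> v = 0 /\ s' t = s t.
  move=> e; have hb := hs t; have hb' := hs' t.
  have v0 : v = 0 by have [h|h] := ltP v 0; [have : v <= -1 by lia | have [//|h'] := eqVneq v 0; have : 1 <= v by lia]; nia.
  by rewrite v0 in e; split=> //; lia.
have box2 t (u v : int) : (s t)%:Z = v * (p t)%:Z - (s' t)%:Z -> v = 1 /\ s' t = (p t - s t)%N.
  move=> e; have hb := hs t; have hb' := hs' t.
  have v1 : v = 1 by have [h|h] := ltP v 1; [have : v <= 0 by lia | have [//|h'] := eqVneq v 1; have : 2 <= v by lia]; nia.
  by rewrite v1 in e; split=> //; lia.
have Hm : (s i + n)%N%:Z = m%:Z * (p i)%:Z + r0%:Z by rewrite hr PoszD PoszM mulrC.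
have boxi1 (v : int) : (s i + n)%N%:Z = (s' i)%:Z + v * (p i)%:Z -> v = m%:Z /\ s' i = r0.
  move=> e; have hb := bx i.
  have v0 : v = m%:Z by have [h|h] := ltP v m%:Z; [have : v <= m%:Z - 1 by lia | have [//|h'] := eqVneq v m%:Z; have : m%:Z + 1 <= v by lia]; nia.
  by rewrite v0 in e; split=> //; lia.
have boxi2 (v : int) : (s i + n)%N%:Z = v * (p i)%:Z - (s' i)%:Z -> [/\ v = m%:Z + 1, s' i = (p i - r0)%N & (0 < r0)%N].
  move=> e; have hb := bx i.
  have v0 : v = m%:Z + 1 by have [h|h] := ltP v (m%:Z + 1); [have : v <= m%:Z by lia | have [//|h'] := eqVneq v (m%:Z + 1); have : m%:Z + 2 <= v by lia]; nia.
  by rewrite v0 in e; split=> //; lia.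
have fin a2 s2 : (0 < r0)%N -> EB a2 s2 E' ->
  a2 = a - xvec p i *~ n%:Z + cvec p *~ (m./2)%:Z + (if odd m then xvec p i *~ r0%:Z else 0) ->
  s2 i = (if odd m then (p i - r0)%N else r0) -> s2 j = s j -> s2 l = s l ->
  (0 < r0)%N /\
  EB (a - xvec p i *~ n%:Z + cvec p *~ (m./2)%:Z + (if odd m then xvec p i *~ r0%:Z else 0))
     (fun t => if t == i then if odd m then (p i - r0)%N else r0 else s t) E'.
  move=> r00 h ea2 e1 e2 e3; rewrite -ea2; split=> //; move: h.
  suff -> : s2 = (fun t => if t == i then if odd m then (p i - r0)%N else r0 else s t) by [].
  by apply/funext => t; case: (ord3_eq t ij il jl) => ->; rewrite ?eqxx ?nij ?nil.
have mm := odd_double_half m.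
have H0 := H1 (fun=> 0).
have fl t (b : int) (x : int) : phi (p t) (b + (s t)%:Z) (p t - s t)%N%:Z x = phi (p t) b (s t) x + 1.
  by have := hs t => hb; rewrite -subzn ?phi_flip //; lia.
have fli (b : int) (x : int) : phi (p i) (b + (s i + n)%N%:Z) (p i - r0)%N%:Z x = phi (p i) b (s i + n)%N%:Z x + m%:Z + 1.
  rewrite Hm [m%:Z * _ + _]addrC phi_adds // addrA phi_add //.
  by rewrite -subzn ?phi_flip //; [ring | exact: ltnW].
have fl0 (b : int) (x : int) : phi (p i) b r0%:Z x = phi (p i) b (s i + n)%N%:Z x - m%:Z.
  by rewrite Hm [m%:Z * _ + _]addrC phi_adds //; ring.
have cp t : xvec p t *~ (p t)%:Z = cvec p by rewrite -[(p t)%:Z]mul1r xvec_cvec.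
have ji : j != i by rewrite eq_sym.
have li : l != i by rewrite eq_sym.
have lj : l != j by rewrite eq_sym.
have A1 := xs3 al; have A2 := xs3 be; rewrite -ea in A1; rewrite -eb in A2.
have leR : (r0 <= p i)%N by exact: ltnW.
have leS t : (s t <= p t)%N by have := hs t; lia.
(* Each index is flipped or not, which gives eight cases. Comparing both sides at 0 fixes the parity
   of m, and [EB_flip], which acts on two indices at a time, restores s_j and s_l. *)
case: Ji => [[ui [vi [bi /boxi1[_ si]]]]|[ui [vi [bi /boxi2[_ si r00]]]]].
- have r00 : (0 < r0)%N by rewrite -si; have := hs' i; lia.
  case: Jj => [[uj [vj [bj /(box1 j uj)[_ sj]]]]|[uj [vj [bj /(box2 j uj)[_ sj]]]]];
  case: Jl => [[ul [vl [bl /(box1 l ul)[_ sl]]]]|[ul [vl [bl /(box2 l ul)[_ sl]]]]];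
  move: H0 A2; rewrite bi bj bl si sj sl !phi_add // ?fl ?fl0 !mulrzDr !xvec_cvec ?mulrNz => H0 A2.
  + have K : ui + uj + ul = (m./2)%:Z by lia.
    have om : odd m = false by lia.
    apply: (fin _ _ r00 hE); rewrite ?om // A1 A2 -K addr0; abel.
  + have K : ui + uj + ul = (m./2)%:Z by lia.
    have om : odd m = true by lia.
    apply: (fin _ _ r00 (EB_flip ji jl il hs' hE)); rewrite /sflip ?om ?eqxx ?(negPf ij) ?(negPf lj) ?si ?sj ?sl ?(negPf jl) //.
      by rewrite /aflip A1 A2 -K si sl -subzn // mulrzBr cp; abel.
    by rewrite subKn.
  + have K : ui + uj + ul = (m./2)%:Z by lia.
    have om : odd m = true by lia.
    apply: (fin _ _ r00 (EB_flip li lj ij hs' hE)); rewrite /sflip ?om ?eqxx ?(negPf il) ?(negPf jl) ?si ?sj ?sl //.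
      by rewrite /aflip A1 A2 -K si sj -subzn // mulrzBr cp; abel.
    by rewrite subKn.
  + have K : ui + uj + ul + 1 = (m./2)%:Z by lia.
    have om : odd m = false by lia.
    apply: (fin _ _ r00 (EB_flip ij il jl hs' hE)); rewrite /sflip ?om ?eqxx ?nij ?nil ?si ?sj ?sl ?subKn //.
    by rewrite /aflip A1 A2 -K sj sl -!subzn // !mulrzBr !cp; abel.
- have Ci : xvec p i *~ (s i + n)%N%:Z = cvec p *~ m%:Z + xvec p i *~ r0%:Z by rewrite Hm mulrzDr xvec_cvec.
  case: Jj => [[uj [vj [bj /(box1 j uj)[_ sj]]]]|[uj [vj [bj /(box2 j uj)[_ sj]]]]];
  case: Jl => [[ul [vl [bl /(box1 l ul)[_ sl]]]]|[ul [vl [bl /(box2 l ul)[_ sl]]]]];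
  move: H0 A2; rewrite bi bj bl si sj sl !phi_add // ?fl ?fli !mulrzDr !xvec_cvec ?mulrNz Ci => H0 A2.
  + have K : ui + uj + ul + m%:Z = (m./2)%:Z by lia.
    have om : odd m = true by lia.
    apply: (fin _ _ r00 hE); rewrite ?om // A1 A2 -K; abel.
  + have K : ui + uj + ul + m%:Z + 1 = (m./2)%:Z by lia.
    have om : odd m = false by lia.
    apply: (fin _ _ r00 (EB_flip ji jl il hs' hE)); rewrite /sflip ?om ?eqxx ?(negPf ij) ?(negPf lj) ?si ?sj ?sl ?(negPf jl) ?subKn //.
    by rewrite /aflip A1 A2 -K si sl -!subzn // !mulrzBr !cp; abel.
  + have K : ui + uj + ul + m%:Z + 1 = (m./2)%:Z by lia.
    have om : odd m = false by lia.
    apply: (fin _ _ r00 (EB_flip li lj ij hs' hE)); rewrite /sflip ?om ?eqxx ?(negPf il) ?(negPf jl) ?si ?sj ?sl ?subKn //.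
    by rewrite /aflip A1 A2 -K si sj -!subzn // !mulrzBr !cp; abel.
  + have K : ui + uj + ul + m%:Z + 1 = (m./2)%:Z by lia.
    have om : odd m = true by lia.
    apply: (fin _ _ r00 (EB_flip ij il jl hs' hE)); rewrite /sflip ?om ?eqxx ?nij ?nil ?si ?sj ?sl ?subKn //.
    by rewrite /aflip A1 A2 -K sj sl -!subzn // !mulrzBr !cp; abel.
Qed.
End HilbertUnique.

(** * Dimensions of Hom and Ext *)

Section Dimensions.
Variable k : finFieldType.
Local Notation q := #|k|.

Lemma basis_card (V : lmodType k) d (b : 'I_d -> V) : is_basis b -> hcard (fun v : V => True) (q ^ d).
Proof.
move=> hb; exists {ffun 'I_d -> k}, (fun a : {ffun 'I_d -> k} => \sum_i a i *: b i); split.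
- by rewrite card_ffun card_ord.
- move=> a a' e; have [c [_ hc]] := hb (\sum_i a i *: b i).
  by rewrite -(hc a) // -(hc a').
- by move=> v; split=> // _; have [a [-> _]] := hb v; exists a.
Qed.

(** Take a spanning family of minimal size: two different expressions of a vector would allow one
    member to be removed. *)
Lemma finite_basis (V : lmodType k) n : hcard (fun v : V => True) n ->
  exists d (b : 'I_d -> V), is_basis b.
Proof.
move=> [F [f [_ _ hf]]].
pose sp d := `[< exists b : 'I_d -> V, forall v, exists a : {ffun 'I_d -> k}, v = \sum_i a i *: b i >].
have ex : exists d, sp d.
  exists #|F|; apply/asboolP; exists (fun i => f (enum_val i)) => v; have [u <-] := (hf v).1 I.
  exists [ffun i => (i == enum_rank u)%:R]; rewrite (bigD1 (enum_rank u)) //= ffunE eqxx scale1r enum_rankK.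
  by rewrite big1 ?addr0 // => i hi; rewrite ffunE (negPf hi) scale0r.
case: (ex_minnP ex) => -[|d] /asboolP[b hb] hmin.
  exists 0%N, b => v; have [a ea] := hb v; exists a; split=> // a' _; apply/ffunP; by case.
exists d.+1, b => v; have [a ea] := hb v; exists a; split=> // a' ea'; apply/ffunP => i0.
apply/eqP/negPn/negP => ne; have : sp d; last by move=> /hmin; rewrite ltnn.
pose c := a i0 - a' i0; have c0 : c != 0 by rewrite subr_eq0.
have E : b i0 = \sum_(t < d) ((- (a (lift i0 t) - a' (lift i0 t)) / c) *: b (lift i0 t)).
  have := ea; rewrite ea' => /eqP; rewrite eq_sym -subr_eq0 -sumrB (bigD1_ord i0) //= => /eqP h.
  apply: (can_inj (scalerK c0)); rewrite scaler_sumr.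
  rewrite (eq_bigr (fun t => - (a (lift i0 t) *: b (lift i0 t) - a' (lift i0 t) *: b (lift i0 t)))) => [|t _].
    by rewrite sumrN; apply/eqP; rewrite -subr_eq0 opprK /c scalerBl; apply/eqP.
  by rewrite scalerA mulrC divfK // scaleNr scalerBl.
apply/asboolP; exists (fun t => b (lift i0 t)) => w; have [e ->] := hb w.
exists [ffun t => e (lift i0 t) + e i0 * (- (a (lift i0 t) - a' (lift i0 t)) / c)].
rewrite (bigD1_ord i0) //= {1}E scaler_sumr -big_split; apply: eq_bigr => t _ /=.
by rewrite ffunE scalerDl scalerA addrC.
Qed.

Lemma hcard_inj (T : Type) (T' : eqType) (P : T -> Prop) (Q : T' -> Prop) n (g : T' -> T) :
  hcard P n -> (forall x, Q x -> P (g x)) -> (forall x y, Q x -> Q y -> g x = g y -> x = y) ->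
  exists m, hcard Q m.
Proof.
move=> [F [f [_ _ hf]]] gP gi.
have H u : exists o : option T', forall x, Q x -> g x = f u -> o = Some x.
  have [[x [Qx e]]|no] := pselect (exists x, Q x /\ g x = f u).
    by exists (Some x) => y Qy ey; congr Some; apply: gi => //; rewrite e ey.
  by exists None => x Qx e; case: no; exists x.
have [h hh] := choice H.
apply: (@hcard_seq _ _ (pmap h (enum F))) => x Qx; have [u eu] := (hf _).1 (gP _ Qx).
by rewrite mem_pmap; apply/mapP; exists u; rewrite ?mem_enum // (hh u x).
Qed.

Variable C : lincat k.

Lemma dimHom_card (M N : C) d : hcard (fun v : Mor M N => True) (q ^ d) -> dimHom M N = d.
Proof.
move=> h; have [d' [b hb]] := finite_basis h; rewrite /dimHom.
case: xgetP => [m -> [b' hb']|/(_ d')]; last by case; exists b.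
have := hcard_uniq (basis_card hb') h; apply: expnI; exact: qgt1.
Qed.

Lemma split_retract (M N Q : C) (f : Mor M N) (g : Mor N Q) : short_exact f g -> split_epi g ->
  exists r, compm r f = idm M.
Proof.
move=> [[gf K] _] [s hs]; have [|r [hr _]] := K _ (idm N - compm s g).
  by rewrite compBr compf1 compA hs comp1f subrr.
exists r; have [u [_ hu]] := K _ f gf; rewrite -(hu (idm M)) ?compf1 //; apply/esym/hu.
by rewrite compA hr compBl comp1f -compA gf comp0r subr0.
Qed.

(** A nonempty basis is impossible: when all extensions split, any family of coefficients represents
    the given class, against uniqueness. The remaining cases, an empty basis and the default value,
    both give 0. *)
Lemma dimExt1_0 (M N : C) : (forall xi : extension M N, split_epi (eproj xi)) -> dimExt1 M N = 0%N.
Proof.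
move=> hsp; rewrite /dimExt1; case: xgetP => [[//|d] _ [xi hxi]|//].
have [a [[B [pr [eta [hpow hpush _]]]] ua]] := hxi (xi ord0).
have R t := split_retract (eexact (xi t)) (hsp (xi t)).
have [rho [hrho _]] := hpow _ (fun t => compm (projT1 (cid (R t))) (projT1 (cid (hpush t)))).
have er : compm rho (einj eta) = idm B.
  have [u [_ hu]] := hpow B pr; rewrite -(hu (idm B)) => [|t]; last by rewrite compf1.
  apply/esym/hu => t; rewrite compA hrho -compA.
  have [-> _] := projT2 (cid (hpush t)); by rewrite compA (projT2 (cid (R t))) comp1f.
have [s hs] := hsp (xi ord0).
have all a2 : a = a2.
  apply: ua; exists B, pr, eta; split=> //; set P := \sum_t _.
  exists (compm (einj (xi ord0)) (compm P rho) + compm s (eproj eta)); split.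
    rewrite compDl -!compA er compf1 (_ : compm (eproj eta) (einj eta) = 0) ?comp0r ?addr0 //.
    exact: (eexact eta).1.1.
  rewrite compDr !compA hs comp1f (_ : compm (eproj (xi ord0)) (einj (xi ord0)) = 0) ?comp0l ?add0r //.
  exact: (eexact (xi ord0)).1.1.
have := all [ffun=> 0]; rewrite (all [ffun=> 1]) => /ffunP/(_ ord0); rewrite !ffunE => /eqP.
by rewrite oner_eq0.
Qed.
End Dimensions.

(** * Morphisms and extensions between extension bundles *)

Section HomBundles.
Variables (k : finFieldType) (p : weights).
Local Notation L := (Lgrp p).
Local Notation A := (coordA k p).
Local Notation X := (Xvar k p).
Local Notation coh := (cohX k p).
Local Notation OO := (OO k).
Local Notation q := #|k|.

Lemma card_OO z w : -1 <= llev (w - z) ->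
  hcard (fun v : @Mor k coh (OO z) (OO w) => True) (q ^ absz (llev (w - z) + 1)).
Proof.
move=> /card_Ahomog h; have := hcard_im (g := fun a : A => elm z (a : OO w)) _ (h k).
move=> H; apply: hcard_iff (H _) => [f|a b ha hb e].
  split=> // _; have [a ha ->] := OO_elm f; by exists a.
apply/eqP; rewrite -subr_eq0; apply/eqP; apply: (@saturated_OO k p w).1.
rewrite -(OO_hc (AhomogD ha (AhomogN hb))); apply/elm0.
by rewrite [X in elm _ X](_ : _ = (a : OO w) - b) // elmD elmN e subrr.
Qed.

Section EBsource.
Variables (i j l : 'I_3) (a : L) (s : 'I_3 -> nat).
Hypotheses (ij : i != j) (il : i != l) (jl : j != l) (hs : sbox p s).

Lemma EB_univ (E : coh) : EB a s E -> exists (Ki : @Mor k coh (OO (bb a s i)) E)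
    (Kj : @Mor k coh (OO (bb a s j)) E) (Kl : @Mor k coh (OO (bb a s l)) E),
  [/\ compm Ki (Xs k a s i) + (compm Kj (Xs k a s j) + compm Kl (Xs k a s l)) = 0,
     forall (N : coh) ni nj nl, compm ni (Xs k a s i) + (compm nj (Xs k a s j) + compm nl (Xs k a s l)) = 0 ->
       exists f : Mor E N, [/\ compm f Ki = ni, compm f Kj = nj & compm f Kl = nl] &
     forall (N : coh) (f g : Mor E N), compm f Ki = compm g Ki -> compm f Kj = compm g Kj ->
       compm f Kl = compm g Kl -> f = g].
Proof.
move=> /(EB_iso hs ij il jl)[e [e' [h1 h2]]].
exists (compm e (elm _ (kapi k a s ij il jl))), (compm e (elm _ (kapj k a s ij il jl))), (compm e (elm _ (kapl k a s ij il jl))).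
split.
- by rewrite -!compA -!compDr kap_rel comp0r.
- move=> N ni nj nl /(W_out ij il jl)[f [f1 f2 f3]]; exists (compm f e').
  by rewrite !compA -![compm (compm f e') e]compA h1 compf1.
- move=> N f g; rewrite !compA => g1 g2 g3; have := W_out_eq g1 g2 g3 => E0.
  by rewrite -[f]compf1 -h2 compA E0 -compA h2 compf1.
Qed.
End EBsource.

Section Pair.
Variables (i j l : 'I_3) (a a' : L) (s s' : 'I_3 -> nat) (E E' : coh).
Hypotheses (ij : i != j) (il : i != l) (jl : j != l) (hs : sbox p s) (hs' : sbox p s')
  (hE : EB a s E) (hE' : EB a' s' E') (sj : s' j = s j) (sl : s' l = s l).
Hypotheses (l1 : forall t, -1 <= llev (ub1 a s - bb a' s' t)) (l2 : forall t, -1 <= llev (ub2 a - bb a' s' t))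
  (l1a : -1 <= llev (ub1 a s - a')) (l2a : 1 <= llev (ub2 a - a')) (lj : (s j)%:Z <= lres (ub1 a s - a') j).
Local Notation Xs' := (Xs k a' s').

Lemma llev_sub (x z : L) (n : nat) : -1 <= llev (x - z) -> -1 <= llev (x - (z - cvec p *~ n%:Z)).
Proof. move=> h; rewrite (_ : _ - _ = x - z + cvec p *~ n%:Z); last by abel.
by rewrite llevDc; lia. Qed.

Lemma h1v_E t : h1v E (bb a' s' t).
Proof.
have [f [g [hfg _]]] := hE; apply: (h1v_ext hfg); try exact/h1v_OO.
by move=> n; apply/h1v_OO/llev_sub.
Qed.

(** With the presentation O(a') -> O(b'_i) (+) O(b'_j) (+) O(b'_l) -> E', this is the obstruction to
    Ext^1(E', E) = 0. The component in O(ub2 a) has level at least 1, the bound of [Ahomog_dec] for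
    N = 1, and splits along two of the maps; the rest lies in O(ub1 a s), where the residue
    hypothesis provides the factor X_j^(s_j). *)
Lemma Xs_surj (y : @Mor k coh (OO a') E) : exists yi yj yl,
  y = compm yi (Xs' i) + (compm yj (Xs' j) + compm yl (Xs' l)).
Proof.
have [f [g [hfg _]]] := hE.
have [b hb eb] := OO_elm (compm g y).
have lj' : l != j by rewrite eq_sym.
have ji : j != i by rewrite eq_sym.
have li : l != i by rewrite eq_sym.
have [|b1 [b2 [hb1 hb2 e]]] := @Ahomog_dec k p _ b j l i 1 jl ji li hb; first by lia.
have spl t : X t ^+ (p t * 1) = X t ^+ s' t * X t ^+ (p t - s' t).
  by rewrite muln1 -exprD subnKC //; have := hs' t; lia.
have hX t : bb a' s' t - a' = xvec p t *~ (s' t)%:Z by rewrite /bb; abel.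
have elX t (c : A) (w : L) : Ahomog (w - bb a' s' t) c ->
    elm a' (X t ^+ s' t * c : OO w) = compm (elm (bb a' s' t) (c : OO w)) (Xs' t).
  move=> hc; rewrite /Xs comp_elmA; last by rewrite hX; exact: AhomogX.
  by rewrite OO_hc.
have hbt t (b0 : A) : Ahomog (ub2 a - a' - cvec p *~ 1) b0 -> Ahomog (ub2 a - bb a' s' t) (X t ^+ (p t - s' t) * b0).
  move=> h; have -> : ub2 a - bb a' s' t = xvec p t *~ (p t - s' t)%N%:Z + (ub2 a - a' - cvec p *~ 1).
    by rewrite -(cvec_minus hs') /bb; abel.
  by apply: AhomogM => //; exact: AhomogX.
have [zj ezj] := lift_h1 (elm (bb a' s' j) (X j ^+ (p j - s' j) * b1 : OO (ub2 a))) hfg (h1v_OO (l1 j)).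
have [zl ezl] := lift_h1 (elm (bb a' s' l) (X l ^+ (p l - s' l) * b2 : OO (ub2 a))) hfg (h1v_OO (l1 l)).
have [[gf K] _] := hfg.
have [|w [hw _]] := K _ (y - (compm zj (Xs' j) + compm zl (Xs' l))).
  rewrite compBr eb compDr !compA ezj ezl -!elX; [|exact: hbt|exact: hbt].
  rewrite -elmD !mulrA -!spl.
  by rewrite e [X in _ - elm _ X](_ : _ = (X j ^+ (p j * 1) * b1 + X l ^+ (p l * 1) * b2 : A)) // subrr.
have [c hc ec] := OO_elm w; have [d ed] := Ahomog_dvdX_res hc lj.
have hd : Ahomog (ub1 a s - bb a' s' j) d.
  have -> : ub1 a s - bb a' s' j = ub1 a s - a' - xvec p j *~ (s j)%:Z by rewrite /bb sj; abel.
  by apply: Ahomog_divX; rewrite -ed.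
exists 0, (zj + compm f (elm (bb a' s' j) (d : OO (ub1 a s)))), zl.
rewrite comp0l add0r compDl -compA -elX // sj -ed -ec hw.
by move: (compm zj _) (compm zl _) => u v; abel.
Qed.

(** The three generators of E' lift because Ext^1 from their line bundles to E vanishes. The lifts
    violate the relation by a map O(a') -> E, and [Xs_surj] absorbs it in a change of the lifts. *)
Lemma ext_split (xi : @extension k coh E' E) : split_epi (eproj xi).
Proof.
have [Ki [Kj [Kl [rel out uniq]]]] := EB_univ ij il jl hs' hE'.
have hx := eexact xi.
have [ni ei] := lift_h1 Ki hx (@h1v_E i); have [nj ej] := lift_h1 Kj hx (@h1v_E j).
have [nl el] := lift_h1 Kl hx (@h1v_E l).
have [[gf K] _] := hx.
have [|y [hy _]] := K _ (compm ni (Xs' i) + (compm nj (Xs' j) + compm nl (Xs' l))).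
  by rewrite !compDr !compA ei ej el.
have [yi [yj [yl ey]]] := Xs_surj y.
have [|f [f1 f2 f3]] := out _ (ni - compm (einj xi) yi) (nj - compm (einj xi) yj) (nl - compm (einj xi) yl).
  rewrite !compBl -!compA.
  have -> : forall u v w u' v' w' : Mor (OO a' : coh) (emid xi), u - u' + (v - v' + (w - w')) = u + (v + w) - (u' + (v' + w')).
    by move=> u v w u' v' w'; abel.
  by rewrite -!compDr -ey hy subrr.
have Z z (t : @Mor k coh z E) : compm (eproj xi) (compm (einj xi) t) = 0 by rewrite compA gf comp0l.
exists f; apply: uniq; rewrite -compA ?f1 ?f2 ?f3 compBr Z subr0 comp1f //.
Qed.

Lemma card_OE z : -1 <= llev (ub1 a s - z) -> -1 <= llev (ub2 a - z) ->
  hcard (fun v : @Mor k coh (OO z) E => True)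
    (q ^ (absz (llev (ub1 a s - z) + 1)%R + absz (llev (ub2 a - z) + 1)%R)).
Proof.
move=> h1 h2; have [f [g [hfg _]]] := hE; rewrite expnD.
have lft (c : @Mor k coh (OO z) (OO (ub2 a))) : exists b, compm g b = c by exact: (lift_h1 c hfg (h1v_OO h1)).
have [psi hpsi] := choice lft; have [[gf K] _] := hfg.
apply: (hcard_prod (g := fun u v => compm f u + psi v) _ _ (card_OO h1) (card_OO h2)).
  move=> u v u' v' _ _ _ _ e; have ev : v = v'.
    by have := congr1 (compm g) e; rewrite !compDr !compA gf !comp0l !add0r !hpsi.
  by split=> //; move: e; rewrite ev => /addIr; exact: (kernel_mono hfg.1).
move=> b; split=> // _; have [|u [hu _]] := K _ (b - psi (compm g b)).
  by rewrite compBr hpsi subrr.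
by exists u, (compm g b); split=> //; rewrite hu subrK.
Qed.

(** The dimension of Hom(E', E) is the sum of those of the Hom(O(b'_t), E) minus that of Hom(O(a'),
    E); the equation for D is written without subtraction. *)
Lemma card_HomE (D : nat) :
  (D + (absz (llev (ub1 a s - a') + 1)%R + absz (llev (ub2 a - a') + 1)%R) =
   (absz (llev (ub1 a s - bb a' s' i) + 1)%R + absz (llev (ub2 a - bb a' s' i) + 1)%R) +
   (absz (llev (ub1 a s - bb a' s' j) + 1)%R + absz (llev (ub2 a - bb a' s' j) + 1)%R) +
   (absz (llev (ub1 a s - bb a' s' l) + 1)%R + absz (llev (ub2 a - bb a' s' l) + 1)%R))%N ->
  euler E' E = D%:Z.
Proof.
move=> hD; rewrite /euler (dimExt1_0 ext_split) subr0; congr Posz; apply: dimHom_card.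
have [Ki [Kj [Kl [rel out uniq]]]] := EB_univ ij il jl hs' hE'.
have ci := card_OE (l1 i) (l2 i); have cj := card_OE (l1 j) (l2 j); have cl := card_OE (l1 l) (l2 l).
have l2a' : -1 <= llev (ub2 a - a') by lia.
have ca := card_OE l1a l2a'.
pose T3 := (@Mor k coh (OO (bb a' s' i)) E * (@Mor k coh (OO (bb a' s' j)) E * @Mor k coh (OO (bb a' s' l)) E))%type.
have c2 := hcard_prod (g := fun u v => (u, v)) (R := fun=> True) (fun u v u' v' _ _ _ _ e => conj (congr1 fst e) (congr1 snd e))
  (fun w => conj (fun=> ex_intro _ w.1 (ex_intro _ w.2 (And3 I I (surjective_pairing w)))) (fun=> I)) cj cl.
have c3 := hcard_prod (g := fun u v => (u, v)) (R := fun w : T3 => True) (fun u v u' v' _ _ _ _ e => conj (congr1 fst e) (congr1 snd e))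
  (fun w => conj (fun=> ex_intro _ w.1 (ex_intro _ w.2 (And3 I I (surjective_pairing w)))) (fun=> I)) ci c2.
pose ev (f : @Mor k coh E' E) : T3 := (compm f Ki, (compm f Kj, compm f Kl)).
have evI f f' : ev f = ev f' -> f = f' by case=> e1 e2 e3; exact: uniq.
have [m hm] := hcard_inj (Q := fun f : @Mor k coh E' E => True) (g := ev) c3 (fun _ _ => I) (fun x y _ _ => @evI x y).
have S1 (y : @Mor k coh (OO a') E) : exists t : T3,
    y = compm t.1 (Xs' i) + (compm t.2.1 (Xs' j) + compm t.2.2 (Xs' l)).
  by have [yi [yj [yl e]]] := Xs_surj y; exists (yi, (yj, yl)).
(* A set-theoretic section of the map to Hom(O(a'), E): it identifies the triples with pairs of a
   morphism E' -> E and a morphism O(a') -> E, which is enough for counting. *)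
have [sg hsg] := choice S1.
pose D3 (t : T3) := compm t.1 (Xs' i) + (compm t.2.1 (Xs' j) + compm t.2.2 (Xs' l)).
have D3D t t' : D3 (t + t') = D3 t + D3 t'
  by rewrite /D3 -[(t + t').1]/(t.1 + t'.1) -[(t + t').2.1]/(t.2.1 + t'.2.1) -[(t + t').2.2]/(t.2.2 + t'.2.2) !compDl [RHS]addrACA; congr (_ + _); exact: addrACA.
have D3ev f : D3 (ev f) = 0 by rewrite /D3 -[(ev f).1]/(compm f Ki) -[(ev f).2.1]/(compm f Kj) -[(ev f).2.2]/(compm f Kl) -!compA -!compDr rel comp0r.
have := hcard_prod (g := fun f y => ev f + sg y) (R := fun w : T3 => True) _ _ hm ca.
move=> /(_ _ _) H.
have {H} c4 := H; have E0 := hcard_uniq (c4 _ _) c3.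
have {}E0 : (m * q ^ (absz (llev (ub1 a s - a') + 1)%R + absz (llev (ub2 a - a') + 1)%R) =
  q ^ (D + (absz (llev (ub1 a s - a') + 1)%R + absz (llev (ub2 a - a') + 1)%R)))%N.
  rewrite hD !expnD in E0 *; rewrite E0; [by rewrite !mulnA | |].
    move=> f y f' y' _ _ _ _ e; have ey : y = y'.
      by have := congr1 D3 e; rewrite !D3D !D3ev !add0r /D3 -!hsg.
    by split=> //; move: e; rewrite ey => /addIr; exact: evI.
  move=> t; split=> // _; have [|f [f1 f2 f3]] := out _ (t - sg (D3 t)).1 (t - sg (D3 t)).2.1 (t - sg (D3 t)).2.2.
    rewrite -[LHS]/(D3 (t - sg (D3 t))).
    have := D3D (t - sg (D3 t)) (sg (D3 t)); rewrite subrK [X in _ = _ + X](_ : _ = D3 t); last exact/esym/hsg.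
    by move=> /eqP; rewrite eq_sym -subr_eq0 addrK => /eqP.
  exists f, (D3 t); split=> //; rewrite /ev f1 f2 f3 -[X in X + _](_ : t - sg (D3 t) = _); first by rewrite subrK.
  by case: (t - sg (D3 t)) => ? [].
move: E0; rewrite [RHS]expnD => /eqP; rewrite eqn_pmul2r; last by rewrite expn_gt0 q_gt0.
by move=> /eqP em; rewrite em in hm.
Qed.
End Pair.
End HomBundles.

(** * Torsion sheaves with simple top *)

Section TorsionSheaves.
Variables (k : fieldType) (p : weights).
Local Notation L := (Lgrp p).
Local Notation A := (coordA k p).
Local Notation X := (Xvar k p).
Local Notation grmod := (grmod k p).
Local Notation coh := (cohX k p).
Local Notation tors0 := (tors [set 0]).
Local Notation OO := (OO k).
Implicit Types (M N Q : grmod) (z x : L).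

(** Otherwise choice yields a strictly increasing chain; finitely many generators of its union
    already lie in one member. *)
Lemma gsub_max M (Phi : set M -> Prop) (P0 : set M) : is_gsub P0 -> Phi P0 ->
  exists P : set M, [/\ is_gsub P, Phi P & forall Q : set M, is_gsub Q -> Phi Q -> P `<=` Q -> Q `<=` P].
Proof.
move=> g0 h0; apply: contrapT => no.
pose good (P : set M) := is_gsub P /\ Phi P.
have nxt P : exists Q : set M, good P -> [/\ good Q, P `<=` Q & ~ (Q `<=` P)].
  have [gP|] := pselect (good P); last by exists P.
  apply: contrapT => no'; apply: no; exists P; split; [exact: gP.1 | exact: gP.2 |].
  move=> Q gQ hQ PQ; apply: contrapT => nQ; apply: no'; by exists Q.
have [F hF] := choice nxt; pose S n := iter n F P0.
have gS n : good (S n).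
  by elim: n => [|n IH]; [split | have [] := hF _ IH].
have S1 n : S n `<=` S n.+1 by have [] := hF _ (gS n).
have Sle m n : (m <= n)%N -> S m `<=` S n.
  by move=> mn; rewrite -(subnK mn); elim: (n - m)%N => [|d IH] u hu //; apply/S1/IH.
pose U := [set u : M | exists n, S n u].
have gU : is_gsub U.
  split; first by exists 0%N; exact: gsub0 g0.
    move=> a u v [m hu] [n hv]; exists (m + n)%N; apply: (gsub_lin (gS _).1).
      by apply: Sle hu; exact: leq_addr.
    by apply: Sle hv; exact: leq_addl.
  by move=> x u [n hu]; exists n; exact: gsub_hc (gS n).1 _ _ hu.
have [s [hs1 hs2]] := gsub_fg gU.
have [N hN] : exists N : nat, forall v, v \in s -> S N v.2.
  elim: s hs1 {hs2} => [|v s IH] hs1; first by exists 0%N.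
  have [N hN] := IH (fun w h => hs1 w (@mem_behead _ (v :: s) _ h)).
  have [_ [n hn]] := hs1 v (mem_head _ _); exists (N + n)%N => w; rewrite inE => /predU1P[->|/hN h].
    by apply: Sle hn; exact: leq_addl.
  by apply: Sle h; exact: leq_addr.
have [_ _ nS] := hF _ (gS N); apply: nS => u hu.
have Uu : U u by exists N.+1.
apply: (hs2 u Uu) (gsub_submod (gS N).1) _ => v /mapP[w ws ->]; exact: hN.
Qed.

Lemma elh_range_gsub z M (u : M) : is_gsub (range (elh z u)).
Proof.
split; first by exists 0 => //; exact: ghom0.
  by move=> a _ _ [x _ <-] [y _ <-]; exists (a *: x + y) => //; exact: ghom_lin.
by move=> x _ [y _ <-]; exists (hc x y) => //; exact: ghom_hc.
Qed.

Section Support.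
Variables (i : 'I_3) (M : coh).
Hypothesis hM : supported_at i M.

(* A homogeneous ideal maximal among those containing the annihilator of u and
   no power of X_i is a point of the support of M. *)
Lemma support_nilp z (u : gcar M) : hc z u = u -> exists n, X i ^+ n *: u = 0.
Proof.
move=> hu; apply: contrapT => no.
have hno n : X i ^+ n *: u <> 0 by move=> h; apply: no; exists n.
pose I0 : set (strA k p) := [set a | (a : A) *: u = 0].
have gI : is_gsub I0.
  split; first exact: scale0r.
    by move=> a b c hb hc; rewrite /I0 /= scalerDl -scalerA hb hc scaler0 addr0.
  move=> x a ha; have := hc_scale (x + z) (a : A) hu; rewrite addrK => e.
  by rewrite /I0 /= -e ha hc0.
pose Phi (P : set (strA k p)) := I0 `<=` P /\ forall n, ~ P (X i ^+ n).
have [|P [gP [IP nP] mP]] := @gsub_max (strA k p) Phi I0 gI; first by split=> // n; exact: hno.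
have adj w (a : A) : Ahomog w a -> ~ P a -> exists n (c y : A), P y /\ X i ^+ n = y + c * a.
  move=> ha na; apply: contrapT => no'.
  pose Pa : set (strA k p) := [set x | exists c y : A, P y /\ x = y + c * a].
  have PPa : P `<=` Pa by move=> x hx; exists 0, x; split=> //; rewrite mul0r addr0.
  have gPa : is_gsub Pa.
    split; first exact: PPa (gsub0 gP).
      move=> b _ _ [c [y [hy ->]]] [c' [y' [hy' ->]]]; exists (b * c + c'), (b * y + y'); split.
        exact: (gsub_lin gP b hy hy').
      by rewrite /GRing.scale /=; ring.
    move=> x _ [c [y [hy ->]]]; exists (Acomp (x - w) c), (Acomp x y); split; first exact: (gsub_hc gP x hy).
    rewrite /= A_hcD; congr (_ + _).
    have -> : Acomp x (c * a) = Acomp (w + (x - w)) (a * c) by rewrite mulrC; congr Acomp; abel.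
    by rewrite (AcompM _ _ ha) mulrC.
  have : Phi Pa.
    split=> [x hx|n [c [y [hy e]]]]; first exact/PPa/IP.
    by apply: no'; exists n, c, y.
  move=> /(mP _ gPa)/(_ PPa a) h; apply: na; apply: h; exists 1, 0; split; first exact: gsub0 gP.
  by rewrite mul1r add0r.
have prime x y (a b : A) : Ahomog x a -> Ahomog y b -> P (a * b) -> P a \/ P b.
  move=> ha hb hab; apply: contrapT => /not_orP[na nb].
  have [n [c [v [hv e]]]] := adj _ _ ha na; have [n' [c' [v' [hv' e']]]] := adj _ _ hb nb.
  apply: (nP (n + n')%N); rewrite exprD e e'.
  have -> : (v + c * a) * (v' + c' * b) = (v' + c' * b) * v + (c * a * v' + c * c' * (a * b)) by ring.
  apply: (gsub_lin gP _ hv); apply: (gsub_lin gP (c * a) hv').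
  by rewrite -[c * c' * _]addr0; apply: (gsub_lin gP (c * c') hab); exact: gsub0 gP.
have pt : is_point P.
  split=> //; first by have := nP 0%N; rewrite expr0.
  by exists i; have := nP 1%N; rewrite expr1.
have : in_support M P.
  by exists u => x s hs ns e; apply: ns; apply: IP.
move=> /(hM pt) e; apply: (nP 1%N); rewrite e; exists 1; by rewrite expr1 mulr1.
Qed.

(** Take n minimal such that X_i^n a kills u for some homogeneous [iunit] a; then X_i^n divides
    everything that kills u. Conversely a and a power of X_i killing u generate an ideal with powers
    of all variables, so X_i^n u is torsion. *)
Lemma cyclic_isSS z (u : gcar M) : hc (- z) u = u -> ~ tors0 u -> (forall v, tors (range (elh z u)) v) ->
  exists n, (0 < n)%N /\ isSS i n z M.
Proof.
move=> hu tu cyc.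
have el (a : A) : elh z u a = a *: u by rewrite -[LHS]/(a *: hc (- z) u) hu.
have [N hN] := support_nilp hu.
pose good n := `[< exists w a, [/\ Ahomog w a, iunit i a & (X i ^+ n * a) *: u = 0] >].
have ex : exists n, good n.
  exists N; apply/asboolP; exists 0, 1; split; [exact: Ahomog1 | exact: dvdX1N | by rewrite mulr1].
case: (ex_minnP ex) => n /asboolP[w [a [ha ua an]]] mn {ex}.
have [N' hN'] := iunit_ideal N ha ua.
have kill (c : A) : tors0 ((X i ^+ n * c) *: u).
  exists N' => t; have [b [d e]] := hN' t; rewrite /= scalerA e.
  have -> : (a * b + X i ^+ N * d) * (X i ^+ n * c) = b * c * (X i ^+ n * a) + d * X i ^+ n * c * X i ^+ N by ring.
  by rewrite scalerDl -[(b * c * _) *: u]scalerA an scaler0 add0r -scalerA hN scaler0.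
have ann (b : A) : b *: u = 0 -> dvdX i n b.
  move=> hb; apply/dvdX_comp => x.
  have hbx : Acomp x b *: u = 0 by rewrite -[x](addrK (- z)) -(hc_scale _ _ hu) hb hc0.
  have [->|/eqP b0] := eqVneq (Acomp x b) 0; first exact: dvdX0.
  have [m [c [e hc' uc]]] := homog_iunit_dec i (Acomp_homog x b) b0.
  apply: (@dvdX_le _ _ _ _ m); last by exists c.
  by apply: mn; apply/asboolP; exists (x - xvec p i *~ m%:Z), c; split=> //; rewrite -e.
exists n; split.
  rewrite lt0n; apply/eqP => n0; apply: tu; rewrite -[u]scale1r.
  by have := kill 1; rewrite n0 expr0 mulr1.
have hX : Ahomog (z - (z - xvec p i *~ n%:Z)) (X i ^+ n) by rewrite subKr; exact: AhomogX.
exists (elm z u); apply: short_exact_intro; split.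
- move=> b c -> /(@saturated_OO k p z).1; rewrite (elh_OO b hX) => /Xpow_reg ->; exact: tors00.
- move=> b c d -> ->; rewrite (elh_OO b hX) el; exact: kill.
- move=> b v ->; rewrite el => -[m hm]; exists m => t.
  have [c ec] := ann (X t ^+ m * b) (etrans (esym (scalerA _ _ _)) (hm t)).
  exists c => //; exact: etrans ec (esym (elh_OO c hX)).
- by move=> v; apply: tors_sub (cyc v) => w' [b _ <-]; exists b.
Qed.
End Support.

Lemma gsub_nonzero M (P : set M) (gP : is_gsub P) : zero_obj (gsubm gP : coh) -> forall u, P u -> tors0 u.
Proof.
move=> h u hu; have := h; rewrite /zero_obj [idm _](_ : _ = qpi (fid _)) // => /qpi0E/(_ (mksub gP hu) _ erefl).
by move=> /gsub_tors.
Qed.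

Section Simple.
Variable T : coh.
Hypothesis hT : simple_obj T.

Lemma simple_gsub (P : set (gcar T)) : is_gsub P -> (forall u, P u -> tors0 u) \/ (forall u, tors P u).
Proof.
move=> gP; have hm : @mono k coh _ _ (gmor (gincl gP)).
  by apply/monoP => u v -> /gsub_tors.
have [h|h] := hT.2 _ _ hm; first by left; exact: gsub_nonzero h.
right=> u; apply: tors_sub (iso_surj h u) => v [w _ ->]; exact: gsvalR.
Qed.

Lemma simple_mono (N : coh) (y : Mor T N) : y <> 0 -> mono y.
Proof.
have [r ->] := qW y => y0.
pose K := [set u : gcar T | exists2 v, r u v & tors0 v].
have gK : is_gsub K.
  split; first by exists 0; [exact: grel0 (fgrP r) | exact: tors00].
    move=> a u v [x hx tx] [x' hx' tx']; exists (a *: x + x'); first exact: (grel_lin (fgrP r)).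
    by apply: tors0D => //; exact: tors0Z.
  move=> x u [v hv tv]; exists (hc x v); first exact: (grel_hc (fgrP r)).
  exact: (gsub_hc (@tors0_gsub _ _ N)).
have [h|h] := simple_gsub gK.
  by apply/monoP => u v hr tv; apply: h; exists v.
case: y0; apply/qpi0E => u v hr; apply: tors0_tors; have [a ha] := h u; exists a => t.
have [v' hv' tv'] := ha t; have := fracB (fracZ (X t ^+ a) hr) hv' => tt.
by rewrite -[_ *: v](subrK v'); exact: tors0D.
Qed.

Lemma simple_cyclic z (u : gcar T) : ~ tors0 u -> hc (- z) u = u -> forall v, tors (range (elh z u)) v.
Proof.
move=> tu hu; have [h|//] := simple_gsub (elh_range_gsub z u).
by case: tu; apply: h; exists (1 : A) => //; rewrite -[LHS]/((1 : A) *: hc (- z) u) hu scale1r.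
Qed.

Lemma nonzero_elt : exists z (u : gcar T), ~ tors0 u /\ hc (- z) u = u.
Proof.
apply: contrapT => no; apply: hT.1; rewrite /zero_obj [idm _](_ : _ = qpi (fid _)) //.
apply/qpi0E => u v ->; apply: (gsub_comp (@tors0_gsub _ _ T)) => x; apply: contrapT => h.
by apply: no; exists (- x), (hc x u); rewrite opprK hcid.
Qed.

Variable i : 'I_3.
Hypothesis hTi : supported_at i T.

(** A nonzero X_i u would generate T, so that u would be a multiple of X_i u up to torsion, against
    the nilpotency of X_i on u. *)
Lemma simple_X z (u : gcar T) : hc (- z) u = u -> tors0 (X i *: u).
Proof.
move=> hu; have [tu|tu] := pselect (tors0 u); first exact: tors0Z.
have hXu : hc (- (z - xvec p i)) (X i *: u) = X i *: u.
  have := hcX i 1 hu; rewrite expr1 mulr1z => h; rewrite -[RHS]h; congr (hc _ _); abel.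
apply: contrapT => tX; have cyc := simple_cyclic tX hXu u.
have [N hN] := support_nilp hTi hu.
have [n [tn tn1]] : exists n, ~ tors0 (X i ^+ n *: u) /\ tors0 (X i ^+ n.+1 *: u).
  apply: contrapT => no; have H n : ~ tors0 (X i ^+ n *: u).
    elim: n => [|n IH]; first by rewrite expr0 scale1r.
    by move=> h; apply: no; exists n.
  by apply: (H N); rewrite hN; exact: tors00.
apply: tn; apply: tors0_tors; have [m hm] := cyc; exists m => t; have [b _ eb] := hm t.
rewrite scalerA mulrC -scalerA -eb -[elh _ _ _]/((b : A) *: hc _ (X i *: u)) hXu !scalerA.
have -> : X i ^+ n * b * X i = b * X i ^+ n.+1 by rewrite exprS; ring.
by rewrite -scalerA; exact: tors0Z.
Qed.

(** The residue at i names the simple. If the residues differed, the values of f at powers of the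
    other variables would become, up to torsion, multiples of u by elements of positive residue,
    hence divisible by X_i, which kills T. *)
Lemma simple_res z (u : gcar T) x (f : @Mor k coh (OO x) T) : ~ tors0 u -> hc (- z) u = u ->
  f <> 0 -> lres (z - x) i = 0.
Proof.
move=> tu hu f0; apply: contrapT => nr; apply: f0; have [j [l [ij il jl]]] := other2 i.
have nr' (m n : int) : lres (z - x + xvec p j *~ m + xvec p l *~ n) i <> 0.
  by rewrite !lresDx (negPf ij) (negPf il).
have cyc := simple_cyclic tu hu.
have [r er] := qW f; rewrite er.
have [N hN] := fdomT r (1 : A).
have key t : i != t -> exists2 m, r (X t ^+ N) m & tors0 m.
  move=> it; have [m0 hm0] := hN t; rewrite /GRing.scale /= mulr1 in hm0.
  pose y : L := xvec p t *~ N%:Z - x; exists (hc y m0).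
    have := grel_hc (fgrP r) y hm0; rewrite [hc y _](_ : _ = X t ^+ N) //.
    by apply/AhomogP; rewrite /y addrC subrK; exact: AhomogX.
  have [M hM] := cyc (hc y m0).
  have H t' : i != t' -> tors0 (X t' ^+ M *: hc y m0).
    move=> it'; have [b _ eb] := hM t'.
    have e : X t' ^+ M *: hc y m0 = Acomp (xvec p t' *~ M%:Z + y + z) b *: u.
      have := hcX t' M (hcid y m0) => h; rewrite -h -eb -[elh _ _ _]/((b : A) *: hc (- z) u) hu.
      by rewrite (hc_scale _ _ hu) opprK.
    have [c ec] : dvdX i 1 (Acomp (xvec p t' *~ M%:Z + y + z) b).
      apply: (Ahomog_dvdX (Acomp_homog _ _)); rewrite lt_def lres_ge0 andbT; apply/eqP.
      have -> : xvec p t' *~ M%:Z + y + z = z - x + xvec p t *~ N%:Z + xvec p t' *~ M%:Z by rewrite /y; abel.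
      by rewrite !lresDx (negPf it) (negPf it').
    by rewrite e ec mulrC -scalerA expr1; apply/tors0Z/simple_X/hu.
  by apply/tors0_tors/(tors2 (@tors0_gsub _ _ T) jl (H j ij) (H l il)).
apply/qpi0E => b v hb; have V t : i != t -> tors0 (X t ^+ N *: v).
  move=> it; have [m hm tm] := key t it.
  rewrite -[X t ^+ N *: v](subrK ((b : A) *: m)); apply: tors0D; last exact: tors0Z.
  have h1 := fracZ (X t ^+ N) hb; have h2 := fracZ (b : A) hm.
  by apply: (fracB h1); rewrite [X t ^+ N *: b](_ : _ = (b : A) *: (X t ^+ N : OO x)) //; exact: mulrC.
by apply/tors0_tors/(tors2 (@tors0_gsub _ _ T) jl (V j ij) (V l il)).
Qed.
End Simple.

Lemma top_unique (S T T' : coh) : is_top S T -> is_top S T' -> isomorphic T T'.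
Proof.
move=> [X1 [f1 [g1 [[m1 r1] c1]]]] [X2 [f2 [g2 [[m2 r2] c2]]]].
have [u hu] : exists u, compm f1 u = f2.
  by apply/r1 => Z g hg; apply: (r2 _ f2).1 => //; exists (idm _); rewrite compf1.
have [u' hu'] : exists u, compm f2 u = f1.
  by apply/r2 => Z g hg; apply: (r1 _ f1).1 => //; exists (idm _); rewrite compf1.
have [|y [hy _]] := c1.2 _ g2; first by rewrite -hu' compA c2.1 comp0l.
have [|y' [hy' _]] := c2.2 _ g1; first by rewrite -hu compA c1.1 comp0l.
exists y, y'; split; apply/eqP; rewrite -subr_eq0; apply/eqP.
  by apply: (cokernel_epi c1); rewrite compBl comp1f -compA hy hy' subrr.
by apply: (cokernel_epi c2); rewrite compBl comp1f -compA hy' hy subrr.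
Qed.

(* If u generated a proper subobject, it would lie in a maximal subobject, which
   contains the radical; the image of u in the top would then vanish. *)
Lemma top_generator (S T : coh) : is_top S T -> simple_obj T -> exists (g : Mor S T) z (u : gcar S),
  [/\ hc (- z) u = u, compm g (elm z u) <> 0 & forall v, tors (range (elh z u)) v].
Proof.
move=> [X1 [f [g [[mf rad] cok]]]] hT; exists g.
have epi := cokernel_epi cok.
have [z [u0 gu0]] : exists z u, compm g (elm z u) <> 0.
  apply: contrapT => no; apply: hT.1; apply: epi; rewrite comp1f; apply: elm_sep => z u.
  by apply: contrapT => h; apply: no; exists z, u.
pose u := hc (- z) u0; exists z, u.
have gu : compm g (elm z u) <> 0 by rewrite elm_hcE.
have hu : hc (- z) u = u by exact: hcid.
split=> // v; apply: contrapT => nv.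
have gR := tors_gsub (elh_range_gsub z u).
pose Phi (P : set (gcar S)) := [/\ P u, forall w, tors P w -> P w & exists w, ~ P w].
have [|P [gP [Pu satP [w0 nw0]] mP]] := @gsub_max S Phi _ gR.
  split; [|by move=> w; apply: tors_idem; exact: elh_range_gsub | by exists v].
  by apply: tors_in; exists (1 : A) => //; rewrite -[LHS]/((1 : A) *: hc (- z) u) hu scale1r.
have maxP : @maximal_sub k coh _ _ (gmor (gincl gP)).
  split.
  - by apply/monoP => x y -> /gsub_tors.
  - move=> /iso_surj h; apply: nw0; apply: satP; apply: tors_sub (h w0) => x [y _ ->]; exact: gsvalR.
  - move=> Z h mh [w hw]; have [r er] := qW h.
    pose Q := tors (rimg r setT).
    have gQ : is_gsub Q by exact/tors_gsub/rimgT_gsub.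
    have PQ : P `<=` Q.
      move=> x hx; have [w' ew'] := qW w; move: hw; rewrite er ew' compE => /qpiE H.
      apply: tors_idem; first exact: rimgT_gsub.
      have [a ha] := fdomT (fcomp r w') (mksub gP hx : gsubm gP); exists a => t; have [y hy] := ha t.
      have := H _ y (X t ^+ a *: x) hy _; rewrite -[X t ^+ a *: x]/(gincl gP (X t ^+ a *: mksub gP hx)).
      move=> /(_ erefl) ty; have [y' _ hy'] := hy.
      rewrite -[gincl gP _](subKr y).
      apply: (gsubB gQ); first by apply: tors_in; exists y'.
      by apply: tors_sub ty => _ ->; exact: gsub0 (rimgT_gsub r).
    have [all|/existsNP[w1 nw1]] := pselect (forall x : gcar S, Q x).
      left; rewrite er; apply: iso_frac => // m hm.
      by rewrite er in mh; exact: (monoP r).1 mh _ _ hm (@tors00 _ _ S).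
    right; have QP : Q `<=` P.
      apply: mP => //; split; [exact: PQ | by move=> x; apply: tors_idem; exact: rimgT_gsub | by exists w1].
    have [[_ K] _] := gproj_cokernel gP; have [|y [hy _]] := K _ h; last by exists y.
    rewrite er /gmor compE; apply/qpi0E => m q [n hn ->]; apply/gproj_tors; apply/tors_in/QP/tors_in.
    by exists m.
have [w hw] : exists w, compm (gmor (gincl gP)) w = f.
  by apply: (rad _ f).1 => //; exists (idm _); rewrite compf1.
have [[pi0 _] _] := gproj_cokernel gP.
have [|y [hy _]] := cok.2 _ (gmor (gproj gP)); first by rewrite -hw compA pi0 comp0l.
have y0 : y <> 0.
  move=> y0; have := hy; rewrite y0 comp0l => /esym/gmor0/(_ w0)/gproj_tors/satP; exact: nw0.
apply: gu; apply: (mono0 (simple_mono hT y0)).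
rewrite compA hy gmor_elm; apply/elm0; rewrite -ghom_hc hu; apply/gproj_tors; exact: tors_in.
Qed.
End TorsionSheaves.

(** * Subobjects with torsion quotient *)

Section Quotients.
Variables (k : fieldType) (p : weights).
Local Notation L := (Lgrp p).
Local Notation A := (coordA k p).
Local Notation X := (Xvar k p).
Local Notation grmod := (grmod k p).
Local Notation coh := (cohX k p).
Local Notation tors0 := (tors [set 0]).
Local Notation OO := (OO k).
Implicit Types (M N Q : grmod) (z : L) (i : 'I_3) (n : nat).

(** f is an isomorphism onto its image in the quotient category, and the image, a graded submodule,
    is the kernel of the projection to its quotient. *)
Lemma mono_cokernel_exact M N Q (f : @Mor k coh M N) (g : @Mor k coh N Q) :
  mono f -> is_cokernel g f -> short_exact f g.
Proof.
have [r er] := qW f => mf cok; split=> //; split; first exact: cok.1.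
pose gR := rimgT_gsub r.
pose r1 (m : M) (x : gsubm gR) := r m (gsval x).
have g1 : is_grel r1.
  split; first by rewrite /r1 gsval0; exact: (grel0 (fgrP r)).
    by move=> a m m' x x' h h'; rewrite /r1 gsvalD gsvalZ; exact: (grel_lin (fgrP r)).
  by move=> x m u h; rewrite /r1 gsval_shc; exact: (grel_hc (fgrP r)).
have d1 m : tors (rdom r1) m.
  apply: tors_sub (fdomT r m) => x [n hn]; have hx : rimg r setT n by exists x.
  by exists (mksub gR hx).
have i1 x : r1 0 x -> tors0 x by move=> h; apply/gsub_tors/(findT h).
pose f1 : @Mor k coh M (gsubm gR) := qpi (mkfrac g1 d1 i1).
have e1 : compm (gmor (gincl gR)) f1 = f.
  by rewrite er /f1 /gmor compE; apply: qpi_sym => m n [x hx ->]; exists (gsval x) => //; rewrite subrr; exact: tors00.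
have [f2 [h1 h2]] : is_iso f1.
  apply: iso_frac => [m hm|x].
    rewrite er in mf; apply: (monoP r).1 mf _ _ (hm : r m (gsval 0)) _; rewrite gsval0; exact: tors00.
  by apply: tors_in; have [m _ hm] := gsvalR x; exists m.
have [[pi0 K] [_ C]] := gproj_cokernel gR.
move=> W h gh.
have [|y [hy _]] := cok.2 _ (gmor (gproj gR)); first by rewrite -e1 compA pi0 comp0l.
have [|x [hx _]] := K _ h; first by rewrite -hy -compA gh comp0r.
exists (compm f2 x); split; first by rewrite -e1 compA -(compA _ f1) h2 compf1.
by move=> w hw; apply: mf; rewrite hw -e1 compA -(compA _ f1) h2 compf1.
Qed.

Lemma kernel_unique M M' N Q (f : @Mor k coh M N) (f' : @Mor k coh M' N) (g : @Mor k coh N Q) :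
  is_kernel f g -> is_kernel f' g -> exists2 u : @Mor k coh M M', is_iso u & compm f' u = f.
Proof.
move=> hf hf'; have [u [hu _]] := hf'.2 _ f hf.1; have [v [hv _]] := hf.2 _ f' hf'.1.
exists u => //; exists v; split.
  by apply: (kernel_mono hf); rewrite compA hv hu compf1.
by apply: (kernel_mono hf'); rewrite compA hu hv compf1.
Qed.

Definition idX i n z : set (OO z) := [set a | dvdX i n (a : A)].
Lemma idX_gsub i n z : is_gsub (@idX i n z).
Proof.
split; first exact: dvdX0.
  by move=> a u v hu hv; apply: dvdXD => //; exact: dvdX_M.
by move=> x u hu; move/dvdX_comp: hu => /(_ (z + x)).
Qed.
Definition SSm i n z : coh := gquo (idX_gsub i n z).

Lemma idX_tors i n z (a : OO z) : tors (@idX i n z) a -> dvdX i n (a : A).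
Proof.
by move=> [m hm]; have [j [l [ij _ _]]] := other2 i; apply: (dvdX_cancelX (m := m) ij); exact: hm.
Qed.

Lemma SSm_tors i n z (v : gcar (SSm i n z)) : tors0 v -> v = 0.
Proof.
rewrite -(greprK v) => /(gproj_tors (idX_gsub i n z)) /idX_tors h.
by apply/(gpiP (idX_gsub i n z)); rewrite subr0.
Qed.

Lemma SS_exact i n z (g : @Mor k coh (OO z) (SSm i n z)) : g = gmor (gproj (idX_gsub i n z)) ->
  short_exact (elm (z - xvec p i *~ n%:Z) (X i ^+ n : OO z)) g.
Proof.
move=> ->; have hX : Ahomog (z - (z - xvec p i *~ n%:Z)) (X i ^+ n) by rewrite subKr; exact: AhomogX.
apply: short_exact_intro; split.
- move=> b c -> /(@saturated_OO k p z).1; rewrite (elh_OO b hX) => /Xpow_reg ->; exact: tors00.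
- move=> b c d -> ->; apply/gproj_tors; apply: tors_in; rewrite (elh_OO b hX); by exists b.
- move=> b v -> /gproj_tors/idX_tors[c ec]; apply: tors_in; exists c => //; exact: etrans ec (esym (elh_OO c hX)).
- move=> v; apply: tors_in; exists (grepr v) => //; exact/esym/greprK.
Qed.

Lemma isSS_SSm i n z S : isSS i n z S -> isomorphic S (SSm i n z : coh).
Proof.
by move=> [g hg]; have [u hu _] := cokernel_unique hg.2 (SS_exact (erefl (gmor (gproj (idX_gsub i n z))))).2; exists u.
Qed.

(** Multiplication by an [iunit] modulo X_i^n is injective by cancellation and onto up to torsion by
    [iunit_ideal]. *)
Lemma SSm_iso1 i n z y (m : A) : Ahomog (y - z) m -> iunit i m -> @isomorphic k coh (SSm i n z) (SSm i n y).
Proof.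
move=> hm um.
have hin (a : A) : dvdX i n a <-> dvdX i n (m * a).
  by split=> [|/(iunit_cancel hm um)] //; exact: dvdX_M.
have H : @short_exact k coh _ _ _ (elm (z - xvec p i *~ n%:Z) (X i ^+ n : OO z))
    (compm (gmor (gproj (idX_gsub i n y))) (elm z (m : OO y))).
  have hX : Ahomog (z - (z - xvec p i *~ n%:Z)) (X i ^+ n) by rewrite subKr; exact: AhomogX.
  rewrite {2}/elm /gmor compE; apply: short_exact_intro; split.
  - move=> b c -> /(@saturated_OO k p z).1; rewrite (elh_OO b hX) => /Xpow_reg ->; exact: tors00.
  - move=> b c d -> [e -> ->]; apply/gproj_tors; apply: tors_in; rewrite (elh_OO b hX).
    have h : dvdX i n (m * (X i ^+ n * (b : A))) by apply: (hin _).1; apply: dvdX_Ml; exact: dvdX_id.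
    by rewrite -(elh_OO _ hm) in h.
  - move=> b v [e -> ->] /gproj_tors/idX_tors; rewrite (elh_OO _ hm) => h; have [c ec] := (hin b).2 h.
    by apply: tors_in; exists c => //; exact: etrans ec (esym (elh_OO c hX)).
  - move=> v; have [N hN] := iunit_ideal n hm um; exists N => t; have [b [d e]] := hN t.
    exists (b * grepr v) => //; exists (m * (b * grepr v)); first exact/esym/elh_OO.
    change (X t ^+ N *: v = gpi (idX_gsub i n y) (m * (b * grepr v))).
    rewrite -{1}(greprK v) -gpiZ; apply/(gpiP (idX_gsub i n y)).
    rewrite /idX /= [_ - _](_ : _ = X i ^+ n * (d * grepr v)); first by exists (d * grepr v).
    by rewrite /GRing.scale /= e; ring.
have [u hu _] := cokernel_unique (SS_exact (erefl (gmor (gproj (idX_gsub i n z))))).2 H.2.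
by exists u.
Qed.

Lemma lres_sub0 (x y : L) i : lres x i = lres y i <-> lres (x - y) i = 0.
Proof.
have [al ->] := xs_surj x; have [be ->] := xs_surj y; rewrite xsN xsD !lres_xs.
split=> [/eqP|/eqP]; first by rewrite eqz_mod_dvd => /dvdz_mod0P.
by move=> h; apply/eqP; rewrite eqz_mod_dvd; apply/dvdz_mod0P/eqP.
Qed.

(** Both sheaves are compared with the one at z plus a large multiple of c, which monomials free of
    X_i reach from z and from y. *)
Lemma SSm_iso i n z (y : L) : lres z i = lres y i -> @isomorphic k coh (SSm i n z) (SSm i n y).
Proof.
move=> /lres_sub0 hr; have [j [l [ij il jl]]] := other2 i.
pose N : int := (absz (llev (z - y)))%:Z; pose x := z + cvec p *~ N.
have e1 : x - z = 0 + cvec p *~ N by rewrite /x; abel.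
have e2 : x - y = z - y + cvec p *~ N by rewrite /x; abel.
have u1 : Ahomog (x - z) (Amono k (x - z) j l).
  by apply: (Amono_homog _ ij il jl); rewrite e1 ?lresDc ?llevDc ?lres0 ?llev0.
have u2 : Ahomog (x - y) (Amono k (x - y) j l).
  by apply: (Amono_homog _ ij il jl); rewrite e2 ?lresDc ?llevDc //; rewrite /N; lia.
have h1 := SSm_iso1 n u1 (@Amono_iunit k p i j l (x - z) ij il).
have h2 := SSm_iso1 n u2 (@Amono_iunit k p i j l (x - y) ij il).
exact: (iso_trans h1 (iso_sym h2)).
Qed.

Section SubInclusion.
Variables (M : grmod) (U R : set M) (gU : is_gsub U) (gR : is_gsub R) (h : U `<=` R).
Definition sincl_fun (u : gsubm gU) : gsubm gR := mksub gR (h (gsvalR u)).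
Lemma sincl_lin (a : A) u v : sincl_fun (a *: u + v) = a *: sincl_fun u + sincl_fun v.
Proof.
apply: gsval_inj; have e1 := gincl_lin (gR := gU) a u v.
exact: etrans e1 (esym (gincl_lin (gR := gR) a (sincl_fun u) (sincl_fun v))).
Qed.
Lemma sincl_hc x u : sincl_fun (hc x u) = hc x (sincl_fun u).
Proof. exact: gsval_inj. Qed.
Definition sincl : ghom (gsubm gU) (gsubm gR) := GHom sincl_lin sincl_hc.
Lemma sincl_tors u : tors0 (sincl u) -> tors0 u.
Proof. by move=> /gsub_tors h1; apply/gsub_tors. Qed.
End SubInclusion.
End Quotients.

(** * Subobjects of the lattice with cyclic torsion quotient *)

Section SubBundles.
Variables (k : fieldType) (p : weights).
Local Notation L := (Lgrp p).
Local Notation A := (coordA k p).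
Local Notation X := (Xvar k p).
Local Notation coh := (cohX k p).
Local Notation OO := (OO k).
Variables (i j l : 'I_3) (a : L) (s : 'I_3 -> nat).
Hypotheses (ij : i != j) (il : i != l) (jl : j != l) (hs : sbox p s).
Local Notation W := (Wm k a s ij il jl).
Local Notation D1 := (wd1 j a s).
Local Notation D2 := (wd2 l a s).
Local Notation lv := (wvec k p j l s).
Local Notation gW := (lat_gsub i (s i) (wvec1 k a s ij il jl) (wvec2 k a s ij il jl)).
Local Notation kj := (kapj k a s ij il jl).
Local Notation kl := (kapl k a s ij il jl).
Local Notation ki := (kapi k a s ij il jl).
Implicit Types (w z : L) (e : A * A) (n : nat).

Lemma lres_xvec t (m : int) : i != t -> lres (xvec p t *~ m) i = 0.
Proof. by move=> it; rewrite -[_ *~ _]add0r lresDx (negPf it) lres0. Qed.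

Lemma iunit_X t m : i != t -> iunit i (X t ^+ m : A).
Proof. by move=> it; rewrite -[X t ^+ m]mulr1 => /(dvdX_cancelX it)/dvdX1N. Qed.

Lemma wvec_isvec : isvec i D1 D2 (- bb a s i) lv.
Proof.
split; first exact: wvec1; first exact: wvec2.
- by rewrite (_ : _ + _ = xvec p l *~ (s l)%:Z) ?lres_xvec //; rewrite /bb /wd1 (vtopE a s ij il jl); abel.
- by rewrite (_ : _ + _ = xvec p j *~ (s j)%:Z) ?lres_xvec //; rewrite /bb /wd2 (vtopE a s ij il jl); abel.
- by left; exact: iunit_X.
Qed.

Section Line.
Variables (w : L) (e : A * A) (n : nat).
Hypotheses (he : isvec i D1 D2 w e) (hl : dvdX i 1 (wedge e lv)).
Local Notation U := (lat (d1 := D1) (d2 := D2) i (s i + n) e).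

Lemma line_gsub : is_gsub U.
Proof. exact: lat_gsub (vec1 he) (vec2 he). Qed.

Lemma line_wvec : dvdX i (s i) (wedge e lv).
Proof.
have /andP[_ /ltnW h] := hs i; apply: dvdX_le h _; exact: wedge_res he wvec_isvec hl.
Qed.

Lemma line_sub : U `<=` lat (d1 := D1) (d2 := D2) i (s i) lv.
Proof.
move=> f hf; apply: (wedge_trans he line_wvec); exact: dvdX_le (leq_addr _ _) hf.
Qed.

Definition lincl := sincl line_gsub gW line_sub.

(** The degree of the quotient by the line of e. The double negation keeps the form required by
    [wquoh] at u = - w. *)
Definition lz : L := D1 + D2 - - w - xvec p i *~ (s i)%:Z.

Lemma lz_res : lres lz i = lres a i.
Proof.
apply/lres_sub0; rewrite (_ : _ - _ = (w + D1) + xvec p j *~ (s j)%:Z); last first.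
  by rewrite /lz /wd2 (vtopE a s ij il jl); abel.
by apply: lres_add0; [exact: vres1 he | exact: lres_xvec].
Qed.

Lemma line_in : dvdX i (s i) (X j ^+ s j * e.1 + X l ^+ s l * e.2).
Proof.
by have := dvd_wedgeC line_wvec; rewrite /wedge /= mulNr opprK addrC.
Qed.

Lemma line_h1 : Ahomog (D1 - - w) e.1. Proof. by rewrite opprK addrC; exact: vec1 he. Qed.
Lemma line_h2 : Ahomog (D2 - - w) e.2. Proof. by rewrite opprK addrC; exact: vec2 he. Qed.
Definition lquo : ghom W (OO lz) := wquoh ij il jl line_h1 line_h2 line_in (erefl lz).

Lemma lquoE (f : W) : X i ^+ s i * (lquo f : A) = wedge e (gsval f).
Proof. exact: wquoE line_in f. Qed.

Lemma lquo_kj : lquo kj = e.1 :> A.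
Proof.
by apply: (@Xpow_inj _ _ i (s i)); rewrite lquoE /wedge /= mulr0 subr0 mulrC.
Qed.
Lemma lquo_kl : lquo kl = e.2 :> A.
Proof.
by apply: (@Xpow_inj _ _ i (s i)); rewrite lquoE /wedge /= mulr0 sub0r mulrN opprK mulrC.
Qed.

Lemma lquo_in (f : W) : dvdX i n (lquo f : A) <-> U (gsval f).
Proof. by rewrite /lat /= -lquoE; exact: iff_sym (dvdXE _ _ _ _). Qed.

Definition lproj : @Mor k coh W (SSm k i n lz) := compm (gmor (gproj (idX_gsub k i n lz))) (gmor lquo).

(** U is the preimage under [lquo] of the multiples of X_i^n. Surjectivity up to torsion holds
    because [lquo] takes the values e.1 and e.2, one of which is an [iunit]. *)
Lemma line_exact : @short_exact k coh _ _ _ (gmor lincl) lproj.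
Proof.
rewrite /lproj /gmor compE; apply: short_exact_intro; split.
- by move=> m f -> /sincl_tors.
- move=> m f v -> [b -> ->]; apply/gproj_tors; apply: tors_in.
  by apply/lquo_in; exact: gsvalR m.
- move=> f v [b -> ->] /gproj_tors/idX_tors/lquo_in hf; apply: tors_in.
  by exists (mksub line_gsub hf) => //; apply: gsval_inj.
- have H c (g : W) wc : Ahomog wc c -> iunit i c -> lquo g = c :> A ->
      forall v, tors (rimg (fcomp (gfrac (gproj (idX_gsub k i n lz))) (gfrac lquo)) setT) v.
    move=> hc uc eg v; have [N hN] := iunit_ideal n hc uc; exists N => t; have [b [d ebd]] := hN t.
    exists ((b * grepr v) *: g) => //; exists (lquo ((b * grepr v) *: g)) => //.
    change (X t ^+ N *: v = gpi (idX_gsub k i n lz) (lquo ((b * grepr v) *: g))).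
    rewrite ghomZ -{1}(greprK v) -gpiZ; apply/(gpiP (idX_gsub k i n lz)).
    exists (d * grepr v); rewrite -[lquo g]/(lquo g : A) eg /GRing.scale /= ebd; ring.
  case: (vprim he) => h; [exact: H (vec1 he) h lquo_kj | exact: H (vec2 he) h lquo_kl].
Qed.
End Line.

(** Converse of [line_exact]. After multiplication by a power of X_l the images of [kapi] and [kapj]
    have homogeneous representatives al and be in A, and these determine e. *)
Lemma epi_line n z (pi : @Mor k coh W (SSm k i n z)) : (0 < n)%N -> lres z i = lres a i ->
  (forall (N : coh) (h : @Mor k coh (SSm k i n z) N), compm h pi = 0 -> h = 0) ->
  exists w e, [/\ isvec i D1 D2 w e, dvdX i 1 (wedge e lv) &
    forall (he : isvec i D1 D2 w e) (hl : dvdX i 1 (wedge e lv)),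
      short_exact (gmor (lincl n he hl)) pi].
Proof.
have [r ->] := qW pi => n0 hz /epi_surj hsurj.
have [N1 h1] := fdomT r ki; have [N2 h2] := fdomT r kj.
pose N := (N1 + N2)%N.
have [vi hi] := tors_le (fdom_gsub r) (leq_addr N2 N1) (h1 l).
have [vj hj] := tors_le (fdom_gsub r) (leq_addl N1 N2) (h2 l).
have gi := grel_hc (fgrP r) (xvec p l *~ N%:Z - bb a s i) hi.
have gj := grel_hc (fgrP r) (xvec p l *~ N%:Z - bb a s j) hj.
rewrite (hcX l N (kapi_hc k a s ij il jl)) in gi.
rewrite (hcX l N (kapj_hc k a s ij il jl)) in gj.
pose al : A := Acomp (z + (xvec p l *~ N%:Z - bb a s i)) (grepr vi).
pose be : A := Acomp (z + (xvec p l *~ N%:Z - bb a s j)) (grepr vj).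
have {}gi : r (X l ^+ N *: ki) (gpi (idX_gsub k i n z) al).
  by move: gi; rewrite -{1}(greprK vi) -[hc _ _]/(gqhc _ _) gqhcE.
have {}gj : r (X l ^+ N *: kj) (gpi (idX_gsub k i n z) be).
  by move: gj; rewrite -{1}(greprK vj) -[hc _ _]/(gqhc _ _) gqhcE.
have hal : Ahomog (z + (xvec p l *~ N%:Z - bb a s i)) al by exact: Acomp_homog.
have hbe : Ahomog (z + (xvec p l *~ N%:Z - bb a s j)) be by exact: Acomp_homog.
clearbody al be; clear hi hj h1 h2 vi vj.
have key (f : W) c v : X j ^+ s j * (gsval f).1 + X l ^+ s l * (gsval f).2 = X i ^+ s i * c -> r f v ->
    X l ^+ (N + s l) *: v = gpi (idX_gsub k i n z) ((gsval f).1 * al + c * be).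
  move=> ec hv; apply/eqP; rewrite -subr_eq0; apply/eqP/SSm_tors.
  have := grel_lin (fgrP r) (gsval f).1 gi (fracZ c gj); rewrite -!gpiZ -gpiD => q.
  apply: (fracB (fracZ _ hv)); move: q; congr (r _ _).
  apply: W_eq; rewrite !gsvalD !gsvalZ /= /GRing.scale /= exprD; first by ring.
  rewrite (_ : _ * _ * _ = X l ^+ N * (X l ^+ s l * (gsval f).2)); last by ring.
  rewrite (_ : X l ^+ s l * _ = X i ^+ s i * c - X j ^+ s j * (gsval f).1); first by ring.
  by rewrite -ec; ring.
(* The degree of al has residue p_i - s_i > 0, so X_i divides al. If it divided be as well, the
   image would consist of multiples of X_i up to torsion, and the map would not be onto. *)
have ube : iunit i be.
  move=> [b ebe].
  have [c ec] : dvdX i 1 al.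
    apply: (Ahomog_dvdX hal); have /andP[s0 s1] := hs i.
    rewrite (_ : z + _ = (z - a) + xvec p l *~ N%:Z + xvec p i *~ (- (s i)%:Z)); last by rewrite /bb; abel.
    rewrite lresDx eqxx lresDx (negPf il) ((lres_sub0 z a i).1 hz) add0r.
    by rewrite -modzDr modz_small; lia.
  have [K hK] := hsurj (gpi (idX_gsub k i n z) 1); have [f _ hf] := hK l.
  have [d ed] := W_in f; have := key f d _ ed hf.
  rewrite -(gpiZ (idX_gsub k i n z) (X l ^+ K) (1 : A)) -gpiZ => /gpiP[d' ed'].
  apply: (@dvdX1N k p i); apply: (dvdX_cancelX (m := N + s l + K) il); rewrite mulr1.
  exists (X i ^+ n.-1 * d' + ((gsval f).1 * c + d * b)).
  move: ed'; rewrite -{1}(prednK n0) exprS /GRing.scale /= => /eqP; rewrite subr_eq => /eqP.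
  rewrite mulr1 -exprD => ->; rewrite ec ebe expr1; ring.
have dz : z + (xvec p l *~ N%:Z - bb a s j) + xvec p l *~ (s l)%:Z = z + xvec p l *~ N%:Z - bb a s j - bb a s i + D1.
  by rewrite /wd1 (vtopE a s ij il jl) /bb; abel.
have dz1 : z + (xvec p l *~ N%:Z - bb a s j) + xvec p j *~ (s j)%:Z = z + xvec p l *~ N%:Z - bb a s j - bb a s i + D2.
  by rewrite /wd2 (vtopE a s ij il jl) /bb; abel.
have dz2 : z + (xvec p l *~ N%:Z - bb a s i) + xvec p i *~ (s i)%:Z = z + xvec p l *~ N%:Z - bb a s j - bb a s i + D2.
  by rewrite /wd2 (vtopE a s ij il jl) /bb; abel.
(* The solution of X_i^(s_i) (f_1 al + c be) = e /\ f, where X_i^(s_i) c = X_j^(s_j) f_1 + X_l^(s_l)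
   f_2. *)
pose e : A * A := (be * X l ^+ s l, - (be * X j ^+ s j) - al * X i ^+ s i).
exists (z + xvec p l *~ N%:Z - bb a s j - bb a s i), e.
have ew (f : W) c : X j ^+ s j * (gsval f).1 + X l ^+ s l * (gsval f).2 = X i ^+ s i * c ->
    wedge e (gsval f) = X i ^+ s i * ((gsval f).1 * al + c * be).
  move=> ec; rewrite mulrDr (_ : X i ^+ s i * (c * be) = X i ^+ s i * c * be); last by ring.
  by rewrite -ec /wedge /=; ring.
have hU (f : W) v : r f v -> (v = 0 <-> lat (d1 := D1) (d2 := D2) i (s i + n) e (gsval f)).
  move=> hv; have [c ec] := W_in f; have k1 := key f c v ec hv.
  rewrite /lat /= (ew f c ec); split=> [v0|/dvdXE hd].
    apply/dvdXE; move: k1; rewrite v0 scaler0 => /esym/gpiP; by rewrite subr0.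
  rewrite -(greprK v); apply/(gpiP (idX_gsub k i n z)); rewrite subr0.
  apply: (dvdX_cancelX (m := N + s l) il).
  have /(gpiP (idX_gsub k i n z)) : gpi (idX_gsub k i n z) (X l ^+ (N + s l) *: grepr v) = gpi (idX_gsub k i n z) 0.
    by rewrite gpiZ greprK k1; apply/(gpiP (idX_gsub k i n z)); rewrite subr0.
  by rewrite subr0.
split.
- split.
  + by rewrite -dz; apply: AhomogM => //; exact: AhomogX.
  + apply: AhomogD; apply: AhomogN.
      by rewrite -dz1; apply: AhomogM => //; exact: AhomogX.
    by rewrite -dz2; apply: AhomogM => //; exact: AhomogX.
  + rewrite -dz (_ : _ + _ = (z - a) + (xvec p l *~ (N%:Z + (s l)%:Z) + xvec p j *~ (- (s j)%:Z))); last by rewrite /bb; abel.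
    by apply: lres_add0; [exact/lres_sub0 | apply: lres_add0; exact: lres_xvec].
  + rewrite -dz1 (_ : _ + _ = (z - a) + xvec p l *~ N%:Z); last by rewrite /bb; abel.
    by apply: lres_add0; [exact/lres_sub0 | exact: lres_xvec].
  + by left; apply: (iunitM hbe (AhomogX _ _ _ _) ube); exact: iunit_X.
- have /andP[s0 _] := hs i; apply: (@dvdX_le _ _ _ 1 (s i)) => //.
  exists (al * X l ^+ s l); rewrite /wedge /=; ring.
move=> he hl; rewrite /gmor; apply: short_exact_intro; split=> //.
- by move=> m f -> /sincl_tors.
- by move=> m f v -> hv; rewrite ((hU _ _ hv).2 (gsvalR m)); exact: tors00.
- move=> f v hv /SSm_tors/(hU _ _ hv) hf; apply: tors_in.
  by exists (mksub (line_gsub n he) hf) => //; apply: gsval_inj.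
Qed.
End SubBundles.

(** * Counting subbundles *)

Section Hall.
Variables (k : finFieldType) (p : weights).
Local Notation L := (Lgrp p).
Local Notation coh := (cohX k p).
Local Notation OO := (OO k).
Variables (i j l : 'I_3) (a : L) (s : 'I_3 -> nat).
Hypotheses (ij : i != j) (il : i != l) (jl : j != l) (hs : sbox p s).
Local Notation W := (Wm k a s ij il jl).
Local Notation D1 := (wd1 j a s).
Local Notation D2 := (wd2 l a s).
Local Notation lv := (wvec k p j l s).
Local Notation gW := (lat_gsub i (s i) (wvec1 k a s ij il jl) (wvec2 k a s ij il jl)).
Local Notation V := (dsum (OO D1) (OO D2)).
Local Notation WW := (lat (d1 := D1) (d2 := D2) i (s i) lv).
Variables (E : coh) (phi : @Mor k coh W E) (psi : @Mor k coh E W).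
Hypotheses (h1 : compm psi phi = idm W) (h2 : compm phi psi = idm E).
Variable n : nat.
Local Notation Fm := (Fam i D1 D2 lv (s i + n)).

Lemma Fam_gsub U : Fm U -> is_gsub (U : set V).
Proof. by move=> [w [e [he _ ->]]]; exact: line_gsub he. Qed.

Lemma Fam_sub U : Fm U -> (U : set V) `<=` WW.
Proof. by move=> [w [e [he hl ->]]]; exact: (line_sub (n := n) ij il jl hs he hl). Qed.

Section Subobject.
Variables (U : set V) (gU : is_gsub U) (hU : U `<=` WW).
Definition smorU : @Mor k coh (gsubm gU) E := compm phi (gmor (sincl gU gW hU)).

Lemma smorU_mono : mono smorU.
Proof.
apply: mono_comp; last by apply: iso_mono; exists psi.
by apply/monoP => m f -> /sincl_tors.
Qed.

Lemma smorU_exact : Fm U -> exists z, lres z i = lres a i /\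
  exists g : @Mor k coh E (SSm k i n z), short_exact smorU g.
Proof.
move=> [w [e [he hl eU]]]; exists (lz i j l a s w); split; first exact: lz_res he.
exists (compm (lproj ij il jl hs n he hl) psi); apply: short_exact_isom => //.
have := line_exact ij il jl hs n he hl.
move: gU hU; rewrite eU => gU' hU'.
by rewrite /lincl (Prop_irrelevance gU' (line_gsub n he)) (Prop_irrelevance hU' (line_sub ij il jl hs he hl)).
Qed.
End Subobject.

(** A factorization makes U vanish under the projection of W attached to U', and the elements that
    this projection kills up to torsion lie in U'. *)
Lemma smorU_inj U U' (gU : is_gsub U) (gU' : is_gsub U') (hU : U `<=` WW) (hU' : U' `<=` WW)
    (u : @Mor k coh (gsubm gU) (gsubm gU')) :
  Fm U' -> compm (smorU gU' hU') u = smorU gU hU -> U `<=` U'.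
Proof.
move=> [w [e [he hl eU]]]; rewrite /smorU -compA => H.
have {}H : compm (gmor (sincl gU' gW hU')) u = gmor (sincl gU gW hU).
  by rewrite -[LHS]comp1f -h1 -compA H compA h1 comp1f.
have ex := line_exact ij il jl hs n he hl.
have : compm (lproj ij il jl hs n he hl) (gmor (sincl gU gW hU)) = 0.
  rewrite -H compA (_ : compm (lproj _ _ _ _ _ _ _) (gmor (sincl gU' gW hU')) = 0) ?comp0l //.
  move: gU' hU' {u H}; rewrite eU => gU' hU'.
  rewrite (Prop_irrelevance gU' (line_gsub n he)) (Prop_irrelevance hU' (line_sub ij il jl hs he hl)).
  exact: ex.1.1.
rewrite /lproj /gmor !compE => /qpi0E h f hf.
suff : lat (d1 := D1) (d2 := D2) i (s i + n) e (gsval (mksub gW (hU f hf))) by rewrite eU.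
apply/(lquo_in hs n he hl (mksub gW (hU f hf))).
apply: idX_tors; apply/(gproj_tors (idX_gsub k i n _)).
by apply: (h (mksub gU hf)); exists (sincl gU gW hU (mksub gU hf)) => //; exists (lquo ij il jl hs he hl (sincl gU gW hU (mksub gU hf))).
Qed.

Lemma smorU_surj (M : coh) (t : @Mor k coh M E) z (g : @Mor k coh E (SSm k i n z)) :
  (0 < n)%N -> lres z i = lres a i -> short_exact t g ->
  exists U, Fm U /\ forall (gU : is_gsub (U : set V)) (hU : U `<=` WW),
    exists2 u : @Mor k coh M (gsubm gU), is_iso u & compm (smorU gU hU) u = t.
Proof.
move=> n0 hz ex.
have ex' : short_exact (compm psi t) (compm g phi) by exact: short_exact_isom.
have [w [e [he hl H]]] := epi_line hs n0 hz (cokernel_epi ex'.2).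
exists (latA i (s i + n) e); split; first by exists w, e.
move=> gU hU; have hk := (H he hl).1.
have hk' : @is_kernel k coh _ _ _ (gmor (sincl gU gW hU)) (compm g phi).
  by rewrite (Prop_irrelevance gU (line_gsub n he)) (Prop_irrelevance hU (line_sub ij il jl hs he hl)).
have [u iu eu] := kernel_unique ex'.1 hk'.
by exists u => //; rewrite /smorU -compA eu compA h2 comp1f.
Qed.
End Hall.

Section HallNumber.
Variables (k : finFieldType) (p : weights).
Local Notation L := (Lgrp p).
Local Notation coh := (cohX k p).
Variables (i j l : 'I_3).
Hypotheses (ij : i != j) (il : i != l) (jl : j != l).

(** The sum V has depth 0 once j and l change places, w is its generic line with parameter -1, and
    all generic lines have the same count by [cn_types]. *)
Lemma Fam_count (a : L) s n m r0 : sbox p s -> (s i + n = p i * m + r0)%N -> (0 < r0 < p i)%N ->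
  hcard (fun U => Fam i (wd1 j a s) (wd2 l a s) (wvec k p j l s) (s i + n) U /\
    ebset (U : set (dsum (OO k (wd1 j a s)) (OO k (wd2 l a s))))) (cn m 0 (Some (1 : k))).
Proof.
move=> hs -> hr0; have lj : l != j by rewrite eq_sym.
have /andP[sj0 sj1] := hs j.
have hst : isst l j 0 (s l) (p j - s j) (wd1 j a s) (wd2 l a s).
  split; [exact: hs | by lia|].
  by rewrite (cXpow sj1) /wd1 /wd2 (vtopE a s ij il jl); abel.
have := tree_count il ij lj hr0 m (Some (-1 : k)) hst.
have [H _ _] := cn_types k m; rewrite (H (-1)) ?oppr_eq0 ?oner_eq0 //.
by rewrite /cntr /line /gg1 /gg2 scalAN scalA1 mulN1r subKn // ltnW.
Qed.

(** The quotients are compared through the model [SSm]: an arbitrary subobject with quotient S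
    becomes the kernel of an epimorphism onto it, hence one of the U, and [smorU_inj] recovers U
    from the subobject. *)
Lemma hall_count (E E' S : coh) a s a' s' z n m r0 :
  sbox p s -> EB a s E -> isSS i n z S -> (0 < n)%N -> lres z i = lres a i ->
  (s i + n = p i * m + r0)%N -> (r0 < p i)%N -> sbox p s' -> EB a' s' E' ->
  (forall x, hilb a' s' x + (llev (z + x) - llev (z - xvec p i *~ n%:Z + x)) = hilb a s x) ->
  hall_number S E' E (cn m 0 (Some (1 : k))).
Proof.
move=> hs hE hS n0 hz hmr hr hs' hE' hh.
have [phi [psi [h1 h2]]] := EB_iso hs ij il jl hE.
have [r00 hEn] := EB_normal ij il jl hs hs' hE' hh hz hmr hr.
have hr0 : (0 < r0 < p i)%N by rewrite r00.
have [F [f [cF fi fP]]] := Fam_count a hs hmr hr0.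
have hF u := ((fP (f u)).2 (ex_intro _ u erefl)).1.
have hEBF u := ((fP (f u)).2 (ex_intro _ u erefl)).2.
have hsn : sbox p (fun t => if t == i then if odd m then (p i - r0)%N else r0 else s t).
  by move=> t; case: eqP => [->|_]; [case: ifP => _; lia | exact: hs].
(* Both bundles have the Hilbert function of E minus that of S, so [EB_normal] brings them to the
   same data. *)
have isoE U (gU : is_gsub (U : set (dsum (OO k (wd1 j a s)) (OO k (wd2 l a s))))) :
    Fam i (wd1 j a s) (wd2 l a s) (wvec k p j l s) (s i + n) U -> ebset U -> @isomorphic k coh (gsubm gU) E'.
  move=> fU [gU']; rewrite (Prop_irrelevance gU' gU) => -[a1 [s1 [hs1 hE1]]].
  have [z1 [hz1 [g hg]]] := smorU_exact hs h1 h2 gU (Fam_sub ij il jl hs fU) fU.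
  have hS1 : isSS i n z1 (SSm k i n z1) by eexists; exact: SS_exact (erefl _).
  have hh1 x : hilb a1 s1 x + (llev (z1 + x) - llev (z1 - xvec p i *~ n%:Z + x)) = hilb a s x.
    apply: (hilb_sum hE hE1 hS1); have [l0 hl0] := dlog_exact x hg.
    by exists l0 => y /hl0.
  have [_ hEn1] := EB_normal ij il jl hs hs1 hE1 hh1 hz1 hmr hr.
  exact: EB_uniq hsn hEn1 hEn.
pose sb u : subobj E := SubObj (smorU_mono h1 h2 (gU := Fam_gsub (hF u)) (hU := Fam_sub ij il jl hs (hF u))).
exists (fun x => sb (@enum_val F F (cast_ord (esym cF) x))); split.
- move=> x; set u := enum_val _; split; first exact: isoE (hF u) (hEBF u).
  have [z1 [hz1 [g hg]]] := smorU_exact hs h1 h2 (Fam_gsub (hF u)) (Fam_sub ij il jl hs (hF u)) (hF u).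
  exists (SSm k i n z1), g; split; first exact: hg.2.
  have hz2 : lres z1 i = lres z i by rewrite hz1.
  exact: iso_trans (SSm_iso k n hz2) (iso_sym (isSS_SSm hS)).
- move=> x y; set u := enum_val _; set v := enum_val _ => -[w [[w' [e1 e2]] ew]].
  suff : u = v by move=> /enum_val_inj/cast_ord_inj.
  apply: fi; apply/seteqP; split; first exact: (smorU_inj hs h1 (hF v) ew).
  have ew' : compm (smor (sb u)) w' = smor (sb v) by rewrite -ew -compA e2 compf1.
  exact: (smorU_inj hs h1 (hF u) ew').
- move=> t [hiso [Q [g [hg hQ]]]].
  have [y hy] := iso_trans hQ (isSS_SSm hS).
  have ht : mono (smor t) by exact: smor_mono.
  have hx := mono_cokernel_exact ht hg.
  have i1 : is_iso (idm (sdom t)) by exists (idm _); rewrite comp1f.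
  have := short_exact_iso i1 hy hx; rewrite compf1 => hx'.
  have [U [fU hU]] := smorU_surj hs h1 h2 n0 hz hx'.
  have [w iw ew] := hU (Fam_gsub fU) (Fam_sub ij il jl hs fU).
  have [|u eu] := (fP U).1.
    split=> //; exists (Fam_gsub fU).
    have hi : isomorphic E' (gsubm (Fam_gsub fU) : coh) by apply: iso_trans (iso_sym hiso) _; exists w.
    by apply: isEB_iso hi _; exists a', s'.
  exists (cast_ord cF (enum_rank u)); rewrite cast_ordK enum_rankK.
  move: hU; rewrite -eu => /(_ (Fam_gsub (hF u)) (Fam_sub ij il jl hs (hF u)))[v iv ev].
  by exists v.
Qed.
End HallNumber.

(** * The Euler form *)

Section EulerForm.
Variables (k : finFieldType) (p : weights) (i j l : 'I_3).
Hypotheses (ij : i != j) (il : i != l) (jl : j != l).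
Local Notation L := (Lgrp p).
Local Notation coh := (cohX k p).

Lemma divz_unique (x d c r : int) : x = c * d + r -> 0 <= r < d -> (x %/ d)%Z = c.
Proof.
move=> -> /andP[h1 h2]; have d0 : d != 0 by lia.
by rewrite divzMDl // divz_box // addr0.
Qed.

(** The quotients by p_i that occur in the levels of [euler_EB], for r = r0 and t = s_i; b is the
    parity of m. *)
Lemma res_levels (d r t : nat) (b : bool) : (0 < r < d)%N -> (0 < t < d)%N ->
  let g : int := if b then 0 else r%:Z in
  let t' : nat := if b then (d - r)%N else r in
  let dt : int := (r < t)%N in
  [/\ (g %/ d)%Z = 0, ((g - t%:Z) %/ d)%Z = - (if b then 1 else dt),
      ((g - t'%:Z) %/ d)%Z = - b%:Z & ((g - t%:Z - t'%:Z) %/ d)%Z = - (if b then 1 + dt else 1)].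
Proof.
move=> /andP[r0 r1] /andP[t0 t1]; rewrite -(ltr_nat int) -!(ltr_nat int) in r0 r1 t0 t1 *.
have hu := divz_unique.
case: b => /=; rewrite -?subzn; try by rewrite ltnW // -(ltr_nat int).
- case: ltrP => h; split; [apply: (hu _ _ _ 0)|apply: (hu _ _ _ (d%:Z - t%:Z))|apply: (hu _ _ _ r%:Z)
    |apply: (hu _ _ _ (d%:Z + r%:Z - t%:Z))|apply: (hu _ _ _ 0)|apply: (hu _ _ _ (d%:Z - t%:Z))
    |apply: (hu _ _ _ r%:Z)|apply: (hu _ _ _ (r%:Z - t%:Z))]; lia.
- case: ltrP => h; split; [apply: (hu _ _ _ r%:Z)|apply: (hu _ _ _ (d%:Z + r%:Z - t%:Z))|apply: (hu _ _ _ 0)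
    |apply: (hu _ _ _ (d%:Z - t%:Z))|apply: (hu _ _ _ r%:Z)|apply: (hu _ _ _ (r%:Z - t%:Z))
    |apply: (hu _ _ _ 0)|apply: (hu _ _ _ (d%:Z - t%:Z))]; lia.
Qed.

Lemma half_odd (m : nat) : m%:Z = 2 * (m%:Z - (m./2)%:Z) - (odd m)%:Z.
Proof. by have := odd_double_half m; case: (odd m); lia. Qed.

(** The spaces Hom between the line bundles involved have dimension one more than a level, and the
    alternating sum of [card_HomE] is 2m or 2m + 1 according to whether r0 < s_i. Its integral half
    is m either way. *)
Lemma euler_EB (E E' : coh) (a : L) s n m r0 : sbox p s -> EB a s E -> (0 < n)%N ->
  (s i + n = p i * m + r0)%N -> (0 < r0 < p i)%N ->
  EB (a - xvec p i *~ n%:Z + cvec p *~ (m./2)%:Z + (if odd m then xvec p i *~ r0%:Z else 0))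
     (fun t => if t == i then if odd m then (p i - r0)%N else r0 else s t) E' ->
  euler E' E = (2 * m + 1 - (r0 < s i))%N%:Z.
Proof.
move=> hs hE n0 hmr hr0; set s' := fun t => _.
(* For both parities of m the degree of the normal form becomes a + (s_i - g) x_i - Kc, with K the
   half of m rounded up. *)
pose g : int := if odd m then 0 else r0%:Z.
pose K : int := m%:Z - (m./2)%:Z.
rewrite (_ : _ + (if _ then _ else _) = a + xvec p i *~ ((s i)%:Z - g) - cvec p *~ K); last first.
  have -> : xvec p i *~ n%:Z = xvec p i *~ (r0%:Z - (s i)%:Z) + cvec p *~ m%:Z.
    rewrite (cvec_xvec p i) -mulrzA -mulrzDr; congr (_ *~ _); move: hmr; lia.
  by rewrite /K /g; case: (odd m); abel.
set a' := a + _ - _ => hE'.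
have hs' : sbox p s' by move=> t; rewrite /s'; case: eqP => [->|_]; [case: ifP => _; lia | exact: hs].
have s'i : s' i = if odd m then (p i - r0)%N else r0 by rewrite /s' eqxx.
have s'j : s' j = s j by rewrite /s' eq_sym (negPf ij).
have s'l : s' l = s l by rewrite /s' eq_sym (negPf il).
have /andP[si0 si1] := hs i; have /andP[sj0 sj1] := hs j; have /andP[sl0 sl1] := hs l.
have dj : ((s j)%:Z %/ p j)%Z = 0 by apply: divz_box; lia.
have dl : ((s l)%:Z %/ p l)%Z = 0 by apply: divz_box; lia.
have dj' : (- (s j)%:Z %/ p j)%Z = -1 by apply: divz_box1; lia.
have dl' : (- (s l)%:Z %/ p l)%Z = -1 by apply: divz_box1; lia.
have d0 (d : nat) : (0 %/ d%:Z)%Z = 0 by rewrite div0z.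
pose dt : int := (r0 < s i)%N.
have [g1 g2 g3 g4] := res_levels (odd m) hr0 (hs i); rewrite -/g -/dt -s'i in g1 g2 g3 g4.
have ev := vtopE a s ij il jl.
have lev1 (x y z : int) : ub1 a s - (a' + xvec p i *~ x + xvec p j *~ y + xvec p l *~ z) =
    xvec p i *~ (g - x) + xvec p j *~ ((s j)%:Z - y) + xvec p l *~ ((s l)%:Z - z) + cvec p *~ (K - 1).
  by rewrite /ub1 ev /a'; abel.
have lev2 (x y z : int) : ub2 a - (a' + xvec p i *~ x + xvec p j *~ y + xvec p l *~ z) =
    xvec p i *~ (g - (s i)%:Z - x) + xvec p j *~ (- y) + xvec p l *~ (- z) + cvec p *~ (K + 1).
  by rewrite /ub2 /a'; abel.
have ea : a' = a' + xvec p i *~ 0 + xvec p j *~ 0 + xvec p l *~ 0 by rewrite !mulr0z !addr0.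
have eb t : bb a' s' t = a' + xvec p i *~ ((s' i)%:Z *+ (t == i)) + xvec p j *~ ((s' j)%:Z *+ (t == j))
    + xvec p l *~ ((s' l)%:Z *+ (t == l)).
  rewrite /bb; have [->|->|->] := ord3_eq t ij il jl; rewrite !eqxx ?(negPf ij) ?(negPf il) ?(negPf jl).
  - by rewrite !mulr0n !mulr0z !addr0.
  - by rewrite eq_sym (negPf ij) !mulr0n !mulr0z !addr0.
  - by rewrite eq_sym (negPf il) eq_sym (negPf jl) !mulr0n !mulr0z !addr0.
have ji : (j == i) = false by rewrite eq_sym (negPf ij).
have li : (l == i) = false by rewrite eq_sym (negPf il).
have lj : (l == j) = false by rewrite eq_sym (negPf jl).
have E1 := (negPf ij, negPf il, negPf jl, ji, li, lj, eqxx).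
have u1a : llev (ub1 a s - a') = K - 1.
  by rewrite {1}ea lev1 (llev3 p ij il jl) !subr0 g1 dj dl !add0r.
have u2a : llev (ub2 a - a') = K + 1 - (if odd m then 1 else dt).
  by rewrite {1}ea lev2 (llev3 p ij il jl) !subr0 oppr0 g2 !d0 !addr0 addrC.
have u1i : llev (ub1 a s - bb a' s' i) = K - 1 - (odd m)%:Z.
  by rewrite eb lev1 (llev3 p ij il jl) !E1 ?mulr1n ?mulr0n !subr0 g3 dj dl !addr0 addrC.
have u2i : llev (ub2 a - bb a' s' i) = K + 1 - (if odd m then 1 + dt else 1).
  by rewrite eb lev2 (llev3 p ij il jl) !E1 ?mulr1n ?mulr0n !oppr0 g4 !d0 !addr0 addrC.
have u1j : llev (ub1 a s - bb a' s' j) = K - 1.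
  by rewrite eb lev1 (llev3 p ij il jl) !E1 ?mulr1n ?mulr0n !subr0 s'j subrr g1 d0 dl !add0r.
have u2j : llev (ub2 a - bb a' s' j) = K - (if odd m then 1 else dt).
  by rewrite eb lev2 (llev3 p ij il jl) !E1 ?mulr1n ?mulr0n !subr0 oppr0 s'j g2 dj' d0; ring.
have u1l : llev (ub1 a s - bb a' s' l) = K - 1.
  by rewrite eb lev1 (llev3 p ij il jl) !E1 ?mulr1n ?mulr0n !subr0 s'l subrr g1 d0 dj !add0r.
have u2l : llev (ub2 a - bb a' s' l) = K - (if odd m then 1 else dt).
  by rewrite eb lev2 (llev3 p ij il jl) !E1 ?mulr1n ?mulr0n !subr0 oppr0 s'l g2 dl' d0; ring.
have hm : m%:Z = 2 * K - (odd m)%:Z.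
  exact: half_odd.
have hdt : dt = (r0 < s i)%N by [].
(* For m = 0 one has r0 = s_i + n, so r0 < s_i fails; the lower bounds on the levels use this. *)
have hm0 : m = 0%N -> dt = 0 by move=> e; rewrite /dt ltnNge -[r0]add0n -(muln0 (p i)) -e -hmr leq_addr.
have hdt1 : 0 <= dt <= 1 by rewrite /dt; case: ltnP.
apply: (card_HomE ij il jl hs' hE hE' s'j s'l); clear dj dl dj' dl' g1 g2 g3 g4 hmr; clearbody K dt.
- move=> t; have [->|->|->] := ord3_eq t ij il jl; rewrite ?u1i ?u1j ?u1l; move: hm; case: (odd m); lia.
- move=> t; have [->|->|->] := ord3_eq t ij il jl; rewrite ?u2i ?u2j ?u2l; move: hm hm0; case: (odd m); lia.
- by rewrite u1a; move: hm; case: (odd m); lia.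
- by rewrite u2a; move: hm hm0; case: (odd m); lia.
- by rewrite {1}ea lev1 (lres3j p ij il jl) subr0 modz_small //; lia.
- by rewrite u1a u2a u1i u2i u1j u2j u1l u2l; move: hm hm0 hdt; case: (odd m); lia.
Qed.
End EulerForm.

(** * The Hall number *)

Section Final.
Variables (k : finFieldType) (p : weights).
Local Notation L := (Lgrp p).
Local Notation coh := (cohX k p).

(* A nonzero map E -> T to a simple T is nonzero on one of the generators
   O(b_t) of E; if t = i, the other presentation of E has a_i = (b_i)_i. *)
Lemma EB_adapted (i : 'I_3) (E T : coh) (f : Mor E T) (z : L) (u : gcar T) :
  isEB E -> simple_obj T -> supported_at i T -> ~ tors [set 0] u -> hc (- z) u = u -> f <> 0 ->
  exists a s, [/\ sbox p s, EB a s E & lres z i = lres a i].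
Proof.
move=> [a [s [hs hE]]] hT hTi hu hz f0.
have [j [l [ij il jl]]] := other2 i.
have [Ki [Kj [Kl [_ _ H]]]] := EB_univ ij il jl hs hE.
have res t (K : @Mor k coh (OO k (bb a s t)) E) : compm f K <> 0 -> lres (z - bb a s t) i = 0.
  by move=> h; exact: (simple_res hT hTi hu hz h).
have rb t : i != t -> lres (z - bb a s t) i = 0 -> exists a s, [/\ sbox p s, EB a s E & lres z i = lres a i].
  move=> it h; exists a, s; split=> //; apply/lres_sub0.
  rewrite (_ : z - a = z - bb a s t + xvec p t *~ (s t)%:Z); last by rewrite /bb; abel.
  by apply: lres_add0 => //; exact: lres_xvec.
have [ei|/res h] := pselect (compm f Ki = 0); last first.
  have li : l != i by rewrite eq_sym.
  have lj : l != j by rewrite eq_sym.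
  exists (aflip i j a s), (sflip p l s); split; first exact: (sflip_box li lj ij hs).
    exact: EB_flip.
  apply/lres_sub0; rewrite (_ : z - _ = z - bb a s i + (xvec p j *~ (- (s j)%:Z) + cvec p *~ 1)); last first.
    by rewrite /bb /aflip; abel.
  by apply: lres_add0 => //; rewrite lresDc lres_xvec.
have [ej|/res h] := pselect (compm f Kj = 0); last exact: rb h.
have [el|/res h] := pselect (compm f Kl = 0); last exact: rb h.
by case: f0; apply: H; rewrite comp0l.
Qed.
End Final.

Theorem proposition4p6 (k : finFieldType) (p : weights)
    (Sij : forall i : 'I_3, 'Z_(p i) -> cohX k p) (hSij : tube_simples Sij)
    (E E' S : cohX k p) (i : 'I_3) (j : 'Z_(p i)) (n : nat)
    (hE : extension_bundle E) (hE' : extension_bundle E')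
    (hn : (1 <= n)%N) (hS : is_tube_indec Sij j n S)
    (hK0 : K0_eq (fun W => cls E' W + cls S W) (cls E))
    (htop : exists T : cohX k p, is_top S T /\ exists f : Mor E T, f <> 0) :
  let q : int := #|k|%:Z in
  let N : int := (euler E' E %/ 2)%Z - 1 in
  exists F : nat,
    hall_number S E' E F /\
    ((N = -1 /\ F = 1%N) \/
     (0 <= N /\ F%:Z = (fpol (N + 1)).[q] - (fpol N).[q] + (-1) ^ N)).
Proof.
move=> q N.
have [h1 _ _ _] := hSij i; have [hT [_ hTi]] := h1 j.
case: hS => -[_ hSi] _ top _.
have [T [topT [f f0]]] := htop.
have [y [y' [y1 y2]]] := top_unique topT top.
(* The top is unique up to isomorphism, so the nonzero map from E may be taken into the chosen
   simple of the tube. *)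
have f1 : compm y f <> 0 by move=> e; case: f0; rewrite -[f]comp1f -y1 -compA e comp0r.
have [z0 [u0 [hu0 hz0]]] := nonzero_elt hT.
have [a [s [hs hEB ra]]] := EB_adapted (extension_bundle_EB hE) hT hTi hu0 hz0 f1.
have [g [z [u [hz gu gen]]]] := top_generator top hT.
(* The generator of S and the presentation of E map to the same simple, so their residues at i
   agree. *)
have ru := simple_res hT hTi hu0 hz0 gu.
have hz' : lres z i = lres a i by rewrite -ra; exact/esym/lres_sub0.
have [|n' [n0 hSS]] := cyclic_isSS hSi hz _ gen.
  move=> hu; case: gu; rewrite (_ : elm z u = 0) ?comp0r //; apply/elm0; by rewrite hz.
have [a' [s' [hs' hEB']]] := extension_bundle_EB hE'.
have hh x := hilb_sum hEB hEB' hSS (K0_eq_dlog x hK0).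
have [j' [l [ij il jl]]] := other2 i.
pose m := ((s i + n') %/ p i)%N; pose r0 := ((s i + n') %% p i)%N.
have hmr : (s i + n' = p i * m + r0)%N by rewrite mulnC; exact: divn_eq.
have hr : (r0 < p i)%N by rewrite ltn_mod; have := wt_ge2 p i; lia.
have [r00 hEn] := EB_normal ij il jl hs hs' hEB' hh hz' hmr hr.
have hr0 : (0 < r0 < p i)%N by rewrite r00.
have ee := euler_EB ij il jl hs hEB n0 hmr hr0 hEn.
exists (cn m 0 (Some (1 : k))); split; first exact: (hall_count ij il jl hs hEB hSS n0 hz' hmr hr hs' hEB' hh).
have eN : N = m%:Z - 1.
  rewrite /N ee; congr (_ - 1); case: (posnP m) => [m0|mp].
    have e : (s i + n' = r0)%N by rewrite hmr m0 muln0.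
    by rewrite ltnNge -e leq_addr m0.
  by case: (r0 < s i)%N => /=; lia.
rewrite eN; case: (m) => [|m']; [left | right].
  by split; rewrite //= oner_eq0.
have -> : m'.+1%:Z - 1 = m'%:Z by lia.
by split=> //; rewrite cG_fpol -exprnP (_ : m'%:Z + 1 = m'.+1%:Z) //; lia.
Qed.
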